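(* Let $Q\in\mathcal{N}_{\kappa}(\mathcal{H})$ be holomorphic at $\infty$, i.e. $Q(z)=\Gamma^{+}(A-z)^{-1}\Gamma$ (minimal representation, with $A$ a bounded self-adjoint operator in a Pontryagin space $\mathcal{K}$ and $\Gamma:\mathcal{H}\to\mathcal{K}$ bounded), and assume that $Q'(\infty):=\lim_{z\to\infty}zQ(z)$ is boundedly invertible. Put $P:=\Gamma(\Gamma^{+}\Gamma)^{-1}\Gamma^{+}$, $\tilde A:=(I-P)A|_{(I-P)\mathcal{K}}$, $$\hat S:=-(\Gamma^{+}\Gamma)^{-1}\Gamma^{+}A\Gamma(\Gamma^{+}\Gamma)^{-1},\quad \hat G:=(\Gamma^{+}\Gamma)^{-1},\quad \tilde\Gamma:=(I-P)A\Gamma(\Gamma^{+}\Gamma)^{-1},$$ $$\hat Q_1(z):=\hat S+z\hat G\in\mathcal{N}_{\kappa_1}(\mathcal{H}),\qquad \hat Q_2(z):=\tilde\Gamma^{+}(\tilde A-z)^{-1}\tilde\Gamma\in\mathcal{N}_{\kappa_2}(\mathcal{H}).$$ Then the inverse function $\hat Q(z):=-Q(z)^{-1}$ has the decomposition $\hat Q(z)=\hat Q_1(z)+\hat Q_2(z)$, and: (i) $\hat Q_1\not\equiv 0$, while $\hat Q_2$ may be the zero function in some cases (i.e. there exist such $Q$ with $\hat Q_2\equiv0$). $\hat Q_1$ has only one generalized pole, which is at $\infty$, while $\hat Q_2$ is holomorphic at $\infty$. (ii) The finite generalized zeros of $Q$ coincide with the generalized poles of $\hat Q_2$, including multiplicities.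 (iii) $\hat Q_1\in\mathcal{N}_{\kappa_1}(\mathcal{H})$, where the negative index $\kappa_1$ is equal to the number of negative eigenvalues of the bounded self-adjoint operator $-Q'(\infty)$ in the Hilbert space $\mathcal{H}$, and this equals the negative index of $P\mathcal{K}$. (iv) $\kappa_1+\kappa_2=\kappa$.
   Context: $(\mathcal{H},(\cdot,\cdot))$ is a nonzero Hilbert space and $\mathcal{L}(\mathcal{H})$ the space of bounded operators on it. For an integer $\kappa\ge 0$, $\mathcal{N}_\kappa(\mathcal{H})$ is the class of functions $Q:\mathcal{D}(Q)\to\mathcal{L}(\mathcal{H})$ that are meromorphic in $\mathbb{C}\setminus\mathbb{R}$, satisfy $Q(z)^*=Q(\bar z)$, and whose kernel $\mathcal{N}_Q(z,w)=\frac{Q(z)-Q(w)^*}{z-\bar w}$, $z,w\in\mathcal{D}(Q)\cap\mathbb{C}^+$, has $\kappa$ negative squares (every Hermitian matrix $((\mathcal{N}_Q(z_i,z_j)h_i,h_j))_{i,j=1}^n$ has at most $\kappa$ negative eigenvalues, and for at least one choice of $n,z_i,h_i$ exactly $\kappa$). $\mathcal{D}(Q)$ is the domain of holomorphy of $Q$. ''$Q$ is holomorphic at $\infty$'' means that $Q$ is holomorphic in a neighbourhood of $\infty$ and the limit $Q'(\infty):=\lim_{z\to\infty}zQ(z)$ exists in the operator norm (so $Q(\infty)=0$). Such $Q$ has a representation $Q(z)=\Gamma^{+}(A-z)^{-1}\Gamma$, $z\in\mathcal{D}(Q)=\rho(A)$, with $A$ a bounded self-adjoint operator in a Pontryagin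 space $(\mathcal{K},[\cdot,\cdot])$ and $\Gamma:\mathcal{H}\to\mathcal{K}$ bounded, which is minimal, i.e. $\mathcal{K}$ is the closed linear span of $\{(A-z)^{-1}\Gamma h: z\in\rho(A),h\in\mathcal{H}\}$ (then the negative index of $\mathcal{K}$ is $\kappa$); $Q'(\infty)=-\Gamma^{+}\Gamma$. Adjoints: $(\Gamma^{+}k,h)=[k,\Gamma h]$; $\tilde\Gamma^{+}$ is the adjoint of $\tilde\Gamma:\mathcal{H}\to(I-P)\mathcal{K}$. $P$ is an orthogonal projection in $\mathcal{K}$, so $\mathcal{K}=(I-P)\mathcal{K}[+]P\mathcal{K}$ with both summands Pontryagin spaces; $(\tilde A-z)^{-1}$ is the resolvent in $(I-P)\mathcal{K}$. The identity $\hat Q=\hat Q_1+\hat Q_2$ is on $\mathcal{D}(Q)\cap\mathcal{D}(\hat Q)$, the set of $z\in\mathcal{D}(Q)$ at which $Q(z)$ is boundedly invertible. Generalized poles and zeros: every $F\in\mathcal{N}_\kappa(\mathcal{H})$ has a representation $F(z)=F(z_0)^*+(z-\bar z_0)\Gamma_{z_0}^{+}(I+(z-z_0)(B-z)^{-1})\Gamma_{z_0}$ with $B$ a self-adjoint linear relation in a Pontryagin space $\mathcal{K}_F$, $z_0\in\rho(B)\cap\mathbb{C}^+$, $\Gamma_{z_0}:\mathcal{H}\to\mathcal{K}_F$ bounded, that is minimal ($\mathcal{K}_F$ is the closed linear span of $(I+(z-z_0)(B-z)^{-1})\Gamma_{z_0}h$, $z\in\rho(B)$, $h\in\mathcal{H}$);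 it is unique up to isomorphism. A point $\alpha\in\mathbb{C}$ is a (finite) generalized pole of $F$ if it is an eigenvalue of $B$; $\infty$ is a generalized pole of $F$ if $B(0):=\{g:\{0,g\}\in B\}\neq\{0\}$. The generalized zeros of $Q$ are the generalized poles of $\hat Q$; multiplicity refers to the dimension of the corresponding root manifold (algebraic eigenspace) of the representing relation. *)

(* Defs.v *)
From HB Require Import structures.
From mathcomp Require Import all_boot all_order all_algebra.
From mathcomp Require Import complex.
From mathcomp Require Import all_classical all_reals all_analysis.
Set Implicit Arguments.
Unset Strict Implicit.
Unset Printing Implicit Defensive.
Import Order.TTheory GRing.Theory Num.Def Num.Theory.
Import numFieldNormedType.Exports.
Local Open Scope classical_set_scope.
Local Open Scope ring_scope.

(* The complex numbers, packaged as a numClosedFieldType so that the topology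
   and the norm of numFieldNormedType.Exports are inferred.  In its order,
   [0 < x] and [x < 0] entail that [x] is real. *)
Definition Cplx (R : realType) : numClosedFieldType := R[i]%C.

(* Operators are plain functions; those that matter satisfy [bounded_op]. *)

Section Operators.
Context {R : realType}.
Local Notation C := (Cplx R).

Definition hilbert_norm {H : completeNormedModType C}
    (ip : {dot H for conjC}) : Prop :=
  forall h : H, `|h| ^+ 2 = ip h h.

Definition bounded_op {V W : completeNormedModType C} (T : V -> W) : Prop :=
  linear T /\ continuous T.

Definition bdd_invertible_on {V : completeNormedModType C} (M : set V)
    (f : V -> V) : Prop :=
  set_bij M M f /\ exists c : C, forall v, M v -> `|v| <= c * `|f v|.

(* The inverse of [f : M -> M]; meaningful under [bdd_invertible_on M f]. *)
Definition inv_on {V : completeNormedModType C} (M : set V) (f : V -> V) :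
    V -> V := 'pinv_(fun=> 0) M f.

Definition resolvent_set_on {V : completeNormedModType C} (M : set V)
    (A : V -> V) : set C :=
  [set z | bdd_invertible_on M (fun v => A v - z *: v)].

Definition resolvent_on {V : completeNormedModType C} (M : set V)
    (A : V -> V) (z : C) : V -> V := inv_on M (fun v => A v - z *: v).

Definition lin_span {V : completeNormedModType C} (S : set V) : set V :=
  [set v | exists n (a : 'I_n -> C) (e : 'I_n -> V),
     (forall i, S (e i)) /\ v = \sum_i a i *: e i].

Definition has_dim {V : completeNormedModType C} (M : set V) (n : nat) : Prop :=
  exists e : 'I_n -> V,
    M = [set v | exists a : 'I_n -> C, v = \sum_i a i *: e i] /\
    forall a : 'I_n -> C, \sum_i a i *: e i = 0 -> forall i, a i = 0.

(* Equality of the (possibly infinite) dimensions of two linear subspaces. *)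
Definition same_dim {V W : completeNormedModType C} (M : set V) (N : set W) :
    Prop :=
  exists f : V -> W, set_bij M N f /\
    forall (a : C) x y, M x -> M y -> f (a *: x + y) = a *: f x + f y.

Definition nb_neg_eigenvalues {H : completeNormedModType C} (T : H -> H)
    (n : nat) : Prop :=
  exists (s : seq C) (d : C -> nat),
    [/\ uniq s,
        forall l, l \in s <-> l < 0 /\ exists2 h, h != 0 & T h = l *: h,
        forall l, l \in s -> has_dim [set h | T h = l *: h] (d l) &
        n = (\sum_(l <- s) d l)%N].

Definition op_cvg {V W : completeNormedModType C} (F : set_system C)
    (T : C -> V -> W) (L : V -> W) : Prop :=
  forall e : C, 0 < e ->
    \forall z \near F, forall v, `|T z v - L v| <= e * `|v|.

Definition at_infinity : set_system C :=
  [set P | exists2 r : C, 0 < r & forall z, r < `|z| -> P z].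

End Operators.

Record opfun {R : realType} (H : completeNormedModType (Cplx R)) := OpFun {
  dom : set (Cplx R);
  opval :> Cplx R -> H -> H }.

Section OperatorFunctions.
Context {R : realType}.
Local Notation C := (Cplx R).
Context {H : completeNormedModType C}.

Definition op_differentiable (F : C -> H -> H) (z : C) : Prop :=
  exists2 D : H -> H, bounded_op D &
    op_cvg z^' (fun w h => (w - z)^-1 *: (F w h - F z h)) D.

Definition holomorphic_on (U : set C) (F : C -> H -> H) : Prop :=
  forall z, U z -> bounded_op (F z) /\ op_differentiable F z.

Definition extends (G F : opfun H) : Prop :=
  dom F `<=` dom G /\ forall z, dom F z -> forall h, G z h = F z h.

Definition holomorphic_at_infinity (F : opfun H) (L : H -> H) : Prop :=
  [/\ exists2 r : C, 0 < r & forall z, r < `|z| -> dom F z,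
      holomorphic_on (dom F) F,
      bounded_op L &
      op_cvg at_infinity (fun z h => z *: F z h) L].

(* The matrix of the numbers (N_F(z_i, z_j) h_i, h_j), where the adjoint in
   N_F(z, w) = (F(z) - F(w)^* ) / (z - w^bar) is moved to the right-hand
   argument of the inner product. *)
Definition nevanlinna_matrix (ip : {dot H for conjC}) (F : opfun H) (n : nat)
    (z : 'I_n -> C) (h : 'I_n -> H) : 'M[C]_n :=
  \matrix_(i, j) ((ip (F (z i) (h i)) (h j) - ip (h i) (F (z j) (h j)))
                  / (z i - conjC (z j))).

(* Counted with algebraic multiplicity, as roots of the characteristic
   polynomial. *)
Definition mx_neg_eigenvalues (n : nat) (M : 'M[C]_n) : nat :=
  count (fun l => l < 0) (sval (closed_field_poly_normal (char_poly M))).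

Record gen_nevanlinna (ip : {dot H for conjC}) (kappa : nat) (F : opfun H) :
    Prop := {
  gn_open : open (dom F);
  gn_holomorphic : holomorphic_on (dom F) F;
  gn_meromorphic : forall z, 'Im z != 0 ->
    exists (k : nat) (U : set C) (G : C -> H -> H),
      [/\ open U, U z, holomorphic_on U G &
          forall w, U w -> w != z ->
            dom F w /\ forall h, (w - z) ^+ k *: F w h = G w h];
  (* [dom F] is the domain of holomorphy: it contains every point to a
     neighbourhood of which [F] continues holomorphically. *)
  gn_maximal : forall (z : C) (U : set C) (G : C -> H -> H),
    open U -> U z -> holomorphic_on U G ->
    (forall w, U w -> dom F w -> forall h, G w h = F w h) -> dom F z;
  gn_symmetric : forall z, dom F z ->
    dom F (conjC z) /\ forall h h', ip (F z h) h' = ip h (F (conjC z) h');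
  gn_kernel_le : forall n (z : 'I_n -> C) (h : 'I_n -> H),
    (forall i, dom F (z i) /\ 0 < 'Im (z i)) ->
    (mx_neg_eigenvalues (nevanlinna_matrix ip F z h) <= kappa)%N;
  gn_kernel_eq : exists n (z : 'I_n -> C) (h : 'I_n -> H),
    (forall i, dom F (z i) /\ 0 < 'Im (z i)) /\
    mx_neg_eigenvalues (nevanlinna_matrix ip F z h) = kappa }.

Definition neg_inverse (F : opfun H) : opfun H :=
  OpFun [set z | dom F z /\ bdd_invertible_on setT (F z)]
        (fun z h => - inv_on setT (F z) h).

End OperatorFunctions.

Section Pontryagin.
Context {R : realType}.
Local Notation C := (Cplx R).
Context {K : completeNormedModType C}.

(* [M = Mp [+] Mm], with [Mp] positive and [Mm] negative. *)
Record fundamental_decomposition (br : {hermitian K for false & conjC})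
    (M Mp Mm : set K) : Prop := {
  fd_pos_submod : submod_closed [in Mp];
  fd_neg_submod : submod_closed [in Mm];
  fd_sum : M = [set k | exists x y, [/\ Mp x, Mm y & k = x + y]];
  fd_ortho : forall x y, Mp x -> Mm y -> br x y = 0;
  fd_pos : forall x, Mp x -> x != 0 -> 0 < br x x;
  fd_neg : forall y, Mm y -> y != 0 -> br y y < 0 }.

(* The closed subspace [M], with the form [br], is a Pontryagin space of
   negative index [n].  The norm of [K] restricted to [M] is only required to
   be equivalent to the norm of a fundamental decomposition, so it defines the
   topology of the Pontryagin space; as [M] is complete, ([Mp], br) is then a
   Hilbert space.  For the space [K] itself take [M = setT]. *)
Definition pontryagin (br : {hermitian K for false & conjC}) (M : set K)
    (n : nat) : Prop :=
  closed M /\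
  exists Mp Mm : set K,
    [/\ fundamental_decomposition br M Mp Mm,
        has_dim Mm n &
        exists c d : C, [/\ 0 < c, 0 < d & forall x y, Mp x -> Mm y ->
          c * `|x + y| ^+ 2 <= br x x - br y y <= d * `|x + y| ^+ 2]].

Definition selfadjoint_op (br : {hermitian K for false & conjC})
    (A : K -> K) : Prop := forall x y, br (A x) y = br x (A y).

Definition selfadjoint_rel (br : {hermitian K for false & conjC})
    (B : set (K * K)) : Prop :=
  B = [set p | forall q, B q -> br p.2 q.1 = br p.1 q.2].

(* [S = (B - z)^-1] as a bounded everywhere defined operator. *)
Definition rel_resolvent (B : set (K * K)) (z : C) (S : K -> K) : Prop :=
  bounded_op S /\ forall x w, S w = x <-> B (x, w + z *: x).

Definition rel_resolvent_set (B : set (K * K)) : set C :=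
  [set z | exists S, rel_resolvent B z S].

(* Points of the extended plane are elements of [option C]; [None] is
   infinity. *)
Definition rel_eigenvalue (B : set (K * K)) (a : option C) : Prop :=
  match a with
  | Some l => exists2 x, x != 0 & B (x, l *: x)
  | None => exists2 g, g != 0 & B (0, g)
  end.

Fixpoint rel_ker_pow (B : set (K * K)) (l : C) (n : nat) (x : K) : Prop :=
  match n with
  | 0%N => x = 0
  | n'.+1 => exists2 y, B (x, y + l *: x) & rel_ker_pow B l n' y
  end.

Definition root_manifold (B : set (K * K)) (l : C) : set K :=
  [set x | exists n, rel_ker_pow B l n x].

End Pontryagin.

Section Representations.
Context {R : realType}.
Local Notation C := (Cplx R).
Context {H : completeNormedModType C}.

(* [B] is the representing relation of a minimal representation
     F(z) = F(z0)^* + (z - z0^bar) Gp (I + (z - z0)(B - z)^-1) G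
   of [F] in the Pontryagin space ([K], [br]); [Fz0s] is F(z0)^* and [Gp] is
   the adjoint of [G]. *)
Definition minimal_representation (ip : {dot H for conjC}) (F : opfun H)
    {K : completeNormedModType C} (br : {hermitian K for false & conjC})
    (B : set (K * K)) : Prop :=
  exists (z0 : C) (G : H -> K) (Gp : K -> H) (Fz0s : H -> H),
    [/\ exists n, pontryagin br setT n,
        selfadjoint_rel br B,
        [/\ 0 < 'Im z0, dom F z0 & rel_resolvent_set B z0],
        [/\ bounded_op G,
            forall k h, ip (Gp k) h = br k (G h) &
            forall h h', ip (Fz0s h) h' = ip h (F z0 h')] &
        (forall z S, dom F z -> rel_resolvent B z S -> forall h,
           F z h = Fz0s h
                   + (z - conjC z0) *: Gp (G h + (z - z0) *: S (G h))) /\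
        closure (lin_span [set k | exists z S h,
           rel_resolvent B z S /\ k = G h + (z - z0) *: S (G h)]) = setT].

Definition generalized_pole (ip : {dot H for conjC}) (F : opfun H)
    (a : option C) : Prop :=
  exists (K : completeNormedModType C) (br : {hermitian K for false & conjC})
    (B : set (K * K)), minimal_representation ip F br B /\ rel_eigenvalue B a.

Definition generalized_zero (ip : {dot H for conjC}) (F : opfun H)
    (a : option C) : Prop := generalized_pole ip (neg_inverse F) a.

(* The multiplicities of [l] as a generalized pole of [F1] and of [F2] agree
   (being 0 at points that are not generalized poles). *)
Definition same_pole_multiplicity (ip : {dot H for conjC}) (F1 F2 : opfun H)
    (l : C) : Prop :=
  forall (K1 K2 : completeNormedModType C)
    (br1 : {hermitian K1 for false & conjC})
    (br2 : {hermitian K2 for false & conjC})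
    (B1 : set (K1 * K1)) (B2 : set (K2 * K2)),
  minimal_representation ip F1 br1 B1 -> minimal_representation ip F2 br2 B2 ->
  same_dim (root_manifold B1 l) (root_manifold B2 l).

End Representations.

Section Decomposition.
Context {R : realType}.
Local Notation C := (Cplx R).
Context {H K : completeNormedModType C}.

(* Below, [Gp] stands for the adjoint of [G : H -> K], and [Gtp] for the
   adjoint of [Gtilde : H -> (I - P) K]. *)

Definition Ghat (G : H -> K) (Gp : K -> H) : H -> H :=
  inv_on setT (Gp \o G).

Definition Pproj (G : H -> K) (Gp : K -> H) : K -> K :=
  fun k => G (Ghat G Gp (Gp k)).

Definition ImP (G : H -> K) (Gp : K -> H) : K -> K :=
  fun k => k - Pproj G Gp k.

Definition Atilde (A : K -> K) (G : H -> K) (Gp : K -> H) : K -> K :=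
  fun k => ImP G Gp (A k).

Definition Shat (A : K -> K) (G : H -> K) (Gp : K -> H) : H -> H :=
  fun h => - Ghat G Gp (Gp (A (G (Ghat G Gp h)))).

Definition Gtilde (A : K -> K) (G : H -> K) (Gp : K -> H) : H -> K :=
  fun h => ImP G Gp (A (G (Ghat G Gp h))).

Definition Qhat1 (A : K -> K) (G : H -> K) (Gp : K -> H) : opfun H :=
  OpFun setT (fun z h => Shat A G Gp h + z *: Ghat G Gp h).

(* The domain is the resolvent set of [Atilde] in the space [(I - P) K]. *)
Definition Qhat2 (A : K -> K) (G : H -> K) (Gp Gtp : K -> H) : opfun H :=
  OpFun (resolvent_set_on (range (ImP G Gp)) (Atilde A G Gp))
        (fun z h => Gtp (resolvent_on (range (ImP G Gp)) (Atilde A G Gp) z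
                           (Gtilde A G Gp h))).

(* [Q] in N_kappa is holomorphic at infinity with Q'(oo) = [L] boundedly
   invertible, and Q(z) = Gp (A - z)^-1 G is a minimal representation. *)
Record invertible_at_infinity (ip : {dot H for conjC}) (kappa : nat)
    (Q : opfun H) (L : H -> H) (br : {hermitian K for false & conjC})
    (A : K -> K) (G : H -> K) (Gp Gtp : K -> H) : Prop := {
  ii_class : gen_nevanlinna ip kappa Q;
  ii_infinity : holomorphic_at_infinity Q L;
  ii_invertible : bdd_invertible_on setT L;
  ii_pontryagin : exists n, pontryagin br setT n;
  ii_A_bounded : bounded_op A;
  ii_A_selfadjoint : selfadjoint_op br A;
  ii_G_bounded : bounded_op G;
  ii_G_adjoint : forall k h, ip (Gp k) h = br k (G h);
  ii_domain : dom Q = resolvent_set_on setT A;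
  ii_formula : forall z, dom Q z -> forall h,
    Q z h = Gp (resolvent_on setT A z (G h));
  ii_minimal : closure (lin_span [set k | exists z h,
    resolvent_set_on setT A z /\ k = resolvent_on setT A z (G h)]) = setT;
  ii_Gtilde_adjoint : forall k h, range (ImP G Gp) k ->
    ip (Gtp k) h = br k (Gtilde A G Gp h) }.

End Decomposition.

(* Main.v *)
(** Let [A~] be the compression of [A] to [ker G+ = (I - P) K]. Splitting
    [A - z] along [K = (I - P) K [+] P K] (a Schur complement) shows that
    [- Q^-1] is represented in [K] by the self-adjoint relation
    [{(x, A x + G h) : G+ x = 0}], whose operator part is [A~] and whose
    multivalued part is [ran G], and this gives the decomposition. The vectors
    [A^k G h] are total in [K] because almost every nonreal point is joined to
    infinity by a vertical ray in the resolvent set; totality descends to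
    [(I - P) K], so the representations of [- Q^-1] and of [Q2^] are minimal.
    A minimal representation is unique up to isomorphism, hence generalized
    poles and root manifolds can be read off these two, where they agree at
    finite points. The numbers of negative squares are the negative indices of
    the minimal spaces; on [P K] the indefinite form is the form of [G+ G]
    transported by [G], and the indices of [P K] and [(I - P) K] add up. *)
Require Import Defs.
From HB Require Import structures.
From mathcomp Require Import all_boot all_order all_algebra.
From mathcomp Require Import complex ring.
From mathcomp Require Import all_classical all_reals all_analysis.
Set Implicit Arguments.
Unset Strict Implicit.
Unset Printing Implicit Defensive.
Import Order.TTheory GRing.Theory Num.Def Num.Theory.
Import numFieldNormedType.Exports.
Local Open Scope classical_set_scope.
Local Open Scope ring_scope.

(** Fundamental decompositions are awkward to transport, so two surrogates replace them. [krein]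
    says that the form is bounded and uniformly nondegenerate; [maxneg] gives a finite negative
    system with nonnegative orthogonal companion, whose length is the index. Such a system yields an
    equivalent Hilbert norm, and also the mechanism behind most existence claims: B - z is bounded
    below where finitely many functionals vanish, so its range is closed, and surjectivity is
    decided by the vectors orthogonal to the range. Statements about points hold off a finite list
    of nonreal points; the points left out are reached by continuity, and two functions are compared
    off the union of their lists. Membership in a class demands the full domain of holomorphy,
    whereas [Qhat2] is given on a resolvent set. Local continuations are therefore glued,
    unambiguously because that set is dense. Meromorphy at nonreal spectral points comes from
    splitting off the root subspace with biorthogonal bases; Neumann series and the resolvent
    identity take the place of contour integrals. *)

Section Scalars.
Variable R : realType.
Local Notation C := (Cplx R).

(** Strict positivity in [Cplx] entails reality, which reduces the claim to the archimedean property
    of [R]. *)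
Lemma inv_nat_lt (e : C) : 0 < e ->
  exists N : nat, forall n, (N <= n)%N -> (n.+1%:R : C)^-1 < e.
Proof.
case: e => a b; rewrite ltcE /= => /andP[/eqP b0 a0]; subst b.
exists (Num.bound a^-1) => n Nn.
change ((a +i* 0)%C) with (a%:C%C : C).
have aC0 : 0 < (a%:C%C : C) by rewrite ltcR.
rewrite invf_plt ?posrE ?ltr0n //.
have -> : (a%:C%C : C)^-1 = (a^-1)%:C%C by rewrite fmorphV.
have -> : n.+1%:R = (n.+1%:R : R)%:C%C :> C by rewrite rmorph_nat.
rewrite ltcR; apply: (lt_le_trans (archi_boundP _)); first by rewrite invr_ge0 ltW.
by rewrite ler_nat (leq_trans Nn).
Qed.

Lemma pos_half (e : C) : 0 < e -> 0 < e / 2.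
Proof. by move=> e0; rewrite divr_gt0. Qed.

Lemma bernoulli (a : C) n : 0 <= a -> 1 + n%:R * a <= (1 + a) ^+ n.
Proof.
move=> a0; elim: n => [|n IH]; first by rewrite mul0r addr0 expr0.
rewrite exprS; apply: le_trans (ler_wpM2l _ IH); last by rewrite addr_ge0.
rewrite -subr_ge0.
have -> : (1 + a) * (1 + n%:R * a) - (1 + n.+1%:R * a) = n%:R * a ^+ 2 :> C.
  by rewrite -(natr1 n); ring.
by rewrite mulr_ge0 ?ler0n ?exprn_ge0.
Qed.

Lemma expr_lt (q e : C) : 0 <= q -> q < 1 -> 0 < e ->
  exists N : nat, forall n, (N <= n)%N -> q ^+ n < e.
Proof.
rewrite le_eqVlt => /predU1P[<- _ e0|q0 q1 e0].
  by exists 1%N => -[|n] //; rewrite expr0n.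
(* With q = 1 / (1 + a), Bernoulli's inequality bounds q^n by 1 / (n a). *)
pose a := q^-1 - 1.
have a0 : 0 < a by rewrite subr_gt0 invf_gt1.
have [N HN] := inv_nat_lt (mulr_gt0 a0 e0).
exists N.+1 => -[//|n]; rewrite ltnS => /HN.
have qa : q = (1 + a)^-1 by rewrite /a addrC subrK invrK.
rewrite qa exprVn => h.
have n0 : 0 < 1 + n.+1%:R * a :> C by rewrite addr_gt0 // mulr_gt0.
have lepow := bernoulli n.+1 (ltW a0).
apply: le_lt_trans (_ : (n.+1%:R * a)^-1 < _).
  rewrite lef_pV2 ?posrE.
  - by apply: le_trans lepow; rewrite lerDr.
  - exact: lt_le_trans n0 lepow.
  - by rewrite mulr_gt0.
by rewrite invfM ltr_pdivrMr// mulrC.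
Qed.

(** Both sides are double sums, compared termwise by ab <= (a^2 + b^2) / 2. *)
Lemma sum_sqr_le n (f : 'I_n -> C) : (forall i, 0 <= f i) ->
  (\sum_i f i) ^+ 2 <= n%:R * \sum_i f i ^+ 2.
Proof.
move=> f0; rewrite expr2 mulr_suml.
under eq_bigr do rewrite mulr_sumr.
have -> : n%:R * \sum_i f i ^+ 2 = \sum_(i < n) \sum_(j < n) ((f i ^+ 2 + f j ^+ 2) / 2) :> C.
  transitivity ((\sum_(i < n) \sum_(j < n) (f i ^+ 2 + f j ^+ 2)) / 2); last first.
    by rewrite mulr_suml; apply: eq_bigr => i _; rewrite mulr_suml.
  rewrite (_ : \sum_(i < n) _ = \sum_(i < n) (f i ^+ 2 *+ n + \sum_(j < n) f j ^+ 2)); last first.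
    by apply: eq_bigr => i _; rewrite big_split /= sumr_const card_ord.
  rewrite big_split /= sumr_const card_ord sumrMnl -mulr2n.
  by rewrite -[_ *+ 2]mulr_natr mulfK ?pnatr_eq0// mulr_natl.
apply: ler_sum => i _; apply: ler_sum => j _.
rewrite ler_pdivlMr// -subr_ge0.
have -> : f i ^+ 2 + f j ^+ 2 - f i * f j * 2 = (f i - f j) ^+ 2 by ring.
by rewrite real_exprn_even_ge0// rpredB// ger0_real.
Qed.

Lemma add_sqr_le (a b : C) : 0 <= a -> 0 <= b -> (a + b) ^+ 2 <= 2 * (a ^+ 2 + b ^+ 2).
Proof.
move=> a0 b0; rewrite -subr_ge0.
have -> : 2 * (a ^+ 2 + b ^+ 2) - (a + b) ^+ 2 = (a - b) ^+ 2 by ring.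
by rewrite real_exprn_even_ge0// rpredB// ger0_real.
Qed.

Lemma not_le0_lt (x : C) : x \is Num.real -> ~ (0 <= x) -> x < 0.
Proof. by move=> xr; case: (real_ge0P xr). Qed.

End Scalars.

Lemma eps_zero (R : realType) (V : normedZmodType (Cplx R)) (x : V) :
  (forall e : Cplx R, 0 < e -> `|x| <= e) -> x = 0.
Proof.
move=> h; apply/eqP; rewrite -normr_le0; apply/negPn/negP => n0.
have x0 : 0 < `|x| by rewrite lt_def normr_ge0 andbT; apply: contra n0 => /eqP ->.
have := h _ (pos_half x0); rewrite ler_pdivlMr// mulr_natr mulr2n.
by rewrite gerDl => /(lt_le_trans x0); rewrite ltxx.
Qed.

(** * Closure, limits and bounded operators in terms of the norm *)

Section Metric.
Variable R : realType.
Local Notation C := (Cplx R).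
Variable K : completeNormedModType C.
Implicit Types (x y : K) (V : set K).

Lemma closureE V x : closure V x <-> forall e : C, 0 < e -> exists2 v, V v & `|x - v| < e.
Proof.
split=> [cl e e0|h B].
  have [v [Vv bv]] := cl _ (nbhsx_ballx x e e0).
  by exists v => //; rewrite -ball_normE in bv.
move=> /nbhs_ballP[e e0 eB]; have [v Vv xv] := h e e0.
by exists v; split=> //; apply: eB; rewrite -ball_normE.
Qed.

Lemma closedE V : closed V <-> forall x, (forall e : C, 0 < e -> exists2 v, V v & `|x - v| < e) -> V x.
Proof. by split=> [cV x /closureE|h x /closureE]; [exact: cV|exact: h]. Qed.

Definition seq_lim (u : nat -> K) (l : K) :=
  forall e : C, 0 < e -> exists N, forall n, (N <= n)%N -> `|l - u n| < e.

Lemma seq_complete (u : nat -> K) :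
  (forall e : C, 0 < e -> exists N, forall m n, (N <= m)%N -> (N <= n)%N -> `|u m - u n| < e) ->
  exists l, seq_lim u l.
Proof.
move=> uc.
have : cauchy (u @ \oo).
  apply/cauchy_ballP => e e0; have [N HN] := uc e e0.
  exists ([set x | exists2 n, (N <= n)%N & x = u n], [set x | exists2 n, (N <= n)%N & x = u n]).
    by split; exists N => // n /= Nn; exists n.
  by move=> [a b] [/= [m Nm ->] [n Nn ->]]; rewrite -ball_normE; exact: HN.
move=> /cauchy_cvg /cvg_ex[l ul]; exists l => e e0.
move/cvgrPdist_lt: ul => /(_ e e0)[N _ HN].
by exists N => n Nn; exact: HN.
Qed.

Lemma seq_lim_unique u l l' : seq_lim u l -> seq_lim u l' -> l = l'.
Proof.
move=> h h'; apply/eqP; rewrite -subr_eq0 -normr_le0; apply/negPn/negP => n0.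
have e0 : 0 < `|l - l'| / 2.
  by rewrite pos_half// lt_def normr_ge0 andbT; apply: contra n0 => /eqP ->.
have [N HN] := h _ e0; have [N' HN'] := h' _ e0.
have := ltrD (HN (maxn N N') (leq_maxl _ _)) (HN' _ (leq_maxr N N')).
rewrite -splitr distrC [X in _ + X]distrC.
set a := u _; rewrite -[X in X + _]normrN opprB => hlt.
have := ler_normD (l - a) (a - l'); rewrite addrA subrK.
by move=> /le_lt_trans /(_ hlt); rewrite ltxx.
Qed.

Lemma normsq_le0 x : `|x| ^+ 2 <= 0 -> x = 0.
Proof.
move=> h; apply/eqP; rewrite -normr_eq0.
have : `|x| ^+ 2 == 0 by rewrite eq_le h exprn_ge0.
by rewrite expf_eq0.
Qed.

End Metric.

Section BoundedOps.
Variable R : realType.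
Local Notation C := (Cplx R).
Variables K K' : completeNormedModType C.

Definition op_bound (T : K -> K') := exists2 c : C, 0 < c & forall x, `|T x| <= c * `|x|.

Lemma bounded_opP (T : K -> K') : bounded_op T <-> linear T /\ op_bound T.
Proof.
split=> [[lT cT]|[lT [c c0 hc]]]; split=> //.
  pose f : {linear K -> K'} := HB.pack T (GRing.isLinear.Build _ _ _ _ _ lT).
  have /linear_bounded_continuous/linear_boundedP/pinfty_ex_gt0[c c0 hc] : continuous f by [].
  by exists c.
pose f : {linear K -> K'} := HB.pack T (GRing.isLinear.Build _ _ _ _ _ lT).
suff : continuous f by [].
apply/linear_bounded_continuous/linear_boundedP.
exists c; split; first exact: gtr0_real.
by move=> r cr x; apply: (le_trans (hc x)); rewrite ler_wpM2r// ltW.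
Qed.

End BoundedOps.

(** * Hermitian forms and maximal negative systems *)

Section Forms.
Variable R : realType.
Local Notation C := (Cplx R).

Section HermForm.
Variables (K : completeNormedModType C) (br : {hermitian K for false & conjC}).

Lemma hfC x y : br x y = (br y x)^*.
Proof. by rewrite hermC mul1r. Qed.
Lemma hfZl a x y : br (a *: x) y = a * br x y.
Proof. by rewrite linearZl_LR. Qed.
Lemma hfZr a x y : br x (a *: y) = a^* * br x y.
Proof. by rewrite linearZr_LR. Qed.
Lemma hfDl x y z : br (x + y) z = br x z + br y z.
Proof. by rewrite linearDl. Qed.
Lemma hfDr x y z : br x (y + z) = br x y + br x z.
Proof. by rewrite linearDr. Qed.
Lemma hfBl x y z : br (x - y) z = br x z - br y z.
Proof. by rewrite linearBl. Qed.
Lemma hfBr x y z : br x (y - z) = br x y - br x z.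
Proof. by rewrite linearBr. Qed.
Lemma hfNl x z : br (- x) z = - br x z.
Proof. by rewrite linearNl. Qed.
Lemma hfNr x z : br x (- z) = - br x z.
Proof. by rewrite linearNr. Qed.
Lemma hf0l z : br 0 z = 0.
Proof. by rewrite linear0l. Qed.
Lemma hf0r z : br z 0 = 0.
Proof. by rewrite linear0r. Qed.
Lemma hf_suml (I : Type) (r : seq I) (P : pred I) E z :
  br (\sum_(i <- r | P i) E i) z = \sum_(i <- r | P i) br (E i) z.
Proof. by rewrite linear_sumlz. Qed.
Lemma hf_sumr (I : Type) (r : seq I) (P : pred I) E z :
  br z (\sum_(i <- r | P i) E i) = \sum_(i <- r | P i) br z (E i).
Proof. by rewrite linear_sumr. Qed.
Lemma hf_real x : br x x \is Num.real.
Proof. by rewrite CrealE -hfC. Qed.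

(** The forms in use are indefinite, so positivity is asked only on the plane spanned by [x] and
    [y], where the discriminant argument runs. *)
Lemma hf_cauchy_schwarz x y :
  (forall a b : C, 0 <= br (a *: x + b *: y) (a *: x + b *: y)) ->
  `|br x y| ^+ 2 <= br x x * br y y.
Proof.
move=> h; set t := br x y.
have E a b : br (a *: x + b *: y) (a *: x + b *: y) =
  a * a^* * br x x + a * b^* * t + b * a^* * t^* + b * b^* * br y y.
  by rewrite hfDl !hfDr !hfZl !hfZr /t (hfC y x); ring.
have A0 : 0 <= br x x by have := h 1 0; rewrite E !(conjC1, conjC0, mul1r, mul0r, mulr0, addr0).
have B0 : 0 <= br y y by have := h 0 1; rewrite E !(conjC1, conjC0, mul1r, mul0r, mulr0, add0r).
set A := br x x in A0 E *; set B := br y y in B0 E *.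
rewrite normCK; have [B_eq0|B_neq0] := eqVneq B 0.
  (* For isotropic [y] this [a] makes the form at [a *: x - t *: y] equal to -a^2 (A + 2), which
     forces a = 0 and with it t = 0. *)
  pose a := t * t^* / (A + 1).
  have t0 : 0 <= t * t^* by rewrite -normCK exprn_ge0.
  have A1 : 0 < A + 1 by rewrite ltr_wpDl.
  have a0 : 0 <= a by rewrite divr_ge0// ltW.
  have ac : a^* = a by apply: conj_Creal; rewrite ger0_real.
  have := h a (- t); rewrite E B_eq0 !mulr0 addr0 rmorphN /= ac.
  have -> : a * a * A + a * - t^* * t + - t * a * t^* = - (a * a * (A + 2)).
    have tt : t * t^* = a * (A + 1) by rewrite divfK// gt_eqF.
    transitivity (a * a * A - 2 * a * (t * t^*)); first by ring.
    by rewrite tt; ring.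
  rewrite oppr_ge0 => h2.
  have A2 : 0 < A + 2 by rewrite ltr_wpDl.
  have : a * a == 0.
    by rewrite eq_le mulr_ge0// andbT -(pmulr_rle0 _ A2) mulrC.
  rewrite mulf_eq0 orbb => /eqP a_eq0.
  by rewrite -[t * t^*](divfK (lt0r_neq0 A1)) -/a a_eq0 mul0r.
have Bp : 0 < B by rewrite lt_def B_neq0.
have := h B (- t); rewrite E rmorphN /= (conj_Creal (ger0_real B0)).
have -> : B * B * A + B * - t^* * t + - t * B * t^* + - t * - t^* * B = B * (A * B - t * t^*) by ring.
by rewrite pmulr_rge0// subr_ge0.
Qed.

Definition negsys (n : nat) (e : 'I_n -> K) := forall i j, br (e i) (e j) = - (i == j)%:R.
(** The algebraic substitute for a fundamental decomposition: by [maxneg_le] no negative system is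
    longer, so [n] is the negative index. *)
Definition maxneg (n : nat) (e : 'I_n -> K) :=
  negsys e /\ forall x, (forall i, br x (e i) = 0) -> 0 <= br x x.

(** For a negative system this is the projection onto its orthogonal companion; the sign is plus
    because [br (e i) (e i)] is -1. *)
Definition eproj (n : nat) (e : 'I_n -> K) x := x + \sum_i br x (e i) *: e i.

Lemma eproj_orth n (e : 'I_n -> K) x j : negsys e -> br (eproj e x) (e j) = 0.
Proof.
move=> he; rewrite hfDl hf_suml (bigD1 j) //= hfZl he eqxx mulrN1 big1 ?addr0 ?subrr// => i ij.
by rewrite hfZl he (negbTE ij) oppr0 mulr0.
Qed.

Lemma eproj_linear n (e : 'I_n -> K) : linear (eproj e).
Proof.
move=> a x y; rewrite /eproj scalerDr addrACA; congr (_ + _).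
rewrite scaler_sumr -big_split; apply: eq_bigr => i _ /=.
by rewrite hfDl hfZl scalerDl scalerA.
Qed.

Lemma negsys_comb n (e : 'I_n -> K) (v w : 'I_n -> C) : negsys e ->
  br (\sum_i v i *: e i) (\sum_i w i *: e i) = - \sum_i v i * (w i)^*.
Proof.
move=> he; rewrite hf_suml -sumrN; apply: eq_bigr => i _.
rewrite hfZl hf_sumr (bigD1 i) //= hfZr he eqxx big1 ?addr0; last first.
  by move=> j ji; rewrite hfZr he eq_sym (negbTE ji) oppr0 mulr0.
by rewrite mulrN1 mulrN.
Qed.

Lemma negsys_comb_orth n (e : 'I_n -> K) (v : 'I_n -> C) i : negsys e ->
  br (\sum_i v i *: e i) (e i) = - v i.
Proof.
move=> he; rewrite hf_suml (bigD1 i)//= hfZl he eqxx mulrN1 big1 ?addr0// => j ji.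
by rewrite hfZl he (negbTE ji) oppr0 mulr0.
Qed.

Lemma eproj_br n (e : 'I_n -> K) x y : negsys e ->
  br x y = br (eproj e x) (eproj e y) - \sum_i br x (e i) * (br y (e i))^*.
Proof.
move=> he; pose u := \sum_i br x (e i) *: e i; pose v := \sum_i br y (e i) *: e i.
have Ex : x = eproj e x - u by rewrite /eproj addrK.
have Ey : y = eproj e y - v by rewrite /eproj addrK.
rewrite [in LHS]Ex [in LHS]Ey hfBl !hfBr.
have o z w : br (eproj e z) (\sum_i br w (e i) *: e i) = 0.
  by rewrite hf_sumr big1// => i _; rewrite hfZr eproj_orth ?mulr0.
rewrite o [br u (eproj _ _)]hfC o conjC0 /u /v negsys_comb// subr0 sub0r opprK.
by [].
Qed.

Lemma sum_normsq_eq0 n (v : 'I_n -> C) : (\sum_i v i * (v i)^* <= 0) -> forall i, v i = 0.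
Proof.
move=> h i; have p j : true -> 0 <= v j * (v j)^* by rewrite -normCK exprn_ge0.
have : \sum_i v i * (v i)^* == 0 by rewrite eq_le h sumr_ge0.
rewrite psumr_eq0// => /allP /(_ i (mem_index_enum i)) /=.
by rewrite -normCK expf_eq0 /= normr_eq0 => /eqP.
Qed.

(** The dimension count behind every comparison of indices: m coefficients subject to fewer than m
    linear equations. *)
Lemma kernel_vector m n (M : 'M[C]_(m, n)) : (n < m)%N ->
  exists2 v : 'I_m -> C, (exists i, v i != 0) & forall j, \sum_i v i * M i j = 0.
Proof.
move=> nm; have rk : (\rank M < m)%N by apply: leq_ltn_trans nm; rewrite rank_leq_col.
have : kermx M != 0 by rewrite -mxrank_eq0 mxrank_ker -lt0n subn_gt0.
move=> /matrix0Pn[i [j kij]].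
exists (fun k => kermx M i k); first by exists j.
move=> l; have /(congr1 (fun A : 'M[C]_(m, n) => A i l)) := mulmx_ker M.
by rewrite !mxE.
Qed.

(** Otherwise some nontrivial combination of the [f i] is orthogonal to all [e j], hence both
    negative and nonnegative. *)
Lemma maxneg_le n m (e : 'I_n -> K) (f : 'I_m -> K) : maxneg e -> negsys f -> (m <= n)%N.
Proof.
move=> [he pe] hf; rewrite leqNgt; apply/negP => nm.
have [v [i vi] hv] := kernel_vector (\matrix_(i, j) br (f i) (e j)) nm.
have : 0 <= br (\sum_i v i *: f i) (\sum_i v i *: f i).
  apply: pe => j; rewrite hf_suml -[RHS](hv j); apply: eq_bigr => k _.
  by rewrite hfZl mxE.
rewrite negsys_comb// oppr_ge0 => /sum_normsq_eq0 /(_ i) vi0.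
by rewrite vi0 eqxx in vi.
Qed.

Lemma maxneg_eq n m (e : 'I_n -> K) (f : 'I_m -> K) : maxneg e -> maxneg f -> n = m.
Proof.
move=> he hf; apply/eqP; rewrite eqn_leq (maxneg_le hf (proj1 he)).
by rewrite (maxneg_le he (proj1 hf)).
Qed.

Definition subspace (V : set K) := V 0 /\ forall a x y, V x -> V y -> V (a *: x + y).

Lemma subspaceZ V a x : subspace V -> V x -> V (a *: x).
Proof. by move=> [V0 VP] Vx; rewrite -[_ *: _]addr0; exact: VP. Qed.
Lemma subspaceD V x y : subspace V -> V x -> V y -> V (x + y).
Proof. by move=> [V0 VP] Vx; rewrite -[x]scale1r; exact: VP. Qed.
Lemma subspaceB V x y : subspace V -> V x -> V y -> V (x - y).
Proof. by move=> VS Vx Vy; apply: subspaceD => //; rewrite -scaleN1r; exact: subspaceZ. Qed.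
Lemma subspace_sum V (I : Type) (r : seq I) (P : pred I) (E : I -> K) : subspace V ->
  (forall i, P i -> V (E i)) -> V (\sum_(i <- r | P i) E i).
Proof. by move=> VS h; elim/big_ind : _ => //; [exact: VS.1|move=> x y; exact: subspaceD]. Qed.

Lemma subspace_submod V : subspace V -> submod_closed [in V].
Proof. by move=> [V0 VP]; split=> [|a x y]; rewrite !inE//; exact: VP. Qed.

Lemma submod_subspace V : submod_closed [in V] -> subspace V.
Proof.
move=> [V0 VP]; split; first by rewrite inE in V0.
by move=> a x y Vx Vy; have := VP a x y; rewrite !inE; apply.
Qed.

Lemma negsys_extend n (e : 'I_n -> K) x : negsys e -> (forall i, br x (e i) = 0) -> br x x < 0 ->
  exists c : C, negsys (fun i : 'I_n.+1 => if unlift ord_max i is Some j then e j else c *: x).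
Proof.
move=> he xe xx; pose s := sqrtC (- br x x).
have s0 : 0 < s by rewrite sqrtC_gt0 oppr_gt0.
have ss : s^-1 * s^-1^* * br x x = -1.
  rewrite (conj_Creal (ger0_real _)) ?invr_ge0 ?ltW// -invfM -expr2 sqrtCK.
  by rewrite invrN mulNr mulVf// lt_eqF.
exists s^-1 => i j; case: unliftP => [i' ->|->]; case: unliftP => [j' ->|->].
- by rewrite he (inj_eq lift_inj).
- by rewrite hfZr hfC xe conjC0 mulr0 eq_sym (negbTE (neq_lift _ _)) oppr0.
- by rewrite hfZl xe mulr0 (negbTE (neq_lift _ _)) oppr0.
- by rewrite hfZl hfZr mulrA ss eqxx.
Qed.

(** A negative vector orthogonal to [f] would extend it to length n + 1, against [maxneg_le]. *)
Lemma negsys_maxneg n (e f : 'I_n -> K) : maxneg e -> negsys f -> maxneg f.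
Proof.
move=> me hf; split=> // x xf; apply: contrapT => /(not_le0_lt (hf_real x)) xx.
by have [c /(maxneg_le me)] := negsys_extend hf xf xx; rewrite ltnn.
Qed.

(* A negative vector orthogonal to a system extends it, so a system of maximal
   size within [V] leaves only nonnegative vectors of [V] in its complement. *)
Lemma exists_maxneg (V : set K) N : subspace V ->
  (forall m (f : 'I_m -> K), (forall i, V (f i)) -> negsys f -> (m <= N)%N) ->
  exists n (e : 'I_n -> K), [/\ forall i, V (e i), negsys e &
    forall x, V x -> (forall i, br x (e i) = 0) -> 0 <= br x x].
Proof.
move=> VS hN; pose P m := `[< exists e : 'I_m -> K, (forall i, V (e i)) /\ negsys e >].
have P0 : exists m, P m.
  exists 0%N; apply/asboolP; exists (fun=> 0); split=> [[]//|[]//].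
have PN m : P m -> (m <= N)%N by move=> /asboolP[e [Ve he]]; exact: hN he.
case: (ex_maxnP P0 PN) => n /asboolP[e [Ve he]] nmax.
exists n, e; split => // x Vx xe; apply: contrapT => /(not_le0_lt (hf_real x)) xx.
have [c hc] := negsys_extend he xe xx.
suff /nmax : P n.+1 by rewrite ltnn.
apply/asboolP; exists (fun i => if unlift ord_max i is Some j then e j else c *: x); split=> //.
by move=> i; case: unliftP => [j _|_]; [exact: Ve|exact: subspaceZ].
Qed.

(** [J] is a fundamental symmetry in weakened form, a bounded function witnessing uniform
    nondegeneracy. In this form the condition passes to the range of a self-adjoint projection by
    composing [J] with the projection, and for the form of a self-adjoint operator bounded below the
    operator itself serves as [J]. *)
Definition krein := exists (J : K -> K) (c b : C), [/\ 0 < c, 0 < b,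
  forall x y, `|br x y| <= b * `|x| * `|y|,
  forall x, `|J x| <= b * `|x| & forall x, c * `|x| ^+ 2 <= br x (J x)].

End HermForm.
End Forms.

(** * Diagonalisation of hermitian matrices *)

Section HermMatrix.
Variable R : realType.
Local Notation C := (Cplx R).

(** Root multiplicities recover the multiset of factors; this ties the algebraic count in
    [mx_neg_eigenvalues] to a diagonal form. *)
Lemma prod_normal_unique n (d : 'I_n -> C) (r : seq C) :
  \prod_(i < n) ('X - (d i)%:P) = \prod_(z <- r) ('X - z%:P) ->
  perm_eq r [seq d i | i <- enum 'I_n].
Proof.
move=> h; rewrite perm_sym; apply/allP => /= z _; apply/eqP.
have := congr1 (mup z) h.
have -> : \prod_(i < n) ('X - (d i)%:P) = \prod_(y <- [seq d i | i <- enum 'I_n]) ('X - y%:P).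
  by rewrite big_map big_enum.
by rewrite !mu_prod_XsubC.
Qed.

(** The spectral theorem, stated as a congruence so that it reads as a change of basis in a
    hermitian form. Unitary congruence is also similarity, so the diagonal entries are the roots of
    the characteristic polynomial. *)
Lemma herm_diag n (M : 'M[C]_n) : (forall i j, M i j = (M j i)^*) ->
  exists (P : 'M[C]_n) (d : 'I_n -> C), [/\ P \in unitmx, forall i, d i \is Num.real,
    forall i j, \sum_k \sum_l P i k * (P j l)^* * M k l = d i *+ (i == j) &
    mx_neg_eigenvalues M = #|[pred i | d i < 0]|].
Proof.
move=> hM.
have Mh : M \is hermsymmx.
  apply/is_hermitianmxP; rewrite expr0 scale1r; apply/matrixP => i j.
  by rewrite !mxE hM.
pose P := spectralmx M; pose sp := spectral_diag M.
have Pu : P \is unitarymx by exact: spectral_unitarymx.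
have EM : M = invmx P *m diag_mx sp *m P by apply/orthomx_spectralP/hermitian_normalmx.
have Punit : P \in unitmx by exact: spectral_unit.
exists P, (fun i => sp 0 i); split=> //.
- by move=> i; have /mxOverP := hermitian_spectral_diag_real Mh; apply.
- move=> i j.
  have E : P *m M *m (P ^t*)%sesqui = diag_mx sp.
    by rewrite EM !mulmxA mulmxV// mul1mx -mulmxA (unitarymxP Pu) mulmx1.
  have := congr1 (fun A : 'M[C]_n => A i j) E; rewrite [in RHS]mxE eq_sym => <-.
  rewrite !mxE exchange_big /=; apply: eq_bigr => l _; rewrite !mxE mulr_suml.
  by apply: eq_bigr => k _; ring.
rewrite /mx_neg_eigenvalues; case: closed_field_poly_normal => r /= Er.
have cp : char_poly M = \prod_(i < n) ('X - (sp 0 i)%:P).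
  have -> : char_poly M = char_poly (diag_mx sp).
    have XC : 'X%:M = map_mx polyC (invmx P) *m 'X%:M *m map_mx polyC P :> 'M[{poly C}]_n.
      rewrite scalar_mxC -mulmxA -map_mxM.
      by rewrite (mulVmx Punit) map_mx1 mulmx1.
    rewrite /char_poly /char_poly_mx [in LHS]EM !map_mxM [X in \det (X - _)]XC.
    rewrite -mulmxBl -mulmxBr !det_mulmx mulrAC -det_mulmx -map_mxM mulVmx//.
    by rewrite map_mx1 det1 mul1r.
  by rewrite char_poly_trig ?diag_mx_is_trig //; apply: eq_bigr => i _; rewrite mxE eqxx.
move: Er; rewrite (monicP (char_poly_monic M)) scale1r cp => /prod_normal_unique/permP -> .
rewrite count_map -size_filter cardE /enum_mem -enumT.
by rewrite -filter_predI; congr size; apply: eq_filter => i; rewrite !inE andbT.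
Qed.

End HermMatrix.

Section MkHerm.
Variable R : realType.
Local Notation C := (Cplx R).
Variable (K : completeNormedModType C).
Variable f : K -> K -> C.
Hypothesis fl : forall z, linear_for *%R (f^~ z).
Hypothesis fs : forall x y, f x y = (f y x)^*.

Lemma mk_hermitian_bilinear : bilinear_for *%R (conjC \; *%R) f.
Proof.
split=> z a x y /=; first exact: fl.
by rewrite fs fl rmorphD rmorphM /= (fs z x) (fs z y).
Qed.

Lemma mk_hermitian_sym x y : f x y = (-1) ^+ false * (f y x)^*.
Proof. by rewrite mul1r. Qed.

Definition mk_hermitian : {hermitian K for false & conjC} :=
  HB.pack f (@bilinear_isBilinear.Build C K K C _ _ f mk_hermitian_bilinear)
   (@isHermitianSesquilinear.Build C K false conjC f mk_hermitian_sym).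

Lemma mk_hermitianE x y : mk_hermitian x y = f x y.
Proof. by []. Qed.
End MkHerm.

Section NegForm.
Variable R : realType.
Local Notation C := (Cplx R).
Variables (K : completeNormedModType C) (br : {hermitian K for false & conjC}).
Lemma negform_linear z : linear_for *%R ((fun x y => - br x y)^~ z).
Proof. by move=> a x y; rewrite hfDl hfZl opprD mulrN. Qed.
Lemma negform_sym x y : - br x y = (- br y x)^*.
Proof. by rewrite rmorphN /= -hfC. Qed.
(** Makes the negative summand of a fundamental decomposition positive, so that [hf_cauchy_schwarz]
    covers it. *)
Definition negform := mk_hermitian negform_linear negform_sym.
Lemma negformE x y : negform x y = - br x y.
Proof. by []. Qed.
End NegForm.

(** * Pontryagin spaces as Krein forms with a maximal negative system *)

Section Pontryagin.
Variable R : realType.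
Local Notation C := (Cplx R).
Variables (K : completeNormedModType C) (br : {hermitian K for false & conjC}).

Definition gram n (f : 'I_n -> K) : 'M[C]_n := \matrix_(i, j) br (f i) (f j).

Lemma gram_diag n (f : 'I_n -> K) :
  exists (P : 'M[C]_n) (d : 'I_n -> C), [/\ P \in unitmx, forall i, d i \is Num.real,
    forall a b, br (\sum_i P a i *: f i) (\sum_i P b i *: f i) = d a *+ (a == b) &
    mx_neg_eigenvalues (gram f) = #|[pred i | d i < 0]|].
Proof.
have [|P [d [Pu dr hP hc]]] := @herm_diag _ _ (gram f).
  by move=> i j; rewrite !mxE hfC.
exists P, d; split=> // a b; rewrite -hP hf_suml; apply: eq_bigr => i _.
rewrite hf_sumr; apply: eq_bigr => j _.
by rewrite hfZl hfZr mxE; ring.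
Qed.

(** Since (1 + k)^2 >= k, no square root has to enter the constants. *)
Lemma sqr_bound (k a b : C) : 0 <= k -> 0 <= a -> 0 <= b -> a ^+ 2 <= k * b ^+ 2 -> a <= (1 + k) * b.
Proof.
move=> k0 a0 b0 h.
rewrite -(@ler_pXn2r _ 2) ?nnegrE// ?mulr_ge0 ?addr_ge0//.
apply: (le_trans h); rewrite exprMn ler_wpM2r ?exprn_ge0//.
rewrite -subr_ge0 (_ : _ - k = 1 + k + k ^+ 2); last by ring.
by rewrite !addr_ge0 ?exprn_ge0.
Qed.

Lemma br_bound_le (b : C) (x : K) : 0 < b -> (forall x y : K, `|br x y| <= b * `|x| * `|y|) -> `|br x x| <= b * `|x| ^+ 2.
Proof. by move=> b0 h; rewrite expr2 mulrA. Qed.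

Lemma eproj_bound n (e : 'I_n -> K) : krein br -> exists2 c : C, 0 < c & forall x, `|eproj br e x| <= c * `|x|.
Proof.
move=> [J [c [b [c0 b0 hb _ _]]]].
exists (1 + \sum_i b * `|e i| * `|e i|).
  by rewrite ltr_wpDr// sumr_ge0// => i _; rewrite !mulr_ge0// ltW.
move=> x; rewrite (le_trans (ler_normD _ _))// mulrDl mul1r lerD2l.
rewrite (le_trans (ler_norm_sum _ _ _))// mulr_suml ler_sum// => i _.
by rewrite normrZ mulrAC ler_wpM2r// mulrAC.
Qed.

(** The middle expression reverses the sign of the form on the span of [e]: it is the Hilbert
    majorant. The lower bound is the substance: on the companion of [e] the form is only known to be
    nonnegative, and Cauchy-Schwarz against the projection of [J y] turns this into a uniform
    bound. *)
Lemma maxneg_norm n (e : 'I_n -> K) : krein br -> maxneg br e ->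
  exists c b : C, [/\ 0 < c, 0 < b & forall x,
    c * `|x| ^+ 2 <= br x x + 2 * \sum_i `|br x (e i)| ^+ 2 <= b * `|x| ^+ 2].
Proof.
move=> Kr [he pe]; have [a a0 ha] := eproj_bound e Kr.
have [J [c [b [c0 b0 hb hJ hc]]]] := Kr.
pose q := eproj br e.
have q0 x : 0 <= br (q x) (q x) by apply: pe => i; exact: eproj_orth.
have qid x : (forall i, br x (e i) = 0) -> q x = x.
  by move=> h; rewrite /q /eproj big1 ?addr0// => i _; rewrite h scale0r.
have qqx x : q (q x) = q x by apply: qid => i; exact: eproj_orth.
(* The bound of the form at [q (J y)] divided by c^2; Cauchy-Schwarz reads (c |y|^2)^2 <= br y y *
   (b a^2 b^2 |y|^2). *)
pose k := b * a ^+ 2 * b ^+ 2 / c ^+ 2.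
have k0 : 0 < k by rewrite !mulr_gt0 ?exprn_gt0 ?invr_gt0 ?exprn_gt0.
have hq x : `|q x| ^+ 2 <= k * br (q x) (q x).
  pose y := q x; have h1 : br y (J y) = br y (q (J y)).
    rewrite (eproj_br y (J y) he) [eproj br e y]qqx.
    by rewrite big1 ?subr0// => i _; rewrite eproj_orth ?mul0r.
  have cs : `|br y (q (J y))| ^+ 2 <= br y y * br (q (J y)) (q (J y)).
    apply: hf_cauchy_schwarz => u v; apply: pe => i.
    by rewrite hfDl !hfZl !eproj_orth// !mulr0 addr0.
  have h2 : br (q (J y)) (q (J y)) <= b * a ^+ 2 * b ^+ 2 * `|y| ^+ 2.
    have nq : `|q (J y)| <= a * b * `|y| by rewrite (le_trans (ha _))// -mulrA ler_pM2l.
    rewrite (le_trans (real_ler_norm (hf_real _ _)))// (le_trans (br_bound_le _ b0 hb))//.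
    rewrite (_ : _ * `|y| ^+ 2 = b * (a * b * `|y|) ^+ 2); last by ring.
    by rewrite ler_pM2l// lerXn2r ?nnegrE// !mulr_ge0// ltW.
  have h3 : (c * `|y| ^+ 2) ^+ 2 <= br y y * (b * a ^+ 2 * b ^+ 2 * `|y| ^+ 2).
    apply: le_trans (le_trans cs _); last by rewrite ler_wpM2l// q0.
    have cy0 : 0 <= c * `|y| ^+ 2 by rewrite mulr_ge0 ?exprn_ge0// ltW.
    rewrite lerXn2r ?nnegrE// -h1.
    exact: le_trans (hc _) (real_ler_norm (ger0_real (le_trans cy0 (hc _)))).
  have [y0|y0] := eqVneq `|y| 0.
    by rewrite -/y y0 expr0n /= mulr_ge0 ?q0// ltW.
  have yp : 0 < `|y| ^+ 2 by rewrite exprn_gt0// lt_def y0 normr_ge0.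
  rewrite -/y -(ler_pM2r yp) -(ler_pM2l (exprn_gt0 2 c0)).
  rewrite [X in X <= _](_ : _ = (c * `|y| ^+ 2) ^+ 2); last by ring.
  rewrite (le_trans h3)// /k le_eqVlt; apply/predU1P; left; field.
  by rewrite gt_eqF.
(* The factor n + 1 dominates both 1, for the part in the companion, and n, for the terms along
   [e]. *)
pose m := n.+1%:R * (k + \sum_i `|e i| ^+ 2) : C.
have se0 : 0 <= \sum_i `|e i| ^+ 2 by rewrite sumr_ge0// => i _; rewrite exprn_ge0.
have m0 : 0 < m by apply: mulr_gt0; [rewrite ltr0n|exact: ltr_wpDr].
have pE x : br x x + 2 * \sum_i `|br x (e i)| ^+ 2 = br (q x) (q x) + \sum_i `|br x (e i)| ^+ 2.
  rewrite (eproj_br x x he) -/(q x) (eq_bigr (fun i => `|br x (e i)| ^+ 2)); first by ring.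
  by move=> i _; rewrite normCK.
exists (2 * m)^-1, (b + 2 * \sum_i (b * `|e i|) ^+ 2); split.
- by rewrite invr_gt0 mulr_gt0.
- rewrite ltr_wpDr// mulr_ge0// sumr_ge0// => i _; rewrite exprn_ge0// mulr_ge0// ltW//.
move=> x; apply/andP; split; last first.
  rewrite [leRHS]mulrDl; apply: lerD.
    by rewrite (le_trans (real_ler_norm (hf_real _ _)))// br_bound_le.
  rewrite -mulrA ler_pM2l// mulr_suml ler_sum// => i _.
  rewrite -exprMn lerXn2r ?nnegrE ?mulr_ge0//; first exact: ltW.
  by rewrite (le_trans (hb _ _))// mulrAC.
have m20 : 0 < 2 * m by exact: mulr_gt0.
rewrite pE ler_pdivrMl//.
have sx0 : 0 <= \sum_i `|br x (e i)| ^+ 2 by rewrite sumr_ge0// => i _; rewrite exprn_ge0.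
have : `|x| ^+ 2 <= 2 * (`|q x| ^+ 2 + (\sum_i `|br x (e i)| * `|e i|) ^+ 2).
  apply: le_trans (add_sqr_le _ _) => //; last by rewrite sumr_ge0// => i _; rewrite mulr_ge0.
  have s0 : 0 <= \sum_i `|br x (e i)| * `|e i| by rewrite sumr_ge0// => i _; rewrite mulr_ge0.
  rewrite lerXn2r ?nnegrE// ?addr_ge0//.
  rewrite -{1}[x](addrK (\sum_i br x (e i) *: e i)) (le_trans (ler_normB _ _))// lerD2l.
  by rewrite (le_trans (ler_norm_sum _ _ _))// ler_sum// => i _; rewrite normrZ.
move/le_trans; apply; rewrite -mulrA ler_pM2l//.
apply: (@le_trans _ _ (k * br (q x) (q x) + n%:R * \sum_i (`|br x (e i)| * `|e i|) ^+ 2)).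
  by rewrite lerD// sum_sqr_le// => i; rewrite mulr_ge0.
rewrite mulrDr lerD//.
  rewrite ler_wpM2r// /m; apply: (@le_trans _ _ (1 * (k + \sum_i `|e i| ^+ 2))).
    by rewrite mul1r lerDl.
  by rewrite ler_wpM2r ?ler1n// addr_ge0// ltW.
have : \sum_i (`|br x (e i)| * `|e i|) ^+ 2 <= (\sum_i `|e i| ^+ 2) * \sum_i `|br x (e i)| ^+ 2.
  rewrite mulr_sumr ler_sum// => i _; rewrite exprMn mulrC ler_wpM2r ?exprn_ge0//.
  by rewrite (bigD1 i)//= lerDl sumr_ge0// => j _; rewrite exprn_ge0.
move=> h; apply: (le_trans (ler_wpM2l _ h)); first exact: ler0n.
rewrite mulrA ler_wpM2r// /m; apply: ler_pM => //; first by rewrite ler_nat.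
by rewrite lerDr ltW.
Qed.

Lemma maxneg_pontryagin n (e : 'I_n -> K) : krein br -> maxneg br e -> pontryagin br setT n.
Proof.
move=> Kr [he pe]; split; first exact: closedT.
have [c [b [c0 b0 hcb]]] := maxneg_norm Kr (conj he pe).
pose Mp := [set x | forall i, br x (e i) = 0].
pose Mm := [set x | exists a : 'I_n -> C, x = \sum_i a i *: e i].
(* On a decomposed vector the majorant is the sum of the two definite parts, the expression to be
   compared with the norm. *)
have pE x y : Mp x -> Mm y -> br (x + y) (x + y) + 2 * \sum_i `|br (x + y) (e i)| ^+ 2 = br x x - br y y.
  move=> xe [a ->]; rewrite negsys_comb// hfDl !hfDr negsys_comb//.
  rewrite (hfC br (\sum_i _) x) hf_sumr big1; last by move=> i _; rewrite hfZr xe mulr0.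
  rewrite (_ : \sum_i `|_| ^+ 2 = \sum_i a i * (a i)^*); first by rewrite conjC0; ring.
  by apply: eq_bigr => i _; rewrite hfDl xe add0r negsys_comb_orth// normrN normCK.
have Mp0 : Mp 0 by move=> i; rewrite hf0l.
have Mm0 : Mm 0 by exists (fun=> 0); rewrite big1// => i _; rewrite scale0r.
exists Mp, Mm; split.
- split.
  + apply: subspace_submod; split=> // a x y xe ye i; by rewrite hfDl hfZl xe ye mulr0 addr0.
  + apply: subspace_submod; split=> // a x y [u ->] [v ->]; exists (fun i => a * u i + v i).
    by rewrite scaler_sumr -big_split; apply: eq_bigr => i _ /=; rewrite scalerDl scalerA.
  + apply/seteqP; split=> // x _; exists (eproj br e x), (- \sum_i br x (e i) *: e i); split.
    * by move=> i; rewrite eproj_orth.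
    * by exists (fun i => - br x (e i)); rewrite -sumrN; apply: eq_bigr => i _; rewrite scaleNr.
    * by rewrite /eproj addrK.
  + by move=> x y xe [a ->]; rewrite hf_sumr big1// => i _; rewrite hfZr xe mulr0.
  + move=> x xe x0; have := hcb x; rewrite big1 ?mulr0 ?addr0; last by move=> i _; rewrite xe normr0 expr0n.
    by move=> /andP[h _]; apply: lt_le_trans h; rewrite mulr_gt0// exprn_gt0// normr_gt0.
  + move=> y [a ->] y0; rewrite negsys_comb// oppr_lt0.
    rewrite lt_def sumr_ge0 ?andbT; last by move=> i _; rewrite -normCK exprn_ge0.
    apply: contra_neq y0 => h; rewrite big1// => i _.
    by rewrite (@sum_normsq_eq0 _ _ a) ?scale0r// h.
- exists e; split => // a h i; have := negsys_comb_orth a i he.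
  by rewrite h hf0l => /esym/eqP; rewrite oppr_eq0 => /eqP.
- exists c, b; split=> // x y xe ye; rewrite -pE//.
Qed.

Lemma pontryagin_maxneg n : pontryagin br setT n -> krein br /\ exists e : 'I_n -> K, maxneg br e.
Proof.
move=> [_ [Mp [Mm [[/submod_subspace Sp /submod_subspace Sm sum_ ortho pos neg] [f [fM findep]] [c [d [c0 d0 hcd]]]]]]].
have dec k : exists p : K * K, [/\ Mp p.1, Mm p.2 & k = p.1 + p.2].
  have : setT k by []. by rewrite sum_ => -[x [y [? ? ?]]]; exists (x, y).
have [p hp] := choice dec.
have pos0 x : Mp x -> 0 <= br x x.
  by move=> hx; have [->|x0] := eqVneq x 0; rewrite ?hf0l// ltW// pos.
have neg0 x : Mm x -> br x x <= 0.
  by move=> hx; have [->|x0] := eqVneq x 0; rewrite ?hf0l// ltW// neg.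
have ortho' x y : Mm x -> Mp y -> br x y = 0 by move=> hx hy; rewrite hfC ortho// conjC0.
have MmN y : Mm y -> Mm (- y) by move=> hy; rewrite -scaleN1r; exact: subspaceZ.
split.
  (* [J] will be the difference of the two components. Replacing the negative component by its
     opposite leaves the definite expression unchanged, so the norm equivalence bounds [J]. *)
  have nJ x : c * `|(p x).1 - (p x).2| ^+ 2 <= d * `|x| ^+ 2.
    have [h1 h2 h3] := hp x; have := hcd _ _ h1 (MmN _ h2); rewrite hfNl hfNr opprK => /andP[h _].
    apply: (le_trans h); rewrite [in X in _ <= X]h3; by have /andP[] := hcd _ _ h1 h2.
  have dc0 : 0 <= d / c by rewrite divr_ge0// ltW.
  have p1 x : br (p x).1 (p x).1 <= d * `|x| ^+ 2.
    have [h1 h2 h3] := hp x; have /andP[_ h] := hcd _ _ h1 h2; rewrite -h3 in h.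
    by apply: le_trans h; rewrite lerDl oppr_ge0 neg0.
  have p2 x : - br (p x).2 (p x).2 <= d * `|x| ^+ 2.
    have [h1 h2 h3] := hp x; have /andP[_ h] := hcd _ _ h1 h2; rewrite -h3 in h.
    by apply: le_trans h; rewrite lerDr pos0.
  (* One constant for two bounds: 2 d for the form and 1 + d / c for [J]. *)
  exists (fun x => (p x).1 - (p x).2), c, (1 + d / c + 2 * d); split=> //.
  - by rewrite ltr_wpDl ?mulr_gt0// addr_ge0.
  - move=> x y; have [hx1 hx2 hx] := hp x; have [hy1 hy2 hy] := hp y.
    have E : br x y = br (p x).1 (p y).1 + br (p x).2 (p y).2.
      by rewrite {1}hx {1}hy hfDl !hfDr (ortho _ _ hx1 hy2) (ortho' _ _ hx2 hy1) addr0 add0r.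
    have b1 : `|br (p x).1 (p y).1| <= d * `|x| * `|y|.
      rewrite -(@ler_pXn2r _ 2) ?nnegrE// ?mulr_ge0// ?(ltW d0)//.
      have := @hf_cauchy_schwarz _ _ br (p x).1 (p y).1.
      move=> /(_ _)/le_trans -> //.
        by move=> u v; apply: pos0; apply: subspaceD => //; apply: subspaceZ.
      rewrite (_ : (d * _ * _) ^+ 2 = (d * `|x| ^+ 2) * (d * `|y| ^+ 2)); last by ring.
      by rewrite ler_pM ?pos0.
    have b2 : `|br (p x).2 (p y).2| <= d * `|x| * `|y|.
      rewrite -(@ler_pXn2r _ 2) ?nnegrE// ?mulr_ge0// ?(ltW d0)//.
      have neg' u v : Mm u -> Mm v -> `|br u v| ^+ 2 <= (- br u u) * (- br v v).
        move=> Mu Mv; have := @hf_cauchy_schwarz _ _ (negform br) u v.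
        by rewrite !negformE normrN; apply=> a b; rewrite negformE oppr_ge0 neg0//; apply: subspaceD => //; apply: subspaceZ.
      rewrite (le_trans (neg' _ _ hx2 hy2))//.
      rewrite (_ : (d * _ * _) ^+ 2 = (d * `|x| ^+ 2) * (d * `|y| ^+ 2)); last by ring.
      by rewrite ler_pM ?oppr_ge0 ?neg0.
    rewrite E (le_trans (ler_normD _ _))// (le_trans (lerD b1 b2))//.
    rewrite (_ : d * `|x| * `|y| + d * `|x| * `|y| = 2 * d * `|x| * `|y|); last by ring.
    by rewrite !ler_wpM2r// lerDr addr_ge0.
  - move=> x; apply: (@le_trans _ _ ((1 + d / c) * `|x|)).
      apply: sqr_bound => //; rewrite mulrAC ler_pdivlMr// mulrC; exact: nJ.
    by rewrite ler_wpM2r// lerDl mulr_ge0// ltW.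
  - move=> x; have [hx1 hx2 hx] := hp x.
    rewrite {2}hx hfBr !hfDl (ortho _ _ hx1 hx2) (ortho' _ _ hx2 hx1) addr0 add0r.
    by have /andP[h _] := hcd _ _ hx1 hx2; rewrite -hx in h.
(* Diagonalising the Gram matrix of a basis of [Mm] gives orthogonal vectors; definiteness makes the
   diagonal negative, so they can be normalised. *)
have [P [t [Pu tr ybr _]]] := gram_diag f.
pose y a := \sum_i P a i *: f i.
have ind (v : 'rV[C]_n) : \sum_a v 0 a *: y a = 0 -> v = 0.
  move=> h; have : v *m P = 0.
    apply/rowP => j; rewrite mxE [RHS]mxE; apply: (findep (fun j => \sum_j0 v 0 j0 * P j0 j)).
    rewrite -[RHS]h /y; under eq_bigr do rewrite scaler_suml.
    rewrite exchange_big; apply: eq_bigr => i _ /=; rewrite scaler_sumr.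
    by apply: eq_bigr => k _; rewrite scalerA.
  by move=> /(congr1 (mulmx^~ (invmx P))); rewrite mulmxK// mul0mx.
have Mmy a : Mm (y a) by rewrite fM; exists (P a).
have t0 a : t a < 0.
  have := ybr a a; rewrite eqxx mulr1n => <-; apply: (neg _ (Mmy a)); apply/eqP => ya0.
  have E : \sum_b (delta_mx 0 a : 'rV[C]_n) 0 b *: y b = 0.
    rewrite (bigD1 a)//= mxE !eqxx scale1r [y a]ya0 big1 ?addr0// => i ia.
    by rewrite mxE (negbTE ia) andbF scale0r.
  have /(congr1 (fun v : 'rV[C]_n => v 0 a)) := ind _ E.
  by rewrite !mxE !eqxx => /eqP; rewrite oner_eq0.
pose s a := sqrtC (- t a).
have s0 a : 0 < s a by rewrite sqrtC_gt0 oppr_gt0.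
pose e a := (s a)^-1 *: y a.
have he : negsys br e.
  move=> a b; rewrite hfZl hfZr ybr; case: eqVneq => [<-|_]; last by rewrite !mulr0 oppr0.
  rewrite mulr1n (conj_Creal (ger0_real _)) ?invr_ge0 ?ltW// mulrA -invfM -expr2 sqrtCK.
  by rewrite invrN mulNr mulVf// lt_eqF.
have Mme a : Mm (e a) by exact: subspaceZ.
have span u : Mm u -> exists v : 'I_n -> C, u = \sum_a v a *: e a.
  rewrite fM => -[w ->].
  exists (fun a => (\sum_i w i * invmx P i a) * s a).
  transitivity (\sum_a (\sum_i w i * invmx P i a) *: y a); last first.
    by apply: eq_bigr => a _; rewrite /e scalerA mulfK// gt_eqF.
  rewrite /y; under [RHS]eq_bigr do rewrite scaler_sumr.
  rewrite exchange_big; apply: eq_bigr => j _ /=.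
  under eq_bigr do rewrite scalerA.
  rewrite -scaler_suml; congr (_ *: _).
  have /(congr1 (fun v : 'rV[C]_n => v 0 j)) := mulmxKV Pu (\row_i w i).
  rewrite !mxE => <-; apply: eq_bigr => a _; rewrite mxE; congr (_ * _).
  by apply: eq_bigr => i _; rewrite mxE.
exists e; split => // x xe.
have [x1 x2 Ex] := hp x; have [v hv] := span _ x2.
have v0 a : v a = 0.
  have := negsys_comb_orth v a he; rewrite -hv => h.
  have := xe a; rewrite Ex hfDl h ortho// add0r => /eqP.
  by rewrite oppr_eq0 => /eqP.
by rewrite Ex hv big1 ?addr0 ?pos0// => a _; rewrite v0 scale0r.
Qed.

End Pontryagin.

(** * Infima and orthogonal complements of closed subspaces *)

Section Infimum.
Variable R : realType.
Local Notation C := (Cplx R).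

(** The order of [Cplx] is partial; the real lower bound [m] makes all values real, and the infimum
    is that of their real parts. *)
Lemma exists_infimum (T : Type) (P : set T) (f : T -> C) (m : C) : P !=set0 -> m \is Num.real ->
  (forall t, P t -> m <= f t) ->
  exists d : C, [/\ d \is Num.real, forall t, P t -> d <= f t & forall e, 0 < e -> exists2 t, P t & f t < d + e].
Proof.
move=> [t0 Pt0] mr hm.
have toR (x : C) : x \is Num.real -> x = (complex.Re x)%:C%C.
  by move=> /Creal_ReP <-; case: x => a b; rewrite RRe_real ?Creal_Re.
have fr t : P t -> f t = (complex.Re (f t))%:C%C.
  by move=> Pt; apply: toR; rewrite -(subrK m (f t)) rpredD// ger0_real// subr_ge0 hm.
have mE := toR _ mr.
pose D := [set complex.Re (f t) | t in P].
have hD : has_inf D.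
  split; first by exists (complex.Re (f t0)), t0.
  exists (complex.Re m) => _ [t Pt <-]; rewrite -lecR -mE -fr//; exact: hm.
exists (inf D)%:C%C; split.
- by rewrite realE !lecE /= eqxx /= le_total.
- move=> t Pt; rewrite fr// lecR; apply: ge_inf; [exact: hD.2|by exists t].
- move=> e e0.
  have eE : e = (complex.Re e)%:C%C by apply: toR; rewrite gtr0_real.
  have e0' : 0 < complex.Re e by rewrite -ltcR -eE.
  have [_ [t Pt <-] ht] := inf_adherent e0' hD.
  by exists t => //; rewrite fr// eE -rmorphD ltcR.
Qed.

End Infimum.

Lemma hf_residual (R : realType) (K : completeNormedModType (Cplx R))
    (br : {hermitian K for false & conjC}) (u z : K) : br u u != 0 ->
  let a := br z u / br u u in
  br (z - a *: u) (z - a *: u) = br z z - `|br u z| ^+ 2 / br u u.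
Proof.
move=> u0 a.
have ac : a^* = br u z / br u u by rewrite fmorph_div /= (conj_Creal (hf_real br u)) -hfC.
rewrite hfBl !hfBr !hfZl !hfZr ac normCK -hfC.
rewrite /a; field.
by [].
Qed.

Section Projection.
Variable R : realType.
Local Notation C := (Cplx R).
Variables (K : completeNormedModType C) (br : {hermitian K for false & conjC}).

Lemma krein_bound : krein br -> exists2 b : C, 0 < b & forall x y, `|br x y| <= b * `|x| * `|y|.
Proof. by move=> [J [c [b [c0 b0 hb _ _]]]]; exists b. Qed.

Lemma krein_nondeg x : krein br -> (forall y, br x y = 0) -> x = 0.
Proof.
move=> [J [c [b [c0 b0 _ _ hc]]]] h; have := hc x; rewrite h.
by rewrite pmulr_rle0// => /normsq_le0.
Qed.

Section Majorant.
Variables (n : nat) (e : 'I_n -> K).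

Definition majorant x y := br x y + 2 * \sum_i br x (e i) * (br y (e i))^*.

Lemma majorant_linear z : linear_for *%R (majorant^~ z).
Proof.
move=> a x y; rewrite /majorant hfDl hfZl mulrDr addrACA; congr (_ + _).
rewrite [RHS](_ : _ = 2 * (a * (\sum_i br x (e i) * (br z (e i))^*) + \sum_i br y (e i) * (br z (e i))^*)); last by ring.
congr (_ * _); rewrite mulr_sumr -big_split; apply: eq_bigr => i _ /=.
by rewrite hfDl hfZl; ring.
Qed.

Lemma majorant_sym x y : majorant x y = (majorant y x)^*.
Proof.
rewrite /majorant rmorphD rmorphM rmorph_sum /= -hfC conjC_nat; congr (_ + _ * _).
by apply: eq_bigr => i _; rewrite rmorphM /= conjCK mulrC.
Qed.

Definition majorant_form := mk_hermitian majorant_linear majorant_sym.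

(** The majorant is [br] twisted by the symmetry that reverses the span of a negative system [e], so
    orthogonality for one becomes orthogonality for the other. *)
Lemma majorant_symmetry x y : majorant x y = br x (y + 2 *: \sum_i br y (e i) *: e i).
Proof.
rewrite hfDr hfZr hf_sumr conjC_nat; congr (_ + _ * _).
by apply: eq_bigr => i _; rewrite hfZr mulrC.
Qed.

Lemma majorantE x : majorant_form x x = br x x + 2 * \sum_i `|br x (e i)| ^+ 2.
Proof. by congr (_ + _ * _); apply: eq_bigr => i _; rewrite normCK. Qed.

End Majorant.

(** The Hilbert space projection theorem for the majorant: a minimising sequence in [V] converges,
    the residual [y] at its limit is orthogonal to [V] for the majorant, and the symmetry moves this
    back to [br]. *)
Lemma separating_vector n (e : 'I_n -> K) (V : set K) x0 : krein br -> maxneg br e ->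
  subspace V -> closed V -> ~ V x0 -> exists2 y, br x0 y != 0 & forall v, V v -> br v y = 0.
Proof.
move=> Kr me VS Vc Vx0; have [c [b [c0 b0 hcb]]] := maxneg_norm Kr me.
pose N := majorant_form e.
have NE x : c * `|x| ^+ 2 <= N x x <= b * `|x| ^+ 2 by rewrite majorantE.
have N0 x : 0 <= N x x.
  by have /andP[h _] := NE x; apply: le_trans h; rewrite mulr_ge0 ?exprn_ge0// ltW.
have N00 x : N x x <= 0 -> x = 0.
  move=> h; have /andP[/le_trans/(_ h) + _] := NE x; by rewrite pmulr_rle0// => /normsq_le0.
have Nbd x y : `|N x y| ^+ 2 <= N x x * N y y by apply: hf_cauchy_schwarz => u v; exact: N0.
have [d [dr dle dex]] : exists d : C, [/\ d \is Num.real, forall t, V t -> d <= N (x0 - t) (x0 - t) &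
    forall e, 0 < e -> exists2 t, V t & N (x0 - t) (x0 - t) < d + e].
  apply: (@exists_infimum _ _ _ _ 0) => //; first by exists 0; exact: VS.1.
have /choice[v hv] : forall k : nat, exists t, V t /\ N (x0 - t) (x0 - t) < d + k.+1%:R^-1.
  by move=> k; have [|t Vt ht] := dex k.+1%:R^-1; [rewrite invr_gt0 ltr0n|exists t].
(* The parallelogram law: the midpoint of [v k] and [v l] stays in [V], so its squared distance to
   [x0] is at least [d]. *)
have vd k l : c * `|v k - v l| ^+ 2 <= 2 * (k.+1%:R^-1 + l.+1%:R^-1).
  have [[Vk hk] [Vl hl]] := (hv k, hv l).
  have /andP[h _] := NE (v k - v l); apply: (le_trans h).
  have Vm : V (2^-1 *: (v k + v l)) by apply: subspaceZ => //; exact: subspaceD.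
  have hm := dle _ Vm.
  have -> : N (v k - v l) (v k - v l) = 2 * N (x0 - v k) (x0 - v k) + 2 * N (x0 - v l) (x0 - v l)
     - 4 * N (x0 - 2^-1 *: (v k + v l)) (x0 - 2^-1 *: (v k + v l)).
    have c2 : (2^-1 : C)^* = 2^-1 by apply: conj_Creal; rewrite rpredV realn.
    by rewrite !(hfBl, hfBr, hfZl, hfZr, hfDl, hfDr) c2; field.
  rewrite lerBlDr; apply: (@le_trans _ _ (2 * (d + k.+1%:R^-1) + 2 * (d + l.+1%:R^-1))).
    by rewrite lerD// ler_wpM2l// ltW.
  rewrite [X in X <= _](_ : _ = 2 * (k.+1%:R^-1 + l.+1%:R^-1) + 4 * d); last by ring.
  by rewrite lerD2l ler_wpM2l.
have [w hw] : exists w, seq_lim v w.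
  apply: seq_complete => e' e0'.
  have [|M hM] := @inv_nat_lt _ (c * e' ^+ 2 / 4); first by rewrite !mulr_gt0 ?exprn_gt0.
  exists M => k l kM lM.
  rewrite -(@ltr_pXn2r _ 2) ?nnegrE// ?(ltW e0')// -(ltr_pM2l c0).
  apply: (le_lt_trans (vd k l)).
  rewrite [ltRHS](_ : _ = 2 * (c * e' ^+ 2 / 4 + c * e' ^+ 2 / 4)); last by field.
  by rewrite ltr_pM2l// ltrD// hM.
have Vw : V w.
  move/closedE: Vc; apply => e' e0'; have [M hM] := hw _ e0'.
  by exists (v M); [exact: (hv M).1|exact: hM].
pose y := x0 - w.
have yn0 : y != 0 by apply: contra_not_neq Vx0 => /eqP; rewrite subr_eq0 => /eqP ->.
have yort u : V u -> N u y = 0.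
  move=> Vu; have [u0|un0] := eqVneq u 0; first by rewrite u0 hf0l.
  have Nu : 0 < N u u by rewrite lt_def N0 andbT; apply: contra_neq un0 => h; apply: N00; rewrite h.
  (* Subtracting the optimal multiple of [u] from x0 - v k cannot undercut [d], so the component
     along [u] is controlled by the excess 1 / (k + 1). *)
  have ap k : `|N u (x0 - v k)| ^+ 2 <= k.+1%:R^-1 * N u u.
    have [Vk hk] := hv k; set z := x0 - v k in hk *.
    pose a := N z u / N u u.
    have h := dle _ (subspaceD VS Vk (subspaceZ a VS Vu)).
    rewrite opprD addrA -/z in h.
    have E : N (z - a *: u) (z - a *: u) = N z z - `|N u z| ^+ 2 / N u u.
      by apply: (@hf_residual _ _ N); rewrite gt_eqF.
    rewrite E lerBrDr in h; rewrite -ler_pdivrMr// -(lerD2l d).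
    by rewrite ltW// (le_lt_trans h).
  apply: eps_zero => e' e0'.
  have B0 : 0 < b * N u u by rewrite mulr_gt0.
  have [M hM] := hw _ (divr_gt0 (pos_half e0') (addr_gt0 ltr01 B0)).
  have [M' hM'] := @inv_nat_lt _ ((e' / 2) ^+ 2 / N u u) (divr_gt0 (exprn_gt0 2 (pos_half e0')) Nu).
  pose k := maxn M M'; have wk := hM k (leq_maxl _ _).
  have -> : y = (x0 - v k) - (w - v k) by rewrite opprB addrA subrK.
  rewrite hfBr (le_trans (ler_normB _ _))// [e']splitr lerD//.
    rewrite -(@ler_pXn2r _ 2) ?nnegrE// ?(ltW (pos_half e0'))//.
    rewrite (le_trans (ap k))// -ler_pdivlMr//; apply: ltW; apply: hM'; exact: leq_maxr.
  have r0 : 0 < e' / 2 / (1 + b * N u u) by rewrite divr_gt0 ?pos_half// addr_gt0.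
  rewrite -(@ler_pXn2r _ 2) ?nnegrE// ?(ltW (pos_half e0'))// (le_trans (Nbd _ _))//.
  have /andP[_ hz] := NE (w - v k); apply: (le_trans (ler_wpM2l (N0 u) hz)).
  rewrite mulrCA mulrA; apply: (@le_trans _ _ ((1 + b * N u u) ^+ 2 * (e' / 2 / (1 + b * N u u)) ^+ 2)).
    apply: ler_pM; rewrite ?exprn_ge0 ?(ltW B0)//; last first.
      by rewrite lerXn2r ?nnegrE// ltW.
    rewrite -subr_ge0 (_ : _ - _ = 1 + b * N u u + (b * N u u) ^+ 2); last by ring.
    by rewrite !addr_ge0 ?exprn_ge0 ?(ltW B0).
  rewrite -exprMn mulrC divfK// gt_eqF// addr_gt0//.
exists (y + 2 *: \sum_i br y (e i) *: e i); last by move=> u Vu; rewrite -majorant_symmetry; exact: yort.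
rewrite -majorant_symmetry; apply: contra_neq yn0 => h; apply: N00.
have -> : N y y = N x0 y - N w y by rewrite /y !hfBl !hfBr; ring.
have -> : N x0 y = 0 by exact: h.
by rewrite (yort w Vw) subr0.
Qed.

Lemma proper_orthogonal n (e : 'I_n -> K) (V : set K) x0 : krein br -> maxneg br e ->
  subspace V -> closed V -> ~ V x0 -> exists2 y, y != 0 & forall v, V v -> br v y = 0.
Proof.
move=> Kr me VS Vc Vx0; have [y y0 hy] := separating_vector Kr me VS Vc Vx0; exists y => //.
by apply: contra_neq y0 => ->; rewrite hf0r.
Qed.
End Projection.

(** * Closed linear relations bounded below up to finite codimension *)

Section ClosedGraph.
Variable R : realType.
Local Notation C := (Cplx R).
Variables (K1 K2 : completeNormedModType C).
Implicit Types T : set (K1 * K2).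

Definition gsub T := T (0, 0) /\ forall a x y x' y', T (x, y) -> T (x', y') -> T (a *: x + x', a *: y + y').
Definition gclosed T := forall x y, (forall e : C, 0 < e ->
  exists x' y', [/\ T (x', y'), `|x - x'| < e & `|y - y'| < e]) -> T (x, y).

Lemma gsubZ T a x y : gsub T -> T (x, y) -> T (a *: x, a *: y).
Proof. by move=> [T0 TP] h; rewrite -[_ *: x]addr0 -[_ *: y]addr0; exact: TP. Qed.
Lemma gsubB T x y x' y' : gsub T -> T (x, y) -> T (x', y') -> T (x - x', y - y').
Proof.
move=> [T0 TP] h h'; rewrite ![_ - _]addrC -(scaleN1r x') -(scaleN1r y'); exact: TP.
Qed.

Lemma range_closed T (c : C) : gsub T -> gclosed T -> 0 < c ->
  (forall x y, T (x, y) -> `|x| <= c * `|y|) ->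
  forall y, (forall e : C, 0 < e -> exists x' y', T (x', y') /\ `|y - y'| < e) -> exists x, T (x, y).
Proof.
move=> TS Tc c0 hc y hy.
have /choice[u hu] : forall k : nat, exists p, T p /\ `|y - p.2| < k.+1%:R^-1.
  by move=> k; have [|x' [y' h]] := hy k.+1%:R^-1; [rewrite invr_gt0 ltr0n|exists (x', y')].
have [x hx] : exists x, seq_lim (fun k => (u k).1) x.
  apply: seq_complete => e e0.
  have [|M hM] := @inv_nat_lt _ (e / c / 2); first by rewrite !mulr_gt0 ?invr_gt0.
  exists M => k l kM lM.
  have [Tk hk] := hu k; have [Tl hl] := hu l.
  move: Tk Tl hk hl; case: (u k) => xk yk; case: (u l) => xl yl /= Tk Tl hk hl.
  rewrite (le_lt_trans (hc _ _ (gsubB TS Tk Tl)))// -ltr_pdivlMl// mulrC.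
  rewrite -(subrK y yk) -addrA (le_lt_trans (ler_normD _ _))// [e / c]splitr ltrD//.
    by rewrite distrC (lt_trans hk)// hM.
  by rewrite (lt_trans hl)// hM.
exists x; apply: Tc => e e0.
have [M hM] := hx _ e0; have [M' hM'] := inv_nat_lt e0.
exists (u (maxn M M')).1, (u (maxn M M')).2; split.
- by rewrite -surjective_pairing; exact: (hu _).1.
- by apply: hM; exact: leq_maxl.
- by apply: (lt_trans (hu _).2); apply: hM'; exact: leq_maxr.
Qed.

(** Induction on the functionals. If [f] does not vanish on the domain, choose a pair (x0, y0) with
    f x0 = 1. Injectivity, with the closed range of the restriction to the kernel of [f], keeps [y0]
    at positive distance from that range, and this bounds |f x| by |y|. *)
Lemma finite_codim_bounded_below (s : seq (K1 -> C)) T (c : C) :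
  (forall f, f \in s -> (forall a x y, f (a *: x + y) = a * f x + f y) /\
      exists2 b : C, 0 < b & forall x, `|f x| <= b * `|x|) ->
  gsub T -> gclosed T -> 0 < c ->
  (forall x y, T (x, y) -> (forall f, f \in s -> f x = 0) -> `|x| <= c * `|y|) ->
  (forall x, T (x, 0) -> x = 0) ->
  exists2 c' : C, 0 < c' & forall x y, T (x, y) -> `|x| <= c' * `|y|.
Proof.
elim: s T c => [|f s IH] T c hs TS Tc c0 hc inj; first by exists c => // x y /hc; apply.
have [fl [b b0 fb]] := hs f (mem_head _ _).
have f0 : f 0 = 0 by apply/eqP; rewrite -normr_le0 (le_trans (fb _))// normr0 mulr0.
have fB x y : f (x - y) = f x - f y by rewrite addrC -scaleN1r fl mulN1r addrC.
pose T' := [set p | T p /\ f p.1 = 0].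
have T'S : gsub T'.
  split; first by split; [exact: TS.1|].
  by move=> a x y x' y' [h1 /= h2] [h3 /= h4]; split; [exact: TS.2|rewrite /= fl h2 h4 mulr0 addr0].
have T'c : gclosed T'.
  move=> x y h; split; first by apply: Tc => e /h[x' [y' [[? ?] ? ?]]]; exists x', y'.
  apply: eps_zero => e e0; have [|x' [y' [[_ /= fx'] hx _]]] := h (e / b); first by rewrite divr_gt0.
  by rewrite /= -[f x]subr0 -fx' -fB (le_trans (fb _))// -ler_pdivlMl// mulrC ltW.
have H1 g : g \in s -> (forall a x y, g (a *: x + y) = a * g x + g y) /\
      exists2 b : C, 0 < b & forall x, `|g x| <= b * `|x|.
  by move=> gs; apply: hs; rewrite inE gs orbT.
have H2 x y : T' (x, y) -> (forall g, g \in s -> g x = 0) -> `|x| <= c * `|y|.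
  move=> [Txy fx] h; apply: hc => // g; rewrite inE => /predU1P[->//|]; exact: h.
have H3 x : T' (x, 0) -> x = 0 by move=> [/inj].
have [c1 c10 hc1] := IH T' c H1 T'S T'c c0 H2 H3.
have [all0|[[x0 y0] [T0 fx0]]] : (forall p, T p -> f p.1 = 0) \/ exists p, T p /\ f p.1 = 1.
  case: (pselect (exists p, T p /\ f p.1 != 0)) => [[[x y] [Tp fp]]|h].
    right; exists ((f x)^-1 *: x, (f x)^-1 *: y); split; first exact: gsubZ.
    by rewrite /= -[_ *: x]addr0 fl f0 addr0 mulVf.
  by left=> p Tp; apply: contrapT => /eqP fp; apply: h; exists p.
  by exists c1 => // x y Txy; apply: hc1; split => //; exact: all0 Txy.
rewrite /= in fx0.
have [dl dl0 hdl] : exists2 dl : C, 0 < dl & forall x y, T' (x, y) -> dl <= `|y0 - y|.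
  apply: contrapT => h.
  have [|x [Tx fx]] := range_closed (y := y0) T'S T'c c10 hc1.
    move=> e e0; apply: contrapT => he; apply: h; exists e => // x y T'xy.
    have [] := real_leP (gtr0_real e0) (normr_real (y0 - y)) => // hlt.
    by case: he; exists x, y.
  have /inj/eqP : T (x0 - x, 0) by rewrite -(subrr y0); exact: gsubB.
  by rewrite subr_eq0 => /eqP xx; move/eqP: fx0; rewrite xx [f x]fx eq_sym oner_eq0.
(* The bound on the kernel of [f], plus |f x| <= |y| / dl times the cost of removing the multiple f
   x of (x0, y0). *)
exists (c1 + (c1 * `|y0| + `|x0|) / dl); first by rewrite ltr_wpDr// divr_ge0// ?addr_ge0 ?mulr_ge0 ?(ltW c10)// ltW.
move=> x y Txy; pose a := f x.
have T'a : T' (x - a *: x0, y - a *: y0).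
  split; first by apply: gsubB => //; exact: gsubZ.
  by rewrite /= fB -[_ *: x0]addr0 fl f0 fx0 addr0 mulr1 subrr.
have ha : `|a| * dl <= `|y|.
  have [->|an0] := eqVneq a 0; first by rewrite normr0 mul0r.
  have := hdl _ _ (gsubZ (- a^-1) T'S T'a).
  rewrite scaleNr opprK scalerBr scalerA mulVf// scale1r addrC subrK.
  by rewrite normrZ normfV ler_pdivlMl ?normr_gt0.
rewrite -[x in leLHS](subrK (a *: x0)) (le_trans (ler_normD _ _))//.
rewrite (le_trans (lerD (hc1 _ _ T'a) (lexx _)))// normrZ.
have a1 : `|a| <= `|y| / dl by rewrite ler_pdivlMr.
apply: (@le_trans _ _ (c1 * `|y| + `|a| * (c1 * `|y0| + `|x0|))).
  rewrite mulrDr addrA lerD2r// mulrCA -normrZ -mulrDr ler_pM2l//.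
  exact: ler_normB.
rewrite mulrDl lerD2l [leRHS]mulrAC -[leRHS]mulrA [leLHS]mulrC; apply: ler_wpM2l => //.
by rewrite addr_ge0// mulr_ge0// ltW.
Qed.

(** The relation may have a kernel, so [y0] may already lie in the range of the restriction, which
    is then the whole range. Otherwise the range is that of an auxiliary relation bounded below. *)
Lemma finite_codim_range_closed (s : seq (K1 -> C)) T (c : C) :
  (forall f, f \in s -> (forall a x y, f (a *: x + y) = a * f x + f y) /\
      exists2 b : C, 0 < b & forall x, `|f x| <= b * `|x|) ->
  gsub T -> gclosed T -> 0 < c ->
  (forall x y, T (x, y) -> (forall f, f \in s -> f x = 0) -> `|x| <= c * `|y|) ->
  forall y, (forall e : C, 0 < e -> exists x' y', T (x', y') /\ `|y - y'| < e) -> exists x, T (x, y).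
Proof.
elim: s T c => [|f s IH] T c hs TS Tc c0 hc.
  by apply: (range_closed TS Tc c0) => x y /hc; apply.
have [fl [b b0 fb]] := hs f (mem_head _ _).
have f0 : f 0 = 0 by apply/eqP; rewrite -normr_le0 (le_trans (fb _))// normr0 mulr0.
have fZ a x : f (a *: x) = a * f x by rewrite -[a *: x]addr0 fl f0 addr0.
have fB x y : f (x - y) = f x - f y by rewrite addrC -scaleN1r fl mulN1r addrC.
have fE x : (forall e : C, 0 < e -> exists2 x', f x' = 0 & `|x - x'| < e) -> f x = 0.
  move=> h; apply: eps_zero => e e0; have [x' fx' hx] := h _ (divr_gt0 e0 b0).
  by rewrite -[f x]subr0 -fx' -fB (le_trans (fb _))// -ler_pdivlMl// mulrC ltW.
pose T' := [set p | T p /\ f p.1 = 0].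
have T'S : gsub T'.
  split; first by split; [exact: TS.1|].
  by move=> a x y x' y' [h1 /= h2] [h3 /= h4]; split; [exact: TS.2|rewrite /= fl h2 h4 mulr0 addr0].
have T'c : gclosed T'.
  move=> x y h; split; first by apply: Tc => e /h[x' [y' [[? ?] ? ?]]]; exists x', y'.
  by apply: fE => e /h[x' [y' [[_ /= fx'] hx _]]]; exists x'.
have ranc : forall y, (forall e : C, 0 < e -> exists x' y', T' (x', y') /\ `|y - y'| < e) -> exists x, T' (x, y).
  apply: (IH T' c) => // [g gs|x y [Txy fx] h]; first by apply: hs; rewrite inE gs orbT.
  by apply: hc => // g; rewrite inE => /predU1P[->//|]; exact: h.
have [all0|[[x0 y0] [T0 /= fx0]]] : (forall p, T p -> f p.1 = 0) \/ exists p, T p /\ f p.1 = 1.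
  case: (pselect (exists p, T p /\ f p.1 != 0)) => [[[x y] [Tp fp]]|h].
    right; exists ((f x)^-1 *: x, (f x)^-1 *: y); split; first exact: gsubZ.
    by rewrite /= fZ mulVf.
  by left=> p Tp; apply: contrapT => /eqP fp; apply: h; exists p.
  move=> y hy; have [|x [Tx _]] := ranc y; last by exists x.
  by move=> e /hy[x' [y' [Tp h]]]; exists x', y'; split=> //; split=> //; exact: all0 Tp.
have [[x1 [T1 /= fx1]]|nx1] := pselect (exists x, T' (x, y0)).
  move=> y hy; have [|x [Tx _]] := ranc y; last by exists x.
  move=> e /hy[x' [y' [Tp h]]]; exists (x' - f x' *: (x0 - x1)), y'; split=> //; split.
    rewrite -[y']subr0 -(scaler0 K2 (f x')) -(subrr y0).
    by apply: (gsubB TS Tp); apply: (gsubZ _ TS); exact: gsubB.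
  by rewrite /= fB fZ fB fx0 fx1 subr0 mulr1 subrr.
have [dl dl0 hdl] : exists2 dl : C, 0 < dl & forall x y, T' (x, y) -> dl <= `|y0 - y|.
  apply: contrapT => h; apply: nx1; apply: ranc => e e0; apply: contrapT => he; apply: h; exists e => // x y T'xy.
  have [] := real_leP (gtr0_real e0) (normr_real (y0 - y)) => // hlt.
  by case: he; exists x, y.
(* Keeping only the component of the first entry along [x0] forgets the kernel: [T2] has the range
   of [T] and is bounded below. *)
pose T2 := [set p : K1 * K2 | p.1 = f p.1 *: x0 /\ exists u, T' (u, p.2 - f p.1 *: y0)].
have T2S : gsub T2.
  split; first by split; rewrite /= f0 scale0r// subr0; exists 0; exact: T'S.1.
  move=> a x y x' y' [/= hx [u Tu]] [/= hx' [u' Tu']]; split; rewrite /= fl.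
    by rewrite scalerDl -scalerA -hx -hx'.
  exists (a *: u + u'); rewrite scalerDl opprD addrACA -scalerA -scalerBr; exact: T'S.2.
have T2c : gclosed T2.
  have M0 : 0 < 1 + b * (`|x0| + `|y0|) by rewrite ltr_pwDl// mulr_ge0 ?addr_ge0// ltW.
  move=> x y h; split=> /=.
    apply/eqP; rewrite -subr_eq0; apply/eqP; apply: eps_zero => e e0.
    have [x' [y' [[/= hx' _] hx _]]] := h _ (divr_gt0 e0 M0).
    have -> : x - f x *: x0 = (x - x') - f (x - x') *: x0.
      by rewrite fB scalerBl -hx' opprB addrA subrK.
    rewrite (le_trans (ler_normB _ _))// normrZ.
    apply: (@le_trans _ _ ((1 + b * (`|x0| + `|y0|)) * `|x - x'|)); last by rewrite mulrC -ler_pdivlMr// ltW.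
    rewrite mulrDl mul1r lerD2l mulrAC ler_pM// ?mulr_ge0//; first by rewrite lerDl.
  apply: ranc => e e0; have [x' [y' [[/= _ [u' Tu']] hx hy]]] := h _ (divr_gt0 e0 M0).
  exists u', (y' - f x' *: y0); split=> //.
  have -> : y - f x *: y0 - (y' - f x' *: y0) = (y - y') - f (x - x') *: y0.
    by rewrite fB scalerBl opprD opprK addrACA; congr (_ + _); rewrite opprB addrC.
  rewrite (le_lt_trans (ler_normB _ _))// normrZ.
  rewrite [e](_ : _ = e / (1 + b * (`|x0| + `|y0|)) + b * (e / (1 + b * (`|x0| + `|y0|))) * (`|x0| + `|y0|)); last first.
    by field; rewrite gt_eqF.
  rewrite ltr_leD// ler_pM// ?lerDr// (le_trans (fb _))// ler_pM2l// ltW//.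
have x00 : 0 < 1 + `|x0| by rewrite ltr_pwDl.
have hc2 x y : T2 (x, y) -> `|x| <= (1 + `|x0|) / dl * `|y|.
  move=> [/= hx [u Tu]]; rewrite hx normrZ mulrAC ler_pdivlMr//.
  rewrite mulrAC [leRHS]mulrC ler_pM ?mulr_ge0 ?(ltW dl0)// ?lerDr//.
  have [->|an0] := eqVneq (f x) 0; first by rewrite normr0 mul0r.
  have := hdl _ _ (gsubZ (- (f x)^-1) T'S Tu).
  rewrite scaleNr opprK scalerBr scalerA mulVf// scale1r addrC subrK.
  by rewrite normrZ normfV ler_pdivlMl ?normr_gt0.
move=> y hy; have [|x [/= _ [u [Tu _]]]] := range_closed (y := y) T2S T2c (divr_gt0 x00 dl0) hc2.
  move=> e /hy[x' [y' [Tp h]]]; exists (f x' *: x0), y'; split=> //.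
  rewrite /T2 /= fZ fx0 mulr1; split=> //; exists (x' - f x' *: x0); split; first by apply: (gsubB TS Tp); exact: gsubZ.
  by rewrite /= fB fZ fx0 mulr1 subrr.
exists (u + f x *: x0); rewrite -[y](subrK (f x *: y0)) -[u]scale1r -[_ - _]scale1r.
by apply: TS.2 => //; exact: gsubZ.
Qed.
End ClosedGraph.

(** * Self-adjoint linear relations: resolvents and nonreal eigenvalues *)

Section LinearRelations.
Variable R : realType.
Local Notation C := (Cplx R).
Variables (K : completeNormedModType C).
Implicit Types (B : set (K * K)) (S : K -> K).

Lemma bounded_op_linear (K' : completeNormedModType C) (S : K -> K') a x y : bounded_op S -> S (a *: x + y) = a *: S x + S y.
Proof. by move=> [h _]; rewrite h. Qed.
Lemma bounded_opZ (K' : completeNormedModType C) (S : K -> K') a x : bounded_op S -> S (a *: x) = a *: S x.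
Proof.
move=> h; have S0 : S 0 = 0.
  by have := bounded_op_linear 1 0 0 h; rewrite !scale1r addr0 => /(congr1 (fun y => y - S 0)); rewrite addrK subrr => <-.
by rewrite -[_ *: x]addr0 bounded_op_linear// S0 addr0.
Qed.
Lemma bounded_op0 (K' : completeNormedModType C) (S : K -> K') : bounded_op S -> S 0 = 0.
Proof. by move=> h; rewrite -(scale0r (0 : K)) bounded_opZ// scale0r. Qed.
Lemma bounded_opD (K' : completeNormedModType C) (S : K -> K') x y : bounded_op S -> S (x + y) = S x + S y.
Proof. by move=> h; rewrite -[x in LHS]scale1r bounded_op_linear// scale1r. Qed.
Lemma bounded_opN (K' : completeNormedModType C) (S : K -> K') x : bounded_op S -> S (- x) = - S x.
Proof. by move=> h; rewrite -scaleN1r bounded_opZ// scaleN1r. Qed.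
Lemma bounded_opB (K' : completeNormedModType C) (S : K -> K') x y : bounded_op S -> S (x - y) = S x - S y.
Proof. by move=> h; rewrite bounded_opD// bounded_opN. Qed.
Lemma bounded_op_sum (K' : completeNormedModType C) (S : K -> K') (I : Type) (r : seq I) (P : pred I) (E : I -> K) : bounded_op S ->
  S (\sum_(i <- r | P i) E i) = \sum_(i <- r | P i) S (E i).
Proof.
by move=> h; elim/big_rec2 : _ => [|i y x Pi <-]; [exact: bounded_op0|rewrite bounded_opD].
Qed.

Lemma rel_resolventK B z S w : rel_resolvent B z S -> B (S w, w + z *: S w).
Proof. by move=> [_ h]; apply/h. Qed.

Lemma rel_resolvent_unique B z S S' : rel_resolvent B z S -> rel_resolvent B z S' -> S =1 S'.
Proof. by move=> [_ h] h' w; apply/(h (S' w) w); exact: (rel_resolventK w h'). Qed.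

Lemma resolvent_identity B z w S S' x : rel_resolvent B z S -> rel_resolvent B w S' ->
  S x - S' x = (z - w) *: S (S' x).
Proof.
move=> hS hS'; have [Sb h] := hS; have := rel_resolventK x hS'.
have -> : x + w *: S' x = (x + (w - z) *: S' x) + z *: S' x.
  by rewrite -addrA -scalerDl subrK.
move=> /h; rewrite bounded_opD// bounded_opZ// => E.
by rewrite -[X in _ - X]E opprD addrA subrr sub0r -scaleNr opprB.
Qed.

Lemma resolvent_comm B z w S S' x : rel_resolvent B z S -> rel_resolvent B w S' -> S (S' x) = S' (S x).
Proof.
have [E|zw] := eqVneq z w => hS hS'.
  by rewrite E in hS; rewrite !(rel_resolvent_unique hS hS').
have zw0 : z - w != 0 by rewrite subr_eq0.
apply: (scalerI zw0); rewrite -(resolvent_identity x hS hS').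
by rewrite -opprB -(opprB w z) scaleNr -(resolvent_identity x hS' hS).
Qed.

Lemma resolvent_eigen B z S l x : rel_resolvent B z S -> B (x, l *: x) -> (l - z) *: S x = x.
Proof.
move=> [Sb h] Bx; rewrite -bounded_opZ//; apply/h.
by rewrite -scalerDl subrK.
Qed.

Lemma eigen_neq B z S l x : rel_resolvent B z S -> B (x, l *: x) -> x != 0 -> l - z != 0.
Proof. by move=> hS Bx x0; apply: contra_neq x0 => lz; rewrite -(resolvent_eigen hS Bx) lz scale0r. Qed.

(** The resolvent is an operator with the same eigenvectors and the distinct eigenvalues 1 / (l -
    z), so the classical elimination works for a relation. *)
Lemma eigen_independent B z S (s : seq C) (x : C -> K) (v : C -> C) : rel_resolvent B z S -> uniq s ->
  (forall l, l \in s -> B (x l, l *: x l) /\ x l != 0) ->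
  \sum_(l <- s) v l *: x l = 0 -> forall l, l \in s -> v l = 0.
Proof.
move=> hS; have Sb := hS.1; elim: s v => [//|m s IH] v /= /andP[ms us] hx.
rewrite big_cons => hsum.
have [Bm xm0] := hx m (mem_head _ _).
have hs l : l \in s -> B (x l, l *: x l) /\ x l != 0 by move=> ls; apply: hx; rewrite inE ls orbT.
have Sx l : l \in m :: s -> S (x l) = (l - z)^-1 *: x l.
  move=> /hx[Bl xl0]; have lz := eigen_neq hS Bl xl0.
  by rewrite -{2}(resolvent_eigen hS Bl) scalerA mulVf ?scale1r.
have vs l : l \in s -> v l = 0.
  move=> ls; have := IH (fun l => v l * ((l - z)^-1 - (m - z)^-1)) us hs.
  have /[swap] /[apply] /(_ l ls) : \sum_(l0 <- s) (v l0 * ((l0 - z)^-1 - (m - z)^-1)) *: x l0 = 0.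
    have h1 : v m *: x m = - \sum_(l0 <- s) v l0 *: x l0 by apply/eqP; rewrite -addr_eq0 hsum.
    have := congr1 S hsum; rewrite bounded_op0// bounded_opD// bounded_opZ// bounded_op_sum//.
    rewrite Sx ?mem_head// scalerA mulrC -scalerA h1 scalerN scaler_sumr -sumrN -big_split /= => h2.
    rewrite -[RHS]h2 big_seq [RHS]big_seq; apply: eq_bigr => k ks.
    rewrite (bounded_opZ _ _ Sb) Sx ?inE ?ks ?orbT// !scalerA -scaleNr -scalerDl; congr (_ *: _).
    by rewrite mulrBr addrC [_^-1 * _]mulrC.
  move=> /eqP; rewrite mulf_eq0 => /orP[/eqP//|]; rewrite subr_eq0 => /eqP /invr_inj /addIr lm.
  by rewrite lm (negbTE ms) in ls.
move=> l; rewrite inE => /predU1P[->|]; last exact: vs.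
move/eqP: hsum; rewrite big_seq big1 => [|k ks]; last by rewrite vs// scale0r.
by rewrite addr0 scaler_eq0 (negbTE xm0) orbF => /eqP.
Qed.

Section SelfAdjoint.
Variables (br : {hermitian K for false & conjC}) (B : set (K * K)).
Hypothesis Bsa : selfadjoint_rel br B.

Lemma selfadjoint_relE p : B p <-> forall q, B q -> br p.2 q.1 = br p.1 q.2.
Proof. by rewrite {1}Bsa. Qed.

Lemma selfadjoint_rel_sub : gsub B.
Proof.
split; first by apply/selfadjoint_relE => q _; rewrite !hf0l.
move=> a x y x' y' /selfadjoint_relE h /selfadjoint_relE h'; apply/selfadjoint_relE => q Bq /=.
by rewrite !hfDl !hfZl h// h'.
Qed.

Lemma selfadjoint_rel_closed : krein br -> gclosed B.
Proof.
move=> /krein_bound[b b0 hb] x y h; apply/selfadjoint_relE => q Bq /=.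
apply/eqP; rewrite -subr_eq0; apply/eqP/eps_zero => e e0.
pose d := b * `|q.1| + b * `|q.2| + 1.
have d0 : 0 < d by rewrite ltr_wpDl// addr_ge0// mulr_ge0// ltW.
have [x' [y' [B' hx hy]]] := h _ (divr_gt0 e0 d0).
have /selfadjoint_relE/(_ q Bq) /= E := B'.
have -> : br y q.1 - br x q.2 = br (y - y') q.1 - br (x - x') q.2 by rewrite !hfBl E; ring.
rewrite (le_trans (ler_normB _ _))//.
apply: (@le_trans _ _ (b * (e / d) * `|q.1| + b * (e / d) * `|q.2|)).
  by apply: lerD; rewrite (le_trans (hb _ _))// ler_wpM2r// ler_pM2l// ltW.
rewrite (_ : _ + _ = (b * `|q.1| + b * `|q.2|) * (e / d)); last by ring.
by rewrite mulrA ler_pdivrMr// mulrC ler_pM2l// lerDl.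
Qed.

Lemma eigen_orthogonal l m x y : B (x, l *: x) -> B (y, m *: y) -> l != m^* -> br x y = 0.
Proof.
move=> /selfadjoint_relE h By lm; have /= := h _ By; rewrite hfZl hfZr => /eqP.
by rewrite -subr_eq0 -mulrBl mulf_eq0 subr_eq0 (negbTE lm) => /eqP.
Qed.

(** For w in (B - z) x, self-adjointness leaves (z - conj z) br x x = br x w - br w x, and on the
    companion of [e] the form dominates the squared norm. *)
Lemma codim_bounded_below n (e : 'I_n -> K) z : krein br -> maxneg br e -> 'Im z != 0 ->
  exists2 c : C, 0 < c & forall x w, B (x, w + z *: x) -> (forall i, br x (e i) = 0) -> `|x| <= c * `|w|.
Proof.
move=> Kr me zi; have [b b0 hb] := krein_bound Kr.
have [c [d [c0 d0 hcd]]] := maxneg_norm Kr me.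
have zz0 : 0 < `|z - z^*|.
  rewrite normr_gt0 subr_eq0; apply: contra zi => /eqP zc.
  by apply/eqP/Creal_ImP; rewrite CrealE -zc.
exists (2 * b / (c * `|z - z^*|)); first by rewrite divr_gt0// mulr_gt0.
move=> x w Txw xe; have /selfadjoint_relE/(_ _ Txw) /= := Txw; rewrite hfDl hfDr hfZl hfZr => E.
have E2 : (z - z^*) * br x x = br x w - br w x.
  by apply/eqP; rewrite -subr_eq0; move/eqP: E; rewrite -subr_eq0 => /eqP E; apply/eqP; rewrite -[RHS]E; ring.
have n1 : `|z - z^*| * `|br x x| <= 2 * b * `|x| * `|w|.
  rewrite -normrM E2 (le_trans (ler_normB _ _))//.
  rewrite (_ : 2 * b * _ * _ = b * `|x| * `|w| + b * `|w| * `|x|); last by ring.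
  exact: lerD.
have := hcd x; rewrite big1 => [|i _]; last by rewrite xe normr0 expr0n.
rewrite mulr0 addr0 => /andP[hc _].
have hc' : c * `|x| ^+ 2 <= `|br x x| by apply: (le_trans hc); apply: real_ler_norm; exact: hf_real.
have [x0|x0] := eqVneq `|x| 0; first by rewrite x0 mulr_ge0// divr_ge0// mulr_ge0// ltW.
have xp : 0 < `|x| by rewrite lt_def x0 normr_ge0.
rewrite mulrAC ler_pdivlMr ?mulr_gt0// -(ler_pM2r xp).
rewrite [leRHS]mulrAC (le_trans _ n1)//.
rewrite [leLHS](_ : _ = `|z - z^*| * (c * `|x| ^+ 2)); last by ring.
by rewrite ler_pM2l.
Qed.

(** Injectivity turns the bound on finite codimension into a bound everywhere, hence a closed range;
    a vector orthogonal to the range is an eigenvector at conj z, so the range is everything. *)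
Lemma resolvent_exists n (e : 'I_n -> K) z : krein br -> maxneg br e -> 'Im z != 0 ->
  (forall x, B (x, z *: x) -> x = 0) -> (forall x, B (x, z^* *: x) -> x = 0) ->
  exists S, rel_resolvent B z S.
Proof.
move=> Kr me zi hz hzc; have [b b0 hb] := krein_bound Kr.
have [c c0 hc] := codim_bounded_below Kr me zi.
have BS := selfadjoint_rel_sub; have Bc := selfadjoint_rel_closed Kr.
pose T := [set p | B (p.1, p.2 + z *: p.1)].
have TS : gsub T.
  split; first by rewrite /T /= scaler0 addr0; exact: BS.1.
  move=> a x y x' y' h h'; rewrite /T /= scalerDr scalerA mulrC -scalerA addrACA -scalerDr.
  exact: BS.2.
have Tc : gclosed T.
  move=> x y h; apply: Bc => r r0.
  have d1 : 0 < 1 + `|z| by rewrite ltr_wpDr.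
  have [x' [y' [hT hx hy]]] := h (r / (1 + `|z|) / 2) (pos_half (divr_gt0 r0 d1)).
  exists x', (y' + z *: x'); split=> //.
    apply: (lt_le_trans hx); rewrite -mulrA ler_piMr ?(ltW r0)// -invfM invf_le1 ?mulr_gt0//.
    by rewrite -[leLHS]mul1r ler_pM// ?ler1n// lerDl.
  rewrite opprD addrACA -scalerBr (le_lt_trans (ler_normD _ _))// normrZ.
  rewrite [r](_ : _ = r / (1 + `|z|) + `|z| * (r / (1 + `|z|))); last by field; rewrite gt_eqF.
  have half : r / (1 + `|z|) / 2 <= r / (1 + `|z|).
    by rewrite ler_piMr ?divr_ge0 ?(ltW r0) ?(ltW d1)// invf_le1// ler1n.
  by rewrite ltr_leD ?(lt_le_trans hy)// ler_wpM2l// (le_trans (ltW hx)).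
pose s := [seq (fun x => br x (e i)) | i <- enum 'I_n].
have hs f : f \in s -> (forall (a : C) (x y : K), f (a *: x + y) = a * f x + f y) /\
      exists2 b : C, 0 < b & forall x, `|f x| <= b * `|x|.
  move=> /mapP[i _ ->]; split; first by move=> a x y; rewrite hfDl hfZl.
  exists (b * `|e i| + 1); first by rewrite ltr_wpDl// mulr_ge0// ltW.
  by move=> x; rewrite (le_trans (hb _ _))// mulrAC ler_wpM2r// lerDl.
have hT x w : T (x, w) -> (forall f, f \in s -> f x = 0) -> `|x| <= c * `|w|.
  move=> Txw hf; apply: hc => // i.
  by apply: (hf (fun x => br x (e i))); apply/mapP; exists i => //; rewrite mem_enum.
have Tinj x : T (x, 0) -> x = 0 by rewrite /T /= add0r; exact: hz.
have [c1 c10 hc1] := finite_codim_bounded_below hs TS Tc c0 hT Tinj.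
pose V := [set w | exists x, T (x, w)].
have VS : subspace V.
  split; first by exists 0; exact: TS.1.
  by move=> a w w' [x h] [x' h']; exists (a *: x + x'); exact: TS.2.
have Vc : closed V.
  apply/closedE => w hw; apply: (range_closed TS Tc c10 hc1) => r r0.
  by have [w' [x' h] ww] := hw r r0; exists x', w'.
have Vall w : V w.
  apply: contrapT => Vw; have [y y0 hy] := proper_orthogonal Kr me VS Vc Vw.
  move/eqP: y0; apply; apply: hzc; apply/selfadjoint_relE => -[x u] Bxu /=.
  have : br (u - z *: x) y = 0 by apply: hy; exists x; rewrite /T /= subrK.
  rewrite hfBl hfZl => /eqP; rewrite subr_eq0 => /eqP /(congr1 conjC).
  by rewrite -hfC rmorphM /= -hfC hfZl => ->.
have [S hS] := choice Vall.
have Suniq x w : T (x, w) -> S w = x.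
  move=> h; apply/eqP; rewrite -subr_eq0; apply/eqP; apply: Tinj.
  by rewrite -(subrr w); exact: gsubB.
exists S; split; last by move=> x w; split=> [<-|h]; [exact: hS|exact: Suniq].
apply/bounded_opP; split.
  by move=> a x y; apply: Suniq; apply: TS.2; exact: hS.
by exists c1 => // w; apply: hc1; exact: hS.
Qed.

(** Eigenvectors at points of [P] are neutral and mutually orthogonal, so their span is neutral; it
    meets the companion of [e] only in 0 and has dimension at most n. *)
Lemma eigenvalues_finite n (e : 'I_n -> K) (P : C -> Prop) z S : krein br -> maxneg br e ->
  rel_resolvent B z S -> (forall l m, P l -> P m -> l != m^*) ->
  exists s : seq C, forall l, P l -> (exists2 x, x != 0 & B (x, l *: x)) -> l \in s.
Proof.
move=> Kr me hS Pc.
pose E l := P l /\ exists2 x, x != 0 & B (x, l *: x).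
have bound s : uniq s -> (forall l, l \in s -> E l) -> (size s <= n)%N.
  move=> us hs; rewrite leqNgt; apply/negP => ns.
  have /choice[x hx] : forall l, exists x, E l -> x != 0 /\ B (x, l *: x).
    by move=> l; case: (pselect (E l)) => [[_ [x x0 Bx]]|nE]; [exists x|exists 0].
  have [v [i vi] hv] := kernel_vector (\matrix_(i < size s, j < n) br (x s`_i) (e j)) ns.
  (* Coefficients indexed by eigenvalues instead of positions; the default 0 is never met on [s]. *)
  pose v' l := if insub (index l s) is Some i then v i else 0.
  have v'E (j : 'I_(size s)) : v' s`_j = v j by rewrite /v' index_uniq// valK.
  pose y := \sum_(l <- s) v' l *: x l.
  have yE : y = \sum_(i < size s) v i *: x s`_i.
    by rewrite /y (big_nth 0) big_mkord; apply: eq_bigr => j _; rewrite v'E.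
  have yy : br y y = 0.
    rewrite yE hf_suml big1// => j _; rewrite hf_sumr big1// => k _.
    rewrite hfZl hfZr; have [Pj _] := hs _ (mem_nth 0 (ltn_ord j)); have [Pk _] := hs _ (mem_nth 0 (ltn_ord k)).
    have [_ Bj] := hx _ (hs _ (mem_nth 0 (ltn_ord j))); have [_ Bk] := hx _ (hs _ (mem_nth 0 (ltn_ord k))).
    by rewrite (eigen_orthogonal Bj Bk) ?Pc// !mulr0.
  have y0 : y = 0.
    have [c [d [c0 d0 hcd]]] := maxneg_norm Kr me.
    have := hcd y; rewrite yy big1 ?mulr0 ?addr0 => [/andP[h _]|j _].
      by apply: normsq_le0; rewrite -(pmulr_rle0 _ c0).
    rewrite yE hf_suml (eq_bigr (fun i => v i * (\matrix_(i < size s, j < n) br (x s`_i) (e j)) i j)).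
      by rewrite hv normr0 expr0n.
    by move=> k _; rewrite hfZl mxE.
  have hxs l : l \in s -> B (x l, l *: x l) /\ x l != 0 by move=> /hs/hx[].
  have := eigen_independent hS us hxs y0 (mem_nth 0 (ltn_ord i)).
  by rewrite v'E => /eqP; rewrite (negbTE vi).
pose Q m := `[< exists s : seq C, [/\ uniq s, size s = m & forall l, l \in s -> E l] >].
have Q0 : exists m, Q m by exists 0%N; apply/asboolP; exists [::].
have Qn m : Q m -> (m <= n)%N by move=> /asboolP[s [us <- hs]]; exact: bound.
case: (ex_maxnP Q0 Qn) => m /asboolP[s [us sm hs]] mmax.
exists s => l Pl hl; apply: contrapT => /negP ls.
suff /mmax : Q m.+1 by rewrite ltnn.
apply/asboolP; exists (l :: s); split; rewrite /= ?ls ?sm// => k.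
by rewrite inE => /predU1P[->|/hs].
Qed.

(** An open half-plane contains no two conjugate points, so each holds finitely many eigenvalues.
    Conjugates join the list because [resolvent_exists] must exclude an eigenvalue at conj z too. *)
Lemma nonreal_resolvent n (e : 'I_n -> K) : krein br -> maxneg br e ->
  (exists z, rel_resolvent_set B z) ->
  exists s : seq C, forall z, 'Im z != 0 -> z \notin s -> rel_resolvent_set B z.
Proof.
move=> Kr me [z0 [S0 hS0]].
have up (l m : C) : 0 < 'Im l -> 0 < 'Im m -> l != m^*.
  by move=> l0 m0; apply/eqP => h; move: l0; rewrite h Im_conj oppr_gt0 => /(lt_trans m0); rewrite ltxx.
have lo (l m : C) : 'Im l < 0 -> 'Im m < 0 -> l != m^*.
  by move=> l0 m0; apply/eqP => h; move: l0; rewrite h Im_conj oppr_lt0 => /(lt_trans m0); rewrite ltxx.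
have [s1 hs1] := eigenvalues_finite Kr me hS0 up.
have [s2 hs2] := eigenvalues_finite Kr me hS0 lo.
exists (s1 ++ s2 ++ map conjC s1 ++ map conjC s2) => z zi.
rewrite !mem_cat !negb_or => /and4P[z1 z2 z3 z4].
have H l : 'Im l != 0 -> l \notin s1 -> l \notin s2 -> forall x, B (x, l *: x) -> x = 0.
  move=> li l1 l2 x Bx; apply/eqP/negPn/negP => x0.
  have := Creal_Im l; rewrite realE => /orP[l0|l0].
    by move/negP: l1; apply; apply: hs1; [rewrite lt_def li|exists x].
  by move/negP: l2; apply; apply: hs2; [rewrite lt_def eq_sym li|exists x].
apply: (resolvent_exists Kr me zi (H _ zi z1 z2)); apply: H.
- by rewrite Im_conj oppr_eq0.
- by apply: contra z3 => h; rewrite -[z]conjCK map_f.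
- by apply: contra z4 => h; rewrite -[z]conjCK map_f.
Qed.

End SelfAdjoint.
End LinearRelations.

(** * Resolvents: continuity, openness, adjoints and graphs of operators *)

Section Resolvents.
Variable R : realType.
Local Notation C := (Cplx R).
Variables (K : completeNormedModType C).
Implicit Types (B : set (K * K)) (S : K -> K).

(** The resolvent identity gives |S' x| <= |S x| + |S' x| / 2, and the last term is absorbed on the
    left. *)
Lemma resolvent_near B z w S S' (c : C) : rel_resolvent B z S -> rel_resolvent B w S' ->
  0 < c -> (forall x, `|S x| <= c * `|x|) -> `|w - z| * c <= 2^-1 ->
  (forall x, `|S' x| <= 2 * c * `|x|) /\ (forall x, `|S' x - S x| <= 2 * c ^+ 2 * `|w - z| * `|x|).
Proof.
move=> hS hS' c0 hc wz.
have hd x : `|S' x - S x| <= `|w - z| * (c * `|S' x|).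
  by rewrite distrC (resolvent_identity x hS hS') normrZ distrC ler_wpM2l.
have h1 x : `|S' x| <= 2 * c * `|x|.
  have : `|S' x| <= `|S x| + 2^-1 * `|S' x|.
    rewrite -[S' x in leLHS](subrK (S x)) addrC (le_trans (ler_normD _ _))// lerD2l.
    by rewrite (le_trans (hd x))// mulrA ler_wpM2r.
  rewrite -lerBlDr (_ : `|S' x| - _ = 2^-1 * `|S' x|); last by field.
  rewrite ler_pdivrMl// => /le_trans; apply.
  by rewrite -mulrA ler_pM2l.
split=> // x; rewrite (le_trans (hd x))//.
rewrite (_ : 2 * _ * _ * _ = `|w - z| * (c * (2 * c * `|x|))); last by ring.
by rewrite ler_wpM2l// ler_pM2l.
Qed.

Lemma neumann (T : K -> K) (q : C) : bounded_op T -> 0 <= q -> q < 1 ->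
  (forall x, `|T x| <= q * `|x|) -> forall y, exists x, x = y + T x.
Proof.
move=> Tb q0 q1 hT y.
pose u := fix u n := if n is m.+1 then y + T (u m) else 0.
have q1' : 0 < 1 - q by rewrite subr_gt0.
have step n : `|u n.+1 - u n| <= q ^+ n * `|y|.
  elim: n => [|n IH]; first by rewrite /= bounded_op0// addr0 subr0 expr0 mul1r.
  rewrite [u n.+2]/= [u n.+1 in X in _ - X]/= opprD addrACA subrr add0r -bounded_opB//.
  by rewrite (le_trans (hT _))// exprS -mulrA ler_wpM2l.
have far n m : `|u (n + m)%N - u n| <= q ^+ n * `|y| / (1 - q).
  have : `|u (n + m)%N - u n| <= q ^+ n * `|y| * (1 - q ^+ m) / (1 - q).
    elim: m => [|m IH]; first by rewrite addn0 subrr normr0 expr0 subrr mulr0 mul0r.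
    rewrite addnS -(subrK (u (n + m)%N) (u _.+1)) -addrA (le_trans (ler_normD _ _))//.
    rewrite (le_trans (lerD (step _) IH))// le_eqVlt; apply/predU1P; left.
    by rewrite exprD exprS; field; rewrite gt_eqF.
  move=> /le_trans; apply; rewrite ler_wpM2r ?invr_ge0 ?(ltW q1')//.
  by rewrite ler_piMr ?mulr_ge0 ?exprn_ge0// gerBl exprn_ge0.
have [x hx] : exists x, seq_lim u x.
  apply: seq_complete => e e0.
  have y1 : 0 < 2 * (`|y| + 1) / (1 - q) by rewrite divr_gt0// mulr_gt0// ltr_wpDl.
  have [N hN] := expr_lt q0 q1 (divr_gt0 e0 y1).
  have near k : (N <= k)%N -> `|u k - u N| < e / 2.
    move=> /subnKC <-; rewrite (le_lt_trans (far _ _))//.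
    have := hN N (leqnn _); rewrite ltr_pdivlMr// => h.
    rewrite ltr_pdivlMr//; apply: le_lt_trans h.
    rewrite (_ : _ * 2 = q ^+ N * (2 * `|y| / (1 - q))); last by ring.
    by rewrite ler_wpM2l ?exprn_ge0// ler_wpM2r ?invr_ge0 ?(ltW q1')// ler_pM2l// lerDl.
  exists N => m n Nm Nn; rewrite -(subrK (u N) (u m)) -addrA (le_lt_trans (ler_normD _ _))//.
  by rewrite [e]splitr ltrD// ?near// distrC near.
exists x; apply: (@seq_lim_unique _ _ (fun n => u n.+1)) => e e0.
  by have [N hN] := hx e e0; exists N => n Nn; apply: hN; exact: leqW.
have [N hN] := hx e e0; exists N => n Nn.
rewrite [u _]/= opprD addrACA subrr add0r -bounded_opB// (le_lt_trans (hT _))//.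
by rewrite (le_lt_trans _ (hN n Nn))// ler_piMl// ltW.
Qed.

(** The value at [u] of the resolvent at [w] is the solution of x = S u + (w - z) S x, a contraction
    equation. *)
Lemma resolvent_open B z w S (c : C) : rel_resolvent B z S -> 0 < c -> (forall x, `|S x| <= c * `|x|) ->
  `|w - z| * c < 1 -> exists S', rel_resolvent B w S'.
Proof.
move=> [Sb hS] c0 hc wz; pose T x := (w - z) *: S x.
have Tl : linear T by move=> a x y; rewrite /T bounded_op_linear// scalerDr !scalerA mulrC.
have hT x : `|T x| <= `|w - z| * c * `|x| by rewrite normrZ -mulrA ler_wpM2l.
have Tb : bounded_op T.
  apply/bounded_opP; split=> //; exists (`|w - z| * c + 1); first by rewrite ltr_wpDl// mulr_ge0// ltW.
  by move=> x; rewrite (le_trans (hT x))// ler_wpM2r// lerDl.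
have q0 : 0 <= `|w - z| * c by rewrite mulr_ge0// ltW.
have inj x : x = T x -> x = 0.
  move=> xT; have := hT x; rewrite -xT -[leLHS]mul1r -subr_ge0 -mulrBl.
  rewrite -oppr_le0 -mulNr opprB pmulr_rle0 ?subr_gt0// normr_le0 => /eqP //.
have [S' hS'] := choice (fun u => neumann Tb q0 wz hT (S u)).
have uni u x : x = S u + T x -> S' u = x.
  move=> xE; apply/eqP; rewrite -subr_eq0; apply/eqP/inj.
  by rewrite {1}(hS' u) {1}xE opprD addrACA subrr add0r /T -scalerBr -bounded_opB.
have key x u : B (x, u + w *: x) <-> x = S u + T x.
  have -> : u + w *: x = u + (w - z) *: x + z *: x by rewrite -addrA -scalerDl subrK.
  rewrite -hS bounded_opD// bounded_opZ// -/(T x); split=> ->//.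
exists S'; split; last by move=> x u; rewrite key; split=> [<-|]; [exact: hS'|exact: uni].
apply/bounded_opP; split.
  move=> a x y; apply: uni; rewrite bounded_op_linear// bounded_op_linear//.
  by rewrite addrACA -scalerDr -!hS'.
have q1 : 0 < 1 - `|w - z| * c by rewrite subr_gt0.
exists (c / (1 - `|w - z| * c)); first by rewrite divr_gt0.
move=> u; rewrite mulrAC ler_pdivlMr// mulrBr mulr1 lerBlDr.
rewrite {1}(hS' u) (le_trans (ler_normD _ _))// lerD// mulrC; exact: hT.
Qed.

Section SelfAdjointResolvent.
Variables (br : {hermitian K for false & conjC}) (B : set (K * K)).
Hypothesis Bsa : selfadjoint_rel br B.

Lemma resolvent_adjoint z S S' x y : rel_resolvent B z S -> rel_resolvent B z^* S' -> br (S x) y = br x (S' y).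
Proof.
move=> /(rel_resolventK x) h /(rel_resolventK y) h'.
have /selfadjoint_relE : B (S x, x + z *: S x) by [].
move=> /(_ br Bsa _ h') /=; rewrite hfDl hfDr hfZl hfZr conjCK => /addIr ->//.
Qed.

(** B - z is onto, so an eigenvector at conj z would be orthogonal to the whole space. *)
Lemma resolvent_conj n (e : 'I_n -> K) z S : krein br -> maxneg br e -> 'Im z != 0 ->
  rel_resolvent B z S -> exists S', rel_resolvent B z^* S'.
Proof.
move=> Kr me zi hS; apply: (resolvent_exists Bsa Kr me).
- by rewrite Im_conj oppr_eq0.
- move=> y; move=> /(selfadjoint_relE Bsa) By; apply: (krein_nondeg Kr) => x.
  have /= := By _ (rel_resolventK x hS); rewrite hfZl hfDr hfZr => /eqP.
  by rewrite -subr_eq0 opprD addrCA subrr addr0 oppr_eq0 => /eqP.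
- move=> y; rewrite conjCK => By; have := resolvent_eigen hS By.
  by rewrite subrr scale0r => <-.
Qed.
End SelfAdjointResolvent.

Definition graph (A : K -> K) : set (K * K) := [set p | p.2 = A p.1].

Lemma graph_selfadjoint (br : {hermitian K for false & conjC}) A : krein br -> selfadjoint_op br A ->
  selfadjoint_rel br (graph A).
Proof.
move=> Kr Asa; apply/seteqP; split=> -[x y]; rewrite /graph /=.
  by move=> -> [u v] /= ->; exact: Asa.
move=> h.
apply/eqP; rewrite -subr_eq0; apply/eqP; apply: (krein_nondeg Kr) => u.
by rewrite hfBl (h (u, A u))//= Asa subrr.
Qed.

Lemma inv_onK (M : set K) (f : K -> K) x : set_bij M M f -> M x -> inv_on M f (f x) = x.
Proof. by move=> [_ fi _] Mx; rewrite /inv_on pinvKV// inE. Qed.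

Lemma inv_onP (M : set K) (f : K -> K) y : set_bij M M f -> M y -> M (inv_on M f y) /\ f (inv_on M f y) = y.
Proof.
move=> fb My; have [_ fi fs] := fb; have [x Mx fx] := fs _ My.
by rewrite -fx inv_onK.
Qed.

Lemma graph_resolventP A z S : rel_resolvent (graph A) z S <->
  [/\ bounded_op S, forall x, A (S x) - z *: S x = x & forall x, S (A x - z *: x) = x].
Proof.
split=> [[Sb h]|[Sb h1 h2]]; split=> //.
- by move=> x; have /= := rel_resolventK x (conj Sb h); rewrite /graph /= => <-; rewrite addrK.
- by move=> x; apply/h; rewrite /graph /= subrK.
- move=> x w; split=> [<-|]; first by rewrite /graph /= -{1}(h1 w) subrK.
  by rewrite /graph /= => wE; rewrite -[RHS]h2 -wE addrK.
Qed.

Lemma resolvent_setTP A z : linear A -> resolvent_set_on setT A z ->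
  rel_resolvent (graph A) z (resolvent_on setT A z).
Proof.
move=> Al [fb [c hc]]; pose f v := A v - z *: v.
have h1 x : f (resolvent_on setT A z x) = x by have [] := inv_onP fb (I : setT x).
have h2 x : resolvent_on setT A z (f x) = x by rewrite /resolvent_on inv_onK.
have fl : linear f by move=> a x y; rewrite /f Al scalerBr addrACA -opprD scalerDr !scalerA mulrC.
apply/graph_resolventP; split=> //; apply/bounded_opP; split.
  by move=> a x y; rewrite -{1}(h1 x) -{1}(h1 y) -fl h2.
(* The definition of bounded invertibility allows any complex constant; its modulus gives an honest
   bound. *)
exists (`|c| + 1); first by rewrite ltr_wpDl.
move=> x; have hx := hc (resolvent_on setT A z x) I; rewrite [X in _ * `|X|]h1 in hx.
apply: (le_trans hx); rewrite -[c * _]ger0_norm ?(le_trans _ hx)// normrM normr_id.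
by rewrite ler_wpM2r// lerDl.
Qed.

Lemma resolvent_setT_of A z S : rel_resolvent (graph A) z S ->
  resolvent_set_on setT A z /\ resolvent_on setT A z = S.
Proof.
move=> /graph_resolventP[Sb h1 h2].
have bij : set_bij setT setT (fun v => A v - z *: v).
  split=> // [x y _ _ E|y _]; first by rewrite -(h2 x) E h2.
  by exists (S y).
split; last by apply/funext => x; rewrite -[x in LHS]h1; exact: inv_onK.
split=> //; have [_ [c c0 hc]] := (bounded_opP S).1 Sb.
by exists c => v _; rewrite -{1}(h2 v).
Qed.

Lemma resolvent_setTE A z : linear A -> (resolvent_set_on setT A z <-> rel_resolvent_set (graph A) z).
Proof.
move=> Al; split=> [/(resolvent_setTP Al) h|[S /resolvent_setT_of[]]//].
by exists (resolvent_on setT A z).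
Qed.

Lemma resolvent_large A (c : C) z : bounded_op A -> (forall x, `|A x| <= c * `|x|) -> 0 <= c -> c < `|z| ->
  exists2 S, rel_resolvent (graph A) z S & forall x, `|S x| <= `|x| / (`|z| - c).
Proof.
move=> Ab hc c0 cz; have z0 : 0 < `|z| by exact: le_lt_trans cz.
have zn0 : z != 0 by rewrite -normr_gt0.
have zc0 : 0 < `|z| - c by rewrite subr_gt0.
pose T x := z^-1 *: A x.
have hT x : `|T x| <= c / `|z| * `|x|.
  by rewrite normrZ normfV mulrAC mulrC ler_wpM2r ?invr_ge0.
have Tb : bounded_op T.
  apply/bounded_opP; split.
    by move=> a x y; rewrite /T bounded_op_linear// scalerDr !scalerA mulrC.
  exists (c / `|z| + 1); first by rewrite ltr_wpDl// divr_ge0.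
  by move=> x; rewrite (le_trans (hT x))// ler_wpM2r// lerDl.
have q1 : c / `|z| < 1 by rewrite ltr_pdivrMr// mul1r.
have [S hS] := choice (fun u => neumann Tb (divr_ge0 c0 (ltW z0)) q1 hT (- (z^-1 *: u))).
pose f x := A x - z *: x.
have fl a x y : f (a *: x + y) = a *: f x + f y.
  by rewrite /f bounded_op_linear// scalerDr opprD addrACA scalerBr !scalerA mulrC.
have h1 x : f (S x) = x.
  rewrite /f [X in _ - _ *: X]hS scalerDr scalerN !scalerA mulfV// !scale1r.
  by rewrite opprD opprK addrCA subrr addr0.
have low x : `|x| * (`|z| - c) <= `|f x|.
  rewrite mulrBr lerBlDr mulrC -normrZ.
  rewrite -[z *: x](subrK (A x)) (le_trans (ler_normD _ _))// distrC lerD2l mulrC//.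
have inj x : f x = 0 -> x = 0.
  move=> h; have := low x; rewrite h normr0 pmulr_lle0// normr_le0 => /eqP//.
have h2 x : S (f x) = x.
  apply/eqP; rewrite -subr_eq0; apply/eqP/inj.
  by rewrite addrC -scaleN1r fl h1 scaleN1r addrC subrr.
have hb x : `|S x| <= `|x| / (`|z| - c) by rewrite ler_pdivlMr// (le_trans (low _))// h1.
exists S => //; apply/graph_resolventP; split=> //; apply/bounded_opP; split.
  by move=> a x y; rewrite -{1}(h1 x) -{1}(h1 y) -fl h2.
exists (`|z| - c)^-1; first by rewrite invr_gt0.
by move=> x; rewrite mulrC.
Qed.
End Resolvents.

(** * Dense isometries between Pontryagin spaces *)

Section Uniqueness.
Variable R : realType.
Local Notation C := (Cplx R).

(** The candidates z + i d / (k + 2) lie on a vertical segment: at most one is real and at most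
    [size s] belong to [s]. Denominators from 2 on keep the distance below [d]. *)
Lemma dense_avoid (s : seq C) z (d : C) : 0 < d -> exists z' : C, [/\ `|z' - z| < d, z' != z, 'Im z' != 0 & z' \notin s].
Proof.
move=> d0.
pose t (k : nat) : C := z + 'i * (d / k.+2%:R).
have tinj : injective t.
  move=> k l /addrI /(mulfI (neq0Ci C)) /(mulfI (lt0r_neq0 d0)) /invr_inj /eqP.
  by rewrite eqr_nat eqSS eqSS => /eqP.
have treal k : d / k.+2%:R \is Num.real by rewrite gtr0_real// divr_gt0.
pose bad := [seq k <- iota 0 (size s).+2 | (t k \in s) || ('Im (t k) == 0)].
have [k hk] : exists k, (t k \notin s) && ('Im (t k) != 0).
  apply: contrapT => h.
  have all_bad k : (t k \in s) || ('Im (t k) == 0).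
    by apply: contrapT => /negP; rewrite negb_or => hk; apply: h; exists k.
  have imt k : 'Im (t k) = 'Im z + d / k.+2%:R.
    by rewrite raddfD /= ImMil (Creal_ReP _ _)//.
  have im1 k l : 'Im (t k) == 0 -> 'Im (t l) == 0 -> k = l.
    rewrite !imt => /eqP hk /eqP hl; have := hk; rewrite -hl => /addrI /(mulfI (lt0r_neq0 d0)) /invr_inj /eqP.
    by rewrite eqr_nat eqSS eqSS => /eqP.
  have [k0 hk0] : exists k0, forall k, k != k0 -> t k \in s.
    case: (pselect (exists k, 'Im (t k) == 0)) => [[k0 hk0]|hn].
      exists k0 => k kk0; have := all_bad k => /orP[//|hk]; by rewrite (im1 _ _ hk hk0) eqxx in kk0.
    by exists 0%N => k _; have := all_bad k => /orP[//|hk]; case: hn; exists k.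
  have : (size [seq t k | k <- [seq k <- iota 0 (size s).+2 | k != k0]] <= size s)%N.
    apply: uniq_leq_size; first by rewrite map_inj_uniq// filter_uniq// iota_uniq.
    by move=> x /mapP[k]; rewrite mem_filter => /andP[hk _] ->; exact: hk0.
  rewrite size_map size_filter.
  have := count_predC (fun k => k != k0) (iota 0 (size s).+2); rewrite size_iota => E h2.
  have : (count (predC (fun k => k != k0)) (iota 0 (size s).+2) <= 1)%N.
    rewrite (eq_count (a2 := pred1 k0)); last by move=> k /=; rewrite negbK.
    by rewrite count_uniq_mem ?iota_uniq// leq_b1.
  by move=> h3; have := leq_add h2 h3; rewrite E addn1 ltnn.
have /andP[ks ki] := hk.
exists (t k); split=> //.
  rewrite /t addrC addKr normrM normCi mul1r gtr0_norm ?divr_gt0//.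
  by rewrite ltr_pdivrMr// ltr_pMr// ltr1n.
by rewrite /t -subr_eq0 addrC addKr mulf_neq0 ?neq0Ci// mulf_neq0 ?invr_eq0 ?pnatr_eq0// gt_eqF.
Qed.

Section Extension.
Variables (K1 K2 : completeNormedModType C).
Variables (br1 : {hermitian K1 for false & conjC}) (br2 : {hermitian K2 for false & conjC}).

Definition gclosure (T : set (K1 * K2)) : set (K1 * K2) := [set p | forall e : C, 0 < e ->
  exists x' y', [/\ T (x', y'), `|p.1 - x'| < e & `|p.2 - y'| < e]].

Lemma gclosure_incl T p : T p -> gclosure T p.
Proof. by case: p => x y h e e0; exists x, y; rewrite !subrr !normr0. Qed.

Lemma gclosure_closed T : gclosed (gclosure T).
Proof.
move=> x y h e e0; have [x' [y' [h' /= hx hy]]] := h _ (pos_half e0).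
have [x2 [y2 [T2 /= hx2 hy2]]] := h' _ (pos_half e0).
exists x2, y2; split=> //=.
  by rewrite -(subrK x' x) -addrA (le_lt_trans (ler_normD _ _))// [e]splitr ltrD.
by rewrite -(subrK y' y) -addrA (le_lt_trans (ler_normD _ _))// [e]splitr ltrD.
Qed.

Lemma gclosure_sub T : gsub T -> gsub (gclosure T).
Proof.
move=> TS; split; first by apply: gclosure_incl; exact: TS.1.
move=> a x y x' y' h h' e e0.
have a1 : 0 < `|a| + 1 by rewrite ltr_wpDl.
have [u [v [T1 /= hx hy]]] := h _ (pos_half (divr_gt0 e0 a1)).
have [u' [v' [T2 /= hx' hy']]] := h' _ (pos_half e0).
exists (a *: u + u'), (a *: v + v'); split=> /=; first exact: TS.2.
  rewrite opprD addrACA -scalerBr (le_lt_trans (ler_normD _ _))// [e]splitr ler_ltD// normrZ.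
  apply: (@le_trans _ _ ((`|a| + 1) * (e / (`|a| + 1) / 2))).
    by rewrite ler_pM// ?lerDl// ltW.
  by rewrite mulrA mulrCA mulrA mulfK// gt_eqF.
rewrite opprD addrACA -scalerBr (le_lt_trans (ler_normD _ _))// [e]splitr ler_ltD// normrZ.
apply: (@le_trans _ _ ((`|a| + 1) * (e / (`|a| + 1) / 2))).
  by rewrite ler_pM// ?lerDl// ltW.
by rewrite mulrA mulrCA mulrA mulfK// gt_eqF.
Qed.

Lemma gclosure_swap_bound T (c : C) : 0 < c -> (forall x y, T (x, y) -> `|x| <= c * `|y|) ->
  forall x y, gclosure T (x, y) -> `|x| <= c * `|y|.
Proof.
move=> c0 hc x y h; rewrite -subr_le0; apply/negPn/negP => hn.
pose t := `|x| - c * `|y|.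
have t0 : 0 < t by rewrite real_ltNge ?real0// rpredB ?normr_real// realM ?normr_real ?gtr0_real.
have c1 : 0 < 1 + c by rewrite addr_gt0.
have [x' [y' [T' /= hx hy]]] := h _ (divr_gt0 t0 c1).
have : t < t.
  rewrite {1}/t ltrBlDr.
  have hx1 : `|x| < t / (1 + c) + `|x'|.
    by rewrite -{1}(subrK x' x) (le_lt_trans (ler_normD _ _))// ltrD2r.
  have hy1 : `|y'| < t / (1 + c) + `|y|.
    by rewrite -{1}(subrK y y') (le_lt_trans (ler_normD _ _))// ltrD2r distrC.
  apply: (lt_le_trans hx1); rewrite -lerBrDl (le_trans (hc _ _ T'))//.
  rewrite (_ : _ - _ = c * (t / (1 + c) + `|y|)); last by field; rewrite gt_eqF.
  by rewrite ler_pM2l// ltW.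
by rewrite ltxx.
Qed.

End Extension.

(** A negative [x] orthogonal to [e] is approximated by [v] in [V]; the projection of [v] stays in
    [V], is orthogonal to [e], and would still be negative. *)
Lemma dense_maxneg (K : completeNormedModType C) (br : {hermitian K for false & conjC}) n (e : 'I_n -> K) (V : set K) :
  krein br -> subspace V -> (forall x (d : C), 0 < d -> exists2 v, V v & `|x - v| < d) ->
  (forall i, V (e i)) -> negsys br e ->
  (forall x, V x -> (forall i, br x (e i) = 0) -> 0 <= br x x) -> maxneg br e.
Proof.
move=> Kr VS Vd Ve he pe; split=> // x xe; apply: contrapT => /(not_le0_lt (hf_real br x)) xx.
have [a a0 ha] := eproj_bound e Kr; have [b b0 hb] := krein_bound Kr.
have qx : eproj br e x = x by rewrite /eproj big1 ?addr0// => i _; rewrite xe scale0r.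
(* For d < 1, [D * d] bounds the change of the form from [x] to the projected vector [w]; the choice
   of [d] makes it smaller than [- br x x]. *)
pose D := b * a * (2 * `|x| + a).
have D0 : 0 < D by rewrite !mulr_gt0// ltr_wpDl// mulr_ge0.
pose d := 1 / (1 + - (br x x)^-1 * D).
have xx0 : 0 < - (br x x)^-1 by rewrite oppr_gt0 invr_lt0.
have p0 : 0 < - (br x x)^-1 * D by rewrite mulr_gt0.
have d0 : 0 < d by rewrite divr_gt0// addr_gt0.
have d1 : d < 1 by rewrite /d div1r invf_lt1 ?ltrDl// addr_gt0.
have [v Vv xv] := Vd x d d0.
pose w := eproj br e v.
have w0 : 0 <= br w w.
  apply: pe; last by move=> i; exact: eproj_orth.
  by apply: subspaceD => //; apply: subspace_sum => // i _; exact: subspaceZ.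
have wx : `|x - w| <= a * d.
  rewrite -{1}qx /w [eproj br e x - _](_ : _ = eproj br e (x - v)).
    by rewrite (le_trans (ha _))// ler_pM2l// ltW.
  by rewrite addrC -scaleN1r -eproj_linear scaleN1r addrC.
have E : br w w - br x x = br (w - x) w + br x (w - x) by rewrite hfBl hfBr; ring.
have hw : `|w| <= `|x| + a.
  rewrite -(subrK x w) addrC (le_trans (ler_normD _ _))// lerD2l distrC (le_trans wx)//.
  by rewrite ler_piMr// ltW.
have : - br x x <= D * d.
  apply: (@le_trans _ _ (br w w - br x x)); first by rewrite -[leLHS]add0r lerD2r.
  apply: (le_trans (real_ler_norm _)); first by rewrite rpredB ?hf_real.
  rewrite E (le_trans (ler_normD _ _))//.
  apply: (@le_trans _ _ (b * (a * d) * (`|x| + a) + b * `|x| * (a * d))).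
    rewrite lerD ?(le_trans (hb _ _))//.
      by rewrite ler_pM ?mulr_ge0 ?(ltW b0)// ler_pM2l// distrC.
    by rewrite ler_wpM2l ?mulr_ge0 ?(ltW b0)// distrC.
  by rewrite le_eqVlt; apply/predU1P; left; rewrite /D; ring.
rewrite /d div1r ler_pdivlMr ?addr_gt0// mulrDr mulr1 mulrA mulrNN mulfV ?lt_eqF// mul1r.
by rewrite gerDr oppr_le0 => /(lt_le_trans xx); rewrite ltxx.
Qed.

(** A dense isometry between Pontryagin spaces is automatically continuous: a maximal negative
    system found inside the domain is carried to one on the other side, and the two majorants agree
    along [T]. *)
Lemma isometry_bounds (K1 K2 : completeNormedModType C) (br1 : {hermitian K1 for false & conjC})
    (br2 : {hermitian K2 for false & conjC}) (T : set (K1 * K2)) n1 (e1 : 'I_n1 -> K1) :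
  krein br1 -> krein br2 -> maxneg br1 e1 -> gsub T ->
  (forall x y x' y', T (x, y) -> T (x', y') -> br1 x x' = br2 y y') ->
  (forall x (d : C), 0 < d -> exists p, T p /\ `|x - p.1| < d) ->
  (forall y (d : C), 0 < d -> exists p, T p /\ `|y - p.2| < d) ->
  exists2 c : C, 0 < c & forall x y, T (x, y) -> `|x| <= c * `|y| /\ `|y| <= c * `|x|.
Proof.
move=> Kr1 Kr2 me1 TS iso d1 d2.
pose V1 := [set x | exists y, T (x, y)]; pose V2 := [set y | exists x, T (x, y)].
have V1S : subspace V1.
  split; first by exists 0; exact: TS.1.
  by move=> a x x' [y h] [y' h']; exists (a *: y + y'); exact: TS.2.
have V2S : subspace V2.
  split; first by exists 0; exact: TS.1.
  by move=> a x x' [y h] [y' h']; exists (a *: y + y'); exact: TS.2.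
have V1d x (d : C) : 0 < d -> exists2 v, V1 v & `|x - v| < d.
  by move=> d0; have [[u v] [h xu]] := d1 x d d0; exists u => //; exists v.
have V2d x (d : C) : 0 < d -> exists2 v, V2 v & `|x - v| < d.
  by move=> d0; have [[u v] [h xu]] := d2 x d d0; exists v => //; exists u.
have [n [e [Ve he pe]]] := @exists_maxneg _ _ br1 V1 n1 V1S (fun m f _ hf => maxneg_le me1 hf).
have me := dense_maxneg Kr1 V1S V1d Ve he pe.
have [f hf] := choice Ve.
have hef : negsys br2 f by move=> i j; rewrite -(iso _ _ _ _ (hf i) (hf j)) he.
have mf : maxneg br2 f.
  apply: (dense_maxneg Kr2 V2S V2d) => // [i|y [x h] yf]; first by exists (e i).
  by rewrite -(iso _ _ _ _ h h); apply: pe => [|i]; [exists y|rewrite (iso _ _ _ _ h (hf i))].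
have [c1 [b1 [c10 b10 h1]]] := maxneg_norm Kr1 me.
have [c2 [b2 [c20 b20 h2]]] := maxneg_norm Kr2 mf.
have r1 : 0 <= b2 / c1 by rewrite divr_ge0// ltW.
have r2 : 0 <= b1 / c2 by rewrite divr_ge0// ltW.
exists (1 + b2 / c1 + b1 / c2); first by rewrite -addrA ltr_wpDr// addr_ge0.
move=> x y h; have E : br1 x x + 2 * \sum_i `|br1 x (e i)| ^+ 2 = br2 y y + 2 * \sum_i `|br2 y (f i)| ^+ 2.
  by rewrite (iso _ _ _ _ h h); congr (_ + _ * _); apply: eq_bigr => i _; rewrite (iso _ _ _ _ h (hf i)).
have /andP[h11 h12] := h1 x; have /andP[h21 h22] := h2 y; rewrite E in h11 h12.
have a1 : `|x| <= (1 + b2 / c1) * `|y|.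
  by apply: sqr_bound => //; rewrite mulrAC ler_pdivlMr// mulrC (le_trans h11).
have a2 : `|y| <= (1 + b1 / c2) * `|x|.
  by apply: sqr_bound => //; rewrite mulrAC ler_pdivlMr// mulrC (le_trans h21).
split; [apply: (le_trans a1)|apply: (le_trans a2)]; rewrite ler_wpM2r//.
  by rewrite lerDl.
by rewrite lerD2r lerDl.
Qed.

Lemma isometry_extension (K1 K2 : completeNormedModType C) (T : set (K1 * K2)) (c : C) :
  gsub T -> 0 < c -> (forall x y, T (x, y) -> `|x| <= c * `|y| /\ `|y| <= c * `|x|) ->
  (forall x (d : C), 0 < d -> exists p, T p /\ `|x - p.1| < d) ->
  (forall y (d : C), 0 < d -> exists p, T p /\ `|y - p.2| < d) ->
  exists V : K1 -> K2, [/\ forall a x y, V (a *: x + y) = a *: V x + V y,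
    injective V, forall y, exists x, V x = y & forall x y, gclosure T (x, y) <-> y = V x].
Proof.
move=> TS c0 hc d1 d2.
have cS := gclosure_sub TS.
have b1 x y : gclosure T (x, y) -> `|x| <= c * `|y|.
  by apply: gclosure_swap_bound => // u v /hc[].
pose Ts := [set p : K2 * K1 | T (p.2, p.1)].
have swap y x : gclosure Ts (y, x) <-> gclosure T (x, y).
  by split=> h e e0; have [u [v [h1 h2 h3]]] := h e e0; exists v, u.
have b2 x y : gclosure T (x, y) -> `|y| <= c * `|x|.
  by move=> /swap; apply: gclosure_swap_bound => // u v /hc[].
have TsS : gsub (gclosure Ts).
  apply: gclosure_sub; split; first exact: TS.1.
  by move=> a x y x' y' h h'; exact: TS.2.
have tot x : exists y, gclosure T (x, y).
  have [|y h] := range_closed TsS (@gclosure_closed _ _ Ts) c0 (fun y x h => b2 x y ((swap y x).1 h)) (y := x).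
    move=> e e0; have [[u v] [h xu]] := d1 x e e0.
    by exists v, u; split => //; apply/swap; exact: gclosure_incl.
  by exists y; apply/swap.
have sur y : exists x, gclosure T (x, y).
  apply: (range_closed cS (@gclosure_closed _ _ T) c0 b1) => e e0.
  by have [[u v] [h xu]] := d2 y e e0; exists u, v; split => //; exact: gclosure_incl.
have [V hV] := choice tot.
have uni x y y' : gclosure T (x, y) -> gclosure T (x, y') -> y = y'.
  move=> h h'; apply/eqP; rewrite -subr_eq0 -normr_le0.
  by have := b2 _ _ (gsubB cS h h'); rewrite subrr normr0 mulr0.
have inj x x' y : gclosure T (x, y) -> gclosure T (x', y) -> x = x'.
  move=> h h'; apply/eqP; rewrite -subr_eq0 -normr_le0.
  by have := b1 _ _ (gsubB cS h h'); rewrite subrr normr0 mulr0.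
exists V; split.
- by move=> a x y; apply: (uni (a *: x + y)) => //; exact: cS.2.
- by move=> x x' E; apply: (inj _ _ (V x)) => //; rewrite E.
- by move=> y; have [x h] := sur y; exists x; apply: uni h.
- by move=> x y; split=> [h|->//]; exact: uni h (hV x).
Qed.

End Uniqueness.

Section DotForm.
Variable R : realType.
Local Notation C := (Cplx R).
Variables (H : completeNormedModType C) (ip : {dot H for conjC}).
Implicit Types (a : C) (x y z : H).

Lemma ipC x y : ip x y = (ip y x)^*. Proof. exact: (hfC ip). Qed.
Lemma ipZl a x y : ip (a *: x) y = a * ip x y. Proof. exact: (hfZl ip). Qed.
Lemma ipZr a x y : ip x (a *: y) = a^* * ip x y. Proof. exact: (hfZr ip). Qed.
Lemma ipDl x y z : ip (x + y) z = ip x z + ip y z. Proof. exact: (hfDl ip). Qed.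
Lemma ipDr x y z : ip x (y + z) = ip x y + ip x z. Proof. exact: (hfDr ip). Qed.
Lemma ipBl x y z : ip (x - y) z = ip x z - ip y z. Proof. exact: (hfBl ip). Qed.
Lemma ipBr x y z : ip x (y - z) = ip x y - ip x z. Proof. exact: (hfBr ip). Qed.
Lemma ipNl x z : ip (- x) z = - ip x z. Proof. exact: (hfNl ip). Qed.
Lemma ipNr x z : ip x (- z) = - ip x z. Proof. exact: (hfNr ip). Qed.
Lemma ip0l z : ip 0 z = 0. Proof. exact: (hf0l ip). Qed.
Lemma ip0r z : ip z 0 = 0. Proof. exact: (hf0r ip). Qed.
Lemma ip_suml (I : Type) (r : seq I) (P : pred I) E z :
  ip (\sum_(i <- r | P i) E i) z = \sum_(i <- r | P i) ip (E i) z.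
Proof. exact: (hf_suml ip). Qed.
Lemma ip_ext x y : (forall z, ip x z = ip y z) -> x = y.
Proof.
move=> h; apply/eqP; rewrite -subr_eq0 -(dnorm_eq0 ip).
by rewrite ipBl h subrr.
Qed.
End DotForm.

(** * Gamma fields and uniqueness of minimal representations *)

Section Representations.
Variable R : realType.
Local Notation C := (Cplx R).

Lemma closure_subspace (K : completeNormedModType C) (V : set K) : subspace V -> subspace (closure V).
Proof.
move=> VS; split; first by apply: subset_closure; exact: VS.1.
move=> a x y /closureE hx /closureE hy; apply/closureE => e e0.
have a1 : 0 < `|a| + 1 by rewrite ltr_wpDl.
have [u Vu xu] := hx _ (pos_half (divr_gt0 e0 a1)); have [v Vv yv] := hy _ (pos_half e0).
exists (a *: u + v); first exact: VS.2.
rewrite opprD addrACA -scalerBr (le_lt_trans (ler_normD _ _))// [e]splitr ler_ltD// normrZ.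
apply: (@le_trans _ _ ((`|a| + 1) * (e / (`|a| + 1) / 2))).
  by rewrite ler_pM// ?lerDl// ltW.
by rewrite mulrA mulrCA mulrA mulfK// gt_eqF.
Qed.

Lemma lin_span_subspace (K : completeNormedModType C) (S V : set K) : subspace V -> S `<=` V -> lin_span S `<=` V.
Proof. by move=> VS SV _ [n [a [e [Se ->]]]]; apply: subspace_sum => // i _; apply: subspaceZ => //; exact: SV. Qed.

Lemma subspace_lin_span (K : completeNormedModType C) (S : set K) : subspace (lin_span S).
Proof.
split; first by exists 0%N, (fun=> 0), (fun=> 0); split=> [[]//|]; rewrite big_ord0.
move=> a _ _ [n [b [e [Se ->]]]] [m [b' [e' [Se' ->]]]].
exists (n + m)%N, (fun i => match fintype.split i with inl j => a * b j | inr j => b' j end),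
  (fun i => match fintype.split i with inl j => e j | inr j => e' j end); split.
  by move=> i; case: (fintype.split i).
rewrite big_split_ord scaler_sumr; congr (_ + _); apply: eq_bigr => i _.
  by rewrite (unsplitK (inl i)) scalerA.
by rewrite (unsplitK (inr i)).
Qed.

Lemma dense_of_span (K : completeNormedModType C) (S V : set K) : subspace V -> S `<=` closure V ->
  closure (lin_span S) = setT -> forall x (d : C), 0 < d -> exists2 v, V v & `|x - v| < d.
Proof.
move=> VS SV ST x; apply/closureE.
have : closure (lin_span S) x by rewrite ST.
have /closureS : lin_span S `<=` closure V by apply: lin_span_subspace => //; exact: closure_subspace.
by move=> /[apply]; exact: closed_closure.
Qed.

Section OneRepresentation.
Variables (H : completeNormedModType C) (ip : {dot H for conjC}).
Variables (K : completeNormedModType C) (br : {hermitian K for false & conjC}) (B : set (K * K)).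
Hypothesis Bsa : selfadjoint_rel br B.
Variables (z0 : C) (G : H -> K) (Gp : K -> H) (Fz0s : H -> H).

(** The gamma field of the representation; the Nevanlinna kernel of the function is its Gram kernel,
    by [gam_kernel]. *)
Definition gam (z : C) (S : K -> K) (h : H) := G h + (z - z0) *: S (G h).

Lemma gam_near z S h : rel_resolvent B z S ->
  exists2 M : C, 0 < M & forall z' S', rel_resolvent B z' S' -> `|z' - z| < M^-1 ->
    `|gam z' S' h - gam z S h| <= M * `|z' - z|.
Proof.
move=> hS; have [_ [c c0 hc]] := (bounded_opP S).1 hS.1.
(* The summand 2 c makes |z' - z| < 1 / M small enough for [resolvent_near]; the other two bound the
   two parts of the increment. *)
pose M := 2 * c * `|G h| + `|z - z0| * (2 * c ^+ 2 * `|G h|) + 2 * c.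
have M0 : 0 < M by rewrite ltr_wpDl ?mulr_gt0// addr_ge0// !mulr_ge0 ?exprn_ge0// ltW.
exists M => // z' S' hS' zz.
have zc : `|z' - z| * c <= 2^-1.
  rewrite -(ler_pM2l (ltr0Sn C 1)) mulrCA mulfV ?pnatr_eq0// -ler_pdivlMr ?mulr_gt0//.
  rewrite (le_trans (ltW zz))// div1r lef_pV2 ?posrE ?mulr_gt0// lerDr.
  by rewrite addr_ge0// !mulr_ge0 ?exprn_ge0// ltW.
have [h1 h2] := resolvent_near hS hS' c0 hc zc.
have -> : gam z' S' h - gam z S h = (z' - z) *: S' (G h) + (z - z0) *: (S' (G h) - S (G h)).
  rewrite /gam opprD addrACA subrr add0r scalerBr addrA -scalerDl.
  by rewrite addrA subrK.
rewrite (le_trans (ler_normD _ _))// !normrZ.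
apply: (@le_trans _ _ (`|z' - z| * (2 * c * `|G h|) + `|z - z0| * (2 * c ^+ 2 * `|z' - z| * `|G h|))).
  by rewrite lerD// ler_wpM2l.
rewrite -subr_ge0 (_ : _ - _ = 2 * c * `|z' - z|); last by rewrite /M; ring.
by rewrite !mulr_ge0// ltW.
Qed.

Lemma resolvent_gam u z Su S h : rel_resolvent B u Su -> rel_resolvent B z S ->
  (u - z) *: Su (gam z S h) = gam u Su h - gam z S h.
Proof.
move=> hu hS; rewrite /gam (bounded_opD _ _ hu.1) (bounded_opZ _ _ hu.1).
rewrite scalerDr scalerA mulrC -scalerA -(resolvent_identity _ hu hS).
rewrite opprD addrACA subrr add0r scalerBr addrA -scalerDl.
by rewrite addrA subrK.
Qed.

(** Everything is expanded in four values of the form; the resolvent identity between z and conj w,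
    in the shape (z - conj w) q = s - t, closes the computation. *)
Lemma gam_kernel (F : C -> H -> H) S0 z w S S' Sc h h' :
  (forall k h, ip (Gp k) h = br k (G h)) ->
  (forall h h', ip (Fz0s h) h' = ip h (F z0 h')) ->
  bounded_op G ->
  rel_resolvent B z0 S0 -> rel_resolvent B z S -> rel_resolvent B w S' -> rel_resolvent B w^* Sc ->
  (forall h, F z0 h = Fz0s h + (z0 - z0^*) *: Gp (gam z0 S0 h)) ->
  (forall h, F z h = Fz0s h + (z - z0^*) *: Gp (gam z S h)) ->
  (forall h, F w h = Fz0s h + (w - z0^*) *: Gp (gam w S' h)) ->
  (z - w^*) * br (gam z S h) (gam w S' h') = ip (F z h) h' - ip h (F w h').
Proof.
move=> hGp hF0 Gb hS0 hS hS' hSc E0 Ez Ew.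
pose a := br (G h) (G h'); pose s := br (S (G h)) (G h'); pose t := br (Sc (G h)) (G h').
pose q := br (Sc (S (G h))) (G h').
have hq : (z - w^*) * q = s - t.
  rewrite /q /s /t -hfBl -hfZl (resolvent_comm _ hSc hS).
  by rewrite (resolvent_identity _ hS hSc).
have hr k : br k (S' (G h')) = br (Sc k) (G h') by rewrite (resolvent_adjoint Bsa k (G h') hSc (_ : rel_resolvent B w^*^* S'))// conjCK.
have ipG k : ip h (Gp k) = br (G h) k by rewrite ipC hGp -hfC.
have E1 : ip (F z h) h' = ip (Fz0s h) h' + (z - z0^*) * (a + (z - z0) * s).
  by rewrite Ez ipDl ipZl hGp /gam hfDl hfZl.
have E2 : ip h (F w h') = ip h (Fz0s h') + (w^* - z0) * (a + (w^* - z0^*) * t).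
  by rewrite Ew ipDr ipZr ipG /gam hfDr hfZr hr !rmorphB /= conjCK.
have E3 : ip h (Fz0s h') = ip (Fz0s h) h' + (z0 - z0^*) * a.
  by rewrite ipC hF0 -ipC E0 ipDl ipZl hGp /gam subrr scale0r addr0.
rewrite E1 E2 E3 /gam hfDl !hfDr !hfZl !hfZr !hr rmorphB /= -/a -/s -/t -/q.
transitivity ((z - w^*) * (a + (z - z0) * s + (w^* - z0^*) * t) + (z - z0) * (w^* - z0^*) * ((z - w^*) * q)); first by ring.
by rewrite hq; ring.
Qed.

End OneRepresentation.

Section TwoRepresentations.
Variables (H : completeNormedModType C) (ip : {dot H for conjC}).

(** What a minimal representation provides off a finite list [s], with one chosen resolvent per
    point. [nr_dense] is minimality in a form that survives the removal of points. *)
Record nearly_all_resolvents (K : completeNormedModType C) (br : {hermitian K for false & conjC}) (B : set (K * K))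
    (F : opfun H) (z0 : C) (G : H -> K) (Rs : C -> K -> K) (s : seq C) : Prop := {
  nr_res : forall z, 'Im z != 0 -> z \notin s -> rel_resolvent B z (Rs z) /\ dom F z;
  nr_kernel : forall z w h h', 'Im z != 0 -> z \notin s -> 'Im w != 0 -> w \notin s ->
    (z - w^*) * br (gam z0 G z (Rs z) h) (gam z0 G w (Rs w) h') = ip (F z h) h' - ip h (F w h');
  nr_dense : forall (V : set K), subspace V ->
    (forall z h, 'Im z != 0 -> z \notin s -> closure V (gam z0 G z (Rs z) h)) ->
    forall x (d : C), 0 < d -> exists2 v, V v & `|x - v| < d }.

(** The list can be enlarged by any [s'], because two representations are compared off the union of
    their lists. *)
Lemma minimal_representation_resolvents (K : completeNormedModType C) (br : {hermitian K for false & conjC})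
    (B : set (K * K)) (F : opfun H) (s0 : seq C) : minimal_representation ip F br B ->
  (forall z, 'Im z != 0 -> z \notin s0 -> dom F z) ->
  krein br /\ (exists n (e : 'I_n -> K), maxneg br e) /\ selfadjoint_rel br B /\
  exists z0 G Rs s, forall s', nearly_all_resolvents br B F z0 G Rs (s ++ s').
Proof.
move=> [z0 [G [Gp [Fz0s [[n /pontryagin_maxneg[Kr [e me]]] Bsa [z0i Fz0 [S0 hS0]] [Gb hGp hF0] [hF hmin]]]]]] hs0.
have [s1 hs1] : exists s : seq C, forall z, 'Im z != 0 -> z \notin s -> rel_resolvent_set B z.
  by apply: (nonreal_resolvent Bsa Kr me); exists z0, S0.
have /choice[Rs hRs] : forall z, exists S, rel_resolvent_set B z -> rel_resolvent B z S.
  by move=> z; case: (pselect (rel_resolvent_set B z)) => [[S hS]|hn]; [exists S|exists id].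
split=> //; split; first by exists n, e.
split=> //; exists z0, G, Rs, (s1 ++ s0) => s'.
have res z : 'Im z != 0 -> z \notin (s1 ++ s0) ++ s' -> rel_resolvent B z (Rs z) /\ dom F z.
  by rewrite !mem_cat !negb_or -andbA => zi /and3P[h1 h2 _]; split; [apply/hRs/hs1|exact: hs0].
split=> //.
- move=> z w h h' zi zs wi ws.
  have [hz Fz] := res z zi zs; have [hw Fw] := res w wi ws.
  have [Sc hSc] := resolvent_conj Bsa Kr me wi hw.
  have := @gam_kernel H ip K br B Bsa z0 G Gp Fz0s F S0 z w (Rs z) (Rs w) Sc h h' hGp hF0 Gb hS0 hz hw hSc.
  by apply=> k; exact: hF.
(* A gamma vector at a removed point is a limit of gamma vectors at admissible points. *)
- move=> V VS hV; apply: (dense_of_span VS) hmin => k [z [S [h [hS ->]]]].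
  apply: closed_closure; apply/closureE => e0 e00.
  have [M M0 hM] := gam_near z0 G h hS.
  have d0 : 0 < e0 * (M^-1 / (1 + e0)).
    by rewrite mulr_gt0// divr_gt0 ?invr_gt0// addr_gt0.
  have [z' [zz _ zi zs]] := dense_avoid ((s1 ++ s0) ++ s') z d0.
  exists (gam z0 G z' (Rs z') h); first exact: hV.
  rewrite -/(gam z0 G z S h) distrC (le_lt_trans (hM _ _ (res _ zi zs).1 _))//.
    rewrite (lt_le_trans zz)// mulrCA ler_piMr ?invr_ge0 ?(ltW M0)//.
    by rewrite ler_pdivrMr ?addr_gt0// mul1r lerDr.
  rewrite -ltr_pdivlMl// (lt_le_trans zz)// mulrA [e0 * _]mulrC ler_piMr ?mulr_ge0 ?invr_ge0 ?(ltW M0) ?(ltW e00)//.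
  by rewrite invf_le1 ?addr_gt0// lerDl ltW.
Qed.

Definition rep_iso (K1 K2 : completeNormedModType C) (B1 : set (K1 * K1)) (B2 : set (K2 * K2)) :=
  exists V : K1 -> K2, [/\ forall a x y, V (a *: x + y) = a *: V x + V y,
    injective V, forall y, exists x, V x = y & forall x y, B1 (x, y) <-> B2 (V x, V y)].

(** Sending one gamma field to the other is isometric, as both Gram kernels are the kernel of [F],
    with dense domain and range; the closure is the isomorphism. A relation is determined by its
    resolvent at one point, so it suffices to intertwine the resolvents at [u]. *)
Lemma minimal_representation_unique (K1 K2 : completeNormedModType C) (br1 : {hermitian K1 for false & conjC})
    (br2 : {hermitian K2 for false & conjC}) (B1 : set (K1 * K1)) (B2 : set (K2 * K2)) (F : opfun H) (s0 : seq C) :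
  (forall z, 'Im z != 0 -> z \notin s0 -> dom F z) ->
  minimal_representation ip F br1 B1 -> minimal_representation ip F br2 B2 -> rep_iso B1 B2.
Proof.
move=> hs0 m1 m2.
have [Kr1 [[n1 [e1 me1]] [Bsa1 [z1 [G1 [R1 [s1 r1]]]]]]] := minimal_representation_resolvents m1 hs0.
have [Kr2 [[n2 [e2 me2]] [Bsa2 [z2 [G2 [R2 [s2 r2]]]]]]] := minimal_representation_resolvents m2 hs0.
pose s := s1 ++ s2.
pose D z := 'Im z != 0 /\ z \notin s.
have {r1} := r1 s2; move=> [res1 ker1 den1].
have {r2} := r2 s1; move=> [res2 ker2 den2].
have sc z : z \notin s -> z \notin s2 ++ s1 by rewrite !mem_cat orbC.
pose g1 z h := gam z1 G1 z (R1 z) h; pose g2 z h := gam z2 G2 z (R2 z) h.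
have dz z (d : C) : 0 < d -> exists z', [/\ D z', z' != z & `|z' - z| < d].
  by move=> d0; have [z' [zz zn zi zs]] := dense_avoid s z d0; exists z'.
have hR1 z : D z -> rel_resolvent B1 z (R1 z) by move=> [zi zs]; exact: (res1 z zi zs).1.
have hR2 z : D z -> rel_resolvent B2 z (R2 z) by move=> [zi zs]; exact: (res2 z zi (sc _ zs)).1.
(* The kernel identity determines the inner product only for z different from conj w; the remaining
   case follows by moving z slightly. *)
have kereq z w h h' : D z -> D w -> br1 (g1 z h) (g1 w h') = br2 (g2 z h) (g2 w h').
  move=> Dz [wi ws].
  have ne z' : D z' -> z' != w^* -> br1 (g1 z' h) (g1 w h') = br2 (g2 z' h) (g2 w h').
    move=> [zi zs] zw; have zw0 : z' - w^* != 0 by rewrite subr_eq0.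
    by apply: (mulfI zw0); rewrite ker1// ker2 ?sc.
  have [zw|] := eqVneq z w^*; last exact: ne.
  have [b1 b10 hb1] := krein_bound Kr1; have [b2 b20 hb2] := krein_bound Kr2.
  have [M1 M10 hM1] := gam_near z1 G1 h (hR1 z Dz); have [M2 M20 hM2] := gam_near z2 G2 h (hR2 z Dz).
  apply/eqP; rewrite -subr_eq0; apply/eqP/eps_zero => e e0.
  pose c := M1 + M2 + (b1 * M1 * `|g1 w h'| + b2 * M2 * `|g2 w h'|) / e.
  have ce0 : 0 <= (b1 * M1 * `|g1 w h'| + b2 * M2 * `|g2 w h'|) / e.
    by rewrite divr_ge0 ?(ltW e0)// addr_ge0// !mulr_ge0// ltW.
  have c0 : 0 < c by rewrite ltr_wpDr// addr_gt0.
  have [z' [Dz' zn zz]] : exists z', [/\ D z', z' != z & `|z' - z| < c^-1] by apply: dz; rewrite invr_gt0.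
  have le1 : `|z' - z| < M1^-1.
    by rewrite (lt_le_trans zz)// lef_pV2 ?posrE// /c -addrA lerDl addr_ge0// ltW.
  have le2 : `|z' - z| < M2^-1.
    by rewrite (lt_le_trans zz)// lef_pV2 ?posrE// /c addrAC lerDr addr_ge0// ltW.
  have a1 := hM1 _ _ (hR1 _ Dz') le1; have a2 := hM2 _ _ (hR2 _ Dz') le2.
  rewrite (_ : br1 _ _ - _ = br2 (g2 z' h - g2 z h) (g2 w h') - br1 (g1 z' h - g1 z h) (g1 w h')); last first.
    by rewrite (hfBl br2) (hfBl br1) (ne z') -?zw//; ring.
  rewrite (le_trans (ler_normB _ _))//.
  apply: (@le_trans _ _ (b2 * (M2 * `|z' - z|) * `|g2 w h'| + b1 * (M1 * `|z' - z|) * `|g1 w h'|)).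
    rewrite lerD// ?(le_trans (hb1 _ _))// ?(le_trans (hb2 _ _))// ler_wpM2r// ler_pM2l//.
  rewrite (_ : _ + _ = (b1 * M1 * `|g1 w h'| + b2 * M2 * `|g2 w h'|) / e * `|z' - z| * e); last by field; rewrite gt_eqF.
  rewrite -[leRHS]mul1r ler_wpM2r ?(ltW e0)// mulrC.
  apply: (@le_trans _ _ (c^-1 * c)); last by rewrite mulVf// gt_eqF.
  by rewrite ler_pM// ?(ltW zz)// lerDr addr_ge0// ltW.
pose T := [set p : K1 * K2 | exists n (a : 'I_n -> C) (z : 'I_n -> C) (h : 'I_n -> H),
  [/\ forall i, D (z i), p.1 = \sum_i a i *: g1 (z i) (h i) & p.2 = \sum_i a i *: g2 (z i) (h i)]].
have TS : gsub T.
  split.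
    exists 0%N, (fun=> 0), (fun=> 0), (fun=> 0); split=> /=; [by case|by rewrite big_ord0..].
  move=> a _ _ _ _ [n [b [z [h [Dz /= -> ->]]]]] [m [b' [z' [h' [Dz' /= -> ->]]]]].
  exists (n + m)%N, (fun i => match fintype.split i with inl j => a * b j | inr j => b' j end),
    (fun i => match fintype.split i with inl j => z j | inr j => z' j end),
    (fun i => match fintype.split i with inl j => h j | inr j => h' j end); split=> /=.
  - by move=> i; case: (fintype.split i).
  - rewrite big_split_ord scaler_sumr; congr (_ + _); apply: eq_bigr => i _.
      by rewrite (unsplitK (inl i)) scalerA.
    by rewrite (unsplitK (inr i)).
  - rewrite big_split_ord scaler_sumr; congr (_ + _); apply: eq_bigr => i _.
      by rewrite (unsplitK (inl i)) scalerA.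
    by rewrite (unsplitK (inr i)).
have Tg z h : D z -> T (g1 z h, g2 z h).
  move=> Dz; exists 1%N, (fun=> 1), (fun=> z), (fun=> h); split=> //=; by rewrite big_ord1 scale1r.
have iso x y x' y' : T (x, y) -> T (x', y') -> br1 x x' = br2 y y'.
  move=> [n [a [z [h [Dz /= -> ->]]]]] [m [b [z' [h' [Dz' /= -> ->]]]]].
  rewrite !hf_suml; apply: eq_bigr => i _; rewrite !hf_sumr; apply: eq_bigr => j _.
  by rewrite !hfZl !hfZr kereq.
have d1 x (d : C) : 0 < d -> exists p, T p /\ `|x - p.1| < d.
  move=> d0; have V1S : subspace [set x | exists y, T (x, y)].
    split; first by exists 0; exact: TS.1.
    by move=> a u v [y h] [y' h']; exists (a *: y + y'); exact: TS.2.
  have [|v [y h] xv] := den1 _ V1S _ x d d0; last by exists (v, y).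
  by move=> z h zi zs; apply: subset_closure; exists (g2 z h); exact: Tg.
have d2 x (d : C) : 0 < d -> exists p, T p /\ `|x - p.2| < d.
  move=> d0; have V2S : subspace [set y | exists x, T (x, y)].
    split; first by exists 0; exact: TS.1.
    by move=> a u v [y h] [y' h']; exists (a *: y + y'); exact: TS.2.
  have [|v [y h] xv] := den2 _ V2S _ x d d0; last by exists (y, v).
  move=> z h zi zs; apply: subset_closure; exists (g1 z h); apply: Tg; split=> //.
  by move: zs; rewrite !mem_cat orbC.
have [c c0 hc] := isometry_bounds Kr1 Kr2 me1 TS iso d1 d2.
have [V [Vl Vi Vs hV]] := isometry_extension TS c0 hc d1 d2.
have [u [Du _ _]] := dz 0 1 ltr01.
have cS := gclosure_sub TS.
have hu1 := hR1 u Du; have hu2 := hR2 u Du.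
have [_ [c1 c10 hc1]] := (bounded_opP _).1 hu1.1; have [_ [c2 c20 hc2]] := (bounded_opP _).1 hu2.1.
have Rcont p (P : K1 * K2 -> Prop) : gclosed P ->
  (forall d : C, 0 < d -> exists x y, [/\ P (R1 u x, R2 u y), `|p.1 - x| < d & `|p.2 - y| < d]) ->
  P (R1 u p.1, R2 u p.2).
  move=> Pc h; apply: Pc => e e0.
  have cc : 0 < c1 + c2 by rewrite addr_gt0.
  have [x [y [Pxy hx hy]]] := h _ (divr_gt0 e0 cc).
  exists (R1 u x), (R2 u y); split=> //.
    rewrite -(bounded_opB _ _ hu1.1) (le_lt_trans (hc1 _))// -ltr_pdivlMl// (lt_le_trans hx)//.
    by rewrite mulrC ler_pM2r// lef_pV2 ?posrE// lerDl ltW.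
  rewrite -(bounded_opB _ _ hu2.1) (le_lt_trans (hc2 _))// -ltr_pdivlMl// (lt_le_trans hy)//.
  by rewrite mulrC ler_pM2r// lef_pV2 ?posrE// lerDr ltW.
(* For z different from u, [resolvent_gam] writes the resolvent of a gamma vector as a difference
   quotient of gamma vectors; z = u is a limit. *)
have Rgen z h : D z -> gclosure T (R1 u (g1 z h), R2 u (g2 z h)).
  move=> Dz; have ne z' : D z' -> z' != u -> gclosure T (R1 u (g1 z' h), R2 u (g2 z' h)).
    move=> Dz' zu; have uz : u - z' != 0 by rewrite subr_eq0 eq_sym.
    have -> : R1 u (g1 z' h) = (u - z')^-1 *: (g1 u h - g1 z' h).
      by rewrite -(resolvent_gam _ _ _ hu1 (hR1 _ Dz')) scalerA mulVf// scale1r.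
    have -> : R2 u (g2 z' h) = (u - z')^-1 *: (g2 u h - g2 z' h).
      by rewrite -(resolvent_gam _ _ _ hu2 (hR2 _ Dz')) scalerA mulVf// scale1r.
    by apply: gclosure_incl; apply: gsubZ => //; apply: gsubB => //; exact: Tg.
  have [zu|] := eqVneq z u; last exact: ne.
  apply: (Rcont (g1 z h, g2 z h)); first exact: gclosure_closed.
  move=> d d0 /=.
  have [M1 M10 hM1] := gam_near z1 G1 h (hR1 z Dz); have [M2 M20 hM2] := gam_near z2 G2 h (hR2 z Dz).
  pose k := (M1 + M2) * (1 + d^-1).
  have k0 : 0 < k by rewrite mulr_gt0 ?addr_gt0 ?invr_gt0.
  have [z' [Dz' zn zz]] : exists z', [/\ D z', z' != z & `|z' - z| < k^-1] by apply: dz; rewrite invr_gt0.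
  have d'0 : 0 <= d^-1 by rewrite invr_ge0 ltW.
  have small M : 0 < M -> M <= M1 + M2 -> `|z' - z| < M^-1 /\ M * `|z' - z| < d.
    move=> M0 hM; split.
      rewrite (lt_le_trans zz)// lef_pV2 ?posrE// (le_trans hM)// /k ler_peMr ?addr_ge0 ?(ltW M10) ?(ltW M20)//.
      by rewrite lerDl.
    have Md : 0 < d^-1 * M by rewrite mulr_gt0 ?invr_gt0.
    rewrite -ltr_pdivlMl// (lt_le_trans zz)// mulrC -[d in leRHS]invrK -invfM lef_pV2 ?posrE//.
    rewrite /k mulrC; apply: ler_pM; rewrite ?invr_ge0 ?(ltW d0) ?(ltW M0)//.
    by rewrite lerDr.
  have [||l1 l2] := small M1; rewrite ?lerDl ?(ltW M20)//.
  have [||l3 l4] := small M2; rewrite ?lerDr ?(ltW M10)//.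
  exists (g1 z' h), (g2 z' h); split.
  - by apply: ne => //; rewrite -zu.
  - by rewrite distrC (le_lt_trans (hM1 _ _ (hR1 _ Dz') l1)).
  - by rewrite distrC (le_lt_trans (hM2 _ _ (hR2 _ Dz') l3)).
have RT x y : T (x, y) -> gclosure T (R1 u x, R2 u y).
  move=> [n [a [z [h [Dz /= -> ->]]]]].
  rewrite (bounded_op_sum _ _ _ hu1.1) (bounded_op_sum _ _ _ hu2.1).
  elim/big_rec2 : _ => [|i y' x' _ IH]; first exact: cS.1.
  by rewrite (bounded_opZ _ _ hu1.1) (bounded_opZ _ _ hu2.1); apply: cS.2 => //; exact: Rgen.
have VR x : V (R1 u x) = R2 u (V x).
  apply/esym/hV; apply: (Rcont (x, V x)); first exact: gclosure_closed.
  move=> d d0; have [x' [y' [h hx hy]]] := (hV x (V x)).2 erefl d d0.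
  by exists x', y'; split => //; exact: RT.
exists V; split=> // x y.
have VB a b : V (a - b) = V a - V b by rewrite addrC -scaleN1r Vl scaleN1r addrC.
have VZ a b : V (a *: b) = a *: V b.
  have V0 : V 0 = 0 by have := VB 0 0; rewrite !subrr.
  by rewrite -[_ *: b]addr0 Vl V0 addr0.
have -> : B1 (x, y) <-> R1 u (y - u *: x) = x by rewrite hu1.2 subrK.
have -> : B2 (V x, V y) <-> R2 u (V y - u *: V x) = V x by rewrite hu2.2 subrK.
by rewrite -VZ -VB -VR; split=> [->//|/Vi].
Qed.

Lemma rep_iso_eigenvalue (K1 K2 : completeNormedModType C) (B1 : set (K1 * K1)) (B2 : set (K2 * K2)) a :
  rep_iso B1 B2 -> rel_eigenvalue B1 a -> rel_eigenvalue B2 a.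
Proof.
move=> [V [Vl Vi Vs hV]].
have V0 : V 0 = 0 by have := Vl (-1) 0 0; rewrite !scaleN1r oppr0 addr0 addNr.
have VZ c b : V (c *: b) = c *: V b by rewrite -[_ *: b]addr0 Vl V0 addr0.
case: a => [l|] [x x0 /hV]; rewrite ?VZ ?V0 => h; exists (V x) => //.
all: by apply: contra_neq x0 => Vx; apply: Vi; rewrite V0.
Qed.

Lemma rep_iso_root_manifold (K1 K2 : completeNormedModType C) (B1 : set (K1 * K1)) (B2 : set (K2 * K2)) l :
  rep_iso B1 B2 -> same_dim (root_manifold B1 l) (root_manifold B2 l).
Proof.
move=> [V [Vl Vi Vs hV]].
have V0 : V 0 = 0 by have := Vl (-1) 0 0; rewrite !scaleN1r oppr0 addr0 addNr.
have VZ c b : V (c *: b) = c *: V b by rewrite -[_ *: b]addr0 Vl V0 addr0.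
have VD a b : V (a + b) = V a + V b by rewrite -[a]scale1r Vl !scale1r.
have hk n x : rel_ker_pow B1 l n x <-> rel_ker_pow B2 l n (V x).
  elim: n x => [|n IH] x /=; first by split=> [->//|]; rewrite -V0 => /Vi.
  split=> [[y /hV h /IH hy]|[y' h hy]].
    by exists (V y) => //; rewrite -VZ -VD.
  have [y yE] := Vs y'; exists y; last by apply/IH; rewrite yE.
  by apply/hV; rewrite VD VZ yE.
exists V; split; last by move=> a x y _ _; exact: Vl.
split=> [x [n /hk h]|x y _ _ /Vi//|y [n h]]; first by exists n.
by have [x xE] := Vs y; exists x => //; exists n; apply/hk; rewrite xE.
Qed.

End TwoRepresentations.
End Representations.

(** * Closed subspaces as complete normed modules *)

Record closed_submod (R : realType) (K : completeNormedModType (Cplx R)) := ClosedSubmod {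
  cs_set :> set K;
  cs_submod : submod_closed [in cs_set];
  cs_closed : closed cs_set }.

Section SubspaceType.
Variable R : realType.
Local Notation C := (Cplx R).
Variable (K : completeNormedModType C) (M : closed_submod K).

Definition in_cs : {pred K} := [in (M : set K)].
HB.instance Definition _ := GRing.isSubmodClosed.Build _ _ in_cs (cs_submod M).

(** The compressed operator acts in the kernel of the adjoint; making a closed subspace a space in
    its own right lets the preceding theory apply to it. *)
Record subsp := SubSp { ssval : K ; _ : ssval \in in_cs }.
HB.instance Definition _ := [isSub for ssval].
HB.instance Definition _ := [Choice of subsp by <:].
HB.instance Definition _ := [SubChoice_isSubLmodule of subsp by <:].

Definition subsp_norm (x : subsp) : C := `|ssval x|.
Lemma subsp_normD x y : subsp_norm (x + y) <= subsp_norm x + subsp_norm y.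
Proof. exact: ler_normD. Qed.
Lemma subsp_normZ (l : C) x : subsp_norm (l *: x) = `|l| * subsp_norm x.
Proof. exact: normrZ. Qed.
Lemma subsp_norm0 x : subsp_norm x = 0 -> x = 0.
Proof. by move=> /normr0_eq0 x0; apply: val_inj. Qed.
HB.instance Definition _ := @Lmodule_isNormed.Build C subsp subsp_norm subsp_normD subsp_normZ subsp_norm0.

Lemma subsp_normE (x : subsp) : `|x| = `|ssval x|. Proof. by []. Qed.
Lemma ssvalP (x : subsp) : (M : set K) (ssval x).
Proof. by case: x => x /=; rewrite inE. Qed.

Lemma subsp_complete (F : set_system subsp) : ProperFilter F -> cauchy F -> cvg F.
Proof.
move=> FF Fc.
have : cauchy (ssval @ F).
  apply/cauchyP => e e0; have /cauchyP/(_ e e0)[x hx] := Fc.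
  exists (ssval x); rewrite /fmap /=; apply: filterS hx => y.
  by rewrite -!ball_normE.
move=> /cauchy_cvg /cvg_ex [l /cvgrPdist_lt Fl].
have Ml : (M : set K) l.
  have /closedE := @cs_closed _ _ M; apply => e e0.
  have /filter_ex [x hx] := Fl e e0.
  by exists (ssval x) => //; exact: ssvalP.
apply/cvg_ex; exists (SubSp (mem_set Ml)).
by apply/cvgrPdist_lt => e e0; exact: Fl.
Qed.
HB.instance Definition _ := Uniform_isComplete.Build subsp subsp_complete.

Definition to_subsp (x : K) (Mx : (M : set K) x) : subsp := SubSp (mem_set Mx).
Lemma ssvalD (x y : subsp) : ssval (x + y) = ssval x + ssval y. Proof. by []. Qed.
Lemma ssvalZ (a : C) (x : subsp) : ssval (a *: x) = a *: ssval x. Proof. by []. Qed.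
Lemma ssval_bounded : bounded_op ssval.
Proof. by apply/bounded_opP; split=> //; exists 1 => // x; rewrite mul1r. Qed.
End SubspaceType.

(** * Negative eigenvalues of an invertible self-adjoint operator in a Hilbert space *)

Section NegativeEigenvalues.
Variable R : realType.
Local Notation C := (Cplx R).
Variables (H : completeNormedModType C) (ip : {dot H for conjC}).
Hypothesis H_hilbert : hilbert_norm ip.

Lemma ip_cauchy_schwarz x y : `|ip x y| <= `|x| * `|y|.
Proof.
rewrite -(@ler_pXn2r _ 2) ?nnegrE ?mulr_ge0// exprMn !H_hilbert.
by apply: (hf_cauchy_schwarz (br := ip)) => a b; exact: dnorm_ge0.
Qed.

Variable T : H -> H.
Hypotheses (Tb : bounded_op T) (Tsa : forall x y, ip (T x) y = ip x (T y)).

Lemma form_of_linear z : linear_for *%R ((fun x y => ip (T x) y)^~ z).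
Proof. by move=> a x y; rewrite (bounded_op_linear _ _ _ Tb) ipDl ipZl. Qed.
Lemma form_of_sym x y : ip (T x) y = (ip (T y) x)^*.
Proof. by rewrite Tsa -ipC. Qed.
Definition form_of := mk_hermitian form_of_linear form_of_sym.
Lemma form_ofE x y : form_of x y = ip (T x) y. Proof. by []. Qed.

(** With [J := T], the form at (x, T x) is the squared norm of [T x]. *)
Lemma form_of_krein (c : C) : 0 < c -> (forall x, `|x| <= c * `|T x|) -> krein form_of.
Proof.
move=> c0 hc; have [_ [b b0 hb]] := (bounded_opP T).1 Tb.
exists T, (c ^+ 2)^-1, b; split=> //; first by rewrite invr_gt0 exprn_gt0.
  by move=> x y; rewrite form_ofE (le_trans (ip_cauchy_schwarz _ _))// ler_wpM2r.
move=> x; rewrite form_ofE -H_hilbert ler_pdivrMl ?exprn_gt0// -exprMn.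
by rewrite lerXn2r ?nnegrE ?mulr_ge0// ltW.
Qed.

Definition orthonormal_sys n (f : 'I_n -> H) := forall i j, ip (f i) (f j) = (i == j)%:R.
Definition eigen_sys n (f : 'I_n -> H) (lam : 'I_n -> C) :=
  [/\ orthonormal_sys f, forall i, T (f i) = lam i *: f i & forall i, lam i < 0].

(** The form is minimised over unit vectors orthogonal to the eigenvectors already found. If the
    infimum [m] were not an eigenvalue, T - m would be bounded below there, and Cauchy-Schwarz for
    its nonnegative form would keep the values away from 0, against the choice of [m]. *)
Lemma eigenvector_below n (e : 'I_n -> H) k (f : 'I_k -> H) lam (c : C) : 0 < c -> (forall x, `|x| <= c * `|T x|) ->
  maxneg form_of e -> eigen_sys f lam -> (k < n)%N ->
  exists x l, [/\ ip x x = 1, l < 0, T x = l *: x & forall i, ip x (f i) = 0].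
Proof.
move=> c0 hc me [fo fe fl] kn; have [_ [b b0 hb]] := (bounded_opP T).1 Tb.
have Kr := form_of_krein c0 hc.
pose X := [set x | forall i, ip x (f i) = 0].
have XS : subspace X.
  by split=> [i|a x y hx hy i]; rewrite ?ip0l// ipDl ipZl hx hy mulr0 addr0.
have XT x : X x -> X (T x).
  by move=> hx i; rewrite Tsa fe ipZr hx mulr0.
have Xc (x : H) : (forall e : C, 0 < e -> exists2 v, X v & `|x - v| < e) -> X x.
  move=> h i; apply: eps_zero => e0 e00.
  have f0 : 0 < `|f i| + 1 by rewrite ltr_wpDl.
  have [v Xv xv] := h _ (divr_gt0 e00 f0).
  rewrite -[ip x _]subr0 -(Xv i) -ipBl (le_trans (ip_cauchy_schwarz _ _))//.
  apply: (@le_trans _ _ (e0 / (`|f i| + 1) * (`|f i| + 1))); last by rewrite divfK// gt_eqF.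
  by rewrite ler_pM// ?lerDl// ltW.
(* As k < n, a nontrivial combination of the [e i] is orthogonal to all k eigenvectors; it is
   negative. *)
have [x1 Xx1 x1n] : exists2 x, X x & form_of x x < 0.
  have [v [i vi] hv] := kernel_vector (\matrix_(i < n, j < k) ip (e i) (f j)) kn.
  exists (\sum_i v i *: e i).
    by move=> j; rewrite ip_suml -[RHS](hv j); apply: eq_bigr => i' _; rewrite ipZl mxE.
  rewrite (negsys_comb v v me.1) oppr_lt0 lt_def sumr_ge0 ?andbT; last by move=> j _; rewrite -normCK exprn_ge0.
  by apply: contra_neq vi => h; apply: (@sum_normsq_eq0 _ _ v); rewrite h.
pose P := [set x | X x /\ ip x x = 1].
have unit x : X x -> x != 0 -> P (`|x|^-1 *: x).
  move=> Xx x0; split; first exact: (subspaceZ _ XS Xx).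
  by rewrite -H_hilbert normrZ normfV normr_id mulVf ?normr_eq0// expr1n.
have scale x : x != 0 -> form_of x x = `|x| ^+ 2 * form_of (`|x|^-1 *: x) (`|x|^-1 *: x).
  move=> x0; rewrite hfZl hfZr (conj_Creal (ger0_real _)) ?invr_ge0//; field.
  by rewrite normr_eq0.
have x10 : x1 != 0 by apply: contraTneq x1n => ->; rewrite hf0l ltxx.
have [m [mr mle mex]] : exists d : C, [/\ d \is Num.real, forall t, P t -> d <= form_of t t &
    forall e, 0 < e -> exists2 t, P t & form_of t t < d + e].
  apply: (@exists_infimum _ _ _ _ (- b)); first by exists (`|x1|^-1 *: x1); exact: unit.
    by rewrite rpredN gtr0_real.
  move=> t [Xt t1]; have tn : `|t| = 1.
    by apply/eqP; rewrite -(@eqrXn2 _ 2)// ?expr1n ?H_hilbert ?t1.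
  have : `|form_of t t| <= b.
    by rewrite form_ofE (le_trans (ip_cauchy_schwarz _ _))// tn mulr1 (le_trans (hb _))// tn mulr1.
  by rewrite real_ler_norml ?hf_real// => /andP[].
have m0 : m < 0.
  apply: le_lt_trans (mle _ (unit _ Xx1 x10)) _.
  by rewrite -(pmulr_rlt0 _ (_ : 0 < `|x1| ^+ 2)) -?scale// exprn_gt0// normr_gt0.
have mle2 x : X x -> m * `|x| ^+ 2 <= form_of x x.
  move=> Xx; have [->|x0] := eqVneq x 0; first by rewrite normr0 expr0n mulr0 hf0l.
  by rewrite scale// mulrC ler_wpM2l ?exprn_ge0// mle//; exact: unit.
pose Tm x := T x - m *: x.
have Tml a x y : Tm (a *: x + y) = a *: Tm x + Tm y.
  by rewrite /Tm (bounded_op_linear _ _ _ Tb) scalerDr opprD addrACA scalerBr !scalerA mulrC.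
have XTm x : X x -> X (Tm x) by move=> Xx; apply: (subspaceB XS); [exact: XT|exact: (subspaceZ _ XS Xx)].
have Tmip x : ip (Tm x) x = form_of x x - m * `|x| ^+ 2 by rewrite ipBl ipZl H_hilbert.
suff [x [Xx x0 Tx]] : exists x, [/\ X x, x != 0 & T x = m *: x].
  exists (`|x|^-1 *: x), m; have [h1 h2] := unit _ Xx x0; split=> //.
  by rewrite (bounded_opZ _ _ Tb) Tx !scalerA mulrC.
apply: contrapT => noeig.
pose Gr := [set p | X p.1 /\ p.2 = Tm p.1].
have GS : gsub Gr.
  split; first by split=> /=; [exact: XS.1|rewrite /Tm (bounded_op0 Tb) scaler0 subrr].
  by move=> a x y x' y' [/= hx ->] [/= hx' ->]; split=> /=; [exact: XS.2|rewrite Tml].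
have Tmb x : `|Tm x| <= (b + `|m|) * `|x|.
  by rewrite (le_trans (ler_normB _ _))// normrZ mulrDl lerD2r.
have bm0 : 0 < b + `|m| by rewrite ltr_wpDr.
have Gc : gclosed Gr.
  move=> x y h; split=> /=; first by apply: Xc => e0 /h[x' [y' [[/= Xx' _] xx _]]]; exists x'.
  apply/eqP; rewrite -subr_eq0; apply/eqP/eps_zero => e0 e00.
  have k0 : 0 < b + `|m| + 1 by rewrite addr_gt0.
  have [x' [y' [[/= Xx' ->] xx yy]]] := h _ (divr_gt0 e00 k0).
  have -> : y - Tm x = (y - Tm x') - Tm (x - x').
    have -> : Tm (x - x') = Tm x - Tm x' by rewrite addrC -scaleN1r Tml scaleN1r addrC.
    by move: (Tm x) (Tm x') => u v; rewrite opprB addrA subrK.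
  rewrite (le_trans (ler_normB _ _))//.
  apply: (@le_trans _ _ (e0 / (b + `|m| + 1) + (b + `|m|) * (e0 / (b + `|m| + 1)))).
    by rewrite lerD ?(ltW yy)// (le_trans (Tmb _))// ler_pM2l// ltW.
  by rewrite -{1}[e0 / _]mul1r -mulrDl addrC mulrC divfK ?gt_eqF.
pose s := [seq (fun x => form_of x (e i)) | i <- enum 'I_n].
have [b' b'0 hb'] := krein_bound Kr.
have hs g : g \in s -> (forall (a : C) (x y : H), g (a *: x + y) = a * g x + g y) /\
      exists2 b : C, 0 < b & forall x, `|g x| <= b * `|x|.
  move=> /mapP[i _ ->]; split; first by move=> a x y; rewrite hfDl hfZl.
  exists (b' * `|e i| + 1); first by rewrite ltr_wpDl// mulr_ge0// ltW.
  by move=> x; rewrite (le_trans (hb' _ _))// mulrAC ler_wpM2r// lerDl.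
have nm0 : 0 < (- m)^-1 by rewrite invr_gt0 oppr_gt0.
(* On the companion of [e] the form of [T] is nonnegative, so T - m is at least -m there; the
   companion is cut out by finitely many functionals. *)
have hG x w : Gr (x, w) -> (forall g, g \in s -> g x = 0) -> `|x| <= (- m)^-1 * `|w|.
  move=> [/= Xx ->] hg; have x0 : 0 <= form_of x x.
    by apply: me.2 => i; apply: (hg (fun x => form_of x (e i))); apply/mapP; exists i => //; rewrite mem_enum.
  rewrite ler_pdivlMl ?oppr_gt0//.
  have [->|xn0] := eqVneq `|x| 0; first by rewrite mulr0.
  have xp : 0 < `|x| by rewrite lt_def xn0 normr_ge0.
  rewrite -(ler_pM2r xp) -mulrA -expr2 (le_trans _ (ip_cauchy_schwarz _ _))//.
  rewrite Tmip (le_trans (_ : _ <= form_of x x - m * `|x| ^+ 2))//; first by rewrite mulNr lerDr.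
  by rewrite real_ler_norm// rpredB ?hf_real// realM// realX// normr_real.
have Ginj x : Gr (x, 0) -> x = 0.
  move=> [/= Xx h]; apply/eqP/negPn/negP => x0; apply: noeig; exists x; split=> //.
  by apply/eqP; rewrite -subr_eq0 -/(Tm x) -h.
have [c1 c10 hc1] := finite_codim_bounded_below hs GS Gc nm0 hG Ginj.
have low x : X x -> `|x| ^+ 2 <= c1 ^+ 2 * (b + `|m|) * (form_of x x - m * `|x| ^+ 2).
  move=> Xx; pose y := Tm x.
  pose gm := fun u v => form_of u v - m * ip u v.
  have gl z : linear_for *%R (gm^~ z) by move=> a u v; rewrite /gm hfDl hfZl ipDl ipZl; ring.
  have gs u v : gm u v = (gm v u)^*.
    by rewrite /gm (hfC form_of u v) (ipC ip u v) rmorphB rmorphM /= (conj_Creal mr).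
  have gmE u v : gm u v = ip (Tm u) v by rewrite /gm ipBl ipZl.
  have cs : `|gm x y| ^+ 2 <= gm x x * gm y y.
    apply: (hf_cauchy_schwarz (br := mk_hermitian gl gs)) => u v.
    rewrite mk_hermitianE gmE Tmip subr_ge0; apply: mle2.
    by apply: (subspaceD XS); apply: (subspaceZ _ XS) => //; exact: XTm.
  have e1 : gm x y = `|y| ^+ 2 by rewrite gmE H_hilbert.
  have e2 : gm y y <= (b + `|m|) * `|y| ^+ 2.
    rewrite gmE; apply: (le_trans (real_ler_norm _)).
      by rewrite Tmip rpredB ?hf_real// realM// realX// normr_real.
    by rewrite (le_trans (ip_cauchy_schwarz _ _))// expr2 mulrA ler_wpM2r.
  have e3 : gm x x = form_of x x - m * `|x| ^+ 2 by rewrite gmE Tmip.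
  have g0 : 0 <= gm x x by rewrite e3 subr_ge0 mle2.
  have h1 : `|x| ^+ 2 <= c1 ^+ 2 * `|y| ^+ 2.
    rewrite -exprMn lerXn2r ?nnegrE ?mulr_ge0 ?(ltW c10)//; exact: hc1.
  apply: (le_trans h1); rewrite -mulrA ler_wpM2l ?exprn_ge0 ?(ltW c10)// -e3.
  have [->|y0] := eqVneq (`|y| ^+ 2) 0; first by rewrite mulr_ge0// ltW.
  have yp : 0 < `|y| ^+ 2 by rewrite lt_def y0 exprn_ge0.
  rewrite -(ler_pM2r yp) -expr2; move: cs; rewrite e1 ger0_norm ?exprn_ge0// => /le_trans; apply.
  by rewrite [leRHS]mulrAC [leRHS]mulrC; apply: ler_wpM2l.
pose dl := (c1 ^+ 2 * (b + `|m|))^-1.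
have dl0 : 0 < dl by rewrite invr_gt0 mulr_gt0// exprn_gt0.
have [t [Xt t1] ht] := mex dl dl0.
have := low t Xt; rewrite H_hilbert t1 mulr1.
rewrite -ler_pdivrMl ?mulr_gt0 ?exprn_gt0// mulr1 -/dl lerBrDl.
by move=> /(lt_le_trans ht); rewrite ltxx.
Qed.

(** An orthonormal system of [n] eigenvectors, rescaled, is again maximal negative, so nothing
    negative is left orthogonal to it. *)
Lemma negative_eigenvalues n (e : 'I_n -> H) (c : C) : 0 < c -> (forall x, `|x| <= c * `|T x|) ->
  maxneg form_of e -> nb_neg_eigenvalues T n.
Proof.
move=> c0 hc me.
have sys k : (k <= n)%N -> exists (f : 'I_k -> H) lam, eigen_sys f lam.
  elim: k => [|k IH] kn; first by exists (fun=> 0), (fun=> 0); split=> -[].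
  have [f [lam es]] := IH (ltnW kn); have [x [l [x1 l0 Tx xf]]] := eigenvector_below c0 hc me es kn.
  have [fo fe fl] := es.
  exists (fun i => if unlift ord_max i is Some j then f j else x), (fun i => if unlift ord_max i is Some j then lam j else l).
  split=> [i j|i|i]; last 2 first.
  - by case: unliftP.
  - by case: unliftP.
  case: unliftP => [i' ->|->]; case: unliftP => [j' ->|->].
  - by rewrite fo (inj_eq lift_inj).
  - by rewrite ipC xf conjC0 eq_sym (negbTE (neq_lift _ _)).
  - by rewrite xf (negbTE (neq_lift _ _)).
  - by rewrite x1 eqxx.
have [f [lam [fo fe fl]]] := sys n (leqnn n).
pose g i := (sqrtC (- lam i))^-1 *: f i.
have ng : negsys form_of g.
  move=> i j; rewrite hfZl hfZr form_ofE fe ipZl fo.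
  have [<-|_] := eqVneq i j; last by rewrite !mulr0 oppr0.
  rewrite mulr1 (conj_Creal (ger0_real _)) ?invr_ge0 ?sqrtC_ge0 ?oppr_ge0 ?(ltW (fl i))//.
  by rewrite mulrA -invfM -expr2 sqrtCK invrN mulNr mulVf// lt_eqF.
have mg := negsys_maxneg me ng.
have lamr i : (lam i)^* = lam i by apply: conj_Creal; rewrite ltr0_real.
have pos h : (forall i, ip h (f i) = 0) -> 0 <= form_of h h.
  by move=> hf; apply: mg.2 => i; rewrite form_ofE ipZr Tsa fe ipZr hf !mulr0.
(* The residual h - u is orthogonal to the system, so its form is nonnegative; it also satisfies T
   (h - u) = l (h - u) with l < 0, so it vanishes. *)
have decomp l h : l < 0 -> T h = l *: h -> h = \sum_(i | lam i == l) ip h (f i) *: f i.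
  move=> l0 Th; have coef i : lam i != l -> ip h (f i) = 0.
    move=> il; have : ip (T h) (f i) = ip h (T (f i)) by rewrite Tsa.
    rewrite Th fe ipZl ipZr lamr => /eqP; rewrite -subr_eq0 -mulrBl mulf_eq0 subr_eq0.
    by rewrite eq_sym (negbTE il) => /eqP.
  pose u := \sum_(i | lam i == l) ip h (f i) *: f i.
  have Tu : T u = l *: u.
    rewrite /u (bounded_op_sum _ _ _ Tb) scaler_sumr; apply: eq_bigr => i /eqP <-.
    by rewrite (bounded_opZ _ _ Tb) fe !scalerA mulrC.
  have uf i : ip (h - u) (f i) = 0.
    rewrite ipBl; have [il|il] := eqVneq (lam i) l.
      rewrite /u ip_suml (bigD1 i) ?il//= ipZl fo eqxx mulr1 big1 ?addr0 ?subrr// => j /andP[_ ji].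
      by rewrite ipZl fo (negbTE ji) mulr0.
    rewrite coef// sub0r /u ip_suml big1 ?oppr0// => j /eqP jl.
    have [ji|ji] := eqVneq j i; first by rewrite -ji jl eqxx in il.
    by rewrite ipZl fo (negbTE ji) mulr0.
  have := pos _ uf; rewrite form_ofE (bounded_opB _ _ Tb) Th Tu -scalerBr ipZl -H_hilbert.
  by rewrite nmulr_rge0// => /normsq_le0/eqP; rewrite subr_eq0 => /eqP.
pose d (l : C) := #|[pred i | lam i == l]|.
exists (undup [seq lam i | i <- enum 'I_n]), d; split.
- exact: undup_uniq.
- move=> l; rewrite mem_undup; split=> [/mapP[i _ ->]|[l0 [h h0 Th]]].
    split=> //; exists (f i); last exact: fe.
    by apply/eqP => fi0; have := fo i i; rewrite fi0 ip0l eqxx => /esym/eqP; rewrite oner_eq0.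
  apply: contrapT => /negP nl; move/eqP: h0; apply; rewrite (decomp l h l0 Th) big1// => i /eqP il.
  by move/negP: nl; case; rewrite -il map_f// mem_enum.
- move=> l; rewrite mem_undup => /mapP[i0 _ lE].
  exists (fun j => f (enum_val j)); split.
    apply/seteqP; split=> h /=.
      move=> Th; exists (fun j => ip h (f (enum_val j))).
      have l0 : l < 0 by rewrite lE.
      by rewrite {1}(decomp l h l0 Th) big_enum_val.
    move=> [a ->]; rewrite (bounded_op_sum _ _ _ Tb) scaler_sumr; apply: eq_bigr => j _.
    rewrite (bounded_opZ _ _ Tb) fe !scalerA.
    by have := enum_valP j; rewrite inE => /eqP ->; rewrite mulrC.
  move=> a h j; have : ip (\sum_i a i *: f (enum_val i)) (f (enum_val j)) = a j.
    rewrite ip_suml (bigD1 j)//= ipZl fo eqxx mulr1 big1 ?addr0// => i ij.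
    by rewrite ipZl fo (inj_eq enum_val_inj) (negbTE ij) mulr0.
  by rewrite h ip0l.
- transitivity (\sum_(i < n) 1)%N; first by rewrite sum_nat_const card_ord muln1.
  rewrite (eq_bigr (fun i => \sum_(l <- undup [seq lam i | i <- enum 'I_n]) (lam i == l : nat))%N); last first.
    move=> i _; rewrite -big_mkcond /= sum1_count (eq_count (a2 := pred1 (lam i))); last by move=> l /=; rewrite eq_sym.
    by rewrite count_uniq_mem ?undup_uniq// mem_undup map_f// mem_enum.
  rewrite exchange_big; apply: eq_bigr => l _ /=.
  by rewrite -big_mkcond /= sum1_card.
Qed.

End NegativeEigenvalues.

(** * Counting negative eigenvalues of Gram matrices *)

Section MatrixCounts.
Variable R : realType.
Local Notation C := (Cplx R).

Definition mxform n k (M : 'M[C]_n) (c : 'I_k -> 'I_n -> C) (a b : 'I_k) : C :=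
  \sum_i \sum_j c a i * (c b j)^* * M i j.

Lemma mxform_comb n k (M : 'M[C]_n) (c : 'I_k -> 'I_n -> C) (v : 'I_k -> C) :
  \sum_a \sum_b v a * (v b)^* * mxform M c a b =
  \sum_i \sum_j (\sum_a v a * c a i) * (\sum_b v b * c b j)^* * M i j.
Proof.
transitivity (\sum_a \sum_i (\sum_b \sum_j v a * (v b)^* * (c a i * (c b j)^* * M i j))).
  apply: eq_bigr => a _; rewrite exchange_big /=; apply: eq_bigr => b _.
  rewrite /mxform mulr_sumr; apply: eq_bigr => i _; rewrite mulr_sumr.
  by apply: eq_bigr => j _.
rewrite exchange_big; apply: eq_bigr => i _ /=.
transitivity (\sum_a \sum_j \sum_b v a * (v b)^* * (c a i * (c b j)^* * M i j)).
  by apply: eq_bigr => a _; rewrite exchange_big.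
rewrite exchange_big; apply: eq_bigr => j _ /=.
rewrite rmorph_sum mulr_suml mulr_suml; apply: eq_bigr => a _.
rewrite mulr_sumr mulr_suml; apply: eq_bigr => b _.
by rewrite rmorphM /=; ring.
Qed.

Lemma mxform_sym n k (M : 'M[C]_n) (c : 'I_k -> 'I_n -> C) a b :
  (forall i j, M i j = (M j i)^*) -> mxform M c b a = (mxform M c a b)^*.
Proof.
move=> hM; rewrite /mxform exchange_big rmorph_sum; apply: eq_bigr => i _ /=.
rewrite rmorph_sum; apply: eq_bigr => j _ /=.
by rewrite rmorphM rmorphM /= conjCK -hM; ring.
Qed.

(** Half of Sylvester's law: if k exceeded the number of negative diagonal entries, some nontrivial
    combination would have no components along them, and the form would be nonnegative there. *)
Lemma mx_neg_eigenvalues_ge n k (M : 'M[C]_n) (c : 'I_k -> 'I_n -> C) :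
  (forall i j, M i j = (M j i)^*) ->
  (forall v : 'I_k -> C, (exists a, v a != 0) -> \sum_a \sum_b v a * (v b)^* * mxform M c a b < 0) ->
  (k <= mx_neg_eigenvalues M)%N.
Proof.
move=> hM hneg; have [P [d [Pu dr hP ->]]] := herm_diag hM.
rewrite leqNgt; apply/negP => hk.
pose N := [pred i : 'I_n | d i < 0].
pose A := \matrix_(a < k, i < n) c a i.
have [v va hv] := kernel_vector (\matrix_(a < k, j < #|N|) (A *m invmx P) a (enum_val j)) hk.
pose w i := \sum_a v a * c a i.
pose y i := \sum_j w j * invmx P j i.
have yN i : d i < 0 -> y i = 0.
  move=> di; have iN : i \in N by rewrite inE.
  have := hv (enum_rank_in iN i); rewrite /y /w => h; rewrite -[RHS]h.
  under [RHS]eq_bigr do rewrite mxE enum_rankK_in// mxE mulr_sumr.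
  rewrite exchange_big; apply: eq_bigr => j _ /=; rewrite mulr_suml.
  by apply: eq_bigr => a _; rewrite mxE mulrA.
have wE j : w j = \sum_i y i * P i j.
  have /(congr1 (fun u : 'rV[C]_n => u 0 j)) := mulmxKV Pu (\row_i w i).
  rewrite !mxE => <-; apply: eq_bigr => i _; rewrite mxE; congr (_ * _).
  by apply: eq_bigr => l _; rewrite mxE.
have := hneg v va; rewrite mxform_comb.
have -> : \sum_i \sum_j (\sum_a v a * c a i) * (\sum_b v b * c b j)^* * M i j =
  \sum_a \sum_b y a * (y b)^* * mxform M (fun a i => P a i) a b.
  rewrite mxform_comb; apply: eq_bigr => i _; apply: eq_bigr => j _.
  by rewrite -!/(w _) !wE.
rewrite (eq_bigr (fun a => `|y a| ^+ 2 * d a)); last first.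
  move=> a _; rewrite (bigD1 a)//= {1}/mxform hP eqxx normCK big1 ?addr0// => b ba.
  by rewrite /mxform hP eq_sym (negbTE ba) mulr0.
suff h0 : 0 <= \sum_a `|y a| ^+ 2 * d a by move=> /(le_lt_trans h0); rewrite ltxx.
apply: sumr_ge0 => a _.
case: (boolP (d a < 0)) => [/yN ->|da]; first by rewrite normr0 expr0n mul0r.
by rewrite mulr_ge0 ?exprn_ge0// real_leNgt ?real0.
Qed.

Lemma mx_neg_eigenvalues_sys n (M : 'M[C]_n) : (forall i j, M i j = (M j i)^*) ->
  exists c : 'I_(mx_neg_eigenvalues M) -> 'I_n -> C, forall a b, mxform M c a b = - (a == b)%:R.
Proof.
move=> hM; have [P [d [Pu dr hP E]]] := herm_diag hM.
rewrite E; pose N := [pred i : 'I_n | d i < 0].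
have dN (a : 'I_#|N|) : d (enum_val a) < 0 by have := enum_valP a; rewrite inE.
pose s (a : 'I_#|N|) := (sqrtC (- d (enum_val a)))^-1.
exists (fun a i => s a * P (enum_val a) i) => a b.
have -> : mxform M (fun a i => s a * P (enum_val a) i) a b = s a * (s b)^* * mxform M (fun a i => P a i) (enum_val a) (enum_val b).
  rewrite /mxform mulr_sumr; apply: eq_bigr => i _; rewrite mulr_sumr; apply: eq_bigr => j _.
  by rewrite rmorphM /=; ring.
rewrite /mxform hP (inj_eq enum_val_inj); have [<-|_] := eqVneq a b; last by rewrite mulr0 oppr0.
rewrite mulr1n /s (conj_Creal (ger0_real _)) ?invr_ge0 ?sqrtC_ge0 ?oppr_ge0 ?(ltW (dN a))//.
by rewrite -invfM -expr2 sqrtCK invrN mulNr mulVf// lt_eqF.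
Qed.

(** Lower semicontinuity of the count: a form negative definite on a fixed subspace stays so under
    small perturbations, while zero eigenvalues of [M] may move either way. *)
Lemma mx_neg_eigenvalues_near n (M : 'M[C]_n) : (forall i j, M i j = (M j i)^*) ->
  exists2 e : C, 0 < e & forall M' : 'M[C]_n, (forall i j, M' i j = (M' j i)^*) ->
    (forall i j, `|M' i j - M i j| <= e) -> (mx_neg_eigenvalues M <= mx_neg_eigenvalues M')%N.
Proof.
move=> hM; have [c hc] := mx_neg_eigenvalues_sys hM.
set k := mx_neg_eigenvalues M in c hc *.
pose W := \sum_a \sum_b \sum_i \sum_j `|c a i| * `|c b j|.
have W0 : 0 <= W by do 4 apply: sumr_ge0 => ? _; rewrite mulr_ge0.
have W1 : 0 < k.+1%:R * (W + 1) by rewrite mulr_gt0 ?ltr0n// ltr_wpDl.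
(* With this tolerance each entry of the compression moves by at most 1 / (k + 1), and the form by
   at most k / (k + 1) times the squared norm, less than needed to reach 0. *)
exists (k.+1%:R * (W + 1))^-1; first by rewrite invr_gt0.
set e := (_)^-1 => M' hM' hMM'.
apply: (mx_neg_eigenvalues_ge (c := c)) => // v [a0 va0].
have N' a b : `|mxform M' c a b + (a == b)%:R| <= k.+1%:R^-1.
  have -> : mxform M' c a b + (a == b)%:R = mxform (M' - M) c a b.
    rewrite -[_%:R]opprK -hc /mxform -sumrB; apply: eq_bigr => i _; rewrite -sumrB.
    by apply: eq_bigr => j _; rewrite !mxE; ring.
  apply: (@le_trans _ _ (e * W)); last first.
    rewrite /e invfM -mulrA ler_piMr ?invr_ge0 ?ler0n// mulrC ler_pdivrMr ?ltr_wpDl//.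
    by rewrite mul1r lerDl.
  apply: (@le_trans _ _ (e * \sum_i \sum_j `|c a i| * `|c b j|)).
    rewrite (le_trans (ler_norm_sum _ _ _))// mulr_sumr ler_sum// => i _.
    rewrite (le_trans (ler_norm_sum _ _ _))// mulr_sumr ler_sum// => j _.
    by rewrite !normrM norm_conjC mulrC !mxE ler_wpM2r ?mulr_ge0.
  rewrite ler_wpM2l ?invr_ge0 ?(ltW W1)// /W (bigD1 a)//= (bigD1 b)//= -addrA lerDl.
  by rewrite addr_ge0//; do ?[apply: sumr_ge0 => ? _]; rewrite ?mulr_ge0.
set X := \sum_a _; pose S := \sum_a `|v a| ^+ 2.
have S0 : 0 < S.
  rewrite /S (bigD1 a0)//= ltr_wpDr ?exprn_gt0 ?normr_gt0//.
  by apply: sumr_ge0 => a _; rewrite exprn_ge0.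
have XS : X + S = \sum_a \sum_b v a * (v b)^* * (mxform M' c a b + (a == b)%:R).
  rewrite /X /S -big_split; apply: eq_bigr => a _ /=.
  rewrite [RHS](eq_bigr (fun b => v a * (v b)^* * mxform M' c a b + v a * (v b)^* * (a == b)%:R)); last by move=> b _; rewrite mulrDr.
  rewrite big_split /=; congr (_ + _); rewrite (bigD1 a)//= eqxx mulr1 normCK big1 ?addr0// => b ba.
  by rewrite eq_sym (negbTE ba) mulr0.
have Xr : X \is Num.real.
  rewrite CrealE /X rmorph_sum [X in _ == X]exchange_big /=; apply/eqP; apply: eq_bigr => a _.
  rewrite rmorph_sum; apply: eq_bigr => b _ /=.
  by rewrite (@mxform_sym _ _ _ c a b hM') rmorphM rmorphM /= conjCK [(v a)^* * _]mulrC.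
have bnd : `|X + S| <= k%:R / k.+1%:R * S.
  rewrite XS (le_trans (ler_norm_sum _ _ _))//.
  apply: (@le_trans _ _ ((\sum_a `|v a|) ^+ 2 / k.+1%:R)).
    rewrite expr2 !mulr_suml ler_sum// => a _; rewrite (le_trans (ler_norm_sum _ _ _))//.
    rewrite mulr_sumr mulr_suml ler_sum// => b _; rewrite !normrM norm_conjC.
    by rewrite ler_wpM2l ?mulr_ge0.
  by rewrite [leRHS]mulrAC ler_wpM2r ?invr_ge0 ?ler0n// sum_sqr_le.
have : X + S < S.
  apply: (le_lt_trans (real_ler_norm _)); first by rewrite rpredD// gtr0_real.
  apply: (le_lt_trans bnd); rewrite gtr_pMl// ltr_pdivrMr ?ltr0n// mul1r ltr_nat//.
by rewrite gtrDr.
Qed.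

Section Gram.
Variables (K : completeNormedModType C) (br : {hermitian K for false & conjC}).

Lemma gram_sym m (f : 'I_m -> K) i j : gram br f i j = (gram br f j i)^*.
Proof. by rewrite !mxE -hfC. Qed.

Lemma gram_comb m k (f : 'I_m -> K) (c : 'I_k -> 'I_m -> C) a b :
  mxform (gram br f) c a b = br (\sum_i c a i *: f i) (\sum_i c b i *: f i).
Proof.
rewrite hf_suml; apply: eq_bigr => i _; rewrite hf_sumr; apply: eq_bigr => j _.
by rewrite hfZl hfZr mxE; ring.
Qed.

Lemma gram_count_le n (e : 'I_n -> K) m (f : 'I_m -> K) : maxneg br e -> (mx_neg_eigenvalues (gram br f) <= n)%N.
Proof.
move=> me; have [c hc] := mx_neg_eigenvalues_sys (gram_sym f).
by apply: (maxneg_le me (f := fun a => \sum_i c a i *: f i)) => a b; rewrite -gram_comb.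
Qed.

Lemma gram_count_ge k m (f : 'I_m -> K) (c : 'I_k -> 'I_m -> C) : negsys br (fun a => \sum_i c a i *: f i) ->
  (k <= mx_neg_eigenvalues (gram br f))%N.
Proof.
move=> h; apply: (mx_neg_eigenvalues_ge (c := c)) => [|v [a va]]; first exact: gram_sym.
rewrite (eq_bigr (fun a => - (v a * (v a)^*))); last first.
  move=> b _; rewrite (bigD1 b)//= gram_comb h eqxx big1 ?addr0 ?mulrN1// => d db.
  by rewrite gram_comb h eq_sym (negbTE db) oppr0 mulr0.
rewrite sumrN oppr_lt0 lt_def sumr_ge0 ?andbT; last by move=> j _; rewrite -normCK exprn_ge0.
by apply: contra_neq va => hv; apply: (@sum_normsq_eq0 _ _ v); rewrite hv.
Qed.

Lemma lin_span_family (S : set K) k (g : 'I_k -> K) : (forall a, lin_span S (g a)) ->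
  exists m (f : 'I_m -> K) (c : 'I_k -> 'I_m -> C), (forall i, S (f i)) /\ forall a, g a = \sum_i c a i *: f i.
Proof.
elim: k g => [|k IH] g hg; first by exists 0%N, (fun=> 0), (fun _ _ => 0); split=> -[].
have [m [f [c [Sf hc]]]] := IH (fun a => g (lift ord_max a)) (fun a => hg _).
have [n [b [e [Se he]]]] := hg ord_max.
exists (m + n)%N, (fun i => match fintype.split i with inl j => f j | inr j => e j end),
  (fun a i => match unlift ord_max a, fintype.split i with
     | Some a', inl j => c a' j | None, inr j => b j | _, _ => 0 end); split.
  by move=> i; case: (fintype.split i).
move=> a; rewrite big_split_ord /=; case: unliftP => [a' ->|->].
  rewrite [X in _ + X]big1 ?addr0 => [|i _]; last by rewrite (unsplitK (inr i)) scale0r.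
  by rewrite hc; apply: eq_bigr => i _; rewrite (unsplitK (inl i)).
rewrite [X in X + _]big1 ?add0r => [|i _]; last by rewrite (unsplitK (inl i)) scale0r.
by rewrite he; apply: eq_bigr => i _; rewrite (unsplitK (inr i)).
Qed.

(** By density a maximal negative system exists inside the span of [S]; the Gram matrix of the
    finitely many generators it uses has at least n negative eigenvalues. *)
Lemma gram_count_attained n (e : 'I_n -> K) (S : set K) : krein br -> maxneg br e ->
  (forall x (d : C), 0 < d -> exists2 v, lin_span S v & `|x - v| < d) ->
  exists m (f : 'I_m -> K), (forall i, S (f i)) /\ mx_neg_eigenvalues (gram br f) = n.
Proof.
move=> Kr me dS; have SS := subspace_lin_span S.
have [k [g [Sg hg pg]]] := @exists_maxneg _ _ br (lin_span S) n SS (fun m f _ hf => maxneg_le me hf).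
have mg := dense_maxneg Kr SS dS Sg hg pg; have nk := maxneg_eq me mg; subst k.
have [m [f [c [Sf hc]]]] := lin_span_family Sg.
exists m, f; split=> //; apply/eqP; rewrite eqn_leq (gram_count_le f me)/=.
apply: (gram_count_ge (c := c)) => a b; rewrite -!hc; exact: hg.
Qed.

End Gram.
End MatrixCounts.

(** * Holomorphic operator functions *)

Section Holomorphy.
Variable R : realType.
Local Notation C := (Cplx R).

Lemma nbhs_CP (z : C) (P : set C) : nbhs z P <-> exists2 e : C, 0 < e & forall w, `|w - z| < e -> P w.
Proof.
split=> [/nbhs_ballP[e e0 eB]|[e e0 h]].
  by exists e => // y xy; apply: eB; rewrite /ball /= distrC.
by apply/nbhs_ballP; exists e => // y; rewrite /ball /= distrC; apply: h.
Qed.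

Lemma open_CP (U : set C) : open U <-> forall z, U z -> exists2 e : C, 0 < e & forall w, `|w - z| < e -> U w.
Proof.
rewrite openE; split=> [h x /h /nbhs_CP //|h x Vx].
by rewrite /interior; apply/nbhs_CP; exact: h.
Qed.

Lemma norm_Im_le (z : C) : `|'Im z| <= `|z|.
Proof.
rewrite -(@ler_pXn2r _ 2) ?nnegrE// (normC2_Re_Im z) (real_normK (Creal_Im z)).
by rewrite lerDr real_exprn_even_ge0// Creal_Re.
Qed.

Lemma ltr_norm_Im (z w : C) : `|w - z| < 'Im z -> 0 < 'Im w.
Proof.
move=> h; have zw : 'Im z - 'Im w <= `|w - z|.
  rewrite distrC (le_trans _ (norm_Im_le _))// raddfB /= real_ler_norm// rpredB// Creal_Im.
by have := le_lt_trans zw h; rewrite ltrBlDr ltrDl.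
Qed.

Lemma pos_lower (s : seq C) : (forall x, x \in s -> 0 < x) -> exists2 m : C, 0 < m & forall x, x \in s -> m <= x.
Proof.
elim: s => [|y s IH] hs; first by exists 1.
have [|m m0 hm] := IH; first by move=> x xs; apply: hs; rewrite inE xs orbT.
have y0 : 0 < y by apply: hs; rewrite mem_head.
have [ym|my] := real_leP (gtr0_real y0) (gtr0_real m0).
  by exists y => // x; rewrite inE => /predU1P[->//|/hm]; exact: le_trans.
by exists m => // x; rewrite inE => /predU1P[->|/hm//]; exact: ltW.
Qed.

Section Operators.
Variables (H : completeNormedModType C).
Implicit Types (F G : C -> H -> H) (z w : C).

Lemma op_differentiableP F z : op_differentiable F z <-> exists2 D : H -> H, bounded_op D &
  forall e : C, 0 < e -> exists2 d : C, 0 < d & forall w, w != z -> `|w - z| < d ->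
    forall h, `|(w - z)^-1 *: (F w h - F z h) - D h| <= e * `|h|.
Proof.
split=> -[D Db hD]; exists D => // e /hD.
  by move=> /nbhs_CP[d d0 hd]; exists d => // w wz wd; exact: hd.
by move=> [d d0 hd]; apply/nbhs_CP; exists d => // w wd wz; exact: hd.
Qed.

Lemma op_differentiable_cont F z (e : C) : op_differentiable F z -> 0 < e ->
  exists2 d : C, 0 < d & forall w, `|w - z| < d -> forall h, `|F w h - F z h| <= e * `|h|.
Proof.
move=> /op_differentiableP[D Db hD] e0; have [c c0 hc] := ((bounded_opP D).1 Db).2.
have [d d0 hd] := hD 1 ltr01.
have c1 : 0 < 1 + c by rewrite addr_gt0.
have dd : minr d (e / (1 + c)) <= d.
  by rewrite minElt; case: ifP => // /negbT; rewrite -real_leNgt ?gtr0_real ?divr_gt0.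
have de : minr d (e / (1 + c)) <= e / (1 + c).
  by rewrite minElt; case: ifP => // /ltW.
exists (minr d (e / (1 + c))); first by rewrite minElt; case: ifP => _ //; rewrite divr_gt0.
move=> w wd h; have [->|wz] := eqVneq w z; first by rewrite subrr normr0 mulr_ge0// ltW.
have wz0 : w - z != 0 by rewrite subr_eq0.
have := hd w wz (lt_le_trans wd dd) h; rewrite mul1r => hw.
have : `|(w - z)^-1 *: (F w h - F z h)| <= (1 + c) * `|h|.
  rewrite -[X in `|X|](subrK (D h)) (le_trans (ler_normD _ _))// mulrDl mul1r lerD//.
rewrite normrZ normfV ler_pdivrMl ?normr_gt0// => /le_trans; apply.
by rewrite mulrA ler_wpM2r// -ler_pdivlMr// (le_trans (ltW wd)).
Qed.

Lemma holomorphic_on_congr (U V : set C) F G : open V -> V `<=` U -> (forall w, V w -> F w =1 G w) ->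
  holomorphic_on U F -> holomorphic_on V G.
Proof.
move=> /open_CP Vo VU FG hF z Vz; have [Fb /op_differentiableP[D Db hD]] := hF z (VU z Vz).
split; first by rewrite -(_ : F z = G z)//; apply/funext => h; exact: FG.
apply/op_differentiableP; exists D => // e /hD[d d0 hd]; have [r r0 hr] := Vo z Vz.
exists (minr d r); first by rewrite minElt; case: ifP.
move=> w wz wd h; rewrite -FG// -?FG//; last first.
  by apply: hr; apply: (lt_le_trans wd); rewrite minElt; case: ifP => // /ltW.
apply: hd => //; apply: (lt_le_trans wd).
by rewrite minElt; case: ifP => // /negbT; rewrite -real_leNgt ?gtr0_real.
Qed.

Lemma op_cvg0_min (P Q : C -> Prop) (z : C) :
  (exists2 d : C, 0 < d & forall w, w != z -> `|w - z| < d -> P w) ->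
  (exists2 d : C, 0 < d & forall w, w != z -> `|w - z| < d -> Q w) ->
  exists2 d : C, 0 < d & forall w, w != z -> `|w - z| < d -> P w /\ Q w.
Proof.
move=> [d d0 hd] [r r0 hr]; exists (minr d r); first by rewrite minElt; case: ifP.
move=> w wz wd; split.
  apply: hd => //; apply: (lt_le_trans wd).
  by rewrite minElt; case: ifP => // /negbT; rewrite -real_leNgt ?gtr0_real.
by apply: hr => //; apply: (lt_le_trans wd); rewrite minElt; case: ifP => // /ltW.
Qed.

Lemma bounded_op_add (K1 K2 : completeNormedModType C) (S T : K1 -> K2) :
  bounded_op S -> bounded_op T -> bounded_op (fun x => S x + T x).
Proof.
move=> Sb Tb; apply/bounded_opP; split.
  by move=> a x y; rewrite (bounded_op_linear _ _ _ Sb) (bounded_op_linear _ _ _ Tb) scalerDr addrACA.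
have [_ [c c0 hc]] := (bounded_opP S).1 Sb; have [_ [d d0 hd]] := (bounded_opP T).1 Tb.
exists (c + d); first by rewrite addr_gt0.
by move=> x; rewrite (le_trans (ler_normD _ _))// mulrDl lerD.
Qed.

Lemma bounded_op_scale (K1 K2 : completeNormedModType C) (a : C) (S : K1 -> K2) :
  bounded_op S -> bounded_op (fun x => a *: S x).
Proof.
move=> Sb; have [_ [c c0 hc]] := (bounded_opP S).1 Sb; apply/bounded_opP; split.
  by move=> b x y; rewrite bounded_op_linear// scalerDr !scalerA mulrC.
exists ((1 + `|a|) * c); first by rewrite mulr_gt0// ltr_pwDl.
by move=> x; rewrite normrZ -mulrA ler_pM// lerDr.
Qed.

Lemma bounded_op_comp (K1 K2 K3 : completeNormedModType C) (S : K2 -> K3) (T : K1 -> K2) :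
  bounded_op S -> bounded_op T -> bounded_op (fun x => S (T x)).
Proof.
move=> Sb Tb; apply/bounded_opP; split; first by move=> a x y; rewrite !bounded_op_linear.
have [_ [c c0 hc]] := (bounded_opP S).1 Sb; have [_ [d d0 hd]] := (bounded_opP T).1 Tb.
exists (c * d); first by rewrite mulr_gt0.
by move=> x; rewrite (le_trans (hc _))// -mulrA ler_pM2l.
Qed.

Lemma bounded_op_id (K : completeNormedModType C) : bounded_op (@id K).
Proof. by apply/bounded_opP; split=> //; exists 1 => // x; rewrite mul1r. Qed.

Lemma bounded_op_sub (K1 K2 : completeNormedModType C) (S T : K1 -> K2) :
  bounded_op S -> bounded_op T -> bounded_op (fun x => S x - T x).
Proof.
move=> Sb Tb; rewrite (_ : (fun x => _) = fun x => S x + (-1) *: T x).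
  by apply: bounded_op_add => //; exact: bounded_op_scale.
by apply/funext => x; rewrite scaleN1r.
Qed.

Lemma bounded_op_zero (K1 K2 : completeNormedModType C) : bounded_op (fun _ : K1 => 0 : K2).
Proof.
apply/bounded_opP; split; first by move=> a x y; rewrite scaler0 addr0.
by exists 1 => // x; rewrite normr0 mulr_ge0.
Qed.

Lemma holomorphic_cst (U : set C) (T : H -> H) : bounded_op T -> holomorphic_on U (fun=> T).
Proof.
move=> Tb z _; split=> //; apply/op_differentiableP; exists (fun=> 0); first exact: bounded_op_zero.
by move=> e e0; exists 1 => // w _ _ h; rewrite subrr scaler0 subr0 normr0; apply: mulr_ge0 => //; exact: ltW.
Qed.

Lemma holomorphic_add (U : set C) F G : holomorphic_on U F -> holomorphic_on U G ->
  holomorphic_on U (fun w h => F w h + G w h).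
Proof.
move=> hF hG z Uz; have [Fb /op_differentiableP[D Db hD]] := hF z Uz.
have [Gb /op_differentiableP[E Eb hE]] := hG z Uz.
split; first exact: bounded_op_add.
apply/op_differentiableP; exists (fun h => D h + E h); first exact: bounded_op_add.
move=> e /pos_half e0; have [d d0 hd] := op_cvg0_min (hD _ e0) (hE _ e0).
exists d => // w wz wd h; have [h1 h2] := hd w wz wd.
rewrite opprD addrACA scalerDr opprD addrACA (le_trans (ler_normD _ _))//.
by rewrite [e]splitr mulrDl lerD.
Qed.

Lemma holomorphic_mul (U : set C) F (a : C) : holomorphic_on U F ->
  holomorphic_on U (fun w h => (w - a) *: F w h).
Proof.
move=> hF z Uz; have [Fb Fd] := hF z Uz; have /op_differentiableP[D Db hD] := Fd.
split; first exact: bounded_op_scale.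
apply/op_differentiableP; exists (fun h => F z h + (z - a) *: D h).
  by apply: bounded_op_add => //; exact: bounded_op_scale.
move=> e e0; have a1 : 0 < 1 + `|z - a| by rewrite ltr_pwDl.
have e1 : 0 < e / 2 / (1 + `|z - a|) by rewrite divr_gt0// pos_half.
have [d d0 hd] : exists2 d : C, 0 < d & forall w, w != z -> `|w - z| < d ->
    (forall h, `|(w - z)^-1 *: (F w h - F z h) - D h| <= e / 2 / (1 + `|z - a|) * `|h|) /\
    forall h, `|F w h - F z h| <= e / 2 * `|h|.
  apply: op_cvg0_min; first exact: hD.
  by have [r r0 hr] := op_differentiable_cont Fd (pos_half e0); exists r => // w _; exact: hr.
exists d => // w wz wd h; have [h1 h2] := hd w wz wd.
have wz0 : w - z != 0 by rewrite subr_eq0.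
have -> : (w - z)^-1 *: ((w - a) *: F w h - (z - a) *: F z h) - (F z h + (z - a) *: D h) =
    (F w h - F z h) + (z - a) *: ((w - z)^-1 *: (F w h - F z h) - D h).
  rewrite -[w - a](subrK (z - a)) (_ : w - a - (z - a) = w - z); last by ring.
  rewrite scalerDl -addrA -scalerBr scalerDr scalerA mulVf// scale1r opprD.
  by rewrite addrACA [(z - a) *: (_ - D h)]scalerBr !scalerA mulrC.
rewrite (le_trans (ler_normD _ _))// [e in leRHS]splitr mulrDl lerD// normrZ.
rewrite (le_trans (ler_wpM2l _ (h1 h)))// mulrA ler_wpM2r//.
rewrite mulrCA ler_piMr ?(ltW (pos_half e0))// ler_pdivrMr// mul1r lerDr//.
Qed.

Lemma holomorphic_pow (U : set C) F (a : C) k : holomorphic_on U F ->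
  holomorphic_on U (fun w h => (w - a) ^+ k *: F w h).
Proof.
move=> hF; elim: k => [|k IH].
  rewrite (_ : (fun w h => _) = F)//; apply/funext => w; apply/funext => h.
  by rewrite expr0 scale1r.
rewrite (_ : (fun w h => _) = (fun w h => (w - a) *: ((w - a) ^+ k *: F w h))).
  exact: holomorphic_mul.
by apply/funext => w; apply/funext => h; rewrite scalerA exprS.
Qed.

Lemma holomorphic_sum (U : set C) (I : Type) (r : seq I) (F : I -> C -> H -> H) :
  (forall i, holomorphic_on U (F i)) -> holomorphic_on U (fun w h => \sum_(i <- r) F i w h).
Proof.
move=> hF; elim: r => [|i r IH].
  rewrite (_ : (fun w h => _) = fun=> fun=> 0); first by apply: holomorphic_cst; exact: bounded_op_zero.
  by apply/funext => w; apply/funext => h; rewrite big_nil.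
rewrite (_ : (fun w h => _) = (fun w h => F i w h + \sum_(i <- r) F i w h)); first exact: holomorphic_add.
by apply/funext => w; apply/funext => h; rewrite big_cons.
Qed.

(** The resolvent identity identifies the derivative of the resolvent as its square and reduces the
    error to continuity of the resolvent. *)
Lemma holomorphic_resolvent (K : completeNormedModType C) (U : set C) (B : set (K * K))
    (S : C -> K -> K) (Phi : K -> H) (Psi : H -> K) : open U -> bounded_op Phi -> bounded_op Psi ->
  (forall w, U w -> rel_resolvent B w (S w)) -> holomorphic_on U (fun w h => Phi (S w (Psi h))).
Proof.
move=> /open_CP Uo Pb Qb hS z Uz; have [Sb _] := hS z Uz.
split; first by apply: bounded_op_comp => //; exact: bounded_op_comp.
apply/op_differentiableP; exists (fun h => Phi (S z (S z (Psi h)))).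
  by do 3 apply: bounded_op_comp => //.
have [c c0 hc] := ((bounded_opP _).1 Sb).2; have [p p0 hp] := ((bounded_opP _).1 Pb).2.
have [q q0 hq] := ((bounded_opP _).1 Qb).2; have [r r0 hr] := Uo z Uz.
move=> e e0; pose M := p * (c * (2 * c ^+ 2 * q)).
have M0 : 0 < M by rewrite !mulr_gt0 ?exprn_gt0.
have [d d0 hd] : exists2 d : C, 0 < d & forall w, w != z -> `|w - z| < d ->
    (U w /\ `|w - z| < e / M) /\ `|w - z| < 2^-1 / c.
  apply: op_cvg0_min; last by exists (2^-1 / c) => //; rewrite divr_gt0.
  apply: op_cvg0_min; first by exists r => // w _ ; exact: hr.
  by exists (e / M) => //; rewrite divr_gt0.
exists d => // w wz wd h; have [[Uw we] wc] := hd w wz wd.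
have wz0 : w - z != 0 by rewrite subr_eq0.
have wc' : `|w - z| * c <= 2^-1 by rewrite -ler_pdivlMr// ltW.
have [_ near] := resolvent_near (hS z Uz) (hS w Uw) c0 hc wc'.
have -> : (w - z)^-1 *: (Phi (S w (Psi h)) - Phi (S z (Psi h))) - Phi (S z (S z (Psi h))) =
    Phi (S z (S w (Psi h) - S z (Psi h))).
  have SE : S w (Psi h) - S z (Psi h) = (w - z) *: S z (S w (Psi h)).
    by rewrite -opprB (resolvent_identity (Psi h) (hS z Uz) (hS w Uw)) -scaleNr opprB.
  rewrite -bounded_opB// SE bounded_opZ// scalerA mulVf// scale1r.
  by rewrite -bounded_opB// -bounded_opB// SE.
rewrite (le_trans (hp _))//; apply: (@le_trans _ _ (p * (c * (2 * c ^+ 2 * `|w - z| * (q * `|h|))))).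
  rewrite ler_pM2l// (le_trans (hc _))// ler_pM2l// (le_trans (near _))//.
  by rewrite ler_wpM2l// !mulr_ge0// ?exprn_ge0// ltW.
rewrite (_ : p * _ = `|w - z| * M * `|h|); last by rewrite /M; ring.
by rewrite ler_wpM2r// -ler_pdivlMr// ltW.
Qed.

End Operators.
End Holomorphy.

Lemma cvg_quotient (F : numFieldType) (a b c d : nat -> F) (a0 b0 c0 d0 : F) : a @ \oo --> a0 -> b @ \oo --> b0 ->
  c @ \oo --> c0 -> d @ \oo --> d0 -> c0 - d0 != 0 ->
  (fun m => (a m - b m) / (c m - d m)) @ \oo --> (a0 - b0) / (c0 - d0).
Proof. by move=> ha hb hc hd n0; apply: cvgM; [exact: cvgB|apply: cvgV => //; exact: cvgB]. Qed.

(** * Extension to the domain of holomorphy *)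

Section MaximalExtension.
Variable R : realType.
Local Notation C := (Cplx R).
Variables (H : completeNormedModType C) (ip : {dot H for conjC}).
Hypothesis H_hilbert : hilbert_norm ip.

(** [H] is a Pontryagin space of index 0, so [proper_orthogonal] supplies a vector orthogonal to the
    kernel of [f]. *)
Lemma riesz (f : H -> C) : (forall a x y, f (a *: x + y) = a * f x + f y) ->
  (exists2 b : C, 0 < b & forall x, `|f x| <= b * `|x|) -> exists y, forall h, f h = ip h y.
Proof.
move=> fl [b b0 hb].
have [f0|/existsNP[x0 /eqP fx0]] := pselect (forall h, f h = 0).
  by exists 0 => h; rewrite f0 ip0r.
have idb : bounded_op (@id H) by apply/bounded_opP; split=> //; exists 1 => // x; rewrite mul1r.
have idsa (x y : H) : ip (id x) y = ip x (id y) by [].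
have Kr : krein (form_of idb idsa).
  by apply: (@form_of_krein _ _ _ H_hilbert _ idb idsa 1) => // x; rewrite mul1r.
have me : @maxneg _ _ (form_of idb idsa) 0 (fun=> 0).
  by split=> [[]//|x _]; rewrite form_ofE -H_hilbert exprn_ge0.
have f00 : f 0 = 0 by have := fl (-1) 0 0; rewrite scaler0 addr0 mulN1r addNr.
have fZ a x : f (a *: x) = a * f x by rewrite -[a *: x]addr0 fl f00 addr0.
have fB x y : f (x - y) = f x - f y by rewrite addrC -scaleN1r fl mulN1r addrC.
have VS : subspace [set h | f h = 0] by split=> // a x y /= hx hy; rewrite fl hx hy mulr0 addr0.
have Vc : closed [set h | f h = 0].
  apply/closedE => x hx; apply: eps_zero => e e0.
  have [v /= fv xv] := hx (e / b) (divr_gt0 e0 b0).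
  by rewrite -[f x]subr0 -fv -fB (le_trans (hb _))// -ler_pdivlMl// mulrC ltW.
have [|y y0 hy] := proper_orthogonal (x0 := x0) Kr me VS Vc; first by move=> /= h; rewrite h eqxx in fx0.
have yy : ip y y != 0 by rewrite dnorm_eq0.
have fy : f y != 0.
  by apply: contra_neq yy => fy; exact: (hy y fy).
exists ((f y / ip y y)^* *: y) => h; rewrite ipZr conjCK.
have : ip (h - (f h / f y) *: y) y = 0 by apply: hy; rewrite /= fB fZ mulfVK// subrr.
rewrite ipBl ipZl => /eqP; rewrite subr_eq0 => /eqP ->; field.
by rewrite fy.
Qed.

Lemma adjoint_bound (T T' : H -> H) (c : C) : 0 <= c -> (forall h h', ip (T h) h' = ip h (T' h')) ->
  (forall h, `|T h| <= c * `|h|) -> forall h, `|T' h| <= c * `|h|.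
Proof.
move=> c0 hT hc h; have [->|n0] := eqVneq `|T' h| 0; first by rewrite mulr_ge0.
have p0 : 0 < `|T' h| by rewrite lt_def n0 normr_ge0.
rewrite -(ler_pM2r p0) -expr2 H_hilbert -hT.
have := ip_cauchy_schwarz H_hilbert (T (T' h)) h.
rewrite ger0_norm; last by rewrite hT -H_hilbert exprn_ge0.
by move=> /le_trans; apply; rewrite mulrAC ler_wpM2r.
Qed.

Lemma adjoint_exists (T : H -> H) : bounded_op T ->
  exists2 T', bounded_op T' & forall h h', ip (T h) h' = ip h (T' h').
Proof.
move=> Tb; have [Tl [c c0 hc]] := (bounded_opP T).1 Tb.
have /choice[T' hT] : forall h', exists y, forall h, ip (T h) h' = ip h y.
  move=> h'; apply: riesz; first by move=> a x y; rewrite Tl ipDl ipZl.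
  exists (c * (1 + `|h'|)); first by rewrite mulr_gt0// ltr_pwDl.
  move=> x; rewrite (le_trans (ip_cauchy_schwarz H_hilbert _ _))// mulrAC.
  by rewrite ler_pM// lerDr.
have hT2 h h' : ip (T h) h' = ip h (T' h') by [].
exists T' => //; apply/bounded_opP; split; last by exists c => //; apply: adjoint_bound hT2 _ => //; exact: ltW.
move=> a x y; apply: (@ip_ext _ _ ip) => z; rewrite [LHS]ipC -hT2 [RHS]ipC; congr (_^*).
by rewrite !ipDr !ipZr !hT2.
Qed.

Definition local_extension (F : opfun H) (z : C) (UG : set C * (C -> H -> H)) :=
  [/\ open UG.1, UG.1 z, holomorphic_on UG.1 UG.2 &
    forall w, UG.1 w -> dom F w -> forall h, UG.2 w h = F w h].

(** All local continuations are glued at once. The value at a point comes from an arbitrarily chosen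
    continuation; [max_extE] shows it to be independent of the choice, because [dom F] is dense. *)
Definition max_ext (F : opfun H) : opfun H :=
  OpFun [set z | exists UG, local_extension F z UG]
    (fun z => if pselect (exists UG, local_extension F z UG) is left p then (sval (cid p)).2 z else fun=> 0).

Variable F : opfun H.
Hypotheses (Fo : open (dom F)) (Fd : forall z (e : C), 0 < e -> exists2 w, dom F w & `|w - z| < e)
  (Fh : holomorphic_on (dom F) F).

Lemma max_extE z U G : open U -> U z -> holomorphic_on U G ->
  (forall w, U w -> dom F w -> forall h, G w h = F w h) ->
  dom (max_ext F) z /\ forall h, max_ext F z h = G z h.
Proof.
move=> Uo Uz hG GF; have ex : exists UG, local_extension F z UG by exists (U, G).
split=> // h; rewrite /=; case: pselect => // p; case: (cid p) => -[U' G'] /= [/= U'o U'z hG' GF'].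
apply/eqP; rewrite -subr_eq0; apply/eqP; apply: eps_zero => e e0.
have e1 : 0 < e / 2 / (`|h| + 1) by rewrite divr_gt0// pos_half.
have [d d0 hd] := op_differentiable_cont (hG _ Uz).2 e1.
have [d' d'0 hd'] := op_differentiable_cont (hG' _ U'z).2 e1.
have [r r0 hr] := (open_CP U).1 Uo z Uz; have [r' r'0 hr'] := (open_CP U').1 U'o z U'z.
have [|m m0 hm] := @pos_lower _ [:: d; d'; r; r'].
  by move=> x; rewrite !inE => /or4P[] /eqP ->.
have [w Fw wz] := Fd z m0.
have [ld ld' lr lr'] : [/\ `|w - z| < d, `|w - z| < d', `|w - z| < r & `|w - z| < r'].
  by split; apply: (lt_le_trans wz); apply: hm; rewrite !inE eqxx ?orbT.
have := hd w ld h; have := hd' w ld' h; rewrite (GF w (hr w lr) Fw) (GF' w (hr' w lr') Fw).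
move=> n1 n2; rewrite -(subrK (F w h) (G' z h)) -addrA (le_trans (ler_normD _ _))//.
rewrite [e]splitr lerD//.
  rewrite distrC (le_trans n1)// -mulrA ler_piMr ?(ltW (pos_half e0))// mulrC ler_pdivrMr// mul1r lerDl//.
rewrite (le_trans n2)// -mulrA ler_piMr ?(ltW (pos_half e0))// mulrC ler_pdivrMr// mul1r lerDl//.
Qed.

Lemma max_ext_extends : extends (max_ext F) F.
Proof. by split=> [z Fz|z Fz]; have [] := max_extE Fo Fz Fh (fun _ _ _ _ => erefl). Qed.

Lemma max_ext_local z : dom (max_ext F) z -> exists U G, [/\ open U, U z, holomorphic_on U G,
  (forall w, U w -> dom F w -> forall h, G w h = F w h) &
  forall w, U w -> dom (max_ext F) w /\ max_ext F w =1 G w].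
Proof.
move=> [[U G] [/= Uo Uz hG GF]]; exists U, G; split=> // w Uw.
by have [] := max_extE Uo Uw hG GF.
Qed.

Lemma max_ext_open : open (dom (max_ext F)).
Proof.
apply/open_CP => z /max_ext_local[U [G [Uo Uz _ _ hU]]]; have [e e0 he] := (open_CP U).1 Uo z Uz.
by exists e => // w /he /hU[].
Qed.

Lemma max_ext_holomorphic : holomorphic_on (dom (max_ext F)) (max_ext F).
Proof.
move=> z /max_ext_local[U [G [Uo Uz hG _ hU]]].
by apply: (holomorphic_on_congr Uo _ _ hG) => // w /hU[_ E] h; rewrite E.
Qed.

Lemma max_ext_maximal z U G : open U -> U z -> holomorphic_on U G ->
  (forall w, U w -> dom (max_ext F) w -> forall h, G w h = max_ext F w h) -> dom (max_ext F) z.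
Proof.
move=> Uo Uz hG GF; exists (U, G); split=> // w Uw Fw h; have [sub eqF] := max_ext_extends.
by rewrite /= GF ?eqF//; exact: sub.
Qed.

Lemma conj_ball (z w : C) : `|w^* - z| = `|w - z^*|.
Proof. by rewrite -norm_conjC rmorphB /= conjCK. Qed.

Lemma open_conj (U : set C) : open U -> open [set w | U w^*].
Proof.
move=> /open_CP Uo; apply/open_CP => z /Uo[e e0 he]; exists e => // w wz /=.
by apply: he; rewrite conj_ball conjCK.
Qed.

(** Difference quotients at reflected points are adjoint to each other, and passing to adjoints
    preserves norm bounds. *)
Lemma holomorphic_adjoint (U : set C) G G' : (forall w, U w -> forall h h', ip (G w h) h' = ip h (G' w h')) ->
  (forall w, U w -> bounded_op (G' w)) -> open U ->
  holomorphic_on U G -> holomorphic_on [set w | U w^*] (fun w => G' w^*).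
Proof.
move=> hGG' G'b /open_CP Uo hG z Uz; split; first exact: G'b.
have [Gb /op_differentiableP[D Db hD]] := hG _ Uz; have [D' D'b hD'] := adjoint_exists Db.
apply/op_differentiableP; exists D' => // e e0; have [d d0 hd] := hD e e0.
have [r r0 hr] := Uo _ Uz.
have [|m m0 hm] := @pos_lower _ [:: d; r]; first by move=> x; rewrite !inE => /orP[] /eqP ->.
exists m => // w wz wd.
have wz' : `|w^* - z^*| < m by rewrite conj_ball conjCK.
have Uw : U w^* by apply: hr; rewrite (lt_le_trans wz')// hm ?inE ?eqxx ?orbT.
apply: (adjoint_bound (T := fun h => (w^* - z^*)^-1 *: (G w^* h - G z^* h) - D h)); first exact: ltW.
  move=> h h'; rewrite !ipBl !ipBr ipZl ipZr ipBl ipBr !hGG'// hD' fmorphV rmorphB /= .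
  by [].
apply: hd; last by rewrite (lt_le_trans wz')// hm ?inE ?eqxx.
by rewrite (inj_eq (can_inj conjCK)).
Qed.

Hypothesis Fsym : forall z, dom F z -> dom F z^* /\ forall h h', ip (F z h) h' = ip h (F z^* h').

Lemma max_ext_symmetric z : dom (max_ext F) z ->
  dom (max_ext F) z^* /\ forall h h', ip (max_ext F z h) h' = ip h (max_ext F z^* h').
Proof.
move=> /max_ext_local[U [G [Uo Uz hG GF hU]]].
have /choice[G' hG'] : forall w, exists T', U w -> bounded_op T' /\ forall h h', ip (G w h) h' = ip h (T' h').
  move=> w; case: (pselect (U w)) => [Uw|]; last by exists (fun=> 0).
  by have [T' Tb hT] := adjoint_exists (hG w Uw).1; exists T'.
have hU' : holomorphic_on [set w | U w^*] (fun w => G' w^*).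
  by apply: (@holomorphic_adjoint U G G') => // w /hG'[].
have Uz' : [set w | U w^*] z^* by rewrite /= conjCK.
have [|dz Ez] := max_extE (open_conj Uo) Uz' hU'.
  move=> w Uw Fw h; have [Fw' Fww] := Fsym Fw; apply: (@ip_ext _ _ ip) => h'.
  by rewrite Fww [LHS]ipC -(hG' _ Uw).2 GF// -ipC.
split=> // h h'; rewrite Ez conjCK -(hG' _ Uz).2; congr (ip _ _).
exact: (hU z Uz).2.
Qed.

Lemma max_ext_approx z (e : C) : dom (max_ext F) z -> 0 < e -> exists2 w, dom F w /\ `|w - z| < e &
  forall h, `|F w h - max_ext F z h| <= e * `|h|.
Proof.
move=> /max_ext_local[U [G [Uo Uz hG GF hU]]] e0.
have [d d0 hd] := op_differentiable_cont (hG z Uz).2 e0; have [r r0 hr] := (open_CP U).1 Uo z Uz.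
have [|m m0 hm] := @pos_lower _ [:: d; r; e]; first by move=> x; rewrite !inE => /or3P[] /eqP ->.
have [w Fw wz] := Fd z m0; exists w.
  by split=> //; rewrite (lt_le_trans wz)// hm ?inE ?eqxx ?orbT.
move=> h; have Uw : U w by apply: hr; rewrite (lt_le_trans wz)// hm ?inE ?eqxx ?orbT.
by rewrite -GF// (hU z Uz).2 hd// (lt_le_trans wz)// hm ?inE ?eqxx.
Qed.

Lemma nevanlinna_matrix_sym (E : opfun H) n (z : 'I_n -> C) h i j :
  nevanlinna_matrix ip E z h i j = (nevanlinna_matrix ip E z h j i)^*.
Proof.
rewrite !mxE rmorphM fmorphV !rmorphB /= conjCK -!ipC -[in RHS]opprB -[(_ - z i)]opprB invrN mulrNN//.
Qed.

(** The matrix at points of the extension is a limit of matrices at points of [dom F], so lower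
    semicontinuity of the count carries the bound over. *)
Lemma max_ext_kernel kappa n (z : 'I_n -> C) (h : 'I_n -> H) :
  (forall n (z : 'I_n -> C) (h : 'I_n -> H), (forall i, dom F (z i) /\ 0 < 'Im (z i)) ->
    (mx_neg_eigenvalues (nevanlinna_matrix ip F z h) <= kappa)%N) ->
  (forall i, dom (max_ext F) (z i) /\ 0 < 'Im (z i)) ->
  (mx_neg_eigenvalues (nevanlinna_matrix ip (max_ext F) z h) <= kappa)%N.
Proof.
move=> le hz.
have [e e0 he] := mx_neg_eigenvalues_near (fun i j => nevanlinna_matrix_sym (max_ext F) z h i j).
have /choice[w hw] : forall m : nat, exists w : 'I_n -> C, forall i,
    [/\ dom F (w i), 0 < 'Im (w i), `|w i - z i| < m.+1%:R^-1 &
     forall h, `|F (w i) h - max_ext F (z i) h| <= m.+1%:R^-1 * `|h|].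
  move=> m; suff hh : forall i, exists w, [/\ dom F w, 0 < 'Im w, `|w - z i| < m.+1%:R^-1 &
     forall h, `|F w h - max_ext F (z i) h| <= m.+1%:R^-1 * `|h|].
    by have [w hw] := choice hh; exists w.
  move=> i; have [zi Iz] := hz i; have m0 : 0 < m.+1%:R^-1 :> C by rewrite invr_gt0 ltr0n.
  have [|d d0 hd] := @pos_lower _ [:: m.+1%:R^-1; 'Im (z i)]; first by move=> x; rewrite !inE => /orP[] /eqP ->.
  have [w' [Fw wz] hF] := max_ext_approx zi d0.
  have dm : d <= m.+1%:R^-1 by rewrite hd ?inE ?eqxx.
  exists w'; split=> //.
  - by apply: (ltr_norm_Im (z := z i)); rewrite (lt_le_trans wz)// hd ?inE ?eqxx ?orbT.
  - exact: lt_le_trans dm.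
  - by move=> k; rewrite (le_trans (hF k))// ler_wpM2r.
have inv0 : (fun m : nat => m.+1%:R^-1 : C) @ \oo --> (0 : C).
  apply/cvgrPdist_lt => d d0; have [N hN] := inv_nat_lt d0; exists N => // m Nm.
  by rewrite sub0r normrN ger0_norm ?invr_ge0 ?ler0n// hN.
have cw i : (fun m => w m i) @ \oo --> z i.
  apply/cvgrPdist_lt => d d0; have [N hN] := inv_nat_lt d0; exists N => // m Nm.
  by have [_ _ h1 _] := hw m i; rewrite distrC (lt_trans h1)// hN.
have cF i j : (fun m => ip (F (w m i) (h i)) (h j)) @ \oo --> ip (max_ext F (z i) (h i)) (h j).
  apply/cvgrPdist_le => d d0; have dM : 0 < d / ((`|h i| + 1) * (`|h j| + 1)).
    by rewrite divr_gt0// mulr_gt0// ltr_wpDl.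
  have [N hN] := inv_nat_lt dM; exists N => // m Nm /=.
  have [_ _ _ h2] := hw m i; rewrite -ipBl (le_trans (ip_cauchy_schwarz H_hilbert _ _))//.
  have := hN m Nm; rewrite ltr_pdivlMr ?mulr_gt0 ?ltr_wpDl// => /ltW; apply: le_trans.
  rewrite distrC (le_trans (ler_wpM2r _ (h2 _)))// -mulrA ler_wpM2l ?invr_ge0 ?ler0n//.
  by rewrite ler_pM// lerDl.
have cF' i j : (fun m => ip (h i) (F (w m j) (h j))) @ \oo --> ip (h i) (max_ext F (z j) (h j)).
  apply/cvgrPdist_le => d d0; have [N _ hN] := (cvgrPdist_le _ _).1 (cF j i) d d0.
  by exists N => // m /hN; rewrite /= -!ipBl -!ipBr ipC norm_conjC.
have cM i j : (fun m => nevanlinna_matrix ip F (w m) h i j) @ \oo --> nevanlinna_matrix ip (max_ext F) z h i j.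
  have -> : (fun m => nevanlinna_matrix ip F (w m) h i j) =
     (fun m => (ip (F (w m i) (h i)) (h j) - ip (h i) (F (w m j) (h j))) / (w m i - (w m j)^*)).
    by apply/funext => m; rewrite mxE.
  have -> : nevanlinna_matrix ip (max_ext F) z h i j =
     (ip (max_ext F (z i) (h i)) (h j) - ip (h i) (max_ext F (z j) (h j))) / (z i - (z j)^*) by rewrite mxE.
  apply: (cvg_quotient (cF i j) (cF' i j) (cw i)).
    apply/cvgrPdist_lt => d d0.
    have [N _ hN] := (cvgrPdist_lt _ _).1 (cw j) d d0; exists N => // m /hN.
    by rewrite /= -rmorphB norm_conjC.
  apply/eqP => /(congr1 (fun x => 'Im x)); rewrite raddfB /= Im_conj opprK raddf0.
  have [[_ zi] [_ zj]] := (hz i, hz j).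
  by move/eqP; rewrite gt_eqF// addr_gt0.
have : \forall m \near \oo, forall i j, `|nevanlinna_matrix ip (max_ext F) z h i j - nevanlinna_matrix ip F (w m) h i j| <= e.
  apply: filter_forall => i; apply: filter_forall => j.
  exact: ((cvgrPdist_le _ _).1 (cM i j) e e0).
move=> [N _ /(_ N (leqnn N)) hN].
apply: (leq_trans (he (nevanlinna_matrix ip F (w N) h) _ _)).
- exact: nevanlinna_matrix_sym.
- by move=> i j; rewrite distrC.
- by apply: le => i; have [] := hw N i.
Qed.

Lemma maximal_extension kappa :
  (forall z, 'Im z != 0 -> exists (k : nat) (U : set C) (G : C -> H -> H),
    [/\ open U, U z, holomorphic_on U G &
      forall w, U w -> w != z -> dom F w /\ forall h, (w - z) ^+ k *: F w h = G w h]) ->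
  (forall n (z : 'I_n -> C) (h : 'I_n -> H), (forall i, dom F (z i) /\ 0 < 'Im (z i)) ->
    (mx_neg_eigenvalues (nevanlinna_matrix ip F z h) <= kappa)%N) ->
  (exists n (z : 'I_n -> C) (h : 'I_n -> H), (forall i, dom F (z i) /\ 0 < 'Im (z i)) /\
    mx_neg_eigenvalues (nevanlinna_matrix ip F z h) = kappa) ->
  exists2 E, gen_nevanlinna ip kappa E & extends E F.
Proof.
move=> mero le [n [z [h [hz eqk]]]]; exists (max_ext F); last exact: max_ext_extends.
have [sub eqF] := max_ext_extends; split.
- exact: max_ext_open.
- exact: max_ext_holomorphic.
- move=> u /mero[k [U [G [Uo Uu hG hU]]]]; exists k, U, G; split=> // w Uw wu.
  by have [Fw hw] := hU w Uw wu; split=> [|g]; [exact: sub|rewrite eqF].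
- exact: max_ext_maximal.
- exact: max_ext_symmetric.
- by move=> m u g hu; apply: max_ext_kernel.
- exists n, z, h; split; first by move=> i; have [/sub] := hz i.
  rewrite -eqk; congr mx_neg_eigenvalues; apply/matrixP => i j; rewrite !mxE.
  by rewrite !eqF//; have [] := hz i; have [] := hz j.
Qed.

End MaximalExtension.

(** * Nonreal root subspaces and poles of the resolvent *)

Section RootSpaces.
Variable R : realType.
Local Notation C := (Cplx R).
Variables (K : completeNormedModType C) (br : {hermitian K for false & conjC}).
Variables (n : nat) (e : 'I_n -> K).
Hypotheses (Kr : krein br) (me : maxneg br e).
Variable A : K -> K.
Hypotheses (Ab : bounded_op A) (Asa : selfadjoint_op br A).

Definition shift (l : C) (x : K) := A x - l *: x.

Lemma shift_bounded l : bounded_op (shift l).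
Proof. exact: (bounded_op_sub Ab (bounded_op_scale l (@bounded_op_id _ K))). Qed.

Lemma shift_sym l x y : br (shift l x) y = br x (shift l^* y).
Proof. by rewrite /shift hfBl hfBr hfZl hfZr conjCK Asa. Qed.

Lemma iter_shift_bounded l k : bounded_op (iter k (shift l)).
Proof.
elim: k => [|k IH]; first by apply/bounded_opP; split=> //; exists 1 => // x; rewrite mul1r.
exact: (bounded_op_comp (shift_bounded l) IH).
Qed.

Lemma iter_shift_sym l k x y : br (iter k (shift l) x) y = br x (iter k (shift l^*) y).
Proof. by elim: k y => // k IH y; rewrite iterS shift_sym IH -iterSr. Qed.

Lemma iter_shift0 l k : iter k (shift l) 0 = 0.
Proof. by rewrite (bounded_op0 (iter_shift_bounded l k)). Qed.

Lemma iter_shift_stable l k m x : (k <= m)%N -> iter k (shift l) x = 0 -> iter m (shift l) x = 0.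
Proof. by move=> /subnK <- h; rewrite iterD h iter_shift0. Qed.

(** Induction on i + j through (l - conj l) br x y = br x (shift l y) - br (shift l x) y. *)
Lemma root_neutral l i j x y : 'Im l != 0 ->
  iter i (shift l) x = 0 -> iter j (shift l) y = 0 -> br x y = 0.
Proof.
move=> li; have ll : l - l^* != 0.
  by rewrite subr_eq0; apply: contra li => /eqP lc; apply/eqP/Creal_ImP; rewrite CrealE -lc.
have [s] := ubnP (i + j); elim: s i j x y => // s IH [|i] [|j] x y ij hx hy.
- by rewrite [x]hx hf0l.
- by rewrite [x]hx hf0l.
- by rewrite [y]hy hf0r.
have h1 : br (shift l x) y = 0.
  by apply: (IH i j.+1) => //; rewrite -iterSr.
have h2 : br x (shift l y) = 0.
  by apply: (IH i.+1 j); [move: ij; rewrite addnS ltnS| |rewrite -iterSr].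
have : (l - l^*) * br x y = br x (shift l y) - br (shift l x) y.
  by rewrite /shift hfBl hfBr hfZl hfZr Asa; ring.
by rewrite h1 h2 subr0 => /eqP; rewrite mulf_eq0 (negbTE ll) => /eqP.
Qed.

(* The root subspace at a nonreal point is neutral, so a chain of length [n.+1]
   in it would contain a vector that is neutral and orthogonal to [e]. *)
Lemma root_chain l x : 'Im l != 0 -> iter n.+1 (shift l) x = 0 -> iter n (shift l) x = 0.
Proof.
move=> li hx; apply/eqP; apply: contraT => xn.
have [v [i0 vi0] hv] := kernel_vector (\matrix_(i < n.+1, j < n) br (iter i (shift l) x) (e j)) (ltnSn n).
pose y := \sum_i v i *: iter i (shift l) x.
have y0 : y = 0.
  have [c [d [c0 d0 hcd]]] := maxneg_norm Kr me; have := hcd y.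
  have -> : br y y = 0.
    rewrite /y hf_suml big1// => i _; rewrite hf_sumr big1// => j _.
    rewrite hfZl hfZr (@root_neutral l n.+1 n.+1) ?mulr0// -iterD addnC iterD hx iter_shift0//.
  rewrite big1 ?mulr0 ?addr0 => [/andP[h _]|j _].
    by apply: normsq_le0; rewrite -(pmulr_rle0 _ c0).
  rewrite /y hf_suml (eq_bigr (fun i => v i * (\matrix_(i < n.+1, j < n) br (iter i (shift l) x) (e j)) i j)).
    by rewrite hv normr0 expr0n.
  by move=> i _; rewrite hfZl mxE.
(* Applying the power n - i to y = 0, with i the first nonzero index, kills all later terms and
   leaves [v i] times the last vector of the chain. *)
have [i vi imin] := @arg_minnP _ i0 (fun i => v i != 0) (fun i : 'I_n.+1 => i : nat) vi0.
have := iter_shift0 l (n - i); rewrite -{1}y0 /y (bounded_op_sum _ _ _ (iter_shift_bounded l (n - i))).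
rewrite (bigD1 i)//= (bounded_opZ _ _ (iter_shift_bounded l _)) -iterD subnK; last by rewrite -ltnS.
rewrite big1 ?addr0 => [/eqP|j ji]; first by rewrite scaler_eq0 (negbTE vi) (negbTE xn).
rewrite (bounded_opZ _ _ (iter_shift_bounded l _)) -iterD.
have [->|vj] := eqVneq (v j) 0; first by rewrite scale0r.
have ij : (i < j)%N by rewrite ltn_neqAle imin// andbT; apply: contra ji => /eqP/val_inj ->.
have le : (n.+1 <= n - i + j)%N.
  by rewrite -[leqLHS](_ : (n - i + i.+1 = n.+1)%N) ?leq_add2l// addnS subnK// -ltnS.
by rewrite (iter_shift_stable le hx) scaler0.
Qed.

Lemma root_stable l k x : 'Im l != 0 -> iter k (shift l) x = 0 -> iter n (shift l) x = 0.
Proof.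
move=> li; have [kn|nk] := leqP k n; first exact: iter_shift_stable.
rewrite -(subnK (ltnW nk)); elim: (k - n)%N => // m IH hx; apply: IH.
have := @root_chain l (iter m (shift l) x) li.
by rewrite -!iterD (addnC n m) (_ : n.+1 + m = m.+1 + n)%N; [apply|rewrite !addSn addnC].
Qed.

(** [codim_bounded_below], used k times, bounds the power below where the functionals
    [br (iter i (shift l) x) (e j)] with i < k vanish, so its range is closed; what is orthogonal to
    the range is annihilated by the power at conj l. *)
Lemma iter_shift_range l k y : 'Im l != 0 -> (forall u, iter k (shift l^*) u = 0 -> br y u = 0) ->
  exists x, y = iter k (shift l) x.
Proof.
move=> li hy; have [c c0 hc] := codim_bounded_below (graph_selfadjoint Kr Asa) Kr me li.
have [b b0 hb] := krein_bound Kr.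
pose T := [set p : K * K | p.2 = iter k (shift l) p.1].
have kb := iter_shift_bounded l k; have [_ [M M0 hM]] := (bounded_opP _).1 kb.
have TS : gsub T.
  split; first by rewrite /T /= iter_shift0.
  by move=> a x y' x' y''; rewrite /T /= => -> ->; rewrite (bounded_op_linear _ _ _ kb).
have Tc : gclosed T.
  move=> x z h; apply/eqP; rewrite -subr_eq0; apply/eqP; apply: eps_zero => r r0 /=.
  have M1 : 0 < 1 + M by rewrite addr_gt0.
  have [x' [z' [Tz hx hz]]] := h _ (divr_gt0 r0 M1); rewrite (Tz : z' = _) /= in hz.
  rewrite -(subrK (iter k (shift l) x') z) -addrA -(bounded_opB _ _ kb) (le_trans (ler_normD _ _))//.
  rewrite [r](_ : _ = r / (1 + M) + M * (r / (1 + M))); last by field; rewrite gt_eqF.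
  by rewrite lerD ?(ltW hz)// (le_trans (hM _))// ler_pM2l// distrC ltW.
pose s := [seq (fun x => br (iter i (shift l) x) (e j)) | i <- iota 0 k, j <- enum 'I_n].
have hs f : f \in s -> (forall (a : C) (x y : K), f (a *: x + y) = a * f x + f y) /\
      exists2 b : C, 0 < b & forall x, `|f x| <= b * `|x|.
  move=> /allpairsP[[i j] [_ _ ->]] /=; have ib := iter_shift_bounded l i.
  have [_ [m m0 hm]] := (bounded_opP _).1 ib.
  split; first by move=> a x z; rewrite (bounded_op_linear _ _ _ ib) hfDl hfZl.
  exists (b * m * (1 + `|e j|)); first by rewrite !mulr_gt0// ltr_pwDl.
  move=> x; rewrite (le_trans (hb _ _))// (_ : b * m * _ * _ = b * (m * `|x|) * (1 + `|e j|)); last by ring.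
  by rewrite ler_pM ?mulr_ge0 ?(ltW b0) ?lerDr// ler_pM2l.
have low x : (forall i, (i < k)%N -> forall j, br (iter i (shift l) x) (e j) = 0) ->
    `|x| <= c ^+ k * `|iter k (shift l) x|.
  elim: (k) => [|i IH] hx; first by rewrite expr0 mul1r.
  have IHx : `|x| <= c ^+ i * `|iter i (shift l) x| by apply: IH => m mi; apply: hx; exact: leqW.
  rewrite (le_trans IHx)// exprSr -mulrA ler_pM2l ?exprn_gt0//; apply: hc; last by move=> j; exact: hx.
  by rewrite /graph /= /shift subrK.
pose V := [set z | exists x, T (x, z)].
have VS : subspace V.
  split; first by exists 0; exact: TS.1.
  by move=> a w w' [x h] [x' h']; exists (a *: x + x'); exact: TS.2.
have Vc : closed V.
  apply/closedE => w hw; apply: (finite_codim_range_closed hs TS Tc (exprn_gt0 k c0)).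
    move=> x z; rewrite {1}/T /= => -> hf; apply: low => i ik j; apply: (hf (fun x => br (iter i (shift l) x) (e j))).
    by apply/allpairsP; exists (i, j); split; rewrite ?mem_iota ?mem_enum.
  by move=> r /hw[w' [x Tx] wr]; exists x, w'.
apply: contrapT => ny; have [|u yu hu] := separating_vector Kr me VS Vc (x0 := y).
  by move=> [x xy]; apply: ny; exists x.
move/eqP: yu; apply; apply: hy; apply: (krein_nondeg Kr) => x.
by rewrite hfC -iter_shift_sym (hu (iter k (shift l) x)) ?conjC0//; exists x.
Qed.

(** Orthogonality puts [x] in the range of the n-th power, and stability of the kernels makes range
    and kernel of that power meet only in 0. *)
Lemma root_nondeg l x : 'Im l != 0 -> iter n (shift l) x = 0 ->
  (forall u, iter n (shift l^*) u = 0 -> br x u = 0) -> x = 0.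
Proof.
move=> li hx /(iter_shift_range li)[w xw].
by rewrite xw; apply: (@root_stable _ (n + n)) => //; rewrite iterD -xw.
Qed.

(** A biorthogonal pair of maximal size: if [X] did not span the root subspace, nondegeneracy of the
    pairing with the root subspace at conj l would enlarge the pair. *)
Lemma root_dual l : 'Im l != 0 -> exists m (X X' : 'I_m -> K),
  [/\ forall i, iter n (shift l) (X i) = 0, forall i, iter n (shift l^*) (X' i) = 0,
      forall x, iter n (shift l) x = 0 -> x = \sum_i br x (X' i) *: X i &
      forall i j, br (X i) (X' j) = (i == j)%:R].
Proof.
move=> li; have lci : 'Im l^* != 0 by rewrite Im_conj oppr_eq0.
pose P m := `[< exists (X X' : 'I_m -> K), [/\ forall i, iter n (shift l) (X i) = 0,
  forall i, iter n (shift l^*) (X' i) = 0 & forall i j, br (X i) (X' j) = (i == j)%:R] >].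
have P0 : exists m, P m by exists 0%N; apply/asboolP; exists (fun=> 0), (fun=> 0); split=> -[].
have Pn m : P m -> (m <= n)%N.
  move=> /asboolP[X [X' [hX hX' d]]].
  (* Both root subspaces are neutral, so these vectors pair to -1/2 - 1/2 = -1 on the diagonal: the
     pair yields a negative system. *)
  apply: (maxneg_le me (f := fun i => X i - 2^-1 *: X' i)) => i j.
  have c2 : (2^-1 : C)^* = 2^-1 by apply: conj_Creal; rewrite rpredV realn.
  rewrite hfBl !hfBr !hfZl !hfZr c2 (root_neutral li (hX i) (hX j)) (root_neutral lci (hX' i) (hX' j)).
  rewrite d [br (X' i) _]hfC d eq_sym; case: (_ == _); by rewrite /= ?conjC1 ?conjC0; field.
case: (ex_maxnP P0 Pn) => m /asboolP[X [X' [hX hX' d]]] mmax.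
exists m, X, X'; split=> // x hx.
apply/eqP; rewrite -subr_eq0; apply: contraT => r0; set r := _ - _ in r0.
have rX' j : br r (X' j) = 0.
  rewrite /r hfBl hf_suml (bigD1 j)//= hfZl d eqxx mulr1 big1 ?addr0 ?subrr// => i ij.
  by rewrite hfZl d (negbTE ij) mulr0.
have lb := iter_shift_bounded l n; have lcb := iter_shift_bounded l^* n.
have hr : iter n (shift l) r = 0.
  rewrite /r (bounded_opB _ _ lb) hx (bounded_op_sum _ _ _ lb) big1 ?subr0// => i _.
  by rewrite (bounded_opZ _ _ lb) hX scaler0.
have [u hu ru] : exists2 u, iter n (shift l^*) u = 0 & br r u != 0.
  apply: contrapT => h; move/eqP: r0; apply; apply: (root_nondeg li hr) => u hu.
  by apply/eqP; apply: contraT => ru; case: h; exists u.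
pose u' := u - \sum_i br u (X i) *: X' i.
have hu' : iter n (shift l^*) u' = 0.
  rewrite /u' (bounded_opB _ _ lcb) hu (bounded_op_sum _ _ _ lcb) big1 ?subr0// => i _.
  by rewrite (bounded_opZ _ _ lcb) hX' scaler0.
have Xu' j : br (X j) u' = 0.
  rewrite /u' hfBr hf_sumr (bigD1 j)//= hfZr d eqxx mulr1 big1 ?addr0 => [|i ij].
    by rewrite -hfC subrr.
  by rewrite hfZr d eq_sym (negbTE ij) mulr0.
have ru' : br r u' = br r u.
  by rewrite /u' hfBr hf_sumr big1 ?subr0// => i _; rewrite hfZr rX' mulr0.
suff /mmax : P m.+1 by rewrite ltnn.
apply/asboolP; exists (fun i => if unlift ord_max i is Some j then X j else (br r u)^-1 *: r),
  (fun i => if unlift ord_max i is Some j then X' j else u'); split.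
- by move=> i; case: unliftP => [j _|_]; rewrite ?hX// (bounded_opZ _ _ lb) hr scaler0.
- by move=> i; case: unliftP => [j _|_].
- move=> i j; case: unliftP => [i' ->|->]; case: unliftP => [j' ->|->].
  + by rewrite d (inj_eq lift_inj).
  + by rewrite Xu' eq_sym (negbTE (neq_lift _ _)).
  + by rewrite hfZl rX' mulr0 (negbTE (neq_lift _ _)).
  + by rewrite hfZl ru' mulVf// eqxx.
Qed.

(* [E] projects onto the root subspace along the range of the [n]-th power, and
   [A1] agrees with [A] on that range but has [l] in its resolvent set. *)
Lemma root_splitting l : 'Im l != 0 -> exists (E A1 : K -> K),
  [/\ bounded_op E, (forall x, iter n (shift l) (E x) = 0) /\ (forall x, E (shift l x) = shift l (E x)),
      forall x, E (A1 x) = (1 + l) *: E x, forall x, E x = 0 -> A1 x = A x &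
      (forall x, E (E x) = E x) /\ exists S, rel_resolvent (graph A1) l S].
Proof.
move=> li; have [m [X [X' [hX hX' span d]]]] := root_dual li.
have [b b0 hb] := krein_bound Kr; have lb := iter_shift_bounded l n.
have sb := shift_bounded l.
pose E x := \sum_i br x (X' i) *: X i.
have Eb : bounded_op E.
  apply/bounded_opP; split.
    move=> a x y; rewrite /E scaler_sumr -big_split; apply: eq_bigr => i _ /=.
    by rewrite hfDl hfZl scalerDl scalerA.
  exists (1 + \sum_i b * `|X' i| * `|X i|).
    by rewrite ltr_pwDl// sumr_ge0// => i _; rewrite !mulr_ge0// ltW.
  move=> x; apply: (@le_trans _ _ ((\sum_i b * `|X' i| * `|X i|) * `|x|)); last by rewrite ler_wpM2r// lerDr.
  rewrite mulr_suml (le_trans (ler_norm_sum _ _ _))// ler_sum// => i _.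
  by rewrite normrZ mulrAC ler_wpM2r// mulrAC.
have ker x : iter n (shift l) (E x) = 0.
  rewrite /E (bounded_op_sum _ _ _ lb) big1// => i _.
  by rewrite (bounded_opZ _ _ lb) hX scaler0.
have EX' x j : br (E x) (X' j) = br x (X' j).
  rewrite /E hf_suml (bigD1 j)//= hfZl d eqxx mulr1 big1 ?addr0// => i ij.
  by rewrite hfZl d (negbTE ij) mulr0.
have EE x : E (E x) = E x by apply: eq_bigr => i _; rewrite EX'.
have E0 x : (forall i, br x (X' i) = 0) -> E x = 0.
  by move=> h; rewrite /E big1// => i _; rewrite h scale0r.
have Eout x : E (x - E x) = 0 by rewrite (bounded_opB _ _ Eb) EE subrr.
have X'out x i : E x = 0 -> br x (X' i) = 0 by rewrite -EX' => ->; rewrite hf0l.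
have X'all u : iter n (shift l^*) u = 0 -> forall x, E x = 0 -> br x u = 0.
  move=> hu x Ex; pose r := u - \sum_i br u (X i) *: X' i.
  have lcb := iter_shift_bounded l^* n.
  have -> : u = \sum_i br u (X i) *: X' i.
    apply/eqP; rewrite -subr_eq0; apply/eqP; apply: (@root_nondeg l^*).
    - by rewrite Im_conj oppr_eq0.
    - rewrite (bounded_opB _ _ lcb) hu (bounded_op_sum _ _ _ lcb) big1 ?subr0// => i _.
      by rewrite (bounded_opZ _ _ lcb) hX' scaler0.
    move=> y; rewrite conjCK => /span ->; rewrite hf_sumr big1// => i _.
    rewrite hfZr hfBl hf_suml (bigD1 i)//= hfZl [br (X' i) _]hfC d eqxx conjC1 mulr1 big1 ?addr0.
      by rewrite subrr mulr0.
    by move=> j ji; rewrite hfZl [br (X' j) _]hfC d eq_sym (negbTE ji) conjC0 mulr0.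
  by rewrite hf_sumr big1// => i _; rewrite hfZr X'out// mulr0.
have Eshift x : E x = 0 -> E (shift l x) = 0.
  move=> Ex; apply: E0 => i; rewrite shift_sym; apply: X'all => //.
  by rewrite -iterSr; apply: (@iter_shift_stable _ n) => //; exact: leqnSn.
have comm x : E (shift l x) = shift l (E x).
  rewrite -{1}(subrK (E x) x) (bounded_opD _ _ sb) (bounded_opD _ _ Eb) Eshift// add0r.
  by apply/esym/span; rewrite -iterSr; apply: (@iter_shift_stable _ n) => //; exact: leqnSn.
(* A1 - l is A - l on the kernel of [E] and the identity on its range. *)
pose A1 x := shift l (x - E x) + E x + l *: x.
have A1b : bounded_op A1.
  apply: bounded_op_add; last exact: bounded_op_scale (@bounded_op_id _ K).
  apply: bounded_op_add => //; apply: (bounded_op_comp sb).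
  exact: (bounded_op_sub (@bounded_op_id _ K)).
have EA1 x : E (A1 x - l *: x) = E x.
  by rewrite /A1 addrK (bounded_opD _ _ Eb) Eshift// add0r.
exists E, A1; split=> //.
- by move=> x; rewrite -[A1 x](subrK (l *: x)) (bounded_opD _ _ Eb) EA1 (bounded_opZ _ _ Eb) scalerDl scale1r.
- by move=> x Ex; rewrite /A1 Ex subr0 addr0 /shift subrK.
split=> //.
pose T := [set p : K * K | p.2 = A1 p.1 - l *: p.1].
have A2b : bounded_op (fun x => A1 x - l *: x).
  exact: bounded_op_sub A1b (bounded_op_scale l (@bounded_op_id _ K)).
have [c c0 hc] := codim_bounded_below (graph_selfadjoint Kr Asa) Kr me li.
have TS : gsub T.
  split; first by rewrite /T /= (bounded_op0 A1b) scaler0 subrr.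
  by move=> a x y x' y'; rewrite /T /= => -> ->; rewrite -(bounded_op_linear _ _ _ A2b).
have Tc : gclosed T.
  have [_ [M M0 hM]] := (bounded_opP _).1 A2b.
  move=> x z h; apply/eqP; rewrite -subr_eq0; apply/eqP; apply: eps_zero => r r0 /=.
  have M1 : 0 < 1 + M by rewrite addr_gt0.
  have [x' [z' [Tz hx hz]]] := h _ (divr_gt0 r0 M1); rewrite (Tz : z' = _) /= in hz.
  rewrite -(subrK (A1 x' - l *: x') z) -addrA -(bounded_opB _ _ A2b) (le_trans (ler_normD _ _))//.
  rewrite [r](_ : _ = r / (1 + M) + M * (r / (1 + M))); last by field; rewrite gt_eqF.
  by rewrite lerD ?(ltW hz)// (le_trans (hM _))// ler_pM2l// distrC ltW.
pose s := [seq (fun x => br x (e i)) | i <- enum 'I_n] ++ [seq (fun x => br x (X' i)) | i <- enum 'I_m].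
have hs f : f \in s -> (forall (a : C) (x y : K), f (a *: x + y) = a * f x + f y) /\
      exists2 b : C, 0 < b & forall x, `|f x| <= b * `|x|.
  have aux u : (forall (a : C) (x y : K), br (a *: x + y) u = a * br x u + br y u) /\
      exists2 b : C, 0 < b & forall x, `|br x u| <= b * `|x|.
    split; first by move=> a x y; rewrite hfDl hfZl.
    exists (b * (1 + `|u|)); first by rewrite mulr_gt0// ltr_pwDl.
    by move=> x; rewrite (le_trans (hb _ _))// mulrAC ler_wpM2r// ler_pM2l// lerDr.
  by rewrite mem_cat => /orP[] /mapP[i _ ->].
have inj x : T (x, 0) -> x = 0.
  rewrite /T /= => /esym h; have Ex : E x = 0 by rewrite -EA1 h (bounded_op0 Eb).
  move: h; rewrite /A1 Ex subr0 addr0 addrK => h; rewrite -Ex; apply: span.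
  exact: (@root_stable _ 1).
have [c1 c10 hc1] : exists2 c' : C, 0 < c' & forall x y, T (x, y) -> `|x| <= c' * `|y|.
  apply: (finite_codim_bounded_below hs TS Tc c0) => // x y; rewrite /T /= => -> hf.
  have Ex : E x = 0.
    apply: E0 => i; apply: (hf (fun x => br x (X' i))).
    by rewrite mem_cat; apply/orP; right; apply/mapP; exists i; rewrite ?mem_enum.
  apply: hc => [|i]; last first.
    by apply: (hf (fun x => br x (e i))); rewrite mem_cat; apply/orP; left; apply/mapP; exists i; rewrite ?mem_enum.
  by rewrite /graph /= subrK /A1 Ex subr0 addr0 /shift subrK.
have sur y : exists x, T (x, y).
  (* One power more than n, so that after undoing a single [shift l] the preimage [w'] still lies in
     the kernel of [E]. *)
  have [|w hw] := @iter_shift_range l n.+1 (y - E y) li.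
    by move=> u hu; apply: (X'all _ _ _ (Eout y)); apply: root_stable hu; rewrite Im_conj oppr_eq0.
  pose w' := iter n (shift l) w.
  have Ew' : E w' = 0 by apply: E0 => i; rewrite iter_shift_sym hX' hf0r.
  exists (w' + E y); rewrite /T /A1 /= addrK (bounded_opD _ _ Eb) Ew' EE add0r addrK.
  by rewrite -/w' -iterS -hw subrK.
have [S hS] := choice sur; exists S; apply/graph_resolventP; split.
- apply/bounded_opP; split; last by exists c1 => // y; exact: hc1.
  move=> a x y; apply/eqP; rewrite -subr_eq0; apply/eqP/inj.
  rewrite -(subrr (a *: x + y)); apply: (gsubB TS) => //; exact: TS.2.
- by move=> x; have := hS x; rewrite /T /= => <-.
- move=> x; apply/eqP; rewrite -subr_eq0; apply/eqP/inj.
  rewrite -(subrr (A1 x - l *: x)); exact: (gsubB TS).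
Qed.

(** On the kernel of [E] the resolvent of [A] is the holomorphic resolvent of [A1]; on the root
    subspace it is a polynomial of degree at most n in 1 / (w - l), cleared by the power. *)
Lemma resolvent_meromorphic (H : completeNormedModType C) (Phi : K -> H) (Psi : H -> K) l :
  'Im l != 0 -> bounded_op Phi -> bounded_op Psi ->
  exists (U : set C) (G : C -> H -> H), [/\ open U, U l, holomorphic_on U G &
    forall w S, U w -> w != l -> rel_resolvent (graph A) w S ->
      forall h, (w - l) ^+ n *: Phi (S (Psi h)) = G w h].
Proof.
move=> li Pb Qb; have [E [A1 [Eb [ker comm] EA1 A1E [EE [S0 hS0]]]]] := root_splitting li.
have [_ [c c0 hc]] := (bounded_opP S0).1 hS0.1.
have c1 : 0 < 1 + c by rewrite addr_gt0.
(* On this disc |w - l| c < 1, so [A1] keeps its resolvent; moreover w - l is never 1, which is what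
   makes [E] annihilate the [A1] part [y] below. *)
pose U := [set w : C | `|w - l| < (1 + c)^-1].
have Uo : open U.
  apply/open_CP => w Uw; exists ((1 + c)^-1 - `|w - l|); first by rewrite subr_gt0.
  move=> w' hw'; rewrite /U /= -(subrK w w') -addrA (le_lt_trans (ler_normD _ _))//.
  by rewrite -ltrBrDr.
have /choice[S1 hS1] : forall w, exists S1, U w -> rel_resolvent (graph A1) w S1.
  move=> w; case: (pselect (U w)) => [Uw|]; last by exists id.
  have [|S1 h] := resolvent_open (w := w) hS0 c0 hc; last by exists S1.
  rewrite (@le_lt_trans _ _ (c / (1 + c)))//; last by rewrite ltr_pdivrMr// mul1r ltrDr.
  by rewrite mulrC ler_pM2l// ltW.
have hG1 : holomorphic_on U (fun w h => Phi (S1 w (Psi h - E (Psi h)))).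
  apply: (@holomorphic_resolvent _ _ _ U (graph A1) S1 Phi (fun h => Psi h - E (Psi h))) => //.
  by apply: bounded_op_sub => //; exact: bounded_op_comp.
have hG2 (j : 'I_n) : holomorphic_on U (fun w h => (w - l) ^+ (n.-1 - j) *: ((-1) *: Phi (iter j (shift l) (E (Psi h))))).
  apply: (@holomorphic_pow _ _ _ (fun w h => (-1) *: Phi (iter j (shift l) (E (Psi h))))).
  apply: holomorphic_cst; apply: bounded_op_scale; apply: (bounded_op_comp Pb).
  by apply: (bounded_op_comp (iter_shift_bounded l j)); exact: bounded_op_comp.
exists U, (fun w h => (w - l) ^+ n *: Phi (S1 w (Psi h - E (Psi h))) +
   \sum_(j < n) (w - l) ^+ (n.-1 - j) *: ((-1) *: Phi (iter j (shift l) (E (Psi h))))); split=> //.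
- by rewrite /U /= subrr normr0 invr_gt0.
- apply: holomorphic_add; first exact: holomorphic_pow.
  by apply: holomorphic_sum => j; exact: hG2.
move=> w S Uw wl /graph_resolventP[Sb hS hS'] h; set x := Psi h; set u := w - l.
have u1 : u != 1.
  apply/eqP => u1; have h1 : (1 + c)^-1 <= 1 by rewrite invf_le1// lerDl ltW.
  by move: Uw; rewrite /U /= -/u u1 normr1 => /lt_le_trans/(_ h1); rewrite ltxx.
pose y := S1 w (x - E x); have /graph_resolventP[_ h1 _] := hS1 w Uw.
have A1y : A1 y - w *: y = x - E x by rewrite h1.
have Ey : E y = 0.
  have := congr1 E A1y; rewrite (bounded_opB _ _ Eb) EA1 (bounded_opZ _ _ Eb) -scalerBl.
  rewrite (bounded_opB _ _ Eb) EE subrr => /eqP; rewrite scaler_eq0 => /orP[|/eqP//].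
  by rewrite (_ : 1 + l - w = - (u - 1)) ?oppr_eq0 ?subr_eq0 ?(negbTE u1)// /u; ring.
have Ay : A y - w *: y = x - E x by rewrite -A1E.
(* The finite Neumann series of the nilpotent part, already multiplied by u^n; applying A - w
   telescopes because the n-th power annihilates [E x]. *)
pose Y := \sum_(j < n) u ^+ (n.-1 - j) *: - iter j (shift l) (E x).
have sw z : A z - w *: z = shift l z - u *: z by rewrite /shift /u scalerBl opprB addrA subrK.
have AY : A Y - w *: Y = u ^+ n *: E x.
  rewrite sw /Y (bounded_op_sum _ _ _ (shift_bounded l)) scaler_sumr -sumrB.
  pose f j := u ^+ (n - j) *: iter j (shift l) (E x).
  rewrite (eq_bigr (fun j : 'I_n => f j - f j.+1)); last first.
    move=> j _; rewrite /f (bounded_opZ _ _ (shift_bounded l)) (bounded_opN _ (shift_bounded l)) -iterS.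
    rewrite !scalerN opprK addrC scalerA -exprS; congr (u ^+ _ *: _ - u ^+ _ *: _).
      by rewrite -subn1 subnAC subn1 prednK// subn_gt0.
    by rewrite subnS -subn1 subnAC subn1.
  rewrite -(big_mkord xpredT (fun j => f j - f j.+1)).
  rewrite (eq_bigr (fun j => (- f j.+1) - (- f j))); last by move=> j _; rewrite opprK addrC.
  rewrite (telescope_sumr (fun j => - f j) (leq0n n)).
  by rewrite /f subn0 subnn ker scaler0 oppr0 opprK add0r.
have -> : u ^+ n *: Phi (S x) = Phi (S (u ^+ n *: x)) by rewrite (bounded_opZ _ _ Sb) (bounded_opZ _ _ Pb).
have -> : u ^+ n *: x = A (u ^+ n *: y + Y) - w *: (u ^+ n *: y + Y).
  rewrite (bounded_opD _ _ Ab) (bounded_opZ _ _ Ab) scalerDr opprD addrACA AY.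
  by rewrite scalerA [w * _]mulrC -scalerA -scalerBr Ay scalerBr subrK.
rewrite hS' (bounded_opD _ _ Pb) (bounded_opZ _ _ Pb) (bounded_op_sum _ _ _ Pb).
congr (_ + _); apply: eq_bigr => j _.
by rewrite (bounded_opZ _ _ Pb) (bounded_opN _ Pb) scaleN1r.
Qed.
End RootSpaces.

(** * Moments and resolvents generate the same closed subspace *)

Section Totality.
Variable R : realType.
Local Notation C := (Cplx R).

Lemma avoid_list (T : eqType) (t : nat -> T) (s : seq T) : injective t -> exists k, t k \notin s.
Proof.
move=> ti; apply: contrapT => h.
have : (size [seq t k | k <- iota 0 (size s).+1] <= size s)%N.
  apply: uniq_leq_size; first by rewrite map_inj_uniq// iota_uniq.
  by move=> x /mapP[k _ ->]; apply: contrapT => /negP hk; apply: h; exists k.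
by rewrite size_map size_iota ltnn.
Qed.

Lemma avoid_verticals (s : seq C) (z d : C) : 0 < d -> exists2 w : C, `|w - z| < d &
  'Im w != 0 /\ forall l, l \in s -> 'Re l != 'Re w.
Proof.
move=> d0; have [w [wz _ wi _]] := dense_avoid [::] z (pos_half d0).
pose t (k : nat) : C := d / 2 / k.+1%:R.
have tr k : t k \is Num.real by rewrite gtr0_real// divr_gt0// pos_half.
have ti : injective (fun k => 'Re w + t k).
  move=> k l /addrI/(mulfI (lt0r_neq0 (pos_half d0)))/invr_inj/eqP.
  by rewrite eqr_nat eqSS => /eqP.
have [k hk] := avoid_list [seq 'Re l | l <- s] ti; exists (w + t k).
  rewrite addrAC (le_lt_trans (ler_normD _ _))// [ltRHS]splitr ltr_leD// gtr0_norm ?divr_gt0 ?pos_half//.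
  by rewrite ler_piMr ?(ltW (pos_half d0))// invf_le1// ler1n.
split; first by rewrite raddfD /= [X in _ + X](Creal_ImP _ (tr k)) addr0.
move=> l ls; apply: contra hk => /eqP; rewrite raddfD /= (Creal_ReP _ (tr k)) => <-.
by apply/mapP; exists l.
Qed.

Section OneOperator.
Variables (K : completeNormedModType C) (A : K -> K).
Hypothesis Ab : bounded_op A.

(** The iterates of v |-> u + T v starting at 0 stay in [W] and converge to [x]. *)
Lemma contraction_closed (W : set K) (T : K -> K) (q : C) u x : bounded_op T -> 0 <= q -> q < 1 ->
  (forall x, `|T x| <= q * `|x|) -> subspace W -> closed W -> (forall v, W v -> W (T v)) -> W u ->
  x = u + T x -> W x.
Proof.
move=> Tb q0 q1 hT WS Wc TW Wu xE.
have approx k : exists2 v, W v & `|x - v| <= q ^+ k * `|x|.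
  elim: k => [|k [v Wv hv]]; first by exists 0; rewrite ?subr0 ?expr0 ?mul1r//; exact: WS.1.
  exists (u + T v); first by apply: subspaceD => //; exact: TW.
  rewrite {1}xE opprD addrACA subrr add0r -(bounded_opB _ _ Tb) (le_trans (hT _))//.
  by rewrite exprS -mulrA ler_wpM2l.
move/closedE: Wc; apply => e e0; have x1 : 0 < 1 + `|x| by rewrite ltr_pwDl.
have [N hN] := expr_lt q0 q1 (divr_gt0 e0 x1); have [v Wv hv] := approx N; exists v => //.
have := hN N (leqnn N); rewrite ltr_pdivlMr// => h; rewrite (le_lt_trans hv)// (le_lt_trans _ h)//.
by rewrite ler_wpM2l ?exprn_ge0// lerDr.
Qed.

(** -z (A - z)^-1 y tends to y as z grows, and (A - z)^-1 A y = y + z (A - z)^-1 y passes the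
    property from y to A y. *)
Lemma moments_of_resolvents (W Z : set K) (U : set C) : subspace W -> closed W ->
  (forall r : C, 0 < r -> exists2 z, U z & r < `|z|) ->
  (forall z S y, U z -> rel_resolvent (graph A) z S -> Z y -> W (S y)) ->
  forall k y, Z y -> W (iter k A y).
Proof.
move=> WS Wc Uu hW; have [_ [c c0 hc]] := (bounded_opP A).1 Ab.
have lim y : (forall z S, U z -> rel_resolvent (graph A) z S -> W (S y)) -> W y.
  move=> hy; move/closedE: Wc; apply => e e0.
  have r0 : 0 < c + c * (1 + `|y|) / e by rewrite addr_gt0// divr_gt0// mulr_gt0// ltr_pwDl.
  have [z Uz hz] := Uu _ r0.
  have cz : c < `|z| by rewrite (lt_trans _ hz)// ltrDl divr_gt0// mulr_gt0// ltr_pwDl.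
  have [S hS Sb] := resolvent_large Ab hc (ltW c0) cz.
  have z0 : 0 < `|z| - c by rewrite subr_gt0.
  exists (- (z *: S y)); first by rewrite -scaleNr; apply: (subspaceZ _ WS); exact: hy hS.
  have /graph_resolventP[_ h1 _] := hS; rewrite opprK -{1}(h1 y) subrK.
  rewrite (le_lt_trans (hc _))// (@le_lt_trans _ _ (c * (1 + `|y|) / (`|z| - c)))//.
    by rewrite -mulrA ler_pM2l// (le_trans (Sb _))// ler_wpM2r ?invr_ge0 ?(ltW z0)// lerDr.
  by rewrite ltr_pdivrMr// -ltr_pdivrMl// mulrC ltrBrDl.
have main k y : (forall z S, U z -> rel_resolvent (graph A) z S -> W (S y)) -> W (iter k A y).
  elim: k y => [|k IH] y hy; first exact: lim.
  rewrite iterSr; apply: IH => z S Uz hS; have /graph_resolventP[Sb _ h2] := hS.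
  have -> : S (A y) = y + z *: S y by rewrite -{2}(h2 y) (bounded_opB _ _ Sb) (bounded_opZ _ _ Sb) subrK.
  apply: (subspaceD WS); first exact: lim.
  by apply: (subspaceZ _ WS); exact: hy hS.
by move=> k y Zy; apply: main => z S Uz hS; exact: hW hS Zy.
Qed.

Definition invariant_at (W : set K) (z : C) := exists2 S, rel_resolvent (graph A) z S & forall v, W v -> W (S v).

Lemma invariant_large (W : set K) : subspace W -> closed W -> (forall v, W v -> W (A v)) ->
  exists2 r : C, 0 < r & forall z, r < `|z| -> invariant_at W z.
Proof.
move=> WS Wc AW; have [_ [c c0 hc]] := (bounded_opP A).1 Ab; exists c => // z cz.
have [S hS _] := resolvent_large Ab hc (ltW c0) cz; exists S => // v Wv.
have z0 : 0 < `|z| by exact: lt_trans cz.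
have zn0 : z != 0 by rewrite -normr_gt0.
have /graph_resolventP[_ h1 _] := hS.
apply: (@contraction_closed W (fun x => z^-1 *: A x) (c / `|z|) (- (z^-1 *: v)) _) => //.
- exact: bounded_op_scale.
- by rewrite divr_ge0// ltW.
- by rewrite ltr_pdivrMr// mul1r.
- by move=> x; rewrite normrZ normfV mulrAC mulrC ler_wpM2r ?invr_ge0.
- by move=> x Wx; apply: (subspaceZ _ WS); exact: AW.
- by rewrite -scalerN -scaleN1r; do 2 apply: (subspaceZ _ WS).
by rewrite -{2}(h1 v) scalerBr opprB scalerA mulVf// scale1r subrK.
Qed.

Lemma invariant_near (W : set K) w S : subspace W -> closed W -> rel_resolvent (graph A) w S ->
  exists2 d : C, 0 < d & forall z z', `|z - w| < d -> `|z' - w| < d -> invariant_at W z -> invariant_at W z'.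
Proof.
move=> WS Wc hS; have [_ [c c0 hc]] := (bounded_opP S).1 hS.1.
have d0 : 0 < (8 * c)^-1 by rewrite invr_gt0 mulr_gt0.
(* Within this radius resolvents are bounded by 2 c and |z' - z| <= 1 / (4 c), so (z' - z) (A -
   z)^-1 contracts by 1/2. *)
exists (8 * c)^-1 => // z z' zw z'w [Sz hSz WSz].
have small u : `|u - w| < (8 * c)^-1 -> `|u - w| * c <= 2^-1.
  move=> h; apply: (@le_trans _ _ ((8 * c)^-1 * c)); first by rewrite ler_pM2r// ltW.
  by rewrite invfM divfK ?gt_eqF// lef_pV2 ?posrE ?ltr0n// ler_nat.
have [S' hS'] : exists S', rel_resolvent (graph A) z' S'.
  apply: (resolvent_open hS c0 hc); rewrite (le_lt_trans (small _ z'w))// invf_lt1// ltr1n//.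
have [hz _] := resolvent_near hS hSz c0 hc (small _ zw).
exists S' => // v Wv.
have q : `|z' - z| * (2 * c) <= 2^-1.
  have : `|z' - z| <= (8 * c)^-1 + (8 * c)^-1.
    rewrite -(subrK w z') -addrA (le_trans (ler_normD _ _))// lerD ?(ltW z'w)//.
    by rewrite distrC ltW.
  move=> /(ler_wpM2r (ltW (mulr_gt0 (ltr0Sn C 1) c0))) /le_trans; apply.
  by rewrite le_eqVlt; apply/predU1P; left; field; rewrite gt_eqF.
apply: (@contraction_closed W (fun x => (z' - z) *: Sz x) 2^-1 (Sz v)) => //.
- by apply: bounded_op_scale; exact: hSz.1.
- by rewrite invf_lt1// ltr1n.
- move=> x; rewrite normrZ (le_trans (ler_wpM2l _ (hz x)))// mulrA ler_wpM2r//.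
- by move=> x Wx; apply: (subspaceZ _ WS); exact: WSz.
- exact: WSz.
rewrite -opprB scaleNr -(resolvent_identity v hSz hS') opprB addrC subrK//.
Qed.

Section Pontryagin.
Variables (br : {hermitian K for false & conjC}) (n : nat) (e : 'I_n -> K).
Hypotheses (Kr : krein br) (me : maxneg br e) (Asa : selfadjoint_op br A).

(* The nonreal spectrum is finite, so almost every vertical ray from a nonreal
   point stays in the resolvent set; invariance is propagated along it from
   infinity. *)
Lemma resolvent_invariant (W : set K) w S v : subspace W -> closed W -> (forall v, W v -> W (A v)) ->
  rel_resolvent (graph A) w S -> W v -> W (S v).
Proof.
move=> WS Wc AW hS Wv; have gsa := graph_selfadjoint Kr Asa.
have [|s hs] := nonreal_resolvent gsa Kr me; first by exists w, S.
have [d d0 hd] := invariant_near WS Wc hS; have [r r0 hr] := invariant_large WS Wc AW.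
suff [z zw hz] : exists2 z, `|z - w| < d & invariant_at W z.
  have [|S' hS' hW] := hd z w zw _ hz; first by rewrite subrr normr0.
  by rewrite (rel_resolvent_unique hS hS'); exact: hW.
have [z zw [zi zs]] := avoid_verticals s w d0; exists z => //.
(* The sign that makes the ray leave the real axis, upward or downward. *)
have [sg [sg1 sgi]] : exists sg : C, (sg = 1 \/ sg = -1) /\ 0 < sg * 'Im z.
  have := Creal_Im z; rewrite realE => /orP[h|h]; [exists 1|exists (-1)].
    by split; [left|rewrite mul1r lt_def zi].
  by split; [right|rewrite mulN1r oppr_gt0 lt_def eq_sym zi].
have sgr : sg \is Num.real by case: sg1 => ->; rewrite ?rpredN ?rpred1.
have sgn : `|sg| = 1 by case: sg1 => ->; rewrite ?normrN normr1.
have sg2 : sg * sg = 1 by case: sg1 => ->; rewrite ?mulrNN mulr1.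
pose ray (t : C) := z + 'i * (sg * t).
have rayD t t' : `|ray t - ray t'| = `|t - t'|.
  by rewrite /ray opprD addrACA subrr add0r -mulrBr -mulrBr !normrM normCi sgn !mul1r.
have rayP t : 0 <= t -> exists S', rel_resolvent (graph A) (ray t) S'.
  move=> t0; have tr : sg * t \is Num.real by rewrite rpredM// ger0_real.
  apply: hs.
    rewrite raddfD /= ImMil (Creal_ReP _ tr); apply: contraTneq sgi => /(congr1 (fun x => sg * x)).
    rewrite mulrDr mulrA sg2 mul1r mulr0 => h; apply/negP => h0.
    by have := ltr_wpDr t0 h0; rewrite h ltxx.
  apply/negP => /zs; rewrite /ray raddfD /= ReMil (Creal_ImP _ tr) oppr0 addr0 eqxx//.
(* The parameters from which the rest of the ray is invariant. [invariant_near] at the infimum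
   extends invariance below it, so the infimum is 0 and is attained. *)
pose P := [set t : C | 0 <= t /\ forall t', t <= t' -> invariant_at W (ray t')].
have [||m [mr mP mi]] := @exists_infimum _ _ P id 0 _ (real0 _).
- exists (r + `|z| + 1); split=> [|t' tt']; first by rewrite !addr_ge0// ltW.
  have t'0 : 0 <= t' by rewrite (le_trans _ tt')// !addr_ge0// ltW.
  apply: hr; rewrite -(ltrD2r `|z|); apply: (@lt_le_trans _ _ t').
    by rewrite (lt_le_trans _ tt')// ltrDl.
  rewrite -[X in X <= _](ger0_norm t'0) -[t' in leLHS]subr0 -rayD.
  rewrite (_ : ray 0 = z); last by rewrite /ray mulr0 mulr0 addr0.
  exact: ler_normB.
- by move=> t [].
have m0 : 0 <= m.
  by rewrite real_leNgt ?real0//; apply/negP; rewrite -oppr_gt0 => /mi[t [t0 _]]; rewrite subrr => /(le_lt_trans t0); rewrite ltxx.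
have [S' hS'] := rayP m m0; have [d' d'0 hd'] := invariant_near WS Wc hS'.
have [t [t0 Pt] tm] := mi d' d'0.
have mt : m <= t by apply: mP.
have near t' : 0 <= t' -> `|t' - m| < d' -> invariant_at W (ray t').
  move=> t'0 t'm; apply: (hd' (ray t)); rewrite ?rayD//; last exact: Pt.
  by rewrite ger0_norm ?subr_ge0// ltrBlDl.
suff mE : m = 0.
  by have := near 0 (lexx _); rewrite mE subrr normr0 /ray !mulr0 addr0; apply.
apply/eqP; apply: contraT => mn0; have mp : 0 < m by rewrite lt_def mn0.
have [|q q0 hq] := @pos_lower _ [:: m; d' / 2].
  by move=> x; rewrite !inE => /orP[] /eqP ->//; exact: pos_half.
have qm : q <= m by rewrite hq ?inE ?eqxx.
have qd : q < d' by rewrite (le_lt_trans (hq (d' / 2) _)) ?inE ?eqxx ?orbT// ltr_pdivrMr// ltr_pMr// ltr1n.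
have : P (m - q).
  split=> [|t' tt']; first by rewrite subr_ge0.
  have t'0 : 0 <= t' by rewrite (le_trans _ tt')// subr_ge0.
  have [tt|tt] := real_leP (ger0_real t0) (ger0_real t'0); first exact: Pt.
  apply: near => //; rewrite real_ltr_norml ?rpredB ?ger0_real//; apply/andP; split.
    by rewrite ltrBrDr (lt_le_trans _ tt')// addrC ltrD2l ltrN2.
  by rewrite ltrBlDl (lt_trans tt).
by move=> /mP; rewrite /= lerDl oppr_ge0 => /(lt_le_trans q0); rewrite ltxx.
Qed.

Lemma iter_span_invariant (Z : set K) (W := closure (lin_span [set x | exists k y, Z y /\ x = iter k A y])) :
  forall v, W v -> W (A v).
Proof.
move=> v /closureE hv; have [_ [c c0 hc]] := (bounded_opP A).1 Ab; apply/closureE => d d0.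
have [u [k [a [f [hf ->]]]] hu] := hv _ (divr_gt0 d0 c0).
exists (A (\sum_i a i *: f i)); last first.
  by rewrite -(bounded_opB _ _ Ab) (le_lt_trans (hc _))// -ltr_pdivlMl// mulrC.
exists k, a, (fun i => A (f i)); split; last first.
  by rewrite (bounded_op_sum _ _ _ Ab); apply: eq_bigr => i _; rewrite (bounded_opZ _ _ Ab).
by move=> i; have [m [y [Zy ->]]] := hf i; exists m.+1, y.
Qed.

(** Moments are recovered from resolvents near infinity, so the points may be confined to any
    unbounded set, such as the upper half-plane. *)
Lemma resolvents_total (Z : set K) (U : set C) :
  closure (lin_span [set x | exists k y, Z y /\ x = iter k A y]) = setT ->
  (forall r : C, 0 < r -> exists2 z, U z & r < `|z|) ->
  closure (lin_span [set x | exists z S y, [/\ U z, rel_resolvent (graph A) z S, Z y & x = S y]]) = setT.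
Proof.
move=> mom Uu; set Y := [set x | exists z S y, _]; set W := closure (lin_span Y).
have WS : subspace W by apply: closure_subspace; exact: subspace_lin_span.
have Wc : closed W by exact: closed_closure.
have sub : Y `<=` W.
  move=> x Yx; apply: subset_closure; exists 1%N, (fun=> 1), (fun=> x); split=> //.
  by rewrite big_ord1 scale1r.
have mW k y : Z y -> W (iter k A y).
  by apply: (@moments_of_resolvents W Z U) => // z S y' Uz hS Zy; apply: sub; exists z, S, y'.
apply/seteqP; split=> // x _; have : closure (lin_span [set x | exists k y, Z y /\ x = iter k A y]) x by rewrite mom.
suff /closureS : lin_span [set x | exists k y, Z y /\ x = iter k A y] `<=` W.
  by move=> /[apply] h; rewrite -(closure_id _).1 in h.
by apply: lin_span_subspace => // y [k [z [Zz ->]]]; exact: mW.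
Qed.

Lemma moments_total (Z : set K) :
  closure (lin_span [set x | exists z S y, rel_resolvent (graph A) z S /\ Z y /\ x = S y]) = setT ->
  closure (lin_span [set x | exists k y, Z y /\ x = iter k A y]) = setT.
Proof.
move=> tot; set W := closure (lin_span [set x | exists k y, _]).
have WS : subspace W by apply: closure_subspace; exact: subspace_lin_span.
have Wc : closed W by exact: closed_closure.
have AW : forall v, W v -> W (A v) by exact: iter_span_invariant.
have ZW y : Z y -> W y.
  move=> Zy; apply: subset_closure; exists 1%N, (fun=> 1), (fun=> y); split=> [_|].
    by exists 0%N, y.
  by rewrite big_ord1 scale1r.
apply/seteqP; split=> // x _; have : closure (lin_span [set x | exists z S y, rel_resolvent (graph A) z S /\ Z y /\ x = S y]) x by rewrite tot.
suff /closureS : lin_span [set x | exists z S y, rel_resolvent (graph A) z S /\ Z y /\ x = S y] `<=` W.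
  by move=> /[apply] h; rewrite -(closure_id _).1 in h.
by apply: lin_span_subspace => // y [z [S [u [hS [Zu ->]]]]]; apply: (resolvent_invariant WS Wc AW hS); exact: ZW.
Qed.

End Pontryagin.
End OneOperator.
End Totality.

(** * From gamma fields to representations and indices *)

Section GammaFields.
Variable R : realType.
Local Notation C := (Cplx R).
Variables (H : completeNormedModType C) (ip : {dot H for conjC}).
Variables (K : completeNormedModType C) (br : {hermitian K for false & conjC}).
Variables (F : opfun H) (Gam : C -> H -> K).

Lemma upper_subconj (z w : C) : 0 < 'Im z -> 0 < 'Im w -> z - w^* != 0.
Proof.
move=> zi wi; apply/eqP => /(congr1 (fun x => 'Im x)); rewrite raddfB /= Im_conj opprK raddf0.
by move/eqP; rewrite gt_eqF// addr_gt0.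
Qed.

(** The kernel identity with second point [z0], tested against all [h'], is the representation
    formula; so it suffices to exhibit a total gamma field. *)
Lemma representation_of_gamma (B : set (K * K)) n (e : 'I_n -> K) z0 S0 (Gp0 : K -> H) (Fz0s : H -> H) :
  krein br -> maxneg br e -> selfadjoint_rel br B -> 0 < 'Im z0 -> dom F z0 -> rel_resolvent B z0 S0 ->
  bounded_op (Gam z0) -> (forall k h, ip (Gp0 k) h = br k (Gam z0 h)) ->
  (forall h h', ip (Fz0s h) h' = ip h (F z0 h')) ->
  (forall z S h, rel_resolvent B z S -> Gam z h = Gam z0 h + (z - z0) *: S (Gam z0 h)) ->
  (forall z S h h', dom F z -> rel_resolvent B z S ->
     (z - z0^*) * br (Gam z h) (Gam z0 h') = ip (F z h) h' - ip h (F z0 h')) ->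
  closure (lin_span [set k | exists z S h, rel_resolvent B z S /\ k = Gam z h]) = setT ->
  minimal_representation ip F br B.
Proof.
move=> Kr me Bsa z0i Fz0 hS0 Gb hGp hFs hG hker hmin.
exists z0, (Gam z0), Gp0, Fz0s; split=> //.
- by exists n; exact: maxneg_pontryagin Kr me.
- by split=> //; exists S0.
split=> [z S Fz hS h|].
  apply: (@ip_ext _ _ ip) => h'; rewrite ipDl ipZl hGp -hG// (hker z S)// hFs.
  by rewrite addrC subrK.
rewrite -hmin; congr (closure (lin_span _)); apply/seteqP; split=> k [z [S [h [hS ->]]]].
  by exists z, S, h; rewrite -hG.
by exists z, S, h; rewrite -hG.
Qed.

Hypothesis ker : forall z w h h', dom F z -> dom F w -> 0 < 'Im z -> 0 < 'Im w ->
  (z - w^*) * br (Gam z h) (Gam w h') = ip (F z h) h' - ip h (F w h').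

Lemma nevanlinna_gram n (z : 'I_n -> C) (h : 'I_n -> H) : (forall i, dom F (z i) /\ 0 < 'Im (z i)) ->
  nevanlinna_matrix ip F z h = gram br (fun i => Gam (z i) (h i)).
Proof.
move=> hz; apply/matrixP => i j; rewrite !mxE; have [[Fi zi] [Fj zj]] := (hz i, hz j).
by rewrite -ker// mulrC mulKf// upper_subconj.
Qed.

Lemma kernel_index_le n (e : 'I_n -> K) m (z : 'I_m -> C) (h : 'I_m -> H) : maxneg br e ->
  (forall i, dom F (z i) /\ 0 < 'Im (z i)) -> (mx_neg_eigenvalues (nevanlinna_matrix ip F z h) <= n)%N.
Proof. by move=> me hz; rewrite nevanlinna_gram//; exact: gram_count_le me. Qed.

Lemma kernel_index_attained n (e : 'I_n -> K) : krein br -> maxneg br e ->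
  closure (lin_span [set k | exists z h, [/\ dom F z, 0 < 'Im z & k = Gam z h]]) = setT ->
  exists m (z : 'I_m -> C) (h : 'I_m -> H), (forall i, dom F (z i) /\ 0 < 'Im (z i)) /\
    mx_neg_eigenvalues (nevanlinna_matrix ip F z h) = n.
Proof.
move=> Kr me tot; set S := [set k | exists z h, _] in tot.
have [|m [f [Sf hf]]] := @gram_count_attained _ _ _ n e S Kr me.
  by move=> x d d0; apply: (closureE (lin_span S) x).1 d d0; rewrite tot.
have [p hp] : exists p : 'I_m -> C * H, forall i, [/\ dom F (p i).1, 0 < 'Im (p i).1 & f i = Gam (p i).1 (p i).2].
  suff hh : forall i, exists p : C * H, [/\ dom F p.1, 0 < 'Im p.1 & f i = Gam p.1 p.2].
    by have [p hp] := choice hh; exists p.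
  by move=> i; have [z [h [? ? ?]]] := Sf i; exists (z, h).
exists m, (fun i => (p i).1), (fun i => (p i).2).
have hz i : dom F (p i).1 /\ 0 < 'Im (p i).1 by have [] := hp i.
have fE : f = fun i => Gam (p i).1 (p i).2 by apply/funext => i; have [] := hp i.
split; first exact: hz.
by rewrite (@nevanlinna_gram _ (fun i => (p i).1) (fun i => (p i).2) hz) -fE.
Qed.

Lemma kernel_index n (e : 'I_n -> K) kappa : krein br -> maxneg br e -> gen_nevanlinna ip kappa F ->
  closure (lin_span [set k | exists z h, [/\ dom F z, 0 < 'Im z & k = Gam z h]]) = setT -> kappa = n.
Proof.
move=> Kr me FN tot; have [m [z [h [hz E]]]] := gn_kernel_eq FN.
have [m' [z' [h' [hz' E']]]] := kernel_index_attained Kr me tot.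
have le1 : (kappa <= n)%N by rewrite -E; exact: kernel_index_le me hz.
have le2 : (n <= kappa)%N by rewrite -E'; exact: gn_kernel_le FN _ _ _ hz'.
by apply/eqP; rewrite eqn_leq le1.
Qed.
End GammaFields.

Section ResolventGamma.
Variable R : realType.
Local Notation C := (Cplx R).
Variables (H : completeNormedModType C) (ip : {dot H for conjC}).
Variables (K : completeNormedModType C) (br : {hermitian K for false & conjC}).
Variables (A : K -> K) (G : H -> K) (Gp : K -> H).
Hypotheses (Asa : selfadjoint_op br A) (Gadj : forall k h, ip (Gp k) h = br k (G h)).

Lemma resolvent_kernel z w S S' h h' : rel_resolvent (graph A) z S -> rel_resolvent (graph A) w S' ->
  (z - w^*) * br (S (G h)) (S' (G h')) = ip (Gp (S (G h))) h' - ip h (Gp (S' (G h'))).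
Proof.
move=> /graph_resolventP[_ h1 _] /graph_resolventP[_ h1' _].
rewrite Gadj [ip h _]ipC Gadj -hfC; set x := S _; set y := S' _.
rewrite -(h1' (G h')) -(h1 (G h)) -/x -/y.
by rewrite hfBl hfBr hfZl hfZr Asa; ring.
Qed.

Lemma resolvent_gamma z w S S' h : rel_resolvent (graph A) z S -> rel_resolvent (graph A) w S' ->
  S (G h) = S' (G h) + (z - w) *: S (S' (G h)).
Proof. by move=> hS hS'; rewrite -(resolvent_identity _ hS hS') addrC subrK. Qed.
End ResolventGamma.

Section Transport.
Variable R : realType.
Local Notation C := (Cplx R).
Variables (K1 K2 : completeNormedModType C).
Variables (br1 : {hermitian K1 for false & conjC}) (br2 : {hermitian K2 for false & conjC}).

Lemma pontryagin_image (V : K1 -> K2) (c : C) n : bounded_op V -> 0 < c -> (forall x, `|x| <= c * `|V x|) ->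
  (forall x y, br2 (V x) (V y) = br1 x y) -> closed (range V) ->
  pontryagin br1 setT n -> pontryagin br2 (range V) n.
Proof.
move=> Vb c0 hc iso Vcl [_ [Mp [Mm [[/submod_subspace Sp /submod_subspace Sm sum ortho pos neg] [f [fM findep]] [a [b [a0 b0 hab]]]]]]].
have [_ [d d0 hd]] := (bounded_opP V).1 Vb.
have Vinj x : V x = 0 -> x = 0.
  by move=> Vx; apply/eqP; rewrite -normr_le0 (le_trans (hc x))// Vx normr0 mulr0.
have im (W : set K1) : subspace W -> submod_closed [in V @` W].
  move=> WS; apply: subspace_submod; split; first by exists 0; [exact: WS.1|rewrite (bounded_op0 Vb)].
  by move=> t _ _ [x Wx <-] [y Wy <-]; exists (t *: x + y); [exact: WS.2|rewrite (bounded_op_linear _ _ _ Vb)].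
split=> //; exists (V @` Mp), (V @` Mm); split.
- split; [exact: im|exact: im| | | |].
  + apply/seteqP; split=> k.
      move=> [x _ <-]; have : setT x by []. rewrite sum => -[u [v [Mu Mv ->]]].
      by exists (V u), (V v); split; [exists u|exists v|rewrite (bounded_opD _ _ Vb)].
    by move=> [_ [_ [[u Mu <-] [v Mv <-] ->]]]; exists (u + v) => //; rewrite (bounded_opD _ _ Vb).
  + by move=> _ _ [x Mx <-] [y My <-]; rewrite iso ortho.
  + move=> _ [x Mx <-] x0; rewrite iso pos//.
    by apply: contra_neq x0 => ->; rewrite (bounded_op0 Vb).
  + move=> _ [x Mx <-] x0; rewrite iso neg//.
    by apply: contra_neq x0 => ->; rewrite (bounded_op0 Vb).
- exists (V \o f); split.
    apply/seteqP; split=> k.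
      move=> [x + <-]; rewrite fM => -[t ->]; exists t.
      by rewrite (bounded_op_sum _ _ _ Vb); apply: eq_bigr => i _; rewrite (bounded_opZ _ _ Vb).
    move=> [t ->]; exists (\sum_i t i *: f i); first by rewrite fM; exists t.
    by rewrite (bounded_op_sum _ _ _ Vb); apply: eq_bigr => i _; rewrite (bounded_opZ _ _ Vb).
  move=> t h; apply: findep; apply: Vinj; rewrite -[RHS]h (bounded_op_sum _ _ _ Vb).
  by apply: eq_bigr => i _; rewrite (bounded_opZ _ _ Vb).
exists (a / d ^+ 2), (b * c ^+ 2); split; [by rewrite divr_gt0// exprn_gt0|by rewrite mulr_gt0// exprn_gt0|].
move=> _ _ [x Mx <-] [y My <-]; rewrite -(bounded_opD _ _ Vb) !iso.
have /andP[h1 h2] := hab _ _ Mx My; apply/andP; split.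
  apply: le_trans h1; rewrite -mulrA ler_pM2l// ler_pdivrMl ?exprn_gt0// -exprMn.
  by rewrite lerXn2r ?nnegrE// mulr_ge0// ltW.
apply: (le_trans h2); rewrite -mulrA ler_pM2l// -exprMn.
by rewrite lerXn2r ?nnegrE// mulr_ge0// ltW.
Qed.
End Transport.

(** * Transfer functions of bounded operators *)

Section TransferFunctions.
Variable R : realType.
Local Notation C := (Cplx R).
Variables (H : completeNormedModType C) (K : completeNormedModType C).
Variables (A : K -> K) (Phi : K -> H) (Psi : H -> K) (F : opfun H).
Hypotheses (Ab : bounded_op A) (Pb : bounded_op Phi) (Qb : bounded_op Psi).
Hypothesis domF : forall z, dom F z <-> rel_resolvent_set (graph A) z.
Hypothesis valF : forall z S h, rel_resolvent (graph A) z S -> F z h = Phi (S (Psi h)).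

Lemma transfer_open : open (dom F).
Proof.
apply/open_CP => z /domF[S hS]; have [_ [c c0 hc]] := (bounded_opP S).1 hS.1.
exists c^-1; first by rewrite invr_gt0.
move=> w wz; apply/domF; apply: (resolvent_open hS c0 hc).
by rewrite -ltr_pdivlMr// div1r.
Qed.

Lemma transfer_holomorphic : holomorphic_on (dom F) F.
Proof.
have /choice[S hS] : forall z, exists S, dom F z -> rel_resolvent (graph A) z S.
  by move=> z; case: (pselect (dom F z)) => [/domF[S hS]|]; [exists S|exists id].
apply: (holomorphic_on_congr transfer_open (F := fun w h => Phi (S w (Psi h))) (U := dom F)) => //.
  by move=> w Fw h; rewrite (valF _ (hS w Fw)).
exact: (holomorphic_resolvent transfer_open Pb Qb hS).
Qed.

Lemma transfer_at_infinity : holomorphic_at_infinity F (fun h => - Phi (Psi h)).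
Proof.
have [_ [c c0 hc]] := (bounded_opP _).1 Ab; have [_ [p p0 hp]] := (bounded_opP _).1 Pb.
have [_ [q q0 hq]] := (bounded_opP _).1 Qb.
split.
- exists c => // z cz; have [S hS _] := resolvent_large Ab hc (ltW c0) cz.
  by apply/domF; exists S.
- exact: transfer_holomorphic.
- rewrite (_ : (fun h => _) = fun h => (-1) *: Phi (Psi h)); last by apply/funext => h; rewrite scaleN1r.
  by apply: bounded_op_scale; exact: bounded_op_comp.
move=> d d0; pose M := p * c * q.
have M0 : 0 < M by rewrite !mulr_gt0.
exists (c + M / d); first by rewrite addr_gt0// divr_gt0.
move=> z hz h; have cz : c < `|z| by rewrite (lt_trans _ hz)// ltrDl divr_gt0.
have [S hS Sb] := resolvent_large Ab hc (ltW c0) cz; have zc : 0 < `|z| - c by rewrite subr_gt0.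
have /graph_resolventP[_ k1 _] := hS.
(* z S = A S - 1, so the distance to the limit is of the order of the resolvent. *)
have -> : z *: F z h - - Phi (Psi h) = Phi (A (S (Psi h))).
  by rewrite opprK (valF _ hS) -(bounded_opZ _ _ Pb) -(bounded_opD _ _ Pb) -{2}(k1 (Psi h)) addrC subrK.
rewrite (le_trans (hp _))// (@le_trans _ _ (M / (`|z| - c) * `|h|))//.
  rewrite /M (_ : p * c * q / _ * _ = p * (c * (q * `|h| / (`|z| - c)))); last by ring.
  rewrite ler_pM2l// (le_trans (hc _))// ler_pM2l// (le_trans (Sb _))//.
  by rewrite ler_wpM2r// invr_ge0 ltW.
by rewrite ler_wpM2r// ler_pdivrMr// -ler_pdivrMl// mulrC lerBrDl ltW.
Qed.
End TransferFunctions.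

Lemma at_infinity_unique (R : realType) (H : completeNormedModType (Cplx R)) (T : Cplx R -> H -> H) (L L' : H -> H) :
  op_cvg (@at_infinity R) T L -> op_cvg (@at_infinity R) T L' -> L =1 L'.
Proof.
move=> hL hL' h; apply/eqP; rewrite -subr_eq0; apply/eqP; apply: eps_zero => e e0.
have e1 : 0 < e / 2 / (1 + `|h|) by rewrite divr_gt0// pos_half.
have [r r0 hr] := hL _ e1; have [r' r'0 hr'] := hL' _ e1.
have zr : 0 < r + r' + 1 by rewrite !addr_gt0.
have := hr (r + r' + 1); have := hr' (r + r' + 1); rewrite gtr0_norm//.
have l1 : r < r + r' + 1 by rewrite -addrA ltrDl addr_gt0.
have l2 : r' < r + r' + 1 by rewrite addrAC ltrDr addr_gt0.
move=> /(_ l2 h) n2 /(_ l1 h) n1; rewrite -(subrK (T (r + r' + 1) h) (L h)) -addrA.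
rewrite (le_trans (ler_normD _ _))// [e in leRHS]splitr lerD//.
  by rewrite distrC (le_trans n1)// -mulrA ler_piMr ?(ltW (pos_half e0))// mulrC ler_pdivrMr// mul1r lerDr.
by rewrite (le_trans n2)// -mulrA ler_piMr ?(ltW (pos_half e0))// mulrC ler_pdivrMr// mul1r lerDr.
Qed.

(** * The self-adjoint case, applied to [Q], to [Qhat2] and to the example *)

Section SelfAdjointTransfer.
Variable R : realType.
Local Notation C := (Cplx R).
Variables (H : completeNormedModType C) (ip : {dot H for conjC}).
Hypothesis H_hilbert : hilbert_norm ip.
Variables (K : completeNormedModType C) (br : {hermitian K for false & conjC}).
Variables (n : nat) (e : 'I_n -> K).
Hypotheses (Kr : krein br) (me : maxneg br e).
Variables (A : K -> K) (Phi : K -> H) (Psi : H -> K) (F : opfun H).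
Hypotheses (Ab : bounded_op A) (Asa : selfadjoint_op br A) (Pb : bounded_op Phi) (Qb : bounded_op Psi).
Hypothesis Padj : forall k h, ip (Phi k) h = br k (Psi h).
Hypothesis domF : forall z, dom F z <-> rel_resolvent_set (graph A) z.
Hypothesis valF : forall z S h, rel_resolvent (graph A) z S -> F z h = Phi (S (Psi h)).

Let gsa := graph_selfadjoint Kr Asa.

Lemma graph_resolvent_nonempty : exists z, rel_resolvent_set (graph A) z.
Proof.
have [_ [c c0 hc]] := (bounded_opP _).1 Ab.
have cz : c < `|c + 1| by rewrite gtr0_norm ?addr_gt0// ltrDl.
by have [S hS _] := resolvent_large Ab hc (ltW c0) cz; exists (c + 1), S.
Qed.

Lemma transfer_nearly_all : exists s : seq C, forall z, 'Im z != 0 -> z \notin s -> dom F z.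
Proof.
have [s hs] := nonreal_resolvent gsa Kr me graph_resolvent_nonempty.
by exists s => z zi zs; apply/domF; exact: hs.
Qed.

Lemma transfer_dense z (d : C) : 0 < d -> exists2 w, dom F w & `|w - z| < d.
Proof.
move=> d0; have [s hs] := transfer_nearly_all; have [w [wz _ wi ws]] := dense_avoid s z d0.
by exists w => //; exact: hs.
Qed.

Lemma transfer_meromorphic z : 'Im z != 0 -> exists (k : nat) (U : set C) (G : C -> H -> H),
  [/\ open U, U z, holomorphic_on U G &
    forall w, U w -> w != z -> dom F w /\ forall h, (w - z) ^+ k *: F w h = G w h].
Proof.
move=> zi; have [U [G [Uo Uz hG hU]]] := resolvent_meromorphic Kr me Ab Asa zi Pb Qb.
have [s hs] := nonreal_resolvent gsa Kr me graph_resolvent_nonempty.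
have [r r0 hr] := (open_CP U).1 Uo z Uz.
(* A radius that avoids the real axis and every exceptional point other than [z], so that the
   punctured disc lies in the resolvent set. *)
have [|d d0 hd] := @pos_lower _ (r :: `|'Im z| :: [seq `|l - z| | l <- s & l != z]).
  move=> x; rewrite !inE => /or3P[/eqP->//|/eqP->|/mapP[l]]; first by rewrite normr_gt0.
  by rewrite mem_filter => /andP[lz _] ->; rewrite normr_gt0 subr_eq0.
pose V := [set w : C | `|w - z| < d].
have VU : V `<=` U by move=> w Vw; apply: hr; rewrite (lt_le_trans Vw)// hd// inE eqxx.
have Vo : open V.
  apply/open_CP => w Vw; exists (d - `|w - z|); first by rewrite subr_gt0.
  move=> w' hw'; rewrite /V /= -(subrK w w') -addrA (le_lt_trans (ler_normD _ _))//.
  by rewrite -ltrBrDr.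
exists n, V, G; split=> //.
- by rewrite /V /= subrr normr0.
- exact: (holomorphic_on_congr Vo VU _ hG).
move=> w Vw wz; have [S hS] : rel_resolvent_set (graph A) w.
  apply: hs.
    apply/eqP => wi; have : `|'Im z| <= `|w - z|.
      have -> : 'Im z = - 'Im (w - z) by rewrite raddfB /= wi sub0r opprK.
      by rewrite normrN norm_Im_le.
    have dI : d <= `|'Im z| by apply: hd; rewrite !inE eqxx orbT.
    by move=> h; have := le_lt_trans (le_trans dI h) Vw; rewrite ltxx.
  apply/negP => ws; have := hd `|w - z|; rewrite !inE (_ : `|w - z| \in _) ?orbT; last first.
    by apply/mapP; exists w; rewrite ?mem_filter ?wz.
  by move=> /(_ isT)/(lt_le_trans Vw); rewrite ltxx.
split=> [|h]; first by apply/domF; exists S.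
by rewrite (valF _ hS); apply: hU => //; exact: VU.
Qed.

Lemma transfer_symmetric z : dom F z -> dom F z^* /\ forall h h', ip (F z h) h' = ip h (F z^* h').
Proof.
move=> /domF[S hS]; have [S' hS'] : exists S', rel_resolvent (graph A) z^* S'.
  have [/eqP/Creal_ImP/conj_Creal ->|zi] := boolP ('Im z == 0); first by exists S.
  by apply: (resolvent_conj gsa Kr me _ hS).
split=> [|h h']; first by apply/domF; exists S'.
by rewrite (valF _ hS) (valF _ hS') Padj (resolvent_adjoint gsa _ _ hS hS') [RHS]ipC Padj -hfC.
Qed.

Lemma transfer_kernel z w S S' h h' : rel_resolvent (graph A) z S -> rel_resolvent (graph A) w S' ->
  (z - w^*) * br (S (Psi h)) (S' (Psi h')) = ip (F z h) h' - ip h (F w h').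
Proof. by move=> hS hS'; rewrite (valF _ hS) (valF _ hS'); exact: (resolvent_kernel Asa Padj h h' hS hS'). Qed.

Lemma transfer_gamma : exists Gam : C -> H -> K,
  (forall z S h, rel_resolvent (graph A) z S -> Gam z h = S (Psi h)) /\
  forall z w h h', dom F z -> dom F w -> 0 < 'Im z -> 0 < 'Im w ->
    (z - w^*) * br (Gam z h) (Gam w h') = ip (F z h) h' - ip h (F w h').
Proof.
have /choice[S hS] : forall z, exists S, dom F z -> rel_resolvent (graph A) z S.
  by move=> z; case: (pselect (dom F z)) => [/domF[S hS]|]; [exists S|exists id].
exists (fun z h => S z (Psi h)); split.
  move=> z S' h hS'; apply: (rel_resolvent_unique _ hS'); apply: hS; apply/domF.
  by exists S'.
by move=> z w h h' Fz Fw _ _; exact: transfer_kernel (hS z Fz) (hS w Fw).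
Qed.

Hypothesis moments : closure (lin_span [set x | exists k y, range Psi y /\ x = iter k A y]) = setT.

Lemma unbounded_upper (s : seq C) (r : C) : 0 < r -> exists2 z : C, [/\ 0 < 'Im z & z \notin s] & r < `|z|.
Proof.
move=> r0; pose t (k : nat) : C := 'i * (r + k.+1%:R).
have tr k : 0 < r + k.+1%:R by rewrite addr_gt0// ltr0n.
have ti : injective t.
  by move=> k l /(mulfI (neq0Ci C))/addrI/eqP; rewrite eqr_nat eqSS => /eqP.
have [k hk] := avoid_list s ti; exists (t k).
  by split=> //; rewrite ImMil (Creal_ReP _ (gtr0_real (tr k))).
by rewrite normrM normCi mul1r gtr0_norm// ltrDl ltr0n.
Qed.

(** Confined to the upper half-plane, where the kernel in [gen_nevanlinna] is evaluated. *)
Lemma transfer_total : closure (lin_span [set k | exists z S h,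
  [/\ 0 < 'Im z, rel_resolvent (graph A) z S & k = S (Psi h)]]) = setT.
Proof.
have [s hs] := transfer_nearly_all.
have := resolvents_total Ab (U := [set z | 0 < 'Im z]) moments.
have [|] := pselect (forall r : C, 0 < r -> exists2 z, [set z : C | 0 < 'Im z] z & r < `|z|); last first.
  by case=> r r0; have [z [zi _] hz] := unbounded_upper [::] r0; exists z.
move=> h /(_ h) <-; congr (closure (lin_span _)); apply/seteqP; split=> k.
  by move=> [z [S [u [zi hS ->]]]]; exists z, S, (Psi u); split=> //; exists u.
by move=> [z [S [_ [zi hS [u _ <-] ->]]]]; exists z, S, u.
Qed.

Lemma transfer_gamma_total (Gam : C -> H -> K) : (forall z S h, rel_resolvent (graph A) z S -> Gam z h = S (Psi h)) ->
  closure (lin_span [set k | exists z h, [/\ dom F z, 0 < 'Im z & k = Gam z h]]) = setT.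
Proof.
move=> hGam; rewrite -transfer_total; congr (closure (lin_span _)); apply/seteqP; split=> k.
  by move=> [z [h [/domF[S hS] zi ->]]]; exists z, S, h; rewrite (hGam _ _ _ hS).
move=> [z [S [h [zi hS ->]]]]; exists z, h; rewrite (hGam _ _ _ hS); split=> //.
by apply/domF; exists S.
Qed.

Lemma transfer_kernel_le m (z : 'I_m -> C) (h : 'I_m -> H) : (forall i, dom F (z i) /\ 0 < 'Im (z i)) ->
  (mx_neg_eigenvalues (nevanlinna_matrix ip F z h) <= n)%N.
Proof. by have [Gam [_ ker]] := transfer_gamma => hz; apply: (kernel_index_le ker _ me hz). Qed.

Lemma transfer_kernel_eq : exists m (z : 'I_m -> C) (h : 'I_m -> H), (forall i, dom F (z i) /\ 0 < 'Im (z i)) /\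
  mx_neg_eigenvalues (nevanlinna_matrix ip F z h) = n.
Proof.
have [Gam [hGam ker]] := transfer_gamma.
exact: (kernel_index_attained ker Kr me (transfer_gamma_total hGam)).
Qed.

Lemma transfer_index kappa : gen_nevanlinna ip kappa F -> kappa = n.
Proof.
have [Gam [hGam ker]] := transfer_gamma => FN.
exact: (kernel_index ker Kr me FN (transfer_gamma_total hGam)).
Qed.

Lemma transfer_extension : exists2 E, gen_nevanlinna ip n E & extends E F.
Proof.
apply: (maximal_extension H_hilbert (transfer_open domF) transfer_dense (transfer_holomorphic Pb Qb domF valF)).
- exact: transfer_symmetric.
- exact: transfer_meromorphic.
- exact: transfer_kernel_le.
- exact: transfer_kernel_eq.
Qed.

Lemma transfer_representation : minimal_representation ip F br (graph A).
Proof.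
have [s hs] := transfer_nearly_all.
have [z0 [z0i z0s] _] := unbounded_upper s ltr01.
have Fz0 : dom F z0 by apply: hs => //; rewrite gt_eqF.
have /domF[S0 hS0] := Fz0; have [Gam [hGam _]] := transfer_gamma.
have [S0' hS0'] : exists S', rel_resolvent (graph A) z0^* S' by apply: (resolvent_conj gsa Kr me _ hS0); rewrite gt_eqF.
have GamE : Gam z0 = fun h => S0 (Psi h) by apply/funext => h; exact: hGam.
apply: (@representation_of_gamma _ _ ip _ br F Gam (graph A) n e z0 S0 (fun k => Phi (S0' k)) (fun h => F z0^* h)) => //.
- by rewrite GamE; exact: bounded_op_comp hS0.1 Qb.
- by move=> k h; rewrite Padj GamE hfC -(resolvent_adjoint gsa _ _ hS0 hS0') hfC conjCK.
- by move=> h h'; rewrite ipC -(transfer_symmetric Fz0).2 -ipC.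
- move=> z S h hS; rewrite (hGam _ _ _ hS) GamE; exact: resolvent_gamma hS hS0.
- move=> z S h h' Fz hS; rewrite (hGam _ _ _ hS) GamE; exact: transfer_kernel.
apply/seteqP; split=> // k _; have : closure (lin_span [set k | exists z S h,
  [/\ 0 < 'Im z, rel_resolvent (graph A) z S & k = S (Psi h)]]) k by rewrite transfer_total.
apply: closureS => _ [m [a [f [hf ->]]]]; exists m, a, f; split=> // i.
by have [z [S [h [_ hS ->]]]] := hf i; exists z, S, h; rewrite (hGam _ _ _ hS).
Qed.

End SelfAdjointTransfer.

(** * Reduction to the kernel of the adjoint and the inverse function *)

Section Reduction.
Variable R : realType.
Local Notation C := (Cplx R).
Variables (H : completeNormedModType C) (ip : {dot H for conjC}).
Hypothesis H_hilbert : hilbert_norm ip.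
Variables (K : completeNormedModType C) (br : {hermitian K for false & conjC}).
Variables (n : nat) (e : 'I_n -> K).
Hypotheses (Kr : krein br) (me : maxneg br e).
Variables (A : K -> K) (G : H -> K) (Gp : K -> H).
Hypotheses (Ab : bounded_op A) (Asa : selfadjoint_op br A) (Gb : bounded_op G).
Hypothesis Gadj : forall k h, ip (Gp k) h = br k (G h).
Hypothesis GpGi : bdd_invertible_on setT (Gp \o G).

Local Notation gh := (Ghat G Gp).
Local Notation P := (Pproj G Gp).
Local Notation I := (ImP G Gp).

Lemma adjoint_op_bounded : bounded_op Gp.
Proof.
have [b b0 hb] := krein_bound Kr; have [_ [g g0 hg]] := (bounded_opP _).1 Gb.
apply/bounded_opP; split.
  by move=> a x y; apply: (@ip_ext _ _ ip) => h; rewrite ipDl ipZl !Gadj hfDl hfZl.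
exists (b * g); first by rewrite mulr_gt0.
move=> k; have [->|n0] := eqVneq `|Gp k| 0; first by rewrite !mulr_ge0// ltW.
have p0 : 0 < `|Gp k| by rewrite lt_def n0 normr_ge0.
rewrite -(ler_pM2r p0) -expr2 H_hilbert Gadj; apply: (le_trans (real_ler_norm _)).
  by rewrite -Gadj -H_hilbert rpredX// normr_real.
rewrite (le_trans (hb _ _))// (_ : b * g * _ * _ = b * `|k| * (g * `|Gp k|)); last by ring.
by rewrite ler_wpM2l// mulr_ge0// ltW.
Qed.
Let Gpb := adjoint_op_bounded.

Lemma gram_op_bounded : bounded_op (Gp \o G).
Proof. exact: (bounded_op_comp Gpb Gb). Qed.

Lemma gram_op_sym x y : ip ((Gp \o G) x) y = ip x ((Gp \o G) y).
Proof. by rewrite /= Gadj [RHS]ipC Gadj -hfC. Qed.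

Lemma GhatK h : gh (Gp (G h)) = h.
Proof. by rewrite /Ghat (inv_onK GpGi.1). Qed.

Lemma KGhat h : Gp (G (gh h)) = h.
Proof. by have [] := inv_onP GpGi.1 (Logic.I : setT h). Qed.

Lemma gram_op_below : exists2 c : C, 0 < c & forall h, `|h| <= c * `|(Gp \o G) h|.
Proof.
have [_ [c hc]] := GpGi; exists (1 + `|c|); first by rewrite ltr_pwDl.
move=> h; have hh := hc h Logic.I; rewrite (le_trans hh)//.
rewrite -[c * _]ger0_norm ?(le_trans _ hh)// normrM normr_id ler_wpM2r// lerDr//.
Qed.

Lemma Ghat_bounded : bounded_op gh.
Proof.
have [c c0 hc] := gram_op_below; apply/bounded_opP; split.
  move=> a x y; rewrite -{1}(KGhat x) -{1}(KGhat y).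
  by rewrite -(bounded_op_linear _ _ _ Gpb) -(bounded_op_linear _ _ _ Gb) GhatK.
by exists c => // h; rewrite -{2}(KGhat h); exact: hc.
Qed.
Let ghb := Ghat_bounded.

Lemma Ghat_sym x y : ip (gh x) y = ip x (gh y).
Proof. by rewrite -{1}(KGhat y) -[X in ip _ X]/((Gp \o G) _) -gram_op_sym /= KGhat. Qed.

Lemma Ghat_below : exists2 c : C, 0 < c & forall h, `|h| <= c * `|gh h|.
Proof.
have [_ [c c0 hc]] := (bounded_opP _).1 gram_op_bounded.
by exists c => // h; rewrite -{1}(KGhat h); exact: hc.
Qed.

Lemma Pproj_bounded : bounded_op P.
Proof. by apply: (bounded_op_comp Gb); exact: bounded_op_comp. Qed.
Let Pb := Pproj_bounded.

Lemma ImP_bounded : bounded_op I.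
Proof. by apply: (bounded_op_sub (@bounded_op_id _ K)). Qed.
Let Ib := ImP_bounded.

Lemma Gp_ImP k : Gp (I k) = 0.
Proof. by rewrite (bounded_opB _ _ Gpb) /Pproj KGhat subrr. Qed.

Lemma ImP_id k : Gp k = 0 -> I k = k.
Proof. by move=> h; rewrite /ImP /Pproj h (bounded_op0 ghb) (bounded_op0 Gb) subr0. Qed.

Lemma ImP_G h : I (G h) = 0.
Proof. by rewrite /ImP /Pproj GhatK subrr. Qed.

(** Describing (I - P) K as a kernel gives its closedness at once. *)
Lemma range_ImPP k : range I k <-> Gp k = 0.
Proof. by split=> [[x _ <-]|/ImP_id h]; [exact: Gp_ImP|exists k]. Qed.

Lemma range_PprojP k : range P k <-> I k = 0.
Proof.
split=> [[x _ <-]|/eqP]; first by rewrite /Pproj ImP_G.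
by rewrite subr_eq0 => /eqP h; exists k.
Qed.

Lemma range_Pproj_range : range P = range G.
Proof.
apply/seteqP; split=> k [x _ <-]; first by exists (gh (Gp x)).
by exists (G x) => //; rewrite /Pproj GhatK.
Qed.

Lemma kernel_closed (K' : completeNormedModType C) (T : K -> K') : bounded_op T -> closed [set k | T k = 0].
Proof.
move=> Tb; have [_ [c c0 hc]] := (bounded_opP _).1 Tb.
apply/closedE => x hx; apply: eps_zero => d d0; have [v /= hv xv] := hx _ (divr_gt0 d0 c0).
by rewrite -[T x]subr0 -hv -(bounded_opB _ _ Tb) (le_trans (hc _))// -ler_pdivlMl// mulrC ltW.
Qed.

Lemma range_ImP_closed : closed (range I).
Proof.
rewrite (_ : range I = [set k | Gp k = 0]); first exact: kernel_closed.
by apply/seteqP; split=> k /range_ImPP.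
Qed.

Lemma range_Pproj_closed : closed (range P).
Proof.
rewrite (_ : range P = [set k | I k = 0]); first exact: kernel_closed.
by apply/seteqP; split=> k /range_PprojP.
Qed.

Lemma range_ImP_submod : submod_closed [in range I].
Proof.
apply: subspace_submod; split; first by apply/range_ImPP; rewrite (bounded_op0 Gpb).
move=> a x y /range_ImPP hx /range_ImPP hy; apply/range_ImPP.
by rewrite (bounded_op_linear _ _ _ Gpb) hx hy scaler0 addr0.
Qed.

Lemma Pproj_sym x y : br (P x) y = br x (P y).
Proof.
have -> : br x (P y) = ip (Gp x) (gh (Gp y)) by rewrite Gadj.
have -> : br (P x) y = ip (gh (Gp x)) (Gp y) by rewrite ipC Gadj -hfC.
exact: Ghat_sym.
Qed.

Lemma ImP_sym x y : br (I x) y = br x (I y).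
Proof. by rewrite /ImP hfBl hfBr Pproj_sym. Qed.

Definition ker_adjoint : closed_submod K := ClosedSubmod range_ImP_submod range_ImP_closed.
Local Notation K2 := (subsp ker_adjoint).

Lemma range_ImP_mem x : (ker_adjoint : set K) (I x). Proof. by exists x. Qed.
Definition cut (x : K) : K2 := to_subsp (range_ImP_mem x).

Lemma ssval_cut x : ssval (cut x) = I x. Proof. by []. Qed.
Lemma ImP_ssval (x : K2) : I (ssval x) = ssval x.
Proof. by apply: ImP_id; apply/range_ImPP; exact: (ssvalP x). Qed.
Lemma Gp_ssval (x : K2) : Gp (ssval x) = 0.
Proof. by apply/range_ImPP; exact: (ssvalP x). Qed.
Lemma cut_ssval (x : K2) : cut (ssval x) = x.
Proof. by apply: val_inj; rewrite /= ImP_ssval. Qed.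
Lemma cut_bounded : bounded_op cut.
Proof.
have [_ [c c0 hc]] := (bounded_opP _).1 Ib; apply/bounded_opP; split; last by exists c.
by move=> a x y; apply: val_inj; rewrite /= (bounded_op_linear _ _ _ Ib).
Qed.
Let cutb := cut_bounded.
Let vb := @ssval_bounded _ K ker_adjoint.

Lemma br2_linear z : linear_for *%R ((fun x y : K2 => br (ssval x) (ssval y))^~ z).
Proof. by move=> a x y; rewrite /= hfDl hfZl. Qed.
Lemma br2_sym (x y : K2) : br (ssval x) (ssval y) = (br (ssval y) (ssval x))^*.
Proof. exact: hfC. Qed.
Definition br2 := mk_hermitian br2_linear br2_sym.
Lemma br2E x y : br2 x y = br (ssval x) (ssval y). Proof. by []. Qed.

Lemma br2_krein : krein br2.
Proof.
have [J [c [b [c0 b0 h1 h2 h3]]]] := Kr; have [_ [p p0 hp]] := (bounded_opP _).1 cutb.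
have pb : 0 <= p * b by rewrite mulr_ge0// ltW.
exists (fun x => cut (J (ssval x))), c, (b + p * b); split=> //.
- by rewrite ltr_wpDr.
- by move=> x y; rewrite br2E (le_trans (h1 _ _))// !ler_wpM2r// lerDl.
- move=> x; rewrite (le_trans (hp _))// mulrDl -mulrA (le_trans (ler_wpM2l (ltW p0) (h2 _)))//.
  by rewrite lerDr mulr_ge0// ltW.
- by move=> x; rewrite br2E ssval_cut -ImP_sym ImP_ssval; exact: h3.
Qed.

Definition A2 (x : K2) : K2 := cut (A (ssval x)).
Definition G2 (h : H) : K2 := cut (A (G (gh h))).
Definition Gp2 (x : K2) : H := gh (Gp (A (ssval x))).

Lemma A2_bounded : bounded_op A2.
Proof. by apply: (bounded_op_comp cutb); exact: bounded_op_comp. Qed.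

Lemma A2_selfadjoint : selfadjoint_op br2 A2.
Proof. by move=> x y; rewrite !br2E !ssval_cut ImP_sym ImP_ssval -ImP_sym ImP_ssval Asa. Qed.

Lemma G2_bounded : bounded_op G2.
Proof. by apply: (bounded_op_comp cutb); apply: (bounded_op_comp Ab); exact: bounded_op_comp. Qed.

Lemma ssval_G2 h : ssval (G2 h) = Gtilde A G Gp h. Proof. by []. Qed.

Lemma G2_adjoint k h : ip (Gp2 k) h = br2 k (G2 h).
Proof. by rewrite br2E ssval_cut -ImP_sym ImP_ssval -Asa -Gadj /Gp2 -Ghat_sym. Qed.

Lemma Gp2_bounded : bounded_op Gp2.
Proof.
apply: (bounded_op_comp ghb); apply: (bounded_op_comp Gpb).
by apply: (bounded_op_comp Ab); exact: vb.
Qed.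

(** [K] is the orthogonal sum of the range of [G] and the kernel of [Gp], so the vectors [G (e1 i)]
    and [e2 j] together form a maximal negative system of [K]; all such systems have the same
    length. *)
Lemma maxneg_split : exists n1 (e1 : 'I_n1 -> H) n2 (e2 : 'I_n2 -> K2),
  [/\ maxneg (form_of gram_op_bounded gram_op_sym) e1, maxneg br2 e2 & (n1 + n2)%N = n].
Proof.
have TT (V : completeNormedModType C) : subspace [set: V] by [].
have FE x y : form_of gram_op_bounded gram_op_sym x y = br (G x) (G y).
  by rewrite form_ofE /= Gadj.
have [n1 [e1 [_ s1 p1]]] := @exists_maxneg _ _ (form_of gram_op_bounded gram_op_sym) setT n (TT H)
  (fun m f _ hf => maxneg_le me (f := G \o f) (fun i j => etrans (esym (FE _ _)) (hf i j))).
have [n2 [e2 [_ s2 p2]]] := @exists_maxneg _ _ br2 setT n (TT K2)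
  (fun m f _ hf => maxneg_le me (f := (fun i => ssval (f i))) hf).
exists n1, e1, n2, e2; split; [by split=> // x; exact: p1|by split=> // x; exact: p2|].
pose f (i : 'I_(n1 + n2)) := match fintype.split i with inl j => G (e1 j) | inr j => ssval (e2 j) end.
have cross' (y : K2) h : br (ssval y) (G h) = 0 by rewrite -Gadj Gp_ssval ip0l.
have cross h (y : K2) : br (G h) (ssval y) = 0 by rewrite hfC cross' conjC0.
apply: (@maxneg_eq _ _ br _ _ f e) me; split.
  move=> i j; rewrite /f -{2}(splitK i) -{2}(splitK j).
  case: (fintype.split i) => i'; case: (fintype.split j) => j' /=.
  - by rewrite -FE s1 (inj_eq (@lshift_inj _ _)).
  - by rewrite cross eq_lrshift oppr0.
  - by rewrite cross' eq_rlshift oppr0.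
  - by rewrite -br2E s2 (inj_eq (@rshift_inj _ _)).
move=> x hx; have xE : x = G (gh (Gp x)) + ssval (cut x) by rewrite ssval_cut /ImP addrC subrK.
have h1 j : br (G (gh (Gp x))) (G (e1 j)) = 0.
  have := hx (lshift n2 j); rewrite /f (unsplitK (inl j)) {1}xE hfDl.
  by rewrite cross' addr0.
have h2 k : br (ssval (cut x)) (ssval (e2 k)) = 0.
  have := hx (rshift n1 k); rewrite /f (unsplitK (inr k)) {1}xE hfDl.
  by rewrite cross add0r.
move: (gh (Gp x)) (cut x) xE h1 h2 => u y -> h1 h2.
rewrite hfDl !hfDr cross cross' addr0 add0r.
by rewrite addr_ge0// -?FE; [apply: p1 => // i; rewrite FE|apply: p2].
Qed.

Lemma resolvent_A2P z : resolvent_set_on (range I) (Atilde A G Gp) z <-> rel_resolvent_set (graph A2) z.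
Proof.
have fE (x : K2) : Atilde A G Gp (ssval x) - z *: ssval x = ssval (A2 x - z *: x) by [].
split=> [[fb [c hc]]|[S /graph_resolventP[Sb h1 h2]]].
  pose S (x : K2) : K2 := @to_subsp _ _ ker_adjoint _ (inv_onP fb (ssvalP x)).1.
  have h1 x : A2 (S x) - z *: S x = x by apply: val_inj; rewrite -[LHS]fE; exact: (inv_onP fb (ssvalP x)).2.
  have h2 x : S (A2 x - z *: x) = x.
    by apply: val_inj; rewrite /= -[RHS](inv_onK fb (ssvalP x)).
  exists S; apply/graph_resolventP; split=> //; apply/bounded_opP; split.
    move=> a x y; rewrite -[RHS]h2; congr (S _).
    rewrite -{1}(h1 x) -{1}(h1 y) (bounded_op_linear _ _ _ A2_bounded).
    by rewrite scalerBr scalerDr !scalerA opprD addrACA [z * a]mulrC.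
  exists (1 + `|c|); first by rewrite ltr_pwDl.
  move=> x; have := hc (ssval (S x)) (@ssvalP _ _ ker_adjoint (S x)); rewrite fE h1 => hx.
  rewrite subsp_normE (le_trans hx)// -[c * _]ger0_norm ?(le_trans _ hx)// normrM normr_id.
  by rewrite ler_wpM2r// lerDr.
have [_ [c c0 hc]] := (bounded_opP _).1 Sb.
have lift k : range I k -> exists x : K2, ssval x = k by move=> hk; exists (@to_subsp _ _ ker_adjoint _ hk).
split; first split.
- by move=> _ /lift[x <-]; rewrite /= fE; exact: (@ssvalP _ _ ker_adjoint).
- move=> k l /set_mem/lift[x <-] /set_mem/lift[y <-]; rewrite !fE => /val_inj E.
  by rewrite -(h2 x) E h2.
- by move=> _ /lift[x <-]; exists (ssval (S x)); [exact: (@ssvalP _ _ ker_adjoint)|rewrite fE h1].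
by exists c => _ /lift[x <-]; rewrite fE -!subsp_normE -{1}(h2 x).
Qed.

Lemma resolvent_A2E z S (x : K2) : rel_resolvent (graph A2) z S ->
  resolvent_on (range I) (Atilde A G Gp) z (ssval x) = ssval (S x).
Proof.
move=> hS; have [|fb _] := (resolvent_A2P z).2; first by exists S.
have /graph_resolventP[_ h1 _] := hS.
rewrite -{1}(h1 x); exact: (inv_onK fb (ssvalP (S x))).
Qed.

Section AtPoint.
Variables (z : C) (S : K -> K).
Hypothesis hS : rel_resolvent (graph A) z S.
Local Notation Qz := (fun h => Gp (S (G h))).

Lemma transfer_bounded : bounded_op Qz.
Proof. by apply: (bounded_op_comp Gpb); apply: (bounded_op_comp hS.1). Qed.

(** The vector y = S2 (G2 h) of the kernel of [Gp] solves (A - z) y = A G gh h + G a. Applying Gp (A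
    - z)^-1 gives 0 = h + z Qz (gh h) + Qz a. *)
Lemma transfer_inverse S2 h : rel_resolvent (graph A2) z S2 ->
  Qz (Shat A G Gp h + z *: gh h + Gp2 (S2 (G2 h))) = - h.
Proof.
move=> /graph_resolventP[_ h1 _]; have /graph_resolventP[Sb k1 k2] := hS.
set y := S2 (G2 h); pose a := Shat A G Gp h + Gp2 y.
have hy : A (ssval y) - z *: ssval y = A (G (gh h)) + G a.
  have := congr1 (@ssval _ _ _) (h1 (G2 h)); rewrite -/y ssval_G2.
  rewrite (_ : ssval (A2 y - z *: y) = I (A (ssval y)) - z *: ssval y)// /Gtilde /ImP => E.
  have -> : G a = P (A (ssval y)) - P (A (G (gh h))).
    by rewrite /a (bounded_opD _ _ Gb) /Shat (bounded_opN _ Gb) addrC.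
  by rewrite [X in _ = _ + X]addrC addrA -E addrAC subrK.
have Sy : ssval y = G (gh h) + z *: S (G (gh h)) + S (G a).
  rewrite -{1}(k2 (ssval y)) hy (bounded_opD _ _ Sb); congr (_ + _).
  by rewrite -{2}(k2 (G (gh h))) (bounded_opB _ _ Sb) (bounded_opZ _ _ Sb) subrK.
have := Gp_ssval y; rewrite Sy !(bounded_opD _ _ Gpb) (bounded_opZ _ _ Gpb) KGhat => E.
have -> : Shat A G Gp h + z *: gh h + Gp2 y = z *: gh h + a by rewrite addrAC addrC.
rewrite (bounded_opD _ _ transfer_bounded) (bounded_opZ _ _ transfer_bounded).
by apply/eqP; rewrite -subr_eq0 opprK addrC addrA E.
Qed.

(** If Qz u = 0, then (A - z)^-1 G u lies in the kernel of [Gp] and is annihilated by A2 - z. *)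
Lemma transfer_injective S2 u : rel_resolvent (graph A2) z S2 -> Qz u = 0 -> u = 0.
Proof.
move=> /graph_resolventP[_ _ h2] hu; have /graph_resolventP[Sb k1 k2] := hS.
pose x : K2 := cut (S (G u)).
have xE : ssval x = S (G u) by rewrite ssval_cut ImP_id.
have x0 : x = 0.
  rewrite -(h2 x) (_ : A2 x - z *: x = 0); last first.
    apply: val_inj; rewrite (_ : \val _ = I (A (ssval x)) - z *: ssval x)// xE.
    rewrite -[X in _ - _ *: X](ImP_id hu) -(bounded_opZ _ _ Ib) -(bounded_opB _ _ Ib) k1.
    exact: ImP_G.
  by have := h2 0; rewrite (bounded_op0 A2_bounded) scaler0 subrr.
have Su : S (G u) = 0 by rewrite -xE x0.
by rewrite -(GhatK u) -(k1 (G u)) Su (bounded_op0 Ab) scaler0 subrr (bounded_op0 Gpb) (bounded_op0 ghb).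
Qed.

Lemma transfer_invertible : bdd_invertible_on setT Qz <-> rel_resolvent_set (graph A2) z.
Proof.
have Qb := transfer_bounded; split=> [[Qbij [c hc]]|[S2 hS2]].
  pose W := inv_on setT Qz.
  have W1 h : Qz (W h) = h by have [] := inv_onP Qbij (Logic.I : setT h).
  have W2 h : W (Qz h) = h by rewrite /W (inv_onK Qbij).
  have Wb : bounded_op W.
    apply/bounded_opP; split.
      by move=> a x y; rewrite -{1}(W1 x) -{1}(W1 y) -(bounded_op_linear _ _ _ Qb) W2.
    exists (1 + `|c|); first by rewrite ltr_pwDl.
    move=> x; have := hc (W x) Logic.I; rewrite W1 => hx.
    by rewrite (le_trans hx)// -[c * _]ger0_norm ?(le_trans _ hx)// normrM normr_id ler_wpM2r// lerDr.
  have /graph_resolventP[Sb k1 k2] := hS.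
  (* A Krein formula for the compressed resolvent: the correction along (A - z)^-1 G cancels the
     [Gp] component. *)
  pose S2 (x : K2) : K2 := cut (S (ssval x) - S (G (W (Gp (S (ssval x)))))).
  have S2E x : ssval (S2 x) = S (ssval x) - S (G (W (Gp (S (ssval x))))).
    by rewrite ssval_cut ImP_id// (bounded_opB _ _ Gpb) W1 subrr.
  exists S2; apply/graph_resolventP; split.
  - apply: (bounded_op_comp cutb); have Svb := bounded_op_comp Sb vb.
    apply: bounded_op_sub => //; apply: (bounded_op_comp Sb); apply: (bounded_op_comp Gb).
    by apply: (bounded_op_comp Wb); exact: (bounded_op_comp Gpb).
  - move=> x; apply: val_inj; rewrite (_ : \val _ = I (A (ssval (S2 x))) - z *: ssval (S2 x))//.
    rewrite -[X in _ - _ *: X]ImP_ssval -(bounded_opZ _ _ Ib) -(bounded_opB _ _ Ib) S2E.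
    have sB u v : A (u - v) - z *: (u - v) = (A u - z *: u) - (A v - z *: v) := bounded_opB u v (shift_bounded Ab z).
    by rewrite sB !k1 (bounded_opB _ _ Ib) ImP_G subr0 ImP_ssval.
  - move=> x; apply: val_inj; rewrite -[LHS]/(ssval (S2 (A2 x - z *: x))) S2E.
    set t := gh (Gp (A (ssval x))).
    have uE : ssval (A2 x - z *: x) = A (ssval x) - z *: ssval x - G t.
      by rewrite (_ : ssval _ = I (A (ssval x)) - z *: ssval x)// /ImP addrAC.
    have Su : S (ssval (A2 x - z *: x)) = ssval x - S (G t) by rewrite uE (bounded_opB _ _ Sb) k2.
    rewrite Su (bounded_opB _ _ Gpb) Gp_ssval sub0r (bounded_opN _ Wb) W2.
    by rewrite (bounded_opN _ Gb) (bounded_opN _ Sb) opprK subrK.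
pose V h := - (Shat A G Gp h + z *: gh h + Gp2 (S2 (G2 h))).
have QV h : Qz (V h) = h by rewrite /V (bounded_opN _ Qb) (transfer_inverse _ hS2) opprK.
have inj u v : Qz u = Qz v -> u = v.
  move=> E; apply/eqP; rewrite -subr_eq0; apply/eqP; apply: (transfer_injective hS2).
  by rewrite (bounded_opB _ _ Qb) E subrr.
have VQ h : V (Qz h) = h by apply: inj; rewrite QV.
have Vb : bounded_op V.
  have b1 : bounded_op (Shat A G Gp).
    rewrite (_ : Shat A G Gp = fun h => (-1) *: gh (Gp (A (G (gh h))))); last by apply/funext => h; rewrite scaleN1r.
    apply: bounded_op_scale; apply: (bounded_op_comp ghb); apply: (bounded_op_comp Gpb).
    by apply: (bounded_op_comp Ab); exact: bounded_op_comp.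
  rewrite (_ : V = fun h => (-1) *: (Shat A G Gp h + z *: gh h + Gp2 (S2 (G2 h)))); last by apply/funext => h; rewrite scaleN1r.
  apply: bounded_op_scale; apply: bounded_op_add.
    by apply: bounded_op_add => //; exact: bounded_op_scale.
  by apply: (bounded_op_comp Gp2_bounded); apply: (bounded_op_comp hS2.1); exact: G2_bounded.
split; first by split=> // [x y _ _ /inj//|y _]; exists (V y).
by have [_ [c _ hc]] := (bounded_opP _).1 Vb; exists c => v _; rewrite -{1}(VQ v).
Qed.

Lemma transfer_neg_inverse S2 h : rel_resolvent (graph A2) z S2 ->
  - inv_on setT Qz h = Shat A G Gp h + z *: gh h + Gp2 (S2 (G2 h)).
Proof.
move=> hS2; have [|Qbij _] := transfer_invertible.2; first by exists S2.
rewrite -{1}[h]opprK -(transfer_inverse h hS2) -(bounded_opN _ transfer_bounded).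
by rewrite (inv_onK Qbij)// opprK.
Qed.
End AtPoint.

(** Since cut (A x) = A2 (cut x) + G2 (Gp x), [cut] sends every moment of (A, G) into the closed
    span of the moments of (A2, G2). *)
Lemma moments_reduce : closure (lin_span [set x | exists k y, range G y /\ x = iter k A y]) = setT ->
  closure (lin_span [set x | exists k y, range G2 y /\ x = iter k A2 y]) = setT.
Proof.
set Y := [set x | exists k y, range G2 y /\ _]; set W := closure (lin_span Y) => tot.
have WS : subspace W by apply: closure_subspace; exact: subspace_lin_span.
have Wc : closed W by exact: closed_closure.
have AW : forall v, W v -> W (A2 v) by exact: (iter_span_invariant A2_bounded).
have GW h : W (G2 h).
  apply: subset_closure; exists 1%N, (fun=> 1), (fun=> G2 h); split=> [_|]; last by rewrite big_ord1 scale1r.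
  by exists 0%N, (G2 h); split=> //; exists h.
have inv k y : range G y -> W (cut (iter k A y)).
  move=> [h _ <-]; elim: k => [|k IH].
    by rewrite /= (_ : cut (G h) = 0); [exact: WS.1|apply: val_inj; rewrite /= ImP_G].
  rewrite iterS; set x := iter k A _ in IH *.
  have -> : cut (A x) = A2 (cut x) + G2 (Gp x).
    have {1}-> : x = ssval (cut x) + G (gh (Gp x)) by rewrite ssval_cut /ImP subrK.
    by rewrite (bounded_opD _ _ Ab) (bounded_opD _ _ cutb).
  by apply: (subspaceD WS); [exact: AW|exact: GW].
apply/seteqP; split=> // x _; rewrite -(cut_ssval x).
have [_ [c c0 hc]] := (bounded_opP _).1 cutb.
have /closureE hx : closure (lin_span [set x | exists k y, range G y /\ x = iter k A y]) (ssval x) by rewrite tot.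
move/closedE: Wc; apply => d d0; have [v [m [a [f [hf ->]]]] hv] := hx _ (divr_gt0 d0 c0).
exists (cut (\sum_i a i *: f i)).
  rewrite (bounded_op_sum _ _ _ cutb); apply: (@subspace_sum _ _ W _ _ _ (fun i => cut (a i *: f i)) WS) => i _.
  by rewrite (bounded_opZ _ _ cutb); apply: (subspaceZ _ WS); have [k [y [hy ->]]] := hf i; exact: inv.
by rewrite -(bounded_opB _ _ cutb) (le_lt_trans (hc _))// -ltr_pdivlMl// mulrC.
Qed.

Hypothesis moments : closure (lin_span [set x | exists k y, range G y /\ x = iter k A y]) = setT.

(* In the minimal representation of the inverse of [Gp (A - z)^-1 G] the
   operator [A] is restricted to the kernel of [Gp], with multivalued part
   the range of [G]. *)
Definition inverse_rel : set (K * K) := [set p | Gp p.1 = 0 /\ I (p.2 - A p.1) = 0].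

Lemma ImP_idem k : I (I k) = I k.
Proof. by apply: ImP_id; exact: Gp_ImP. Qed.

Lemma inverse_relE x y : inverse_rel (x, y) <-> Gp x = 0 /\ I y = I (A x).
Proof.
rewrite /inverse_rel /= (bounded_opB _ _ Ib); split=> -[-> h]; split=> //.
  by apply/eqP; rewrite -subr_eq0 h.
by rewrite h subrr.
Qed.

Lemma inverse_rel_selfadjoint : selfadjoint_rel br inverse_rel.
Proof.
have br_I x y : Gp x = 0 -> br y x = br (I y) x.
  by move=> hx; rewrite ImP_sym ImP_id.
apply/seteqP; split=> -[x y].
  move=> /inverse_relE[Gx Iy] -[u v] /inverse_relE[Gu Iv] /=.
  rewrite br_I// Iy -br_I// Asa hfC br_I// -Iv -br_I// -hfC//.
(* Pairing with the multivalued part (0, G k) forces [x] into the kernel of [Gp]; pairing with (I w,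
   A (I w)) then determines [I y]. *)
move=> /= h; have Gx : Gp x = 0.
  apply: (@ip_ext _ _ ip) => k; rewrite ip0l Gadj.
  by rewrite -(h (0, G k)) ?hf0r//; apply/inverse_relE; rewrite (bounded_op0 Gpb) (bounded_op0 Ab) (bounded_op0 Ib) ImP_G.
apply/inverse_relE; split=> //; apply/eqP; rewrite -subr_eq0 -(bounded_opB _ _ Ib); apply/eqP.
apply: (krein_nondeg Kr) => w; rewrite ImP_sym hfBl Asa.
rewrite (h (I w, A (I w))) ?subrr//; apply/inverse_relE; split=> //; exact: Gp_ImP.
Qed.

Lemma ssval_A2 z (u : K2) : ssval (A2 u - z *: u) = I (A (ssval u)) - z *: ssval u.
Proof. by []. Qed.

Lemma inverse_rel_resolvent z S2 : rel_resolvent (graph A2) z S2 ->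
  rel_resolvent inverse_rel z (fun w => ssval (S2 (cut w))).
Proof.
move=> hS2; have /graph_resolventP[Sb h1 h2] := hS2; split.
  by apply: (bounded_op_comp vb); exact: bounded_op_comp.
move=> x w; split=> [<-|/inverse_relE[Gx Ix]].
  apply/inverse_relE; split; first exact: Gp_ssval.
  have := congr1 (@ssval _ _ _) (h1 (cut w)); rewrite ssval_A2 ssval_cut => E.
  by rewrite (bounded_opD _ _ Ib) (bounded_opZ _ _ Ib) ImP_ssval -E subrK.
have xE : ssval (cut x) = x by rewrite ssval_cut ImP_id.
rewrite -[RHS]xE -[in RHS](h2 (cut x)); congr (ssval (S2 _)); apply: val_inj.
rewrite -[RHS]/(ssval _) ssval_A2 xE -Ix (bounded_opD _ _ Ib) (bounded_opZ _ _ Ib) (ImP_id Gx).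
by rewrite addrK.
Qed.

Lemma inverse_rel_resolvent_set z S : rel_resolvent inverse_rel z S -> rel_resolvent_set (graph A2) z.
Proof.
move=> hS; have [Sb _] := hS; exists (fun x => cut (S (ssval x))); apply/graph_resolventP; split.
- by apply: (bounded_op_comp cutb); exact: (bounded_op_comp Sb).
- move=> x; have /inverse_relE[Gu Iu] := rel_resolventK (ssval x) hS.
  have uE : ssval (cut (S (ssval x))) = S (ssval x) by rewrite ssval_cut ImP_id.
  apply: val_inj; rewrite -[LHS]/(ssval _) ssval_A2 uE -Iu (bounded_opD _ _ Ib) (bounded_opZ _ _ Ib).
  by rewrite (ImP_id Gu) addrK ImP_ssval.
- move=> x; rewrite -[RHS]cut_ssval; congr (cut _); apply/(hS.2 _ _)/inverse_relE; split; first exact: Gp_ssval.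
  by rewrite ssval_A2 subrK ImP_idem.
Qed.

Lemma inverse_rel_eigenvalue l : rel_eigenvalue inverse_rel (Some l) <-> rel_eigenvalue (graph A2) (Some l).
Proof.
split=> [[x x0 /inverse_relE[Gx Ix]]|[x x0 hx]].
  exists (cut x); first by apply: contra_neq x0 => /(congr1 (@ssval _ _ _)); rewrite ssval_cut ImP_id.
  apply: val_inj; rewrite -[LHS]/(ssval (l *: cut x)) -[RHS]/(I (A (ssval (cut x)))) ssvalZ ssval_cut (ImP_id Gx) -Ix.
  by rewrite (bounded_opZ _ _ Ib) (ImP_id Gx).
exists (ssval x); first by apply: contra_neq x0 => h; apply: val_inj.
apply/inverse_relE; split; first exact: Gp_ssval.
by rewrite (bounded_opZ _ _ Ib) ImP_ssval; exact: (congr1 (@ssval _ _ _) (hx : l *: x = A2 x)).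
Qed.

(** The domain of [inverse_rel] is the kernel of [Gp], where [cut] and [ssval] are mutually inverse
    and exchange the root chains. *)
Lemma inverse_rel_root_manifold l : same_dim (root_manifold inverse_rel l) (root_manifold (graph A2) l).
Proof.
have ker m x : rel_ker_pow inverse_rel l m x -> Gp x = 0 /\ rel_ker_pow (graph A2) l m (cut x).
  elim: m x => [|m IH] x /=.
    by move=> ->; rewrite (bounded_op0 Gpb) (bounded_op0 cutb).
  move=> [y /inverse_relE[Gx Ix] /IH[Gy hy]]; split=> //; exists (cut y) => //.
  apply: val_inj; rewrite -[LHS]/(I y + l *: I x) -[RHS]/(I (A (I x))) (ImP_id Gx) -Ix.
  by rewrite (bounded_opD _ _ Ib) (bounded_opZ _ _ Ib) (ImP_id Gx).
have ker' m (x : K2) : rel_ker_pow (graph A2) l m x -> rel_ker_pow inverse_rel l m (ssval x).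
  elim: m x => [|m IH] x /=; first by move=> ->.
  move=> [y hy /IH h]; exists (ssval y) => //; apply/inverse_relE; split; first exact: Gp_ssval.
  rewrite (bounded_opD _ _ Ib) (bounded_opZ _ _ Ib) !ImP_ssval.
  exact: (congr1 (@ssval _ _ _) (hy : y + l *: x = A2 x)).
exists cut; split; last by move=> a x y _ _; rewrite (bounded_op_linear _ _ _ cutb).
split.
- by move=> x [m /ker[_ h]]; exists m.
- move=> x y /set_mem[m /ker[Gx _]] /set_mem[m' /ker[Gy _]] /(congr1 (@ssval _ _ _)).
  by rewrite !ssval_cut !ImP_id.
- by move=> x [m hx]; exists (ssval x); [exists m; exact: ker'|exact: cut_ssval].
Qed.

Section Q2.
Variable Gtp : K -> H.
Hypothesis Gtadj : forall k h, range I k -> ip (Gtp k) h = br k (Gtilde A G Gp h).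

Lemma Gtp_ssval (x : K2) : Gtp (ssval x) = Gp2 x.
Proof.
apply: (@ip_ext _ _ ip) => h; rewrite G2_adjoint Gtadj//.
exact: (@ssvalP _ _ ker_adjoint).
Qed.

Lemma Qhat2_val z S h : rel_resolvent (graph A2) z S -> Qhat2 A G Gp Gtp z h = Gp2 (S (G2 h)).
Proof. by move=> hS; rewrite /Qhat2 /= -ssval_G2 (resolvent_A2E _ hS) Gtp_ssval. Qed.
End Q2.

Lemma Shat_bounded : bounded_op (Shat A G Gp).
Proof.
rewrite (_ : Shat A G Gp = fun h => (-1) *: gh (Gp (A (G (gh h))))); last by apply/funext => h; rewrite scaleN1r.
apply: bounded_op_scale; apply: (bounded_op_comp ghb); apply: (bounded_op_comp Gpb).
by apply: (bounded_op_comp Ab); exact: bounded_op_comp.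
Qed.

Lemma Shat_sym x y : ip (Shat A G Gp x) y = ip x (Shat A G Gp y).
Proof.
rewrite /Shat ipNl ipNr; congr (- _).
by rewrite [LHS]Ghat_sym -[RHS]Ghat_sym [RHS]ipC !Gadj -hfC Asa.
Qed.

Section Inverse.
Variable Q : opfun H.
Hypothesis domQ : forall z, dom Q z <-> rel_resolvent_set (graph A) z.
Hypothesis valQ : forall z S h, rel_resolvent (graph A) z S -> Q z h = Gp (S (G h)).

Lemma neg_inverse_dom z : dom (neg_inverse Q) z <-> dom Q z /\ rel_resolvent_set (graph A2) z.
Proof.
have QE S : rel_resolvent (graph A) z S -> Q z = fun h => Gp (S (G h)) by move=> hS; apply/funext => h; exact: valQ.
split=> [[Qz]|[Qz h]].
  by have /domQ[S hS] := Qz; rewrite (QE S hS) => h; split=> //; apply/(transfer_invertible hS).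
by have /domQ[S hS] := Qz; split=> //; rewrite (QE S hS); apply/(transfer_invertible hS).
Qed.

Lemma neg_inverse_val z S2 h : dom Q z -> rel_resolvent (graph A2) z S2 ->
  neg_inverse Q z h = Shat A G Gp h + z *: gh h + Gp2 (S2 (G2 h)).
Proof.
move=> /domQ[S hS] hS2; rewrite -(transfer_neg_inverse hS h hS2) /neg_inverse /=; congr (- inv_on _ _ _).
by apply/funext => u; exact: valQ.
Qed.

Let A2b := A2_bounded.
Let A2sa := A2_selfadjoint.

Lemma inverse_representation n2 (e2 : 'I_n2 -> K2) : maxneg br2 e2 ->
  minimal_representation ip (neg_inverse Q) br inverse_rel.
Proof.
move=> me2; have gsa := graph_selfadjoint br2_krein A2sa.
have [s hs] := nonreal_resolvent (graph_selfadjoint Kr Asa) Kr me (graph_resolvent_nonempty Ab).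
have [s' hs'] := nonreal_resolvent gsa br2_krein me2 (graph_resolvent_nonempty A2b).
have [z0 [z0i]] := unbounded_upper (s ++ s') ltr01; rewrite mem_cat negb_or => /andP[z0s z0s'] _.
have Iz0 : 'Im z0 != 0 by rewrite gt_eqF.
have Qz0 : dom Q z0 by apply/domQ; exact: hs.
have [S0 hS0] := hs' z0 Iz0 z0s'.
have [S0' hS0'] := resolvent_conj gsa br2_krein me2 Iz0 hS0.
have /choice[S hS] : forall z, exists S, rel_resolvent_set (graph A2) z -> rel_resolvent (graph A2) z S.
  by move=> z; case: (pselect (rel_resolvent_set (graph A2) z)) => [[S hS]|]; [exists S|exists id].
(* A constant part for the linear summand plus the gamma field of [Qhat2]; the two are orthogonal,
   so their kernels add as the functions do. *)
pose Gam z h := G (gh h) + ssval (S z (G2 h)).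
have GamE z S1 h : rel_resolvent (graph A2) z S1 -> Gam z h = G (gh h) + ssval (S1 (G2 h)).
  by move=> hS1; rewrite /Gam (rel_resolvent_unique (hS z _) hS1)//; exists S1.
have Fz0 : dom (neg_inverse Q) z0 by apply/neg_inverse_dom; split=> //; exists S0.
have cross (x : K2) h : br (ssval x) (G h) = 0 by rewrite -Gadj Gp_ssval ip0l.
have cross' (x : K2) h : br (G h) (ssval x) = 0 by rewrite hfC cross conjC0.
have gG h h' : br (G (gh h)) (G (gh h')) = ip (gh h) h' by rewrite -Gadj KGhat Ghat_sym.
have Fb : bounded_op (neg_inverse Q z0).
  rewrite (_ : (neg_inverse Q z0 : H -> H) = fun h => Shat A G Gp h + z0 *: gh h + Gp2 (S0 (G2 h))); last first.
    by apply/funext => h; exact: neg_inverse_val.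
  apply: bounded_op_add; first by apply: bounded_op_add; [exact: Shat_bounded|exact: bounded_op_scale].
  by apply: (bounded_op_comp Gp2_bounded); apply: (bounded_op_comp hS0.1); exact: G2_bounded.
have [Fs _ hFs] := adjoint_exists H_hilbert Fb.
apply: (@representation_of_gamma _ _ ip _ br (neg_inverse Q) Gam inverse_rel n e z0 (fun w => ssval (S0 (cut w)))
   (fun k => gh (Gp k) + Gp2 (S0' (cut k))) Fs) => //.
- exact: inverse_rel_selfadjoint.
- exact: inverse_rel_resolvent.
- rewrite (_ : Gam z0 = fun h => G (gh h) + ssval (S0 (G2 h))); last by apply/funext => h; exact: GamE.
  apply: bounded_op_add; first exact: bounded_op_comp.
  by apply: (bounded_op_comp vb); apply: (bounded_op_comp hS0.1); exact: G2_bounded.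
- move=> k h; rewrite (GamE _ _ _ hS0) hfDr ipDl Ghat_sym Gadj; congr (_ + _).
  rewrite G2_adjoint [RHS](_ : _ = br2 (cut k) (S0 (G2 h))); last by rewrite br2E ssval_cut ImP_sym ImP_ssval.
  by rewrite hfC -(resolvent_adjoint gsa _ _ hS0 hS0') -hfC.
- by move=> h h'; rewrite ipC -hFs -ipC.
- move=> z S1 h hS1; have [S2 hS2] := inverse_rel_resolvent_set hS1.
  rewrite (rel_resolvent_unique hS1 (inverse_rel_resolvent hS2)) (GamE _ _ _ hS2) (GamE _ _ _ hS0).
  rewrite (bounded_opD _ _ cutb) cut_ssval (_ : cut (G (gh h)) = 0) ?add0r; last by apply: val_inj; exact: ImP_G.
  rewrite -addrA; congr (_ + _); rewrite -ssvalZ -ssvalD; congr ssval.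
  exact: (resolvent_gamma _ _ hS2 hS0).
- move=> z S1 h h' Fz _; have [Qz [S2 hS2]] := (neg_inverse_dom z).1 Fz.
  have -> : br (Gam z h) (Gam z0 h') = ip (gh h) h' + br2 (S2 (G2 h)) (S0 (G2 h')).
    by rewrite (GamE _ _ _ hS2) (GamE _ _ _ hS0) hfDl !hfDr cross cross' addr0 add0r gG.
  rewrite mulrDr (resolvent_kernel A2sa G2_adjoint _ _ hS2 hS0).
  rewrite (neg_inverse_val _ Qz hS2) (neg_inverse_val _ Qz0 hS0).
  by rewrite !ipDl !ipDr !ipZl !ipZr Shat_sym -Ghat_sym; ring.
set Y := [set k | exists z S h, _]; set W := closure (lin_span Y).
have WS : subspace W by apply: closure_subspace; exact: subspace_lin_span.
have Wc : closed W by exact: closed_closure.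
have YW z S1 h : rel_resolvent (graph A2) z S1 -> W (G (gh h) + ssval (S1 (G2 h))).
  move=> hS1; apply: subset_closure; exists 1%N, (fun=> 1), (fun=> G (gh h) + ssval (S1 (G2 h))).
  split=> [_|]; last by rewrite big_ord1 scale1r.
  exists z, (fun w => ssval (S1 (cut w))), h; split; first exact: inverse_rel_resolvent.
  by rewrite (GamE _ _ _ hS1).
(* As z goes to infinity the second part of the gamma vector vanishes, so the constant part lies in
   the closed span. *)
have WG h : W (G h).
  rewrite -(GhatK h); move: (Gp (G h)) => {}h; move/closedE: Wc; apply => d d0.
  have [_ [c c0 hc]] := (bounded_opP _).1 A2b.
  have d1 : 0 < c + (1 + `|G2 h|) / d by rewrite addr_gt0// divr_gt0// ltr_pwDl.
  have cz : c < `|c + (1 + `|G2 h|) / d| by rewrite gtr0_norm// ltrDl divr_gt0// ltr_pwDl.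
  have [S1 hS1 S1b] := resolvent_large A2b hc (ltW c0) cz; exists (G (gh h) + ssval (S1 (G2 h))); first exact: YW hS1.
  rewrite opprD addrA subrr sub0r normrN -subsp_normE (le_lt_trans (S1b _))// gtr0_norm//.
  by rewrite addrAC subrr add0r invf_div mulrCA gtr_pMr// ltr_pdivrMr ?ltr_pwDl// mul1r ltrDr.
(* With the constant part removed, the resolvent vectors of [A2] remain, and these are total in the
   kernel of [Gp]. *)
have W2 (x : K2) : W (ssval x).
  have := resolvents_total A2b (U := setT) (moments_reduce moments).
  have [h|[]] := pselect (forall r : C, 0 < r -> exists2 z, [set: C] z & r < `|z|); last first.
    by move=> r r0; exists (r + 1) => //; rewrite gtr0_norm ?addr_gt0// ltrDl.
  move=> /(_ h) tot; have : closure (lin_span [set x | exists z S y, [/\ [set: C] z, rel_resolvent (graph A2) z S, range G2 y & x = S y]]) x by rewrite tot.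
  move=> /closureE hx; move/closedE: Wc; apply => d d0.
  have [v [m [a [f [hf ->]]]] xv] := hx d d0; exists (ssval (\sum_i a i *: f i)) => //.
  rewrite (bounded_op_sum _ _ _ vb); apply: (@subspace_sum _ _ W _ _ _ (fun i => ssval (a i *: f i)) WS) => i _.
  rewrite ssvalZ; apply: (subspaceZ _ WS).
  have [z [S1 [_ [_ hS1 [u _ <-] ->]]]] := hf i.
  by rewrite -[ssval _](addKr (G (gh u))); apply: (subspaceD WS); [rewrite -scaleN1r; exact: (subspaceZ _ WS)|exact: YW hS1].
apply/seteqP; split=> // k _.
have -> : k = G (gh (Gp k)) + ssval (cut k) by rewrite ssval_cut /ImP addrC subrK.
by apply: (subspaceD WS).
Qed.
End Inverse.

Lemma lin_span_all (V : completeNormedModType C) (S : set V) : (forall v, S v) -> closure (lin_span S) = setT.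
Proof.
move=> hS; apply/seteqP; split=> // v _; apply: subset_closure; exists 1%N, (fun=> 1), (fun=> v).
by split=> //; rewrite big_ord1 scale1r.
Qed.

(** * The linear summand [Qhat1] *)

Section LinearPart.
Let br1 := form_of ghb Ghat_sym.

Lemma Qhat1_kernel z w h h' : (z - w^*) * br1 h h' = ip (Qhat1 A G Gp z h) h' - ip h (Qhat1 A G Gp w h').
Proof. by rewrite form_ofE /= ipDl ipDr ipZl ipZr Shat_sym -[ip h (gh h')]Ghat_sym; ring. Qed.

Lemma Qhat1_sym z h h' : ip (Qhat1 A G Gp z h) h' = ip h (Qhat1 A G Gp z^* h').
Proof. by rewrite /= ipDl ipDr ipZl ipZr conjCK Shat_sym Ghat_sym. Qed.

Lemma Ghat_form_krein : krein br1.
Proof. by have [c c0 hc] := Ghat_below; exact: (form_of_krein H_hilbert _ _ c0 hc). Qed.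

Variables (n1 : nat) (e1 : 'I_n1 -> H).
Hypothesis me1 : maxneg (form_of gram_op_bounded gram_op_sym) e1.

(** An invertible self-adjoint operator carries its own form to that of its inverse, so both have
    the same index. *)
Lemma Ghat_form_maxneg : maxneg br1 (fun i => Gp (G (e1 i))).
Proof.
have E x y : br1 x (Gp (G y)) = form_of gram_op_bounded gram_op_sym (gh x) y.
  exact: (esym (gram_op_sym (gh x) y)).
have [s1 p1] := me1; split=> [i j|x hx]; first by rewrite E GhatK.
by rewrite -{2}(KGhat x) E; apply: p1 => i; rewrite -E.
Qed.

Lemma Qhat1_class : gen_nevanlinna ip n1 (Qhat1 A G Gp).
Proof.
(* The kernel of an affine function is constant, here the form of [gh], so the identity of [H] is a
   gamma field. *)
pose Gam (_ : C) (h : H) := h.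
have ker z w h h' : dom (Qhat1 A G Gp) z -> dom (Qhat1 A G Gp) w -> 0 < 'Im z -> 0 < 'Im w ->
    (z - w^*) * br1 (Gam z h) (Gam w h') = ip (Qhat1 A G Gp z h) h' - ip h (Qhat1 A G Gp w h').
  by move=> *; exact: Qhat1_kernel.
have holo : holomorphic_on setT (Qhat1 A G Gp).
  rewrite (_ : (Qhat1 A G Gp : C -> H -> H) = fun z h => Shat A G Gp h + (z - 0) *: gh h); last first.
    by apply/funext => z; apply/funext => h; rewrite subr0.
  apply: holomorphic_add; first by apply: holomorphic_cst; exact: Shat_bounded.
  by apply: (@holomorphic_mul _ _ _ (fun=> gh)); exact: holomorphic_cst.
split=> //.
- exact: openT.
- move=> z _; exists 0%N, setT, (Qhat1 A G Gp); split=> //; first exact: openT.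
  by move=> w _ _; split=> // h; rewrite expr0 scale1r.
- by move=> z _; split=> // h h'; exact: Qhat1_sym.
- by move=> m z h hz; apply: (kernel_index_le ker h Ghat_form_maxneg hz).
- apply: (kernel_index_attained ker Ghat_form_krein Ghat_form_maxneg).
  by apply: lin_span_all => v; exists 'i, v; split=> //; rewrite Im_i ltr01.
Qed.

(** The purely multivalued relation: its resolvent is 0 at every point, and infinity is its only
    eigenvalue when [H] is nonzero. *)
Definition zero_domain_rel : set (H * H) := [set p | p.1 = 0].

Lemma zero_domain_resolvent z : rel_resolvent zero_domain_rel z (fun=> 0).
Proof.
split; first exact: bounded_op_zero.
by move=> x w; rewrite /zero_domain_rel /=; split.
Qed.

Lemma Qhat1_representation : minimal_representation ip (Qhat1 A G Gp) br1 zero_domain_rel.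
Proof.
apply: (@representation_of_gamma _ _ ip _ br1 (Qhat1 A G Gp) (fun _ h => h) zero_domain_rel _ _ 'i (fun=> 0) gh
  (fun h => Qhat1 A G Gp ('i)^* h) Ghat_form_krein Ghat_form_maxneg) => //.
- apply/seteqP; split=> -[x y]; rewrite /zero_domain_rel /=.
    by move=> -> [u v] /= ->; rewrite ip0r (bounded_op0 ghb) ip0l.
  move=> h; apply: (krein_nondeg Ghat_form_krein) => v.
  by have := h (0, v) erefl; rewrite /= ip0r => /esym.
- by rewrite Im_i ltr01.
- exact: zero_domain_resolvent.
- exact: bounded_op_id.
- by move=> h h'; rewrite Qhat1_sym conjCK.
- by move=> z S h hS; rewrite (rel_resolvent_unique hS (zero_domain_resolvent z)) scaler0 addr0.
- by move=> z S h h' _ _; exact: Qhat1_kernel.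
- by apply: lin_span_all => v; exists 0, (fun=> 0), v; split=> //; exact: zero_domain_resolvent.
Qed.

Lemma Qhat1_pole (H_nonzero : exists h : H, h != 0) a : generalized_pole ip (Qhat1 A G Gp) a <-> a = None.
Proof.
split=> [[K' [br' [B' [rep hB]]]]|->]; last first.
  by exists H, br1, zero_domain_rel; split; [exact: Qhat1_representation|have [h h0] := H_nonzero; exists h].
have iso := @minimal_representation_unique _ _ ip _ _ _ _ _ _ (Qhat1 A G Gp) [::]
  (fun _ _ _ => Logic.I) rep Qhat1_representation.
have := rep_iso_eigenvalue iso hB; case: a {hB} => [l|//] [x x0 hx].
by move: x0; rewrite (hx : x = 0) eqxx.
Qed.
End LinearPart.

Lemma Qhat1_nonzero (H_nonzero : exists h : H, h != 0) : exists z h, Qhat1 A G Gp z h != 0.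
Proof.
have [h h0] := H_nonzero; apply: contrapT => hn.
have q0 z : Shat A G Gp h + z *: gh h = 0.
  by apply/eqP; apply: contraT => hz; case: hn; exists z, h.
have g0 : gh h = 0 by have := q0 1; have := q0 0; rewrite scale0r addr0 => ->; rewrite add0r scale1r.
by move/eqP: h0; apply; rewrite -(KGhat h) g0 (bounded_op0 Gb) (bounded_op0 Gpb).
Qed.

Lemma range_Pproj_pontryagin n1 (e1 : 'I_n1 -> H) : maxneg (form_of gram_op_bounded gram_op_sym) e1 ->
  pontryagin br (range P) n1.
Proof.
move=> me1; have [c c0 hc] := gram_op_below; have [_ [p p0 hp]] := (bounded_opP _).1 Gpb.
have FK := form_of_krein H_hilbert gram_op_bounded gram_op_sym c0 hc.
have cl := range_Pproj_closed; rewrite range_Pproj_range in cl *.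
apply: (@pontryagin_image _ _ _ (form_of gram_op_bounded gram_op_sym) br G (c * p)) => //.
- by rewrite mulr_gt0.
- by move=> x; rewrite (le_trans (hc x))// -mulrA ler_pM2l//; exact: hp.
- by move=> x y; rewrite form_ofE /= Gadj.
- exact: maxneg_pontryagin FK me1.
Qed.

End Reduction.

(** * Poles read off any given minimal representation *)

Section DimensionsAndRepresentations.
Variable R : realType.
Local Notation C := (Cplx R).

Lemma same_dim_trans (V W X : completeNormedModType C) (M : set V) (N : set W) (O : set X) :
  same_dim M N -> same_dim N O -> same_dim M O.
Proof.
move=> [f [[fM fi fs] fl]] [g [[gN gi gs] gl]]; exists (g \o f); split; first split.
- by move=> x /fM/gN.
- move=> x y xM yM /= E; apply: fi => //; apply: gi E; apply/mem_set/fM; exact: set_mem.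
- by move=> z /gs[y /fs[x Mx <-] <-]; exists x.
by move=> a x y Mx My /=; rewrite fl// gl//; exact: fM.
Qed.

Variables (H : completeNormedModType C) (ip : {dot H for conjC}) (F : opfun H).
Variables (K : completeNormedModType C) (br : {hermitian K for false & conjC}) (B : set (K * K)).
Variable s : seq C.
Hypotheses (hs : forall z, 'Im z != 0 -> z \notin s -> dom F z) (rep : minimal_representation ip F br B).

Lemma generalized_poleP a : generalized_pole ip F a <-> rel_eigenvalue B a.
Proof.
split=> [[K' [br' [B' [rep' h]]]]|h]; last by exists K, br, B.
exact: rep_iso_eigenvalue (minimal_representation_unique hs rep' rep) h.
Qed.
End DimensionsAndRepresentations.

(** * A function with vanishing second summand: -1/z times the identity *)

Section Example.
Variable R : realType.
Local Notation C := (Cplx R).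
Variables (H : completeNormedModType C) (ip : {dot H for conjC}).
Hypotheses (H_hilbert : hilbert_norm ip) (H_nonzero : exists h : H, h != 0).

Lemma idsym (x y : H) : ip (id x) y = ip x (id y). Proof. by []. Qed.
Let br' := form_of (@bounded_op_id _ H) idsym.
Let A' (h : H) : H := 0.
Let Q' : opfun H := OpFun [set z : C | z != 0] (fun z h => - (z^-1 *: h)).

Lemma zero_op_resolvent z : z != 0 -> rel_resolvent (graph A') z (fun h => - (z^-1 *: h)).
Proof.
move=> z0; apply/graph_resolventP; split.
- rewrite (_ : (fun h => _) = (fun h : H => (- z^-1) *: id h)); last by apply/funext => h; rewrite scaleNr.
  by apply: bounded_op_scale; exact: bounded_op_id.
- by move=> x; rewrite /A' sub0r scalerN opprK scalerA mulfV// scale1r.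
- by move=> x; rewrite /A' sub0r scalerN opprK scalerA mulVf// scale1r.
Qed.

Lemma zero_op_resolvent_set z : z != 0 <-> rel_resolvent_set (graph A') z.
Proof.
split=> [z0|[S /graph_resolventP[_ h1 _]]]; first by exists (fun h => - (z^-1 *: h)); exact: zero_op_resolvent.
apply/eqP => z0; have [h /eqP] := H_nonzero; apply.
by rewrite -(h1 h) z0 scale0r /A' subrr.
Qed.

Lemma reciprocal_val z S h : rel_resolvent (graph A') z S -> Q' z h = id (S (id h)).
Proof.
move=> hS; have z0 : z != 0 by apply/zero_op_resolvent_set; exists S.
by rewrite (rel_resolvent_unique hS (zero_op_resolvent z0)).
Qed.

Lemma identity_krein : krein br'.
Proof. by apply: (@form_of_krein _ _ _ H_hilbert _ _ _ 1) => // x; rewrite mul1r. Qed.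

Lemma identity_maxneg : @maxneg _ _ br' 0 (fun=> 0).
Proof. by split=> [[]//|x _]; rewrite form_ofE -H_hilbert exprn_ge0. Qed.

Lemma zero_op_selfadjoint : selfadjoint_op br' A'.
Proof. by move=> x y; apply: (etrans (ip0l ip y)); exact: (esym (ip0r ip x)). Qed.

Lemma zero_op_bounded : bounded_op A'. Proof. exact: bounded_op_zero. Qed.

Lemma reciprocal_class : gen_nevanlinna ip 0 Q'.
Proof.
have idb := @bounded_op_id _ H.
have adj k h : ip (id k) h = br' k (id h) by [].
have dQ z : dom Q' z <-> rel_resolvent_set (graph A') z := zero_op_resolvent_set z.
have vQ := reciprocal_val.
have mom : closure (lin_span [set x | exists k y, range (@id H) y /\ x = iter k A' y]) = setT.
  by apply: lin_span_all => v; exists 0%N, v; split=> //; exists v.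
split.
- exact: (transfer_open dQ).
- exact: (transfer_holomorphic idb idb dQ vQ).
- exact: (transfer_meromorphic identity_krein identity_maxneg zero_op_bounded zero_op_selfadjoint idb idb dQ vQ).
(* No continuation across 0 exists: at a small positive point [m] the reciprocal exceeds the local
   bound [M] that a continuation would impose. *)
- move=> z U G Uo Uz hG GF /=; apply/eqP => z0; rewrite {z}z0 in Uz.
  have [d d0 hd] := op_differentiable_cont (hG 0 Uz).2 ltr01; have [r r0 hr] := (open_CP U).1 Uo 0 Uz.
  have [h h0] := H_nonzero; have h1 : 0 < `|h| by rewrite normr_gt0.
  pose M := `|G 0 h| + `|h|; have M0 : 0 < M by rewrite ltr_wpDl.
  have [|m m0 hm] := @pos_lower _ [:: d / 2; r / 2; `|h| / M / 2].
    by move=> x; rewrite !inE => /or3P[] /eqP ->; rewrite pos_half// divr_gt0.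
  have half (x : C) : 0 < x -> m <= x / 2 -> m < x.
    by move=> x0 /le_lt_trans; apply; rewrite ltr_pdivrMr// ltr_pMr// ltr1n.
  have md : m < d by apply: half => //; apply: hm; rewrite !inE eqxx.
  have mr : m < r by apply: half => //; apply: hm; rewrite !inE eqxx orbT.
  have mM : m < `|h| / M by apply: half; [rewrite divr_gt0|apply: hm; rewrite !inE eqxx !orbT].
  have mn : `|m - 0| = m by rewrite subr0 gtr0_norm.
  have Um : U m by apply: hr; rewrite mn.
  have := hd m; rewrite mn => /(_ md h); rewrite mul1r (GF m Um); last by rewrite /= gt_eqF.
  move=> hle; have : `|m^-1 *: h| <= M.
    by rewrite -normrN -[X in `|X|](subrK (G 0 h)) (le_trans (ler_normD _ _))// addrC lerD2l.
  rewrite normrZ normfV (gtr0_norm m0) ler_pdivrMl// => hle2.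
  by move: mM; rewrite ltr_pdivlMr// => /lt_le_trans /(_ hle2); rewrite ltxx.
- exact: (transfer_symmetric identity_krein identity_maxneg zero_op_selfadjoint adj dQ vQ).
- exact: (transfer_kernel_le identity_maxneg zero_op_selfadjoint adj dQ vQ).
- exact: (transfer_kernel_eq identity_krein identity_maxneg zero_op_bounded zero_op_selfadjoint adj dQ vQ mom).
Qed.

(** With [G] the identity the projection P is the identity, the reduced space is 0, and the zero map
    is the adjoint required there. *)
Lemma reciprocal_invertible : invertible_at_infinity ip 0 Q' (fun h => - id (id h)) br' A' id id (fun=> 0).
Proof.
have idb := @bounded_op_id _ H; have dQ z : dom Q' z <-> rel_resolvent_set (graph A') z := zero_op_resolvent_set z.
have vQ := reciprocal_val.
have Al : linear A' by move=> a x y; rewrite /A' scaler0 addr0.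
have res z : z != 0 -> resolvent_set_on setT A' z /\ resolvent_on setT A' z = fun h => - (z^-1 *: h).
  by move=> /zero_op_resolvent/resolvent_setT_of.
have GpGi : bdd_invertible_on setT (@id H \o id).
  by split; [split=> // y _; exists y|exists 1 => v _; rewrite mul1r].
have gid h : Ghat id id h = h :> H by rewrite /Ghat -{1}[h]/((@id H \o id) h) (inv_onK GpGi.1).
split.
- exact: reciprocal_class.
- exact: (transfer_at_infinity zero_op_bounded idb idb dQ vQ).
- split; last by exists 1 => v _; rewrite mul1r normrN.
  by split=> // [x y _ _ /oppr_inj|y _] //; exists (- y) => //; rewrite opprK.
- by exists 0%N; exact: maxneg_pontryagin identity_krein identity_maxneg.
- exact: zero_op_bounded.
- exact: zero_op_selfadjoint.
- exact: idb.
- by [].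
- apply/seteqP; split=> z; first by move=> /res[].
  by move=> /(resolvent_setTE _ Al)/dQ.
- by move=> z z0 h; rewrite (res z z0).2.
- apply: lin_span_all => v; exists (-1), v; have n1 : (-1 : C) != 0 by rewrite oppr_eq0 oner_eq0.
  have [h1 ->] := res (-1) n1.
  by split=> //; rewrite invrN1 scaleN1r opprK.
- by move=> k h [x _ <-]; rewrite /ImP /Pproj gid subrr ip0l hf0l.
Qed.
End Example.

Theorem theorem4p1 (R : realType)
    (H : completeNormedModType (Cplx R)) (ip : {dot H for conjC})
    (H_hilbert : hilbert_norm ip) (H_nonzero : exists h : H, h != 0)
    (kappa : nat) (Q : opfun H) (L : H -> H)
    (K : completeNormedModType (Cplx R))
    (br : {hermitian K for false & conjC})
    (A : K -> K) (G : H -> K) (Gp Gtp : K -> H)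
    (HQ : invertible_at_infinity ip kappa Q L br A G Gp Gtp) :
  exists kappa1 kappa2 : nat,
  [/\ (* the decomposition of the inverse, and the classes of the summands *)
      (forall z, dom (neg_inverse Q) z ->
         dom (Qhat2 A G Gp Gtp) z /\
         forall h, neg_inverse Q z h
                   = Qhat1 A G Gp z h + Qhat2 A G Gp Gtp z h) /\
      gen_nevanlinna ip kappa1 (Qhat1 A G Gp) /\
      (exists2 F2, gen_nevanlinna ip kappa2 F2
                   & extends F2 (Qhat2 A G Gp Gtp)),
      (* (i) *)
      [/\ exists z h, Qhat1 A G Gp z h != 0,
          exists (kappa' : nat) (Q' : opfun H) (L' : H -> H)
            (K' : completeNormedModType (Cplx R))
            (br' : {hermitian K' for false & conjC})
            (A' : K' -> K') (G' : H -> K') (Gp' Gtp' : K' -> H),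
            invertible_at_infinity ip kappa' Q' L' br' A' G' Gp' Gtp' /\
            forall z, dom (Qhat2 A' G' Gp' Gtp') z ->
              forall h, Qhat2 A' G' Gp' Gtp' z h = 0,
          forall a, generalized_pole ip (Qhat1 A G Gp) a <-> a = None &
          exists L2, holomorphic_at_infinity (Qhat2 A G Gp Gtp) L2],
      (* (ii) *)
      (forall a, generalized_pole ip (Qhat2 A G Gp Gtp) a <->
                 a <> None /\ generalized_zero ip Q a) /\
      (forall l, same_pole_multiplicity ip (neg_inverse Q)
                                        (Qhat2 A G Gp Gtp) l),
      (* (iii) *)
      nb_neg_eigenvalues (fun h => - L h) kappa1 /\
      pontryagin br (range (Pproj G Gp)) kappa1 &
      (* (iv) *)
      (kappa1 + kappa2)%N = kappa].
Proof.
case: HQ => QN [_ _ _ Lcvg] Linv [n /pontryagin_maxneg[Kr [e me]]] Ab Asa Gb Gadj dQ fQ Qmin Gtadj.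
have Al : linear A by move=> a x y; exact: bounded_op_linear.
have domQ z : dom Q z <-> rel_resolvent_set (graph A) z by rewrite dQ; exact: resolvent_setTE.
have valQ z S h : rel_resolvent (graph A) z S -> Q z h = Gp (S (G h)).
  by move=> hS; rewrite fQ ?(resolvent_setT_of hS).2//; apply/domQ; exists S.
have Gpb := adjoint_op_bounded H_hilbert Kr Gb Gadj.
(* The transfer formula yields a second limit of z Q(z) at infinity; the two limits must agree. *)
have LE h : L h = - Gp (G h).
  have [_ _ _ cvg] := transfer_at_infinity Ab Gpb Gb domQ valQ.
  exact: at_infinity_unique Lcvg cvg h.
have NLE : (fun h => - L h) = Gp \o G by apply/funext => h; rewrite LE opprK.
have GpGi : bdd_invertible_on setT (Gp \o G).
  have [[_ Li Ls] [c hc]] := Linv; split; last first.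
    by exists c => v _; rewrite -NLE normrN; exact: hc.
  split=> // [x y xT yT E|y _]; first by apply: Li => //; rewrite !LE; congr (- _).
  by have [x _ xy] := Ls (- y) Logic.I; exists x => //; rewrite -NLE xy opprK.
have mom : closure (lin_span [set x | exists k y, range G y /\ x = iter k A y]) = setT.
  apply: (moments_total Ab Kr me Asa); rewrite -Qmin; congr (closure (lin_span _)).
  apply/seteqP; split=> x.
    by move=> [z [S [_ [hS [[h _ <-] ->]]]]]; have [hz SE] := resolvent_setT_of hS; exists z, h; rewrite SE.
  move=> [z [h [hz ->]]]; exists z, (resolvent_on setT A z), (G h).
  by split; [exact: resolvent_setTP|split=> //; exists h].
have kn : kappa = n := transfer_index Kr me Ab Asa Gadj domQ valQ mom QN.
have [n1 [e1 [n2 [e2 [me1 me2 nE]]]]] := maxneg_split H_hilbert Kr me Gb Gadj GpGi.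
have K2 := br2_krein H_hilbert Kr Gb Gadj GpGi.
have A2b := A2_bounded H_hilbert Kr Ab Gb Gadj GpGi.
have A2s : selfadjoint_op (br2 H_hilbert Kr Gb Gadj GpGi) (A2 A (GpGi := GpGi)) by exact: A2_selfadjoint.
have G2b := G2_bounded H_hilbert Kr Ab Gb Gadj GpGi.
have Gp2b := Gp2_bounded H_hilbert Kr Ab Gb Gadj GpGi.
have G2a k h : ip (Gp2 A k) h = br2 H_hilbert Kr Gb Gadj GpGi k (G2 H_hilbert Kr A Gb Gadj GpGi h) by exact: G2_adjoint.
have mom2 := moments_reduce H_hilbert Kr Ab Gb Gadj GpGi mom.
have dom2 z : dom (Qhat2 A G Gp Gtp) z <-> _ := resolvent_A2P H_hilbert Kr Ab Gb Gadj GpGi z.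
have val2 z S h : _ -> Qhat2 A G Gp Gtp z h = _ :=
  @Qhat2_val _ _ _ H_hilbert _ _ Kr _ _ _ Ab Asa Gb Gadj GpGi _ Gtadj z S h.
have rep2 := transfer_representation K2 me2 A2b A2s G2b G2a dom2 val2 mom2.
have [s2 hs2] := transfer_nearly_all K2 me2 A2b A2s dom2.
have reph := inverse_representation me Ab Asa mom domQ valQ me2.
have domh := neg_inverse_dom H_hilbert Kr Ab Gb Gadj GpGi domQ valQ.
have [s hs] := transfer_nearly_all Kr me Ab Asa domQ.
(* The inverse is defined where both [A] and [A2] have a resolvent, hence the two exceptional
   lists. *)
have hsh z : 'Im z != 0 -> z \notin s ++ s2 -> dom (neg_inverse Q) z.
  move=> zi; rewrite mem_cat negb_or => /andP[zs zs2]; apply/domh; split; first exact: hs.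
  by apply/dom2; exact: hs2.
have pole2 := generalized_poleP hs2 rep2; have poleh := generalized_poleP hsh reph.
exists n1, n2; split.
- split; last split.
  + move=> z /domh[Qz [S2 hS2]]; split=> [|h]; first by apply/dom2; exists S2.
    rewrite (neg_inverse_val Ab domQ valQ h Qz hS2).
    by rewrite (val2 _ _ _ hS2).
  + exact: (Qhat1_class Ab Asa GpGi me1).
  + exact: (transfer_extension H_hilbert K2 me2 A2b A2s Gp2b G2b G2a dom2 val2 mom2).
- split.
  + exact: (Qhat1_nonzero H_hilbert Kr A Gb Gadj GpGi H_nonzero).
  + exists 0%N; do 8 eexists; split; first exact: (reciprocal_invertible H_hilbert H_nonzero).
    by [].
  + exact: (Qhat1_pole Asa GpGi me1 H_nonzero).
  + by eexists; exact: (transfer_at_infinity A2b Gp2b G2b dom2 val2).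
- split=> [a|l K1 K1' br1 br1' B1 B1' rep1 rep1'].
    have eigen l := inverse_rel_eigenvalue H_hilbert Kr A Gb Gadj GpGi l.
    rewrite pole2 /generalized_zero poleh; case: a => [l|].
      by rewrite -eigen; split=> [|[]].
    (* Infinity is no pole of [Qhat2], whose representing relation is the graph of an operator. *)
    split=> [[g /eqP g0 hg]|[]//]; case: g0.
    by move: hg; rewrite /graph /= (bounded_op0 A2b).
  (* Arbitrary representations are compared through the two explicit ones, which share their finite
     root manifolds up to isomorphism. *)
  have iso1 := minimal_representation_unique hsh rep1 reph.
  have iso2 := minimal_representation_unique hs2 rep2 rep1'.
  apply: same_dim_trans (rep_iso_root_manifold l iso1) _.
  apply: same_dim_trans (rep_iso_root_manifold l iso2).
  exact: inverse_rel_root_manifold.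
- split; last exact: (range_Pproj_pontryagin GpGi me1).
  have [c c0 hc] := gram_op_below GpGi; rewrite NLE.
  exact: (negative_eigenvalues H_hilbert c0 hc me1).
- by rewrite kn.
Qed.
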